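(* Let $r_j,\rho_j\in[0,1]$ with $r_j+\rho_j>0$, and let $\omega_j\in\mathscr P_{r_j,\rho_j}(\mathbf R^{2d})$, $j=0,1,2$. Let $\varphi\in\mathfrak F$ be a simple phase function and assume that $$\rho_2=1,\quad r_0=\min\{r_1,r_2,1\},\quad \rho_0=\min\{\rho_1,1\},\quad \omega_0(x,\xi)=\omega_1(x,\xi)\,\omega_2(x,\varphi'_x(x,\xi)).$$ Assume that $\omega_2$ is $(\phi,2)$-invariant with respect to $\phi\colon\xi\mapsto\varphi'_x(x,\xi)$, i.e. $$\omega_2(x,\varphi'_x(z_1+z_2,\xi))\lesssim\omega_2(x,\varphi'_x(z_1,\xi)),\qquad x,\xi,z_1,z_2\in\mathbf R^d,$$ with a constant independent of $x,\xi,z_1,z_2$. Let $a\in \mathrm{SG}^{(\omega_1)}_{r_1,\rho_1}(\mathbf R^{2d})$, $p\in \mathrm{SG}^{(\omega_2)}_{r_2,1}(\mathbf R^{2d})$, and let $$\psi(x,y,\xi)=\varphi(y,\xi)-\varphi(x,\xi)-\langle y-x,\varphi'_x(x,\xi)\rangle .$$ Then there is $c\in \mathrm{SG}^{(\omega_0)}_{r_0,\rho_0}(\mathbf R^{2d})$ admitting the asymptotic expansion $$c(x,\xi)\sim\sum_{\alpha}\frac{i^{|\alpha|}}{\alpha!}\,(D^\alpha_\xi p)(x,\varphi'_x(x,\xi))\,D^\alpha_y\!\left[e^{i\psi(x,y,\xi)}a(y,\xi)\right]_{y=x},$$ such that $$\operatorname{Op}(p)\circ\operatorname{Op}_\varphi(a)-\operatorname{Op}_\varphi(c)\in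 \operatorname{Op}_\varphi\big(\mathrm{SG}^{(\omega_0\vartheta_{0,-\infty})}_0\big)\quad\text{if } r_1=0,$$ $$\operatorname{Op}(p)\circ\operatorname{Op}_\varphi(a)-\operatorname{Op}_\varphi(c)\in \operatorname{Op}(\mathscr S(\mathbf R^{2d}))\quad\text{if } r_1>0.$$
   Context: Notation: $\langle x\rangle=(1+|x|^2)^{1/2}$; $D=-i\partial$; $A\lesssim B$ means $A\le cB$ for a constant $c>0$; $A\asymp B$ means $A\lesssim B$ and $B\lesssim A$; $\widehat f(\xi)=(2\pi)^{-d/2}\int f(x)e^{-i\langle x,\xi\rangle}dx$; $\vartheta_{m,\mu}(x,\xi)=\langle x\rangle^m\langle\xi\rangle^\mu$. Weights: $\mathscr P(\mathbf R^{2d})$ is the set of positive measurable functions $\omega$ on $\mathbf R^{2d}$ for which there is a polynomial $v$ with $\omega(X+Y)\lesssim\omega(X)v(Y)$. For $r,\rho\ge0$, $\mathscr P_{r,\rho}(\mathbf R^{2d})$ is the set of $\omega\in\mathscr P(\mathbf R^{2d})\cap C^\infty(\mathbf R^{2d})$ with $\langle x\rangle^{r|\alpha|}\langle\xi\rangle^{\rho|\beta|}\,\partial_x^\alpha\partial_\xi^\beta\omega(x,\xi)/\omega(x,\xi)\in L^\infty(\mathbf R^{2d})$ for all multi-indices $\alpha,\beta$. Symbols: $\mathrm{SG}^{(\omega)}_{r,\rho}(\mathbf R^{2d})$ is the set of $a\in C^\infty(\mathbf R^{2d})$ with $|D_x^\alpha D_\xi^\beta a(x,\xi)|\lesssim\omega(x,\xi)\langle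 x\rangle^{-r|\alpha|}\langle\xi\rangle^{-\rho|\beta|}$ for all $\alpha,\beta$; $\mathrm{SG}^{m,\mu}_{r,\rho}=\mathrm{SG}^{(\vartheta_{m,\mu})}_{r,\rho}$. Moreover $\mathrm{SG}^{(\omega\vartheta_{0,-\infty})}_r=\bigcap_{N\ge0}\mathrm{SG}^{(\omega\vartheta_{0,-N})}_{r,\rho}$ (independent of $\rho$). Phases: $\mathfrak F$ (simple phase functions) is the set of real-valued $\varphi\in \mathrm{SG}^{1,1}_{1,1}(\mathbf R^{2d})$ with $\langle\varphi'_\xi(x,\xi)\rangle\asymp\langle x\rangle$ and $\langle\varphi'_x(x,\xi)\rangle\asymp\langle\xi\rangle$ uniformly on $\mathbf R^{2d}$. Operators (on $f\in\mathscr S(\mathbf R^d)$): $\operatorname{Op}(p)f(x)=(2\pi)^{-d/2}\int e^{i\langle x,\xi\rangle}p(x,\xi)\widehat f(\xi)\,d\xi$ and $\operatorname{Op}_\varphi(a)f(x)=(2\pi)^{-d/2}\int e^{i\varphi(x,\xi)}a(x,\xi)\widehat f(\xi)\,d\xi$ (the operator whose distribution kernel is $(2\pi)^{-d}\int e^{i(\varphi(x,\xi)-\langle y,\xi\rangle)}a(x,\xi)\,d\xi$). For a set $\mathcal B$ of symbols, $\operatorname{Op}(\mathcal B)=\{\operatorname{Op}(h):h\in\mathcal B\}$, $\operatorname{Op}_\varphi(\mathcal B)=\{\operatorname{Op}_\varphi(h):h\in\mathcal B\}$. Asymptotic expansions: let $r,\rho\ge 0$, $r+\rho>0$, $a\in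 \mathrm{SG}^{(\omega)}_{r,\rho}(\mathbf R^{2d})$. One writes $a\sim\sum_{j\ge0}a_j$ if there are sequences $s_j,\sigma_j\le0$, with $s_j\to-\infty$ if $r>0$ and $s_j=0$ for all $j$ otherwise, $\sigma_j\to-\infty$ if $\rho>0$ and $\sigma_j=0$ for all $j$ otherwise, such that with $\omega_{(j)}=\omega\,\vartheta_{s_j,\sigma_j}$ one has $a_j\in \mathrm{SG}^{(\omega_{(j)})}_{r,\rho}$ and $a-\sum_{j=0}^Na_j\in \mathrm{SG}^{(\omega_{(N+1)})}_{r,\rho}$ for every $N\ge 0$. For a sum over multi-indices $\alpha$, $a_j$ is the sum of the terms with $|\alpha|=j$. *)

(* Defs.v *)
From HB Require Import structures.
From mathcomp Require Import all_boot all_order all_algebra.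
From mathcomp Require Import all_classical all_reals all_analysis.
From mathcomp Require Import complex.
From mathcomp Require mpoly.
Set Implicit Arguments.
Unset Strict Implicit.
Unset Printing Implicit Defensive.
Import Order.TTheory GRing.Theory Num.Theory.
Import numFieldNormedType.Exports.
Local Open Scope classical_set_scope.
Local Open Scope ring_scope.
Local Open Scope complex_scope.

(* The library has no Lebesgue measure on R^n: it is built here on n-tuples as an
   iterated product, transported along (x, t) |-> x :: t. *)
Section lebesgue_cons.
Context (R : realType) (n : nat).
Variable m : {sigma_finite_measure set (n.-tuple (measurableTypeR R)) -> \bar R}.

Definition consp (p : measurableTypeR R * n.-tuple (measurableTypeR R)) :
  n.+1.-tuple (measurableTypeR R) := [tuple of p.1 :: p.2].

Lemma measurable_consp : measurable_fun setT consp.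
Proof. exact: measurable_cons. Qed.

Definition lebesgue_cons :=
  pushforward (lebesgue_measure \x m)%E consp.


Let mu0 : lebesgue_cons set0 = 0%E.
Proof. by rewrite /lebesgue_cons /pushforward preimage_set0 measure0. Qed.

Let mu_ge0 A : (0 <= lebesgue_cons A)%E.
Proof. exact: (@measure_ge0 _ _ _ [the measure _ _ of (lebesgue_measure \x m)%E]). Qed.

Let mu_sigma_additive : semi_sigma_additive lebesgue_cons.
Proof.
move=> F mF tF mUF; rewrite /lebesgue_cons /pushforward preimage_bigcup.
have mV A : measurable A -> measurable (consp @^-1` A).
  by move=> mA; rewrite -[X in measurable X]setTI; exact: measurable_consp.
apply: measure_semi_sigma_additive.
- by move=> k; exact: mV.
- apply/trivIsetP => /= i j _ _ ij; rewrite -preimage_setI.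
  by move/trivIsetP : tF => /(_ _ _ _ _ ij) ->//; rewrite preimage_set0.
- by rewrite -preimage_bigcup; exact: mV.
Qed.

HB.instance Definition _ :=
  isMeasure.Build _ _ _ lebesgue_cons mu0 mu_ge0 mu_sigma_additive.

Let mu_sigma_finite : sigma_finite setT lebesgue_cons.
Proof.
have /sigma_finiteP[F [TF ndF Foo]] := sigma_finiteT (@lebesgue_measure R).
have /sigma_finiteP[G [TG ndG Goo]] := sigma_finiteT m.
pose g (t : n.+1.-tuple (measurableTypeR R)) : measurableTypeR R * n.-tuple (measurableTypeR R)
  := (thead t, [tuple of behead t]).
have mg : measurable_fun setT g.
  apply/measurable_fun_pair => /=; [exact: measurable_tnth|exact: measurable_behead].
have gK : cancel consp g by move=> [x t]; rewrite /g /consp theadE; congr pair; exact: val_inj.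
exists (fun k => g @^-1` (F k `*` G k)).
  rewrite -preimage_bigcup -(preimage_setT g); congr (g @^-1` _).
  rewrite -setXTT TF TG predeqE => -[x y]; split.
    move=> [/= [k _ Fx] [l _ Gy]]; exists (maxn k l) => //; split.
    - by move: x Fx; exact/subsetPset/ndF/leq_maxl.
    - by move: y Gy; exact/subsetPset/ndG/leq_maxr.
  by move=> [k _ []/= ? ?]; split; exists k.
move=> k; have [? ?] := Foo k; have [? ?] := Goo k; split.
  by rewrite -[X in measurable X]setTI; apply: mg => //; exact: measurableX.
rewrite /lebesgue_cons /pushforward -comp_preimage.
rewrite (_ : g \o consp = id); last by apply/funext => p; exact: gK.
by rewrite preimage_id product_measure1E// lte_mul_pinfty// ge0_fin_numE.
Qed.

HB.instance Definition _ :=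
  Measure_isSigmaFinite.Build _ _ _ lebesgue_cons mu_sigma_finite.

End lebesgue_cons.

Fixpoint lebesgue_tuple (R : realType) (n : nat) :
    {sigma_finite_measure set (n.-tuple (measurableTypeR R)) -> \bar R} :=
  match n with
  | 0 => dirac [tuple]
  | n'.+1 => lebesgue_cons (lebesgue_tuple R n')
  end.
Lemma lebesgue_tuple_box (R : realType) n (A : 'I_n -> set (measurableTypeR R)) :
  (forall i, measurable (A i)) ->
  (lebesgue_tuple R n [set t | forall i, A i (tnth t i)] =
   \prod_(i < n) lebesgue_measure (A i))%E.
Proof.
elim: n A => [|n IH] A mA /=.
  rewrite big_ord0 /dirac indicE mem_set//.
  by move=> [].
rewrite /lebesgue_cons /pushforward big_ord_recl -IH; last by move=> i; exact: mA.
have mB : measurable [set t : n.-tuple (measurableTypeR R) | forall i, A (lift ord0 i) (tnth t i)].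
  rewrite (_ : [set _ | _] =
      \bigcap_(i in [set: 'I_n]) ((fun t => tnth t i) @^-1` A (lift ord0 i))).
    apply: fin_bigcap_measurable => // i _.
    by rewrite -[X in measurable X]setTI; apply: measurable_tnth.
  by apply/seteqP; split => t /= tA i => [_|]; apply: tA.
rewrite -product_measure1E//; congr ((_ \x _) _)%E.
apply/seteqP; split => -[x t] /=.
  move=> xtA; split; first by have := xtA ord0; rewrite (tnth_nth x).
  by move=> i; have := xtA (lift ord0 i); rewrite tnthS.
move=> [xA tA] i; case: (unliftP ord0 i) => [j ->|->]; first by rewrite tnthS.
by rewrite (tnth_nth x).
Qed.

Section integral_Rn.
Context (R : realType) (n : nat).

Definition row_of_tuple (t : n.-tuple (measurableTypeR R)) : 'rV[R]_n :=
  \row_i tnth t i.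

Definition integralC (f : 'rV[R]_n -> R[i]) : R[i] :=
  (\int[lebesgue_tuple R n]_t complex.Re (f (row_of_tuple t)))
  +i* (\int[lebesgue_tuple R n]_t complex.Im (f (row_of_tuple t))).

End integral_Rn.

(* Existence and continuity of all iterated directional derivatives. *)
Definition smooth (R : realType) (V : normedModType R) (f : V -> R) : Prop :=
  forall vs : seq V, let g : V -> R := foldr (fun v h => 'D_v h) f vs in
    continuous g /\ forall v x, derivable g x v.

Definition smoothC (R : realType) (V : normedModType R) (f : V -> R[i]) : Prop :=
  smooth (fun x => complex.Re (f x)) /\ smooth (fun x => complex.Im (f x)).

Definition lesssim (R : realType) (T : Type) (f g : T -> R) : Prop :=
  exists2 c : R, 0 < c & forall t, f t <= c * g t.

Definition asympeq (R : realType) (T : Type) (f g : T -> R) : Prop :=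
  lesssim f g /\ lesssim g f.

Section multi_index.
Context (R : realType) (d : nat).
Local Notation vec := 'rV[R]_d.
Implicit Types (alpha beta : 'I_d -> nat).

Definition mi_size alpha : nat := (\sum_i alpha i)%N.
Definition mi_fact alpha : nat := (\prod_i (alpha i)`!)%N.
Definition monom alpha (x : vec) : R := \prod_i x 0 i ^+ alpha i.

(* The multi-indices of length j have entries at most j. *)
Definition sum_mi (j : nat) (F : ('I_d -> nat) -> R[i]) : R[i] :=
  \sum_(alpha : {ffun 'I_d -> 'I_j.+1} | mi_size (fun i => alpha i) == j)
    F (fun i => alpha i).

Definition partial (i : 'I_d) (f : vec -> R) : vec -> R :=
  'D_(delta_mx 0 i) f.

Definition pderiv alpha (f : vec -> R) : vec -> R :=
  foldr (fun i g => iter (alpha i) (partial i) g) f (enum 'I_d).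

Definition pderiv2 alpha beta (f : vec -> vec -> R) (x xi : vec) : R :=
  pderiv alpha (fun y => pderiv beta (f y) xi) x.

(* D^alpha with D = - i partial. *)
Definition Dmi alpha (f : vec -> R[i]) (x : vec) : R[i] :=
  (- 'i%C) ^+ mi_size alpha *
  (pderiv alpha (fun y => complex.Re (f y)) x
   +i* pderiv alpha (fun y => complex.Im (f y)) x).

Definition Dmi2 alpha beta (a : vec -> vec -> R[i]) (x xi : vec) : R[i] :=
  Dmi alpha (fun y => Dmi beta (a y) xi) x.

End multi_index.

Section SG.
Context (R : realType) (d : nat).
Local Notation vec := 'rV[R]_d.
Local Notation symbol := (vec -> vec -> R[i]).
Implicit Types (w : vec -> vec -> R) (phi : vec -> vec -> R) (a c p : symbol).

Definition dotv (x y : vec) : R := \sum_i x 0 i * y 0 i.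

Definition jap (x : vec) : R := Num.sqrt (1 + dotv x x).

Definition theta (m mu : R) (x xi : vec) : R := jap x `^ m * jap xi `^ mu.

Definition expi (t : R) : R[i] := cos t +i* sin t.

Definition weight w : Prop :=
  [/\ forall x xi, 0 < w x xi,
      measurable_fun setT
        (fun t : d.-tuple (measurableTypeR R) * d.-tuple (measurableTypeR R) =>
           w (row_of_tuple t.1) (row_of_tuple t.2) : measurableTypeR R)
    & exists v : mpoly.mpoly (d + d) R,
        lesssim
          (fun t : (vec * vec) * (vec * vec) =>
             w (t.1.1 + t.2.1) (t.1.2 + t.2.2))
          (fun t => w t.1.1 t.1.2 *
             mpoly.meval (fun i => row_mx t.2.1 t.2.2 0 i) v)].

(* The quotients are continuous functions, so that being in L^oo means being
   bounded. *)
Definition smooth_weight (r rho : R) w : Prop :=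
  [/\ weight w, smooth (fun X : vec * vec => w X.1 X.2)
    & forall alpha beta, exists C : R, forall x xi,
        `| jap x `^ (r * (mi_size alpha)%:R) * jap xi `^ (rho * (mi_size beta)%:R)
           * pderiv2 alpha beta w x xi / w x xi | <= C].

Definition SG w (r rho : R) : set symbol :=
  [set a | smoothC (fun X : vec * vec => a X.1 X.2) /\
    forall alpha beta,
      lesssim (fun X : vec * vec => Normc.normc (Dmi2 alpha beta a X.1 X.2))
        (fun X => w X.1 X.2 * jap X.1 `^ (- (r * (mi_size alpha)%:R))
                            * jap X.2 `^ (- (rho * (mi_size beta)%:R)))].

(* SG^(w theta_{0,-oo})_r; the choice rho = 0 is immaterial by SG_mooE. *)
Definition SG_moo w (r : R) : set symbol :=
  \bigcap_(N in [set: nat]) SG (fun x xi => w x xi * theta 0 (- N%:R) x xi) r 0.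

Definition schwartz (f : vec -> R[i]) : Prop :=
  smoothC f /\ forall alpha beta, exists C : R, forall x,
    Normc.normc ((monom alpha x)%:C * Dmi beta f x) <= C.

Definition schwartz2 : set symbol :=
  [set s | smoothC (fun X : vec * vec => s X.1 X.2) /\
    forall alpha beta gamma delta, exists C : R, forall x xi,
      Normc.normc ((monom alpha x * monom beta xi)%:C * Dmi2 gamma delta s x xi) <= C].

Definition gradx phi (x xi : vec) : vec := \row_i partial i (phi^~ xi) x.
Definition gradxi phi (x xi : vec) : vec := \row_i partial i (phi x) xi.

Definition simple_phase phi : Prop :=
  [/\ SG (theta 1 1) 1 1 (fun x xi => (phi x xi)%:C),
      asympeq (fun X : vec * vec => jap (gradxi phi X.1 X.2)) (fun X => jap X.1)
    & asympeq (fun X : vec * vec => jap (gradx phi X.1 X.2)) (fun X => jap X.2)].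

Definition phi2_invariant phi w : Prop :=
  lesssim
    (fun t : (vec * vec) * (vec * vec) => w t.1.1 (gradx phi (t.2.1 + t.2.2) t.1.2))
    (fun t => w t.1.1 (gradx phi t.2.1 t.1.2)).

Definition fourier (f : vec -> R[i]) (xi : vec) : R[i] :=
  ((2 * pi) `^ (- (d%:R / 2)))%:C *
  integralC (fun x => f x * expi (- dotv x xi)).

Definition Opphi phi a (f : vec -> R[i]) (x : vec) : R[i] :=
  ((2 * pi) `^ (- (d%:R / 2)))%:C *
  integralC (fun xi => expi (phi x xi) * a x xi * fourier f xi).

Definition Op p : (vec -> R[i]) -> vec -> R[i] := Opphi dotv p.

(* Operators are compared on Schwartz functions. *)
Definition Opphi_class phi (B : set symbol) : set ((vec -> R[i]) -> vec -> R[i]) :=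
  [set T | exists2 h, B h & forall f, schwartz f -> T f = Opphi phi h f].

Definition Op_class (B : set symbol) : set ((vec -> R[i]) -> vec -> R[i]) :=
  [set T | exists2 h, B h & forall f, schwartz f -> T f = Op h f].

Definition asymp_expansion w (r rho : R) a (a_ : nat -> symbol) : Prop :=
  exists s sigma : nat -> R,
  let w_ j := fun x xi => w x xi * theta (s j) (sigma j) x xi in
  [/\ forall j, s j <= 0 /\ sigma j <= 0,
      if 0 < r then s @ \oo --> -oo else forall j, s j = 0,
      if 0 < rho then sigma @ \oo --> -oo else forall j, sigma j = 0,
      forall j, SG (w_ j) r rho (a_ j)
    & forall N : nat, SG (w_ N.+1) r rho
        (fun x xi => a x xi - \sum_(j < N.+1) a_ j x xi)].

Definition psi phi (x y xi : vec) : R :=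
  phi y xi - phi x xi - dotv (y - x) (gradx phi x xi).

Lemma dotv_ge0 (x : vec) : 0 <= dotv x x.
Proof. by apply: sumr_ge0 => i _; exact: sqr_ge0. Qed.

Lemma jap_ge1 (x : vec) : 1 <= jap x.
Proof.
by rewrite -sqrtr1 ler_wsqrtr// lerDl dotv_ge0.
Qed.

Lemma SG_mooE w (r rho : R) a : 0 <= rho -> (forall x xi, 0 < w x xi) ->
  SG_moo w r a <->
  forall N : nat, SG (fun x xi => w x xi * theta 0 (- N%:R) x xi) r rho a.
Proof.
move=> rho0 w0.
have aux x xi (u s t s' t' : R) : s + t <= s' + t' ->
    w x xi * theta 0 s x xi * jap x `^ u * jap xi `^ t <=
    w x xi * theta 0 s' x xi * jap x `^ u * jap xi `^ t'.
  move=> st; rewrite /theta powRr0 !mul1r !(mulrAC _ (_ `^ u)) ler_wpM2r ?powR_ge0//.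
  have j0 : jap xi != 0 by rewrite gt_eqF// (lt_le_trans ltr01 (jap_ge1 _)).
  have jD (b e : R) : jap xi `^ b * jap xi `^ e = jap xi `^ (b + e).
    by rewrite powRD// j0 implybT.
  by rewrite -!mulrA !jD ler_wpM2l ?(ltW (w0 _ _))// ler_powR ?jap_ge1.
split=> [H N|H N _].
- split; first exact: (H 0%N Logic.I).1.
  move=> alpha beta; pose M := Num.truncn (rho * (mi_size beta)%:R).
  have [_ /(_ alpha beta)[C C0 HC]] := H (N + M.+1)%N Logic.I.
  exists C => // X; apply: (le_trans (HC X)).
  rewrite ler_wpM2l ?(ltW C0)// aux// mul0r oppr0 addr0 natrD opprD lerD2l lerN2.
  by rewrite ltW// truncnS_gt.
- split; first exact: (H 0%N).1.
  move=> alpha beta; have [_ /(_ alpha beta)[C C0 HC]] := H N.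
  exists C => // X; apply: (le_trans (HC X)).
  by rewrite ler_wpM2l ?(ltW C0)// aux// mul0r oppr0 lerD2l oppr_le0 mulr_ge0.
Qed.

End SG.

(* Main.v *)
Require Import Defs.
From HB Require Import structures.
From mathcomp Require Import all_boot all_order all_algebra.
From mathcomp Require Import all_classical all_reals all_analysis.
From mathcomp Require Import measurable_realfun complex.
From mathcomp Require Import ring lra.
From mathcomp Require mpoly.
Set Implicit Arguments.
Unset Strict Implicit.
Unset Printing Implicit Defensive.
Import Order.TTheory GRing.Theory Num.Theory.
Import numFieldNormedType.Exports.
Local Open Scope classical_set_scope.
Local Open Scope ring_scope.
Local Open Scope complex_scope.

(* Write y = x + z. Composing the two operators formally gives Op(p) o Op_phi(a) = Op_phi(c) with
     c(x, xi) = (2 pi)^-d \iint e^(-i <z, eta>) e^(i (phi(y, xi) - phi(x, xi))) p(x, eta) a(y, xi) dz deta,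
   an oscillatory integral, defined as the limit of Gaussian regularisations. These converge at rate O(eps),
   with constants that are powers of <xi>, which is enough to apply Fubini to the regularised integrals: the
   composition formula is exact, and both remainders of the theorem are 0.
   For the expansion, p(x, .) is expanded by Taylor's formula at th = phi'_x(x, xi). The homogeneous part of
   degree j gives exactly the j-th term, as multiplication by eta acts as D_z and the integral of a function
   of z alone is (2 pi)^d times its value at z = 0. In the remainder one integrates by parts along the
   vector fields <y>^s <xi>^(-1/2) d_z and <x>^-s <xi>^(1/4) d_eta, with s = r1 / 4; each order of the Taylor
   expansion then gains a factor <x>^-s <xi>^(-1/4), and the (phi, 2)-invariance compares w2(x, phi'_x(y, xi))
   to w2(x, th). Derivatives of c minus a partial sum need no further expansion: they are interpolated
   (Landau) between this decay and crude polynomial bounds on all derivatives. *)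

(** The crude bounds lose powers of <xi> and never of <x>. This is forced: for r1 = 0 the gain
    <x>^-s <xi>^(-1/4) does not decay in x, so a lost power of <x> could not be recovered, whereas
    four powers of the gain always pay for one power of <xi>. This is why the kernel is estimated
    through the difference phi(y, xi) - phi(x, xi): its derivatives in (x, xi) cost a power of <xi>
    and a power of z only. All integrations by parts are governed by the bracket b of the gradient
    of the whole phase, measured in the units of the two vector fields. Where z, or eta - phi'_x(y,
    xi), leaves the region in which the weights vary slowly, b dominates a power of the scales
    involved. So no partition of phase space is needed: every loss there is a power of b, and enough
    integrations by parts give any negative power of b. Making the integrals converge costs a fixed
    number 8 d of gains. Estimating a longer partial sum, and then giving back the additional terms,
    which are known symbols, removes this loss. *)

Lemma eqW_le {disp} {T : porderType disp} (x y : T) : x = y -> (x <= y)%O.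
Proof. by move=> ->. Qed.

Lemma ler_Xn {R : numDomainType} (x y : R) n : 0 <= x -> x <= y -> x ^+ n <= y ^+ n.
Proof. by move=> x0 xy; rewrite lerXn2r// nnegrE (le_trans x0). Qed.

Lemma subrACA (V : zmodType) (a b c d : V) : a - b - (c - d) = a - c - (b - d).
Proof. by rewrite !opprB addrACA addrAC [in RHS]addrACA [RHS]addrAC [- b + _]addrC. Qed.

Lemma dist_half (R : realFieldType) (z a b e : R) :
 `|z - a| <= e / 2 -> `|z - b| <= e / 2 -> `|a - b| <= e.
Proof.
move=> za zb; rewrite -(subrKA z) (le_trans (ler_normD _ _))// [e]splitr lerD//.
by rewrite distrC.
Qed.

(** * Directional derivatives *)

Section real_derivatives.
Context {R : realType} {V : normedModType R}.
Implicit Types (f : V -> R) (x v w : V).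

Lemma line_quotientE f x v (t : R) :
 (fun h : R => h^-1 *: (((fun s : R => f (s *: v + x)) \o shift t) (h *: 1)
        - f (t *: v + x)))
 = (fun h : R => h^-1 *: ((f \o shift (t *: v + x)) (h *: v) - f (t *: v + x))).
Proof.
apply/funext => h /=; congr (_ *: (f _ - _)).
by rewrite [h *: 1]mulr1 scalerDl addrA.
Qed.

Lemma derivable_line f x v (t : R) :
 derivable f (t *: v + x) v -> derivable (fun s : R => f (s *: v + x)) t 1.
Proof. by rewrite /derivable line_quotientE. Qed.

Lemma derive_line f x v (t : R) :
 'D_1 (fun s : R => f (s *: v + x)) t = 'D_v f (t *: v + x).
Proof. by rewrite /derive line_quotientE. Qed.

Lemma is_derive_line f x v (t : R) : derivable f (t *: v + x) v ->
 is_derive t 1 (fun s : R => f (s *: v + x)) ('D_v f (t *: v + x)).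
Proof.
move=> fd; apply: DeriveDef; first exact: derivable_line.
exact: derive_line.
Qed.

Lemma MVT_line f x v : (forall y, derivable f y v) ->
 exists2 s : R, 0 < s < 1 & f (x + v) - f x = 'D_v f (x + s *: v).
Proof.
move=> fd.
have D (t : R) : is_derive t 1 (fun s : R => f (s *: v + x)) ('D_v f (t *: v + x)).
 exact: is_derive_line.
have C : {within `[0, 1], continuous (fun s : R => f (s *: v + x))}.
 apply: continuous_subspaceT => t.
 by apply: differentiable_continuous; apply/derivable1_diffP; exact: derivable_line.
have [s] := MVT ltr01 (fun t _ => D t) C.
rewrite in_itv/= => s01 E; exists s => //.
by move: E; rewrite scale1r scale0r add0r subr0 mulr1 (addrC v) => ->; rewrite addrC.
Qed.

Lemma shift_quotientE f x v a :
 (fun h : R => h^-1 *: (((fun y => f (y + a)) \o shift x) (h *: v) - f (x + a)))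
 = (fun h : R => h^-1 *: ((f \o shift (x + a)) (h *: v) - f (x + a))).
Proof. by apply/funext => h /=; rewrite addrA. Qed.

Lemma derive_shiftE f x v a : 'D_v (fun y => f (y + a)) x = 'D_v f (x + a).
Proof. by rewrite /derive shift_quotientE. Qed.

Lemma derivable_shiftE f x v a :
 derivable (fun y => f (y + a)) x v <-> derivable f (x + a) v.
Proof. by rewrite /derivable shift_quotientE. Qed.

Lemma derive_cvgP f x v (l : R) :
 (forall e : R, 0 < e -> exists2 d : R, 0 < d & forall t : R, t != 0 -> `|t| < d ->
   `|f (x + t *: v) - f x - t * l| <= e * `|t|) ->
 derivable f x v /\ 'D_v f x = l.
Proof.
move=> H.
have C : h^-1 *: ((f \o shift x) (h *: v) - f x) @[h --> 0^'] --> l.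
 apply/cvgrPdist_le => e e0; have [d d0 Hd] := H e e0.
 near=> h.
 have h0 : h != 0 by near: h; exact: nbhs_dnbhs_neq.
 have hd : `|h| < d by near: h; exact: dnbhs0_lt.
 have := Hd h h0 hd; rewrite /= [x + _]addrC -ler_pdivrMr ?normr_gt0//.
 apply: le_trans; rewrite -normrV ?unitfE// -normrM -normrN.
 by apply: eqW_le; congr `|_|; rewrite /GRing.scale/=; field.
split; first by apply/cvg_ex; exists l.
exact: cvg_lim.
Unshelve. all: by end_near. Qed.

Lemma derive_epsP f x v : derivable f x v ->
 forall e : R, 0 < e -> exists2 d : R, 0 < d & forall t : R, `|t| < d ->
   `|f (x + t *: v) - f x - t * 'D_v f x| <= e * `|t|.
Proof.
move=> fd e e0.
have /cvgrPdist_le/(_ _ e0) := fd : h^-1 *: ((f \o shift x) (h *: v) - f x) @[h --> 0^'] --> 'D_v f x.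
move=> [d /= d0 Hd]; exists d => // t td.
have [->|t0] := eqVneq t 0.
 by rewrite scale0r addr0 subrr mul0r subr0 normr0 mulr0.
have := Hd t; rewrite /ball_ /= sub0r normrN => /(_ td t0).
rewrite -ler_pdivrMr ?normr_gt0// [X in f (X)]addrC; apply: le_trans.
rewrite -normrV ?unitfE// -normrM -normrN.
by apply: eqW_le; congr `|_|; rewrite /GRing.scale/=; field.
Qed.

Lemma deriveZv f x v (c : R) : derivable f x v ->
 derivable f x (c *: v) /\ 'D_(c *: v) f x = c * 'D_v f x.
Proof.
move=> fd; have [->|c0] := eqVneq c 0.
 rewrite scale0r mul0r; split; [exact: derivable0|exact: derive0].
apply: derive_cvgP => e e0.
have [|d d0 Hd] := derive_epsP fd (e := e / `|c|).
 by rewrite divr_gt0// normr_gt0.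
exists (d / `|c|) => [|t t0 td]; first by rewrite divr_gt0// normr_gt0.
rewrite scalerA mulrA; apply: (le_trans (Hd _ _)).
 by rewrite normrM -ltr_pdivlMr ?normr_gt0.
by rewrite normrM [`|t| * _]mulrC mulrA divfK// normr_eq0.
Qed.

Lemma near_norm f x : {for x, continuous f} -> forall e : R, 0 < e ->
 exists2 d : R, 0 < d & forall y, `|y| < d -> `|f (x + y) - f x| <= e.
Proof.
move=> /cvgrPdist_le fc e e0; have /nbhs_ballP[d /= d0 Hd] := fc e e0.
exists d => // y yd; rewrite distrC; apply: Hd.
by rewrite -ball_normE/= opprD addrA subrr sub0r normrN.
Qed.

Lemma small_scale v (d : R) : 0 < d -> exists2 d' : R, 0 < d' &
 forall t : R, `|t| < d' -> `|t *: v| < d.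
Proof.
move=> d0; exists (d / (`|v| + 1)) => [|t td].
 by rewrite divr_gt0// ltr_wpDl.
rewrite normrZ (@le_lt_trans _ _ (`|t| * (`|v| + 1)))//.
 by rewrite ler_wpM2l// lerDl.
by rewrite -ltr_pdivlMr// ltr_wpDl.
Qed.

(** Only directional derivatives are available, no total differential. The increment along v + w is
    split into a leg along v and a leg along w; the mean value theorem on the second leg and the
    continuity of 'D_w f compare it with 'D_w f at x. *)
Lemma deriveDv f v w : (forall y, derivable f y v) -> (forall y, derivable f y w) ->
 continuous ('D_w f) -> forall x,
 derivable f x (v + w) /\ 'D_(v + w) f x = 'D_v f x + 'D_w f x.
Proof.
move=> fv fw cw x; apply: derive_cvgP => e e0.
have e2 : 0 < e / 2 by rewrite divr_gt0.
have [d1 d10 H1] := derive_epsP (fv x) e2.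
have [d2 d20 H2] := near_norm (cw x) e2.
have [d3 d30 H3] := small_scale v (divr_gt0 d20 (ltr0Sn R 1)).
have [d4 d40 H4] := small_scale w (divr_gt0 d20 (ltr0Sn R 1)).
exists (Num.min d1 (Num.min d3 d4)); first by rewrite !lt_min d10 d30 d40.
move=> t t0; rewrite !lt_min => /and3P[t1 t3 t4].
have fw' y : derivable f y (t *: w) by have [] := deriveZv t (fw y).
have [s s01 E] := MVT_line (x + t *: v) fw'.
have -> : f (x + t *: (v + w)) - f x - t * ('D_v f x + 'D_w f x) =
 (f (x + t *: v) - f x - t * 'D_v f x) +
 t * ('D_w f (x + (t *: v + s *: (t *: w))) - 'D_w f x).
 rewrite scalerDr addrA.
 move: E; rewrite (deriveZv t (fw _)).2 addrA => E.
 by rewrite mulrBr -E; ring.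
rewrite (le_trans (ler_normD _ _))// [e]splitr mulrDl lerD ?H1//.
rewrite normrM mulrC ler_wpM2r//; apply: H2.
rewrite (le_lt_trans (ler_normD _ _))// [d2]splitr ltrD ?H3//.
rewrite normrZ (@le_lt_trans _ _ `|t *: w|) ?H4//.
have /andP[s0 s1] := s01.
by rewrite ger0_norm ?(ltW s0)// ler_piMl// ltW.
Qed.

(** Schwarz's argument: the second difference of f over a parallelogram with sides t v and t w,
    divided by t^2, is a value of either mixed derivative at a nearby point, by two uses of the mean
    value theorem in either order. *)
Lemma derive_comm f v w :
 (forall y, derivable f y v) -> (forall y, derivable f y w) ->
 (forall y, derivable ('D_v f) y w) -> (forall y, derivable ('D_w f) y v) ->
 continuous ('D_w ('D_v f)) -> continuous ('D_v ('D_w f)) ->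
 forall x, 'D_w ('D_v f) x = 'D_v ('D_w f) x.
Proof.
move=> fv fw fvw fwv c1 c2 x.
have main (g : V -> R) (a b : V) : (forall y, derivable g y a) ->
  (forall y, derivable ('D_a g) y b) ->
  forall t : R, t != 0 -> exists2 p : R * R, (0 < p.1 < 1) && (0 < p.2 < 1) &
  g (x + t *: b + t *: a) - g (x + t *: b) - (g (x + t *: a) - g x)
   = t * t * 'D_b ('D_a g) (x + (p.1 *: (t *: a) + p.2 *: (t *: b))).
 move=> ga gab t t0.
 pose G y := g (y + t *: b) - g y.
 have Ga y : derivable G y a.
  by apply: derivableB => //; apply/derivable_shiftE.
 have DG y : 'D_a G y = 'D_a g (y + t *: b) - 'D_a g y.
  rewrite (deriveB _ (ga y)); last by apply/derivable_shiftE.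
  by rewrite derive_shiftE.
 have Gta y : derivable G y (t *: a) by have [] := deriveZv t (Ga y).
 have [s s01 Es] := MVT_line x Gta.
 have gtb y : derivable ('D_a g) y (t *: b) by have [] := deriveZv t (gab y).
 have [r r01 Er] := MVT_line (x + s *: (t *: a)) gtb.
 exists (s, r); first by rewrite /= s01 r01.
 move: Es; rewrite (deriveZv t (Ga _)).2 DG Er (deriveZv t (gab _)).2 /G addrA => E.
 have -> : x + t *: b + t *: a = x + t *: a + t *: b by rewrite addrAC.
 by rewrite /= -[RHS]mulrA -E subrACA.
apply/eqP; rewrite -subr_eq0 -normr_eq0; apply/eqP/le_anti; rewrite normr_ge0 andbT.
apply/ler_addgt0Pl => e e0; rewrite addr0.
have e2 : 0 < e / 2 by rewrite divr_gt0.
have [d1 d10 H1] := near_norm (c1 x) e2.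
have [d2 d20 H2] := near_norm (c2 x) e2.
pose d := Num.min d1 d2.
have d0 : 0 < d by rewrite lt_min d10 d20.
have [d3 d30 H3] := small_scale v (divr_gt0 d0 (ltr0Sn R 1)).
have [d4 d40 H4] := small_scale w (divr_gt0 d0 (ltr0Sn R 1)).
pose t := Num.min d3 d4 / 2.
have m0 : 0 < Num.min d3 d4 by rewrite lt_min d30 d40.
have t0 : 0 < t by rewrite divr_gt0.
have tm : t < Num.min d3 d4 by rewrite ltr_pdivrMr// ltr_pMr// ltr1n.
move: tm; rewrite lt_min => /andP[t3 t4].
have [p p01 Ep] := main f v w fv fvw t (lt0r_neq0 t0).
have [q q01 Eq] := main f w v fw fwv t (lt0r_neq0 t0).
have small (r : R * R) (a b : V) : `|t *: a| < d / 2 -> `|t *: b| < d / 2 ->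
  (0 < r.1 < 1) && (0 < r.2 < 1) ->
  `|r.1 *: (t *: a) + r.2 *: (t *: b)| < d.
 move=> ta tb /andP[/andP[r10 r11] /andP[r20 r21]].
 rewrite (le_lt_trans (ler_normD _ _))// [d]splitr ltrD//.
 - by rewrite normrZ (le_lt_trans _ ta)// ger0_norm ?(ltW r10)// ler_piMl// ltW.
 - by rewrite normrZ (le_lt_trans _ tb)// ger0_norm ?(ltW r20)// ler_piMl// ltW.
have tv : `|t *: v| < d / 2 by apply: H3; rewrite gtr0_norm.
have tw : `|t *: w| < d / 2 by apply: H4; rewrite gtr0_norm.
have Epq : 'D_w ('D_v f) (x + (p.1 *: (t *: v) + p.2 *: (t *: w))) =
      'D_v ('D_w f) (x + (q.1 *: (t *: w) + q.2 *: (t *: v))).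
 apply: (mulfI (lt0r_neq0 (mulr_gt0 t0 t0))).
 apply: etrans (esym Ep) (etrans _ Eq).
 by rewrite (addrAC x) subrACA.
have A1 := H1 _ (lt_le_trans (small p v w tv tw p01) _).
have A2 := H2 _ (lt_le_trans (small q w v tw tv q01) _).
have {}A1 := A1 (ltac:(by rewrite ge_min lexx)).
have {}A2 := A2 (ltac:(by rewrite ge_min lexx orbT)).
rewrite Epq in A1.
exact: dist_half A1 A2.
Qed.

End real_derivatives.

Notation normc := Normc.normc.
Notation Re := complex.Re.
Notation Im := complex.Im.

Lemma ReM (R : rcfType) (a b : R[i]) : Re (a * b) = Re a * Re b - Im a * Im b.
Proof. by case: a => ? ?; case: b. Qed.
Lemma ImM (R : rcfType) (a b : R[i]) : Im (a * b) = Re a * Im b + Im a * Re b.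
Proof. by case: a => ? ?; case: b. Qed.
Lemma ReD (R : rcfType) (a b : R[i]) : Re (a + b) = Re a + Re b.
Proof. by case: a => ? ?; case: b. Qed.
Lemma ImD (R : rcfType) (a b : R[i]) : Im (a + b) = Im a + Im b.
Proof. by case: a => ? ?; case: b. Qed.
Lemma ReB (R : rcfType) (a b : R[i]) : Re (a - b) = Re a - Re b.
Proof. by case: a => ? ?; case: b. Qed.
Lemma ImB (R : rcfType) (a b : R[i]) : Im (a - b) = Im a - Im b.
Proof. by case: a => ? ?; case: b. Qed.
Lemma ReMr (R : rcfType) (r : R) (a : R[i]) : Re (r%:C * a) = r * Re a.
Proof. by rewrite ReM /= mul0r subr0. Qed.
Lemma ImMr (R : rcfType) (r : R) (a : R[i]) : Im (r%:C * a) = r * Im a.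
Proof. by rewrite ImM /= mul0r addr0. Qed.
Lemma complexP (R : rcfType) (a b : R[i]) : Re a = Re b -> Im a = Im b -> a = b.
Proof. by case: a => ? ?; case: b => ? ? /= -> ->. Qed.
Lemma Re_le_normc (R : rcfType) (a : R[i]) : `|Re a| <= normc a.
Proof.
by case: a => x y /=; rewrite -sqrtr_sqr ler_wsqrtr// lerDl sqr_ge0.
Qed.
Lemma Im_le_normc (R : rcfType) (a : R[i]) : `|Im a| <= normc a.
Proof.
by case: a => x y /=; rewrite -sqrtr_sqr ler_wsqrtr// lerDr sqr_ge0.
Qed.
Lemma normc_le_ReIm (R : rcfType) (a : R[i]) : normc a <= `|Re a| + `|Im a|.
Proof.
case: a => x y /=; rewrite -ler_sqr ?nnegrE//.
rewrite sqr_sqrtr ?addr_ge0 ?sqr_ge0// sqrrD !real_normK ?num_real//.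
by rewrite -addrA lerD2l lerDr mulrn_wge0// mulr_ge0.
Qed.
Lemma normc_ge0 (R : rcfType) (a : R[i]) : 0 <= normc a.
Proof. by case: a => x y /=; exact: sqrtr_ge0. Qed.
Lemma normcR (R : rcfType) (a : R) : normc a%:C = `|a|.
Proof. by rewrite /= expr0n/= addr0 sqrtr_sqr. Qed.

HB.lock Definition dC (R : realType) (V : normedModType R) (v : V) (f : V -> R[i]) (x : V) : R[i] :=
 'D_v (fun y => Re (f y)) x +i* 'D_v (fun y => Im (f y)) x.

Section complex_derivatives.
Context {R : realType} {V : normedModType R}.
Implicit Types (f g : V -> R[i]) (x v w : V).

Definition contC f := continuous (fun y => Re (f y)) /\ continuous (fun y => Im (f y)).

Definition derC f v := forall x, derivable (fun y => Re (f y)) x v /\ derivable (fun y => Im (f y)) x v.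

Definition is_dC f v x (l : R[i]) :=
 is_derive x v (fun y => Re (f y)) (Re l) /\ is_derive x v (fun y => Im (f y)) (Im l).

Lemma dC_Re v f x : Re (dC v f x) = 'D_v (fun y => Re (f y)) x.
Proof. by rewrite dC.unlock. Qed.
Lemma dC_Im v f x : Im (dC v f x) = 'D_v (fun y => Im (f y)) x.
Proof. by rewrite dC.unlock. Qed.

Lemma derC_is f v x : derC f v -> is_dC f v x (dC v f x).
Proof.
by move=> /(_ x)[d1 d2]; split; apply: DeriveDef => //; rewrite ?dC_Re ?dC_Im.
Qed.

Lemma is_dC_val f v x l : is_dC f v x l -> dC v f x = l.
Proof.
move=> [[_ d1] [_ d2]]; apply: complexP.
 by rewrite dC_Re; exact: d1.
by rewrite dC_Im; exact: d2.
Qed.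

Lemma derC_mk f v (l : V -> R[i]) : (forall x, is_dC f v x (l x)) ->
 derC f v /\ dC v f = l.
Proof.
move=> H; split; first by move=> x; have [[? _] [? _]] := H x.
by apply/funext => x; exact: is_dC_val.
Qed.

Lemma is_der_add (f g : V -> R) v x a b : is_derive x v f a -> is_derive x v g b ->
 is_derive x v (fun y => f y + g y) (a + b).
Proof. by move=> ? ?; exact: (is_deriveD (f := f) (g := g)). Qed.

Lemma is_der_sub (f g : V -> R) v x a b : is_derive x v f a -> is_derive x v g b ->
 is_derive x v (fun y => f y - g y) (a - b).
Proof. by move=> ? ?; exact: (is_deriveB (f := f) (g := g)). Qed.

Lemma is_der_mul (f g : V -> R) v x a b : is_derive x v f a -> is_derive x v g b ->
 is_derive x v (fun y => f y * g y) (a * g x + f x * b).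
Proof.
move=> fa gb; have := is_deriveM (f := f) (g := g) fa gb.
by rewrite /GRing.scale/= addrC [g x * a]mulrC.
Qed.

Lemma is_dC_add f g v x a b : is_dC f v x a -> is_dC g v x b ->
 is_dC (fun y => f y + g y) v x (a + b).
Proof.
move=> [f1 f2] [g1 g2]; rewrite /is_dC ReD ImD; split.
 by under eq_fun do rewrite ReD; exact: is_der_add.
by under eq_fun do rewrite ImD; exact: is_der_add.
Qed.

Lemma is_dC_mul f g v x a b : is_dC f v x a -> is_dC g v x b ->
 is_dC (fun y => f y * g y) v x (a * g x + f x * b).
Proof.
move=> [f1 f2] [g1 g2]; rewrite /is_dC ReD ImD !ReM !ImM; split.
 under eq_fun do rewrite ReM.
 rewrite addrACA -opprD; apply: is_der_sub; exact: is_der_mul.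
under eq_fun do rewrite ImM.
by rewrite addrACA; apply: is_der_add; exact: is_der_mul.
Qed.

Lemma is_dC_cst (c : R[i]) v x : is_dC (fun=> c) v x 0.
Proof. by split; exact: is_derive_cst. Qed.

Lemma is_dC_real (h : V -> R) v x l : is_derive x v h l ->
 is_dC (fun y => (h y)%:C) v x (l%:C).
Proof. by move=> hl; split => //=; exact: is_derive_cst. Qed.

Lemma is_derive_lineP (h : V -> R) v x (a : R) :
 is_derive x v h a <-> is_derive (0 : R) (1 : R) (fun t : R => h (t *: v + x)) a.
Proof.
have E : (0 : R) *: v + x = x by rewrite scale0r add0r.
split=> [[hd <-]|[hd <-]].
 by rewrite -[in X in is_derive _ _ _ X]E; apply: is_derive_line; rewrite E.
apply: DeriveDef; last by rewrite derive_line E.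
by move: hd; rewrite /derivable line_quotientE E.
Qed.

Lemma is_der_comp (F : R -> R) (h : V -> R) v x (a b : R) :
 is_derive x v h a -> is_derive (h x) (1 : R) F b -> is_derive x v (fun y => F (h y)) (a * b).
Proof.
move=> /is_derive_lineP ha Fb; apply/is_derive_lineP; rewrite mulrC.
by apply: (is_derive1_comp (f := F)); rewrite ?scale0r ?add0r.
Qed.

(** Recursion on the order takes the place of the words of directions in [smooth], so that products
    and compositions can be treated by induction on k; [smooth_CinfP] relates the two notions. *)
Fixpoint Ck k f : Prop := contC f /\
 (if k is k'.+1 then forall v, derC f v /\ Ck k' (dC v f) else True).

Definition Cinf f := forall k, Ck k f.

Lemma Ck_cont k f : Ck k f -> contC f. Proof. by case: k => [|k] []. Qed.
Lemma Ck_dC k f v : Ck k.+1 f -> Ck k (dC v f).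
Proof. by move=> [_ /(_ v)[]]. Qed.
Lemma Ck_derC k f v : Ck k.+1 f -> derC f v.
Proof. by move=> [_ /(_ v)[]]. Qed.

Lemma Ck_le k f : Ck k.+1 f -> Ck k f.
Proof.
elim: k f => [|k IH] f [fc fd]; first by split.
by split => // v; split; [exact: (fd v).1|apply: IH; exact: (fd v).2].
Qed.

Lemma Cinf_dC f v : Cinf f -> Cinf (dC v f).
Proof. by move=> fs k; exact: Ck_dC (fs k.+1). Qed.
Lemma Cinf_derC f v : Cinf f -> derC f v.
Proof. by move=> fs; exact: Ck_derC (fs 1%N). Qed.
Lemma Cinf_cont f : Cinf f -> contC f.
Proof. by move=> fs; exact: Ck_cont (fs 0%N). Qed.
Lemma Cinf_coind (P : (V -> R[i]) -> Prop) :
 (forall f, P f -> contC f /\ forall v, derC f v /\ P (dC v f)) ->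
 forall f, P f -> Cinf f.
Proof.
move=> H f Pf k; elim: k f Pf => [|k IH] f /H[fc fd]; split => // v.
by have [? ?] := fd v; split => //; exact: IH.
Qed.

Lemma smooth_coind (P : (V -> R) -> Prop) :
 (forall f : V -> R, P f -> continuous f /\ forall v, (forall x, derivable f x v) /\ P ('D_v f)) ->
 forall f : V -> R, P f -> smooth f.
Proof.
(* [foldr] differentiates along the last direction of [vs] first, hence the induction from the
   right. *)
move=> H f Pf vs; elim/last_ind: vs f Pf => [|vs v IH] f Pf /=.
 by have [? fd] := H _ Pf; split => // v; exact: (fd v).1.
by have [? fd] := H _ Pf; rewrite foldr_rcons; apply: IH; exact: (fd v).2.
Qed.

Lemma smoothD (f : V -> R) v : smooth f -> smooth ('D_v f).
Proof. by move=> fs vs; have := fs (rcons vs v); rewrite foldr_rcons. Qed.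

Lemma smooth_CinfP f : smoothC f <-> Cinf f.
Proof.
split=> [|fs].
 apply: (Cinf_coind (P := @smoothC R V)) => {}f [f1 f2].
 have [[c1 d1] [c2 d2]] := (f1 [::], f2 [::]).
 split; first by split.
 move=> v; split; first by move=> x; split; [exact: d1|exact: d2].
 have ReE : (fun x => Re (dC v f x)) = 'D_v (fun x => Re (f x)) by apply/funext => x; exact: dC_Re.
 have ImE : (fun x => Im (dC v f x)) = 'D_v (fun x => Im (f x)) by apply/funext => x; exact: dC_Im.
 rewrite /smoothC ReE ImE.
 by split; [exact: (smoothD v f1)|exact: (smoothD v f2)].
split.
- apply: (smooth_coind (P := fun g : V -> R => exists2 h : V -> R[i], Cinf h & g = fun y => Re (h y)) _ (ex_intro2 _ _ f fs erefl)).
 move=> g [h hs ->]; have [c1 _] := Cinf_cont hs; split => // v; split.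
  by move=> x; have [] := Cinf_derC v hs x.
 by exists (dC v h); [exact: Cinf_dC|apply/funext => x; rewrite dC_Re].
- apply: (smooth_coind (P := fun g : V -> R => exists2 h : V -> R[i], Cinf h & g = fun y => Im (h y)) _ (ex_intro2 _ _ f fs erefl)).
 move=> g [h hs ->]; have [_ c1] := Cinf_cont hs; split => // v; split.
  by move=> x; have [] := Cinf_derC v hs x.
 by exists (dC v h); [exact: Cinf_dC|apply/funext => x; rewrite dC_Im].
Qed.

Lemma cont_add (f g : V -> R) : continuous f -> continuous g -> continuous (fun y => f y + g y).
Proof. by move=> fc gc x; exact: (cvgD (fc x) (gc x)). Qed.
Lemma cont_sub (f g : V -> R) : continuous f -> continuous g -> continuous (fun y => f y - g y).
Proof. by move=> fc gc x; exact: (cvgB (fc x) (gc x)). Qed.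
Lemma cont_mul (f g : V -> R) : continuous f -> continuous g -> continuous (fun y => f y * g y).
Proof. by move=> fc gc x; exact: (cvgM (fc x) (gc x)). Qed.

Lemma contC_add f g : contC f -> contC g -> contC (fun y => f y + g y).
Proof.
move=> [f1 f2] [g1 g2]; split.
 by under eq_fun do rewrite ReD; exact: cont_add.
by under eq_fun do rewrite ImD; exact: cont_add.
Qed.

Lemma contC_mul f g : contC f -> contC g -> contC (fun y => f y * g y).
Proof.
move=> [f1 f2] [g1 g2]; split.
 by under eq_fun do rewrite ReM; apply: cont_sub; exact: cont_mul.
by under eq_fun do rewrite ImM; apply: cont_add; exact: cont_mul.
Qed.

Lemma contC_cst (c : R[i]) : contC (fun=> c).
Proof. by split => x; exact: cst_continuous. Qed.

Lemma contC_real (h : V -> R) : continuous h -> contC (fun y => (h y)%:C).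
Proof. by move=> hc; split => // x; exact: cst_continuous. Qed.

Lemma dC_addE f g v : derC f v -> derC g v ->
 derC (fun y => f y + g y) v /\ dC v (fun y => f y + g y) = fun y => dC v f y + dC v g y.
Proof. by move=> fd gd; apply: derC_mk => x; apply: is_dC_add; exact: derC_is. Qed.

Lemma dC_mulE f g v : derC f v -> derC g v ->
 derC (fun y => f y * g y) v /\
 dC v (fun y => f y * g y) = fun y => dC v f y * g y + f y * dC v g y.
Proof. by move=> fd gd; apply: derC_mk => x; apply: is_dC_mul; exact: derC_is. Qed.

Lemma dC_cstE (c : R[i]) v :
 derC (fun=> c) v /\ dC v (fun=> c) = fun=> 0.
Proof. by apply: derC_mk => x; exact: is_dC_cst. Qed.

Lemma Ck_add k f g : Ck k f -> Ck k g -> Ck k (fun y => f y + g y).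
Proof.
elim: k f g => [|k IH] f g [fc fd] [gc gd]; split => //; try exact: contC_add.
move=> v; have [d ->] := dC_addE (fd v).1 (gd v).1.
by split; [exact: d|apply: IH; [exact: (fd v).2|exact: (gd v).2]].
Qed.

Lemma Ck_cst k (c : R[i]) : Ck k (fun=> c).
Proof.
elim: k c => [|k IH] c; split => //; try exact: contC_cst.
by move=> v; have [d ->] := dC_cstE c v; split; [exact: d|exact: IH].
Qed.

Lemma Ck_mul k f g : Ck k f -> Ck k g -> Ck k (fun y => f y * g y).
Proof.
elim: k f g => [|k IH] f g fk gk.
 by split=> //; apply: contC_mul; [exact: (Ck_cont fk)|exact: (Ck_cont gk)].
split=> [|v]; first by apply: contC_mul; [exact: (Ck_cont fk)|exact: (Ck_cont gk)].
have [d ->] := dC_mulE (Ck_derC v fk) (Ck_derC v gk); split => //.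
by apply: Ck_add; apply: IH; try exact: Ck_dC; exact: Ck_le.
Qed.

Lemma Cinf_add f g : Cinf f -> Cinf g -> Cinf (fun y => f y + g y).
Proof. by move=> fs gs k; exact: Ck_add. Qed.
Lemma Cinf_mul f g : Cinf f -> Cinf g -> Cinf (fun y => f y * g y).
Proof. by move=> fs gs k; exact: Ck_mul. Qed.
Lemma Cinf_cst (c : R[i]) : Cinf (fun=> c). Proof. by move=> k; exact: Ck_cst. Qed.
Lemma Cinf_scale (c : R[i]) f : Cinf f -> Cinf (fun y => c * f y).
Proof. by move=> fs; apply: Cinf_mul => //; exact: Cinf_cst. Qed.
Lemma Cinf_opp f : Cinf f -> Cinf (fun y => - f y).
Proof.
move=> fs; have -> : (fun y => - f y) = (fun y => -1 * f y).
 by apply/funext => y; rewrite mulN1r.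
exact: Cinf_scale.
Qed.
Lemma Cinf_sub f g : Cinf f -> Cinf g -> Cinf (fun y => f y - g y).
Proof. by move=> fs gs; apply: Cinf_add => //; exact: Cinf_opp. Qed.
Lemma Cinf_sum (I : Type) (r : seq I) (P : pred I) (F : I -> V -> R[i]) :
 (forall i, P i -> Cinf (F i)) -> Cinf (fun y => \sum_(i <- r | P i) F i y).
Proof.
move=> Fs; elim: r => [|i r IH].
 by under eq_fun do rewrite big_nil; exact: Cinf_cst.
under eq_fun do rewrite big_cons; case Pi : (P i); last exact: IH.
by apply: Cinf_add; [exact: Fs|exact: IH].
Qed.
Lemma dC_add f g v : Cinf f -> Cinf g ->
 dC v (fun y => f y + g y) = fun y => dC v f y + dC v g y.
Proof. by move=> fs gs; apply: (dC_addE _ _).2; exact: Cinf_derC. Qed.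
Lemma dC_mul f g v : Cinf f -> Cinf g ->
 dC v (fun y => f y * g y) = fun y => dC v f y * g y + f y * dC v g y.
Proof. by move=> fs gs; apply: (dC_mulE _ _).2; exact: Cinf_derC. Qed.
Lemma dC_cst (c : R[i]) v : dC v (fun=> c : R[i]) = fun=> 0.
Proof. exact: (dC_cstE _ _).2. Qed.
Lemma dC_scale (c : R[i]) f v : Cinf f ->
 dC v (fun y => c * f y) = fun y => c * dC v f y.
Proof.
move=> fs; rewrite (dC_mul v (Cinf_cst c) fs) dC_cst.
by apply/funext => y; rewrite mul0r add0r.
Qed.
Lemma dC_opp f v : Cinf f -> dC v (fun y => - f y) = fun y => - dC v f y.
Proof.
move=> fs; have -> : (fun y => - f y) = (fun y => -1 * f y).
 by apply/funext => y; rewrite mulN1r.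
by rewrite (dC_scale (-1) v fs); apply/funext => y; rewrite mulN1r.
Qed.
Lemma dC_sub f g v : Cinf f -> Cinf g ->
 dC v (fun y => f y - g y) = fun y => dC v f y - dC v g y.
Proof.
by move=> fs gs; rewrite (dC_add v fs (Cinf_opp gs)) (dC_opp v gs).
Qed.
Lemma dC_sum (I : Type) (r : seq I) (P : pred I) (F : I -> V -> R[i]) v :
 (forall i, P i -> Cinf (F i)) ->
 dC v (fun y => \sum_(i <- r | P i) F i y) = fun y => \sum_(i <- r | P i) dC v (F i) y.
Proof.
move=> Fs; elim: r => [|i r IH].
 under eq_fun do rewrite big_nil; rewrite dC_cst.
 by apply/funext => y; rewrite big_nil.
under eq_fun do rewrite big_cons; under [in RHS]eq_fun do rewrite big_cons.
case Pi : (P i); last exact: IH.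
by rewrite (dC_add v (Fs i Pi) (Cinf_sum _ Fs)) IH.
Qed.

End complex_derivatives.

Section directions.
Context {R : realType} {V : normedModType R}.
Implicit Types (f g : V -> R[i]) (x v w : V).

Lemma dC_real (h : V -> R) v x : dC v (fun y => (h y)%:C) x = ('D_v h x)%:C.
Proof.
apply: complexP; rewrite ?dC_Re ?dC_Im //=.
exact: derive_cst.
Qed.

Lemma Cinf_real_is (h : V -> R) v x : Cinf (fun y => (h y)%:C) -> is_derive x v h ('D_v h x).
Proof. by move=> hs; apply: DeriveDef => //; have [] := Cinf_derC v hs x. Qed.

Lemma dCZv f v (c : R) : Cinf f -> dC (c *: v) f = fun x => c%:C * dC v f x.
Proof.
move=> fs; apply/funext => x; have [d1 d2] := Cinf_derC v fs x.
apply: complexP; rewrite ?ReM ?ImM /= !mul0r ?subr0 ?addr0 ?dC_Re ?dC_Im.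
 exact: (deriveZv c d1).2.
exact: (deriveZv c d2).2.
Qed.

Lemma dCDv f v w : Cinf f -> dC (v + w) f = fun x => dC v f x + dC w f x.
Proof.
move=> fs; apply/funext => x.
have [c1 c2] := Cinf_cont (Cinf_dC w fs).
have E1 : (fun x => Re (dC w f x)) = 'D_w (fun x => Re (f x)) by apply/funext => ?; exact: dC_Re.
have E2 : (fun x => Im (dC w f x)) = 'D_w (fun x => Im (f x)) by apply/funext => ?; exact: dC_Im.
rewrite E1 in c1; rewrite E2 in c2.
apply: complexP; rewrite ?ReD ?ImD ?dC_Re ?dC_Im.
 exact: (deriveDv (fun y => (Cinf_derC v fs y).1) (fun y => (Cinf_derC w fs y).1) c1 x).2.
exact: (deriveDv (fun y => (Cinf_derC v fs y).2) (fun y => (Cinf_derC w fs y).2) c2 x).2.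
Qed.

Lemma dC0v f : dC 0 f = fun=> 0.
Proof. by apply/funext => x; apply: complexP; rewrite ?dC_Re ?dC_Im; exact: derive0. Qed.

Lemma dC_sumv f (I : Type) (r : seq I) (c : I -> R) (e : I -> V) : Cinf f ->
 dC (\sum_(i <- r) c i *: e i) f = fun x => \sum_(i <- r) (c i)%:C * dC (e i) f x.
Proof.
move=> fs; elim: r => [|i r IH].
 by rewrite big_nil dC0v; apply/funext => x; rewrite big_nil.
by rewrite big_cons (dCDv _ _ fs) (dCZv _ _ fs) IH; apply/funext => x; rewrite big_cons.
Qed.

Lemma dC_comm f v w : Cinf f -> dC w (dC v f) = dC v (dC w f).
Proof.
move=> fs; apply/funext => x.
have ReE u : (fun x => Re (dC u f x)) = 'D_u (fun x => Re (f x)) by apply/funext => ?; exact: dC_Re.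
have ImE u : (fun x => Im (dC u f x)) = 'D_u (fun x => Im (f x)) by apply/funext => ?; exact: dC_Im.
have Re2 u u' : (fun x => Re (dC u' (dC u f) x)) = 'D_u' ('D_u (fun x => Re (f x))).
 by apply/funext => ?; rewrite dC_Re ReE.
have Im2 u u' : (fun x => Im (dC u' (dC u f) x)) = 'D_u' ('D_u (fun x => Im (f x))).
 by apply/funext => ?; rewrite dC_Im ImE.
have d1 u y : derivable (fun x => Re (f x)) y u by have [] := Cinf_derC u fs y.
have d2 u y : derivable (fun x => Im (f x)) y u by have [] := Cinf_derC u fs y.
have dd1 u u' y : derivable ('D_u (fun x => Re (f x))) y u'.
 by rewrite -ReE; have [] := Cinf_derC u' (Cinf_dC u fs) y.
have dd2 u u' y : derivable ('D_u (fun x => Im (f x))) y u'.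
 by rewrite -ImE; have [] := Cinf_derC u' (Cinf_dC u fs) y.
have c1 u u' : continuous ('D_u' ('D_u (fun x => Re (f x)))).
 by rewrite -Re2; have [] := Cinf_cont (Cinf_dC u' (Cinf_dC u fs)).
have c2 u u' : continuous ('D_u' ('D_u (fun x => Im (f x)))).
 by rewrite -Im2; have [] := Cinf_cont (Cinf_dC u' (Cinf_dC u fs)).
apply: complexP; rewrite ?dC_Re ?dC_Im ?ReE ?ImE.
 exact: (derive_comm (d1 v) (d1 w) (dd1 v w) (dd1 w v) (c1 v w) (c1 w v)).
exact: (derive_comm (d2 v) (d2 w) (dd2 v w) (dd2 w v) (c2 v w) (c2 w v)).
Qed.

(** The factor 2 comes from applying the real mean value theorem to the real and the imaginary part
    separately. *)
Lemma mean_value f v x (B : R) : Cinf f ->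
 (forall s : R, 0 <= s <= 1 -> normc (dC v f (x + s *: v)) <= B) ->
 normc (f (x + v) - f x) <= 2 * B.
Proof.
move=> fs H; apply: le_trans (normc_le_ReIm _) _; rewrite mulr_natl mulr2n.
have oc (s : R) : 0 < s < 1 -> 0 <= s <= 1 by move=> /andP[? ?]; rewrite !ltW.
apply: lerD.
 have [s /oc s01] := MVT_line x (fun y => (Cinf_derC v fs y).1).
 rewrite -dC_Re ReB => ->.
 by apply: le_trans (H s s01); exact: Re_le_normc.
have [s /oc s01] := MVT_line x (fun y => (Cinf_derC v fs y).2).
rewrite -dC_Im ImB => ->.
by apply: le_trans (H s s01); exact: Im_le_normc.
Qed.

Lemma second_order f v x (B : R) : Cinf f ->
 (forall s : R, 0 <= s <= 1 -> normc (dC v (dC v f) (x + s *: v)) <= B) ->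
 normc (f (x + v) - f x - dC v f x) <= 4 * B.
Proof.
move=> fs H.

have sB (s : R) : 0 <= s <= 1 -> normc (dC v f (x + s *: v) - dC v f x) <= 2 * B.
 move=> /andP[s0 s1].
 apply: mean_value; first exact: Cinf_dC.
 move=> t /andP[t0 t1]; rewrite (dCZv _ _ (Cinf_dC v fs)) Normc.normcM normcR ger0_norm//.
 rewrite scalerA; apply: le_trans (H (t * s) _); last by rewrite mulr_ge0//= mulr_ile1.
 by rewrite ler_piMl// normc_ge0.
have oc (s : R) : 0 < s < 1 -> 0 <= s <= 1 by move=> /andP[? ?]; rewrite !ltW.
apply: le_trans (normc_le_ReIm _) _.
have -> : 4 * B = 2 * B + 2 * B by rewrite -mulrDl -natrD.
apply: lerD.
 have [s /oc s01] := MVT_line x (fun y => (Cinf_derC v fs y).1).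
 rewrite -dC_Re => E; apply: le_trans (sB s s01); apply: le_trans (Re_le_normc _).
 by rewrite !ReB E.
have [s /oc s01] := MVT_line x (fun y => (Cinf_derC v fs y).2).
rewrite -dC_Im => E; apply: le_trans (sB s s01); apply: le_trans (Im_le_normc _).
by rewrite !ImB E.
Qed.

(** Differentiation under an integral sign goes through this criterion: a second-order Taylor bound
    on the integrand, integrated, is a quadratic error for the integral, and no limit has to be
    exchanged with it. *)
Lemma is_dC_quad f v x (l : R[i]) (B : R) :
 (forall t : R, `|t| <= 1 -> normc (f (x + t *: v) - f x - t%:C * l) <= B * t ^+ 2) ->
 is_dC f v x l.
Proof.
move=> H.
have main (h : V -> R) (m : R) :
  (forall t : R, `|t| <= 1 -> `|h (x + t *: v) - h x - t * m| <= B * t ^+ 2) ->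
  is_derive x v h m.
 move=> Hh; have [? ?] : derivable h x v /\ 'D_v h x = m; last exact: DeriveDef.
 apply: derive_cvgP => e e0.
 pose d := Num.min 1 (e / (`|B| + 1)).
 exists d; first by rewrite lt_min ltr01 divr_gt0.
 move=> t t0; rewrite lt_min => /andP[t1 td].
 apply: (le_trans (Hh t (ltW t1))).
 rewrite -real_normK ?num_real// expr2 mulrA ler_wpM2r//.
 apply: (@le_trans _ _ ((`|B| + 1) * `|t|)).
  by rewrite ler_wpM2r// (le_trans (ler_norm B))// lerDl.
 by rewrite mulrC -ler_pdivlMr// ltW.
split; apply: main => t t1; apply: le_trans (H t t1).
 by apply: le_trans (Re_le_normc _); rewrite !ReB ReMr.
by apply: le_trans (Im_le_normc _); rewrite !ImB ImMr.
Qed.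

End directions.

(** * Compositions of smooth functions and the chain rule *)

Section compositions.
Context {R : realType} {V : normedModType R}.
Implicit Types (f g : V -> R[i]) (x v w : V).

Lemma contC_comp (W : normedModType R) (A : V -> W) (f : W -> R[i]) :
 continuous A -> contC f -> contC (fun y => f (A y)).
Proof.
move=> Ac [f1 f2]; split => y.
 exact: (continuous_comp (Ac y) (f1 (A y))).
exact: (continuous_comp (Ac y) (f2 (A y))).
Qed.

Lemma dC_affine (W : normedModType R) (A : V -> W) (v : V) (a : W) (f : W -> R[i]) :
 (forall (t : R) x, A (t *: v + x) = t *: a + A x) ->
 forall x, dC v (fun y => f (A y)) x = dC a f (A x).
Proof.
move=> AE x.
have E (h : W -> R) : 'D_v (fun y => h (A y)) x = 'D_a h (A x).
 rewrite /derive (_ : (fun t => _) = (fun t => t^-1 *: ((h \o shift (A x)) (t *: a) - h (A x))))//.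
 by apply/funext => t /=; rewrite AE.
apply: complexP; [rewrite !dC_Re|rewrite !dC_Im].
 exact: (E (fun u => Re (f u))).
exact: (E (fun u => Im (f u))).
Qed.

Lemma Cinf_affine (W : normedModType R) (A : V -> W) (A0 : V -> W) (f : W -> R[i]) :
 continuous A -> (forall v (t : R) x, A (t *: v + x) = t *: A0 v + A x) ->
 Cinf f -> Cinf (fun y => f (A y)).
Proof.
move=> Ac AE fs.
apply: (Cinf_coind (P := fun g => exists2 h : W -> R[i], Cinf h & g = fun y => h (A y))); last by exists f.
move=> g [h hs ->]; split; first exact: contC_comp (Cinf_cont hs).
move=> v; split.
 move=> x; have [d1 d2] := Cinf_derC (A0 v) hs (A x).
 have E (k : W -> R) : derivable k (A x) (A0 v) -> derivable (fun y => k (A y)) x v.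
  rewrite /derivable (_ : (fun t : R => t^-1 *: ((k \o shift (A x)) (t *: A0 v) - k (A x))) =
   (fun t : R => t^-1 *: (((fun y => k (A y)) \o shift x) (t *: v) - k (A x))))//.
  by apply/funext => t /=; rewrite AE.
 by split; [exact: (E (fun u => Re (h u)))|exact: (E (fun u => Im (h u)))].
exists (dC (A0 v) h); first exact: Cinf_dC.
by apply/funext => x; exact: dC_affine.
Qed.

(** A solution of the linear equations D_v F = G_v F is as regular as its coefficients; this covers
    exponentials. *)
Lemma Cinf_gen (F : V -> R[i]) (G : V -> V -> R[i]) : contC F ->
 (forall v, derC F v /\ dC v F = fun y => G v y * F y) ->
 forall k, (forall v, Ck k (G v)) -> Ck k F.
Proof.
move=> Fc Fd; elim=> [|k IH] Gk; first by split.
split => // v; have [d ->] := Fd v; split => //.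
by apply: Ck_mul; [exact: Ck_le (Gk v)|apply: IH => w; exact: Ck_le (Gk w)].
Qed.

Lemma is_dC_expi (h : V -> R) v x (l : R) : is_derive x v h l ->
 is_dC (fun y => expi (h y)) v x ('i%C * l%:C * expi (h x)).
Proof.
move=> hl; split.
 apply: (is_derive_eq (is_der_comp (F := @cos R) hl (is_derive_cos _))).
 by rewrite !ReM !ImM /=; ring.
apply: (is_derive_eq (is_der_comp (F := @sin R) hl (is_derive_sin _))).
by rewrite !ImM !ReM /=; ring.
Qed.

Lemma cont_of_Cinf (h : V -> R) : Cinf (fun y => (h y)%:C) -> continuous h.
Proof. by move=> hs; have [] := Cinf_cont hs. Qed.

Lemma dC_expi (h : V -> R) v : Cinf (fun y => (h y)%:C) ->
 derC (fun y => expi (h y)) v /\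
 dC v (fun y => expi (h y)) = fun y => 'i%C * dC v (fun y => (h y)%:C) y * expi (h y).
Proof.
move=> hs; apply: derC_mk => x; rewrite dC_real; exact: (is_dC_expi (Cinf_real_is v x hs)).
Qed.

Lemma Cinf_expi (h : V -> R) : Cinf (fun y => (h y)%:C) -> Cinf (fun y => expi (h y)).
Proof.
move=> hs k; apply: (Cinf_gen (G := fun v y => 'i%C * dC v (fun y => (h y)%:C) y)).
- split => x.
  exact: (continuous_comp (@cont_of_Cinf h hs x) (@continuous_cos R (h x))).
 exact: (continuous_comp (@cont_of_Cinf h hs x) (@continuous_sin R (h x))).
- by move=> v; exact: dC_expi.
- by move=> v; apply: Cinf_scale; exact: Cinf_dC.
Qed.

Lemma dC_expR (h : V -> R) v : Cinf (fun y => (h y)%:C) ->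
 derC (fun y => (expR (h y))%:C) v /\
 dC v (fun y => (expR (h y))%:C) = fun y => dC v (fun y => (h y)%:C) y * (expR (h y))%:C.
Proof.
move=> hs; apply: derC_mk => x; rewrite dC_real -rmorphM; apply: is_dC_real.
exact: (is_der_comp (Cinf_real_is v x hs) (is_derive_expR _)).
Qed.

Lemma Cinf_expR (h : V -> R) : Cinf (fun y => (h y)%:C) -> Cinf (fun y => (expR (h y))%:C).
Proof.
move=> hs k; apply: (Cinf_gen (G := fun v y => dC v (fun y => (h y)%:C) y)).
- apply: contC_real => x.
 exact: (continuous_comp (@cont_of_Cinf h hs x) (@continuous_expR R (h x))).
- by move=> v; exact: dC_expR.
- by move=> v; exact: Cinf_dC.
Qed.

Lemma dC_inv (h : V -> R) v : Cinf (fun y => (h y)%:C) -> (forall y, h y != 0) ->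
 derC (fun y => ((h y)^-1)%:C) v /\
 dC v (fun y => ((h y)^-1)%:C) = fun y => - dC v (fun y => (h y)%:C) y * ((h y)^-1)%:C * ((h y)^-1)%:C.
Proof.
move=> hs h0; apply: derC_mk => x; rewrite dC_real -rmorphN -!rmorphM; apply: is_dC_real.
have -> : - 'D_v h x * (h x)^-1 * (h x)^-1 = 'D_v h x * (- (h x) ^- 2 *: 1).
 by rewrite /GRing.scale/= mulr1 -mulrA mulNr mulrN expr2 invfM.
apply: (is_der_comp (F := fun t => t^-1) (Cinf_real_is v x hs)).
exact: (is_deriveV (f := id)).
Qed.

Lemma Cinf_inv (h : V -> R) : Cinf (fun y => (h y)%:C) -> (forall y, h y != 0) ->
 Cinf (fun y => ((h y)^-1)%:C).
Proof.
move=> hs h0; elim=> [|k IH].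
 split => //; apply: contC_real => x.
 exact: (continuous_comp (@cont_of_Cinf h hs x) (inv_continuous (h0 x))).
split; first exact: Ck_cont IH.
move=> v; have [d ->] := dC_inv v hs h0; split => //.
by apply: Ck_mul => //; apply: Ck_mul => //; apply: Cinf_opp; exact: Cinf_dC.
Qed.

Lemma dC_ln (h : V -> R) v : Cinf (fun y => (h y)%:C) -> (forall y, 0 < h y) ->
 derC (fun y => (ln (h y))%:C) v /\
 dC v (fun y => (ln (h y))%:C) = fun y => dC v (fun y => (h y)%:C) y * ((h y)^-1)%:C.
Proof.
move=> hs h0; apply: derC_mk => x; rewrite dC_real -rmorphM; apply: is_dC_real.
exact: (is_der_comp (Cinf_real_is v x hs) (is_derive1_ln (h0 x))).
Qed.

Lemma Cinf_ln (h : V -> R) : Cinf (fun y => (h y)%:C) -> (forall y, 0 < h y) ->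
 Cinf (fun y => (ln (h y))%:C).
Proof.
move=> hs h0 k.
have c : contC (fun y => (ln (h y))%:C).
 apply: contC_real => x.
 exact: (continuous_comp (@cont_of_Cinf h hs x) (@continuous_ln R (h x) (h0 x))).
case: k => [|k]; first by split.
split => // v; have [d ->] := dC_ln v hs h0; split => //.
apply: Ck_mul; first exact: Cinf_dC.
by apply: Cinf_inv => // y; rewrite gt_eqF.
Qed.

End compositions.

Lemma telescope_step (R : comRingType) (a b c d t : R) :
 a - b - (c + t) = a - d - c + (d - b - t).
Proof. ring. Qed.

Section chain_rule.
Context {R : realType} {V W : normedModType R} {I : finType}.
Variables (e : I -> W) (co : I -> W -> R).
Hypothesis co_sum : forall w, w = \sum_i co i w *: e i.
Hypothesis coB : forall i w w', co i (w - w') = co i w - co i w'.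

Lemma finite_delta (P : I -> R -> Prop) :
 (forall i, exists2 d : R, 0 < d & forall d', d' <= d -> P i d') ->
 exists2 d : R, 0 < d & forall i, P i d.
Proof.
move=> H.
suff [d d0 Hd] : exists2 d : R, 0 < d & forall i, i \in enum I -> forall d', d' <= d -> P i d'.
 by exists d => // i; apply: (Hd i); rewrite ?mem_enum.
elim: (enum I) => [|i r [d d0 Hd]]; first by exists 1.
have [d1 d10 H1] := H i.
exists (Num.min d d1) => [|j]; first by rewrite lt_min d0.
rewrite inE => /orP[/eqP->|jr] d'; rewrite le_min => /andP[dd dd1]; first exact: H1.
exact: Hd.
Qed.

(** First-order expansion from continuous partial derivatives: the increments are added one
    coordinate at a time, each leg being treated by the mean value theorem. *)
Lemma C1_expansion (h : W -> R) (y : W) (r : seq I) :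
 (forall i z, derivable h z (e i)) ->
 (forall i, continuous ('D_(e i) h)) ->
 forall eps : R, 0 < eps -> exists2 d : R, 0 < d & forall c : I -> R, (forall i, `|c i| < d) ->
 `|h (y + \sum_(i <- r) c i *: e i) - h y - \sum_(i <- r) c i * 'D_(e i) h y|
   <= eps * \sum_(i <- r) `|c i|.
Proof.
move=> hd hc eps eps0; elim: r => [|i r [d d0 Hd]].
 by exists 1 => // c _; rewrite !big_nil addr0 subrr subr0 normr0 mulr0.
have [d1 d10 H1] := near_norm (hc i y) eps0.
pose K := \sum_(j <- i :: r) `|e j| + 1.
have K0 : 0 < K by rewrite ltr_wpDl// sumr_ge0.
exists (Num.min d (d1 / K)); first by rewrite lt_min d0 divr_gt0.
move=> c Hc; have cd j : `|c j| < d by have := Hc j; rewrite lt_min => /andP[].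
have cd1 j : `|c j| < d1 / K by have := Hc j; rewrite lt_min => /andP[].
set S := \sum_(j <- r) c j *: e j.
have hdi z : derivable h z (c i *: e i) by have [] := deriveZv (c i) (hd i z).
have [s /andP[s0 s1] Es] := MVT_line (y + S) hdi.
rewrite (deriveZv _ (hd i _)).2 in Es.
rewrite !big_cons -/S addrCA addrC.
have -> : h (y + S + c i *: e i) - h y - (c i * 'D_(e i) h y + \sum_(j <- r) c j * 'D_(e j) h y)
 = c i * ('D_(e i) h (y + (S + s *: (c i *: e i))) - 'D_(e i) h y) +
  (h (y + S) - h y - \sum_(j <- r) c j * 'D_(e j) h y).
 by rewrite (addrA y S) mulrBr -Es; exact: telescope_step.
rewrite (le_trans (ler_normD _ _))// [leRHS]mulrDr lerD ?Hd//.
rewrite normrM mulrC ler_wpM2r// H1//.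
apply: (@le_lt_trans _ _ ((d1 / K) * \sum_(j <- i :: r) `|e j|)).
 rewrite big_cons mulrDr addrC (le_trans (ler_normD _ _))// lerD//.
  rewrite !normrZ ger0_norm ?(ltW s0)// mulrA ler_wpM2r// -[leRHS]mul1r.
  by rewrite ler_pM// ?ltW.
 rewrite /S; elim: (r) => [|j t IH]; first by rewrite !big_nil normr0 mulr0.
 by rewrite !big_cons mulrDr (le_trans (ler_normD _ _))// lerD// normrZ ler_wpM2r// ltW.
rewrite -ltr_pdivlMl; last by rewrite divr_gt0.
by rewrite invf_div divfK ?gt_eqF// /K ltrDl.
Qed.

Lemma is_der_chain (h : W -> R) (g : V -> W) (v x : V) (a : I -> R) :
 (forall i z, derivable h z (e i)) -> (forall i, continuous ('D_(e i) h)) ->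
 (forall i, is_derive x v (fun y => co i (g y)) (a i)) ->
 is_derive x v (fun y => h (g y)) (\sum_i a i * 'D_(e i) h (g x)).
Proof.
move=> hd hc ga.
suff [? ?] : derivable (fun y => h (g y)) x v /\
  'D_v (fun y => h (g y)) x = \sum_i a i * 'D_(e i) h (g x) by exact: DeriveDef.
apply: derive_cvgP => eps eps0.
pose K := \sum_i (`|a i| + 1) + 1.
have K0 : 0 < K by rewrite ltr_wpDl// sumr_ge0// => i _; rewrite addr_ge0.
pose L := \sum_i `|'D_(e i) h (g x)| + 1.
have L0 : 0 < L by rewrite ltr_wpDl// sumr_ge0.
have [d d0 Hd] := C1_expansion (g x) (index_enum I) hd hc (divr_gt0 (divr_gt0 eps0 (ltr0Sn R 1)) K0).
(* The bound by 1 gives |c i| <= (|a i| + 1) |t|; the other one makes the error of linearising the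
   coordinates of g at most half of eps |t|. *)
pose e1 := Num.min 1 (eps / 2 / L).
have e10 : 0 < e1 by rewrite lt_min ltr01 divr_gt0// divr_gt0.
have [d1 d10 Hd1] : exists2 d1 : R, 0 < d1 & forall i, forall t : R, `|t| < d1 ->
  `|co i (g (x + t *: v)) - co i (g x) - t * a i| <= e1 * `|t|.
 apply: finite_delta => i.
 have [gd gE] := ga i.
 have [d2 d20 H2] := derive_epsP gd e10.
 exists d2 => // d' d'd t td; have := H2 t (lt_le_trans td d'd).
 by rewrite gE.

exists (Num.min d1 (d / K)); first by rewrite lt_min d10 divr_gt0.
move=> t t0; rewrite lt_min => /andP[td1 td].
pose c i := co i (g (x + t *: v)) - co i (g x).
have cle i : `|c i| <= (`|a i| + 1) * `|t|.
 have := Hd1 i t td1; rewrite -/(c i) => H.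
 rewrite -[c i](subrK (t * a i)) (le_trans (ler_normD _ _))// addrC mulrDl lerD//.
  by rewrite normrM mulrC.
 by rewrite (le_trans H)// ler_wpM2r// /e1 ge_min lexx.
have cd i : `|c i| < d.
 apply: (le_lt_trans (cle i)); apply: (@le_lt_trans _ _ (K * `|t|)).
  rewrite ler_wpM2r// /K (bigD1 i)//= -[leRHS]addrA lerDl ltW// ltr_wpDl//.
  by rewrite sumr_ge0// => j _; rewrite ltW.
 by rewrite mulrC -ltr_pdivlMr.
have Eg : g (x + t *: v) = g x + \sum_i c i *: e i.
 rewrite -[LHS](subrK (g x)) addrC; congr (_ + _).
 by rewrite [LHS]co_sum; apply: eq_bigr => i _; rewrite coB.
have := Hd c cd; rewrite -Eg => H.
have E2 : h (g (x + t *: v)) - h (g x) - t * (\sum_i a i * 'D_(e i) h (g x)) =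
 (h (g (x + t *: v)) - h (g x) - \sum_i c i * 'D_(e i) h (g x)) +
 \sum_i (c i - t * a i) * 'D_(e i) h (g x).
 have -> : \sum_i (c i - t * a i) * 'D_(e i) h (g x) =
   \sum_i c i * 'D_(e i) h (g x) - t * (\sum_i a i * 'D_(e i) h (g x)).
  by rewrite mulr_sumr -sumrB; apply: eq_bigr => i _; rewrite mulrBl mulrA.
 by rewrite subrKA.
rewrite E2 (le_trans (ler_normD _ _))// [eps]splitr mulrDl lerD//.
 apply: (le_trans H); rewrite -[leLHS]mulrA ler_wpM2l ?divr_ge0// ?(ltW eps0)//.
 rewrite ler_pdivrMl// /K mulrDl mul1r mulr_suml.
 by rewrite (@le_trans _ _ (\sum_i (`|a i| + 1) * `|t|)) ?ler_sum// lerDl.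
apply: (le_trans (ler_norm_sum _ _ _)).
apply: (@le_trans _ _ (\sum_i (e1 * `|t|) * `|'D_(e i) h (g x)|)).
 by apply: ler_sum => i _; rewrite normrM ler_wpM2r// Hd1.
rewrite -mulr_sumr mulrAC ler_wpM2r//.
apply: (@le_trans _ _ (e1 * L)); first by rewrite ler_wpM2l ?(ltW e10)// lerDl.
by rewrite -ler_pdivlMr// /e1 ge_min lexx orbT.
Qed.

Lemma is_dC_chain (f : W -> R[i]) (g : V -> W) (v x : V) (a : I -> R) : Cinf f ->
 (forall i, is_derive x v (fun y => co i (g y)) (a i)) ->
 is_dC (fun y => f (g y)) v x (\sum_i (a i)%:C * dC (e i) f (g x)).
Proof.
move=> fs ga.
have ReE u : 'D_u (fun x => Re (f x)) = (fun x => Re (dC u f x)) by apply/funext => ?; rewrite dC_Re.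
have ImE u : 'D_u (fun x => Im (f x)) = (fun x => Im (dC u f x)) by apply/funext => ?; rewrite dC_Im.
have RS (F : I -> R[i]) : Re (\sum_i F i) = \sum_i Re (F i).
 by elim/big_rec2 : _ => // i y z _ <-; rewrite ReD.
have IS (F : I -> R[i]) : Im (\sum_i F i) = \sum_i Im (F i).
 by elim/big_rec2 : _ => // i y z _ <-; rewrite ImD.
rewrite /is_dC RS IS; split.
 under eq_bigr do rewrite ReMr dC_Re.
 apply: (is_der_chain (h := fun y => Re (f y)) (g := g)) => //.
  by move=> i z; have [] := Cinf_derC (e i) fs z.
 by move=> i; rewrite ReE; have [] := Cinf_cont (Cinf_dC (e i) fs).
under eq_bigr do rewrite ImMr dC_Im.
apply: (is_der_chain (h := fun y => Im (f y)) (g := g)) => //.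
 by move=> i z; have [] := Cinf_derC (e i) fs z.
by move=> i; rewrite ImE; have [] := Cinf_cont (Cinf_dC (e i) fs).
Qed.

Lemma dC_chain (f : W -> R[i]) (g : V -> W) (v : V) : Cinf f ->
 (forall i, Cinf (fun y => (co i (g y))%:C)) ->
 derC (fun y => f (g y)) v /\
 dC v (fun y => f (g y)) =
  fun x => \sum_i dC v (fun y => (co i (g y))%:C) x * dC (e i) f (g x).
Proof.
move=> fs gs; apply: derC_mk => x.
under eq_bigr do rewrite dC_real.
by apply: is_dC_chain => // i; exact: Cinf_real_is.
Qed.

Lemma Cinf_chain (f : W -> R[i]) (g : V -> W) : Cinf f -> continuous g ->
 (forall i, Cinf (fun y => (co i (g y))%:C)) -> Cinf (fun y => f (g y)).
Proof.
move=> fs gc gs k; elim: k f fs => [|k IH] f fs.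
 by split => //; apply: contC_comp => //; exact: Cinf_cont.
split; first by apply: contC_comp => //; exact: Cinf_cont.
move=> v; have [d ->] := dC_chain v fs gs; split => //.
elim: (index_enum I) => [|i r IHr].
 by under eq_fun do rewrite big_nil; exact: Ck_cst.
under eq_fun do rewrite big_cons; apply: Ck_add => //.
apply: Ck_mul; first exact: Cinf_dC.
by apply: IH; exact: Cinf_dC.
Qed.

End chain_rule.

(** * Symbol classes *)

Section words.
Context {R : realType} {V : normedModType R} {I : eqType}.
Variable e : I -> V.

Fixpoint Dw (w : seq I) (f : V -> R[i]) : V -> R[i] :=
 if w is i :: w' then Dw w' (dC (e i) f) else f.

Lemma Cinf_Dw w f : Cinf f -> Cinf (Dw w f).
Proof. by elim: w f => //= i w IH f fs; apply: IH; exact: Cinf_dC. Qed.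

Lemma Dw_cat w1 w2 f : Dw (w1 ++ w2) f = Dw w2 (Dw w1 f).
Proof. by elim: w1 f => //= i w1 IH f. Qed.

Lemma Dw_dC w v f : Cinf f -> Dw w (dC v f) = dC v (Dw w f).
Proof.
elim: w f => //= i w IH f fs.
by rewrite (dC_comm v (e i) fs) IH//; exact: Cinf_dC.
Qed.

Lemma Dw_rcons w i f : Dw (rcons w i) f = dC (e i) (Dw w f).
Proof. by rewrite -cats1 Dw_cat. Qed.

Lemma Dw_perm w1 w2 f : Cinf f -> perm_eq w1 w2 -> Dw w1 f = Dw w2 f.
Proof.
elim: w1 w2 f => [|i w1 IH] w2 f fs.
 by move=> /perm_size/esym/size0nil ->.
move=> p; have iw2 : i \in w2 by rewrite -(perm_mem p) mem_head.
have p' := perm_to_rem iw2.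
have := perm_trans p p'; rewrite perm_cons => p1.
rewrite /= (IH _ _ (Cinf_dC _ fs) p1).
case/splitPr: iw2 {p p' p1} => r s.
elim: r f fs => [|j r IHr] f fs /=; first by rewrite eqxx.
case: eqVneq => [->//|ji].
by rewrite /= -IHr; [rewrite (dC_comm _ _ fs)|exact: Cinf_dC].
Qed.

Lemma Dw_add w f g : Cinf f -> Cinf g ->
 Dw w (fun y => f y + g y) = fun y => Dw w f y + Dw w g y.
Proof.
elim: w f g => //= i w IH f g fs gs.
by rewrite dC_add// IH//; exact: Cinf_dC.
Qed.
Lemma Dw_scale w (c : R[i]) f : Cinf f -> Dw w (fun y => c * f y) = fun y => c * Dw w f y.
Proof.
elim: w f => //= i w IH f fs.
by rewrite dC_scale// IH//; exact: Cinf_dC.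
Qed.
Lemma Dw_sub w f g : Cinf f -> Cinf g ->
 Dw w (fun y => f y - g y) = fun y => Dw w f y - Dw w g y.
Proof.
elim: w f g => //= i w IH f g fs gs.
by rewrite dC_sub// IH//; exact: Cinf_dC.
Qed.
Lemma Dw_cst i w (c : R[i]) : Dw (i :: w) (fun=> c) = fun=> 0.
Proof. by rewrite /= dC_cst; elim: w => //= j w IH; rewrite dC_cst. Qed.
End words.

Section symbol_classes.
Context {R : realType} {V : normedModType R} {I : eqType} {T : Type}.
Variable e : I -> V.
Local Notation wgt := (T -> V -> R).
Local Notation fam := (T -> V -> R[i]).
Implicit Types (m : wgt) (f g : fam) (sg : I -> wgt).

Definition bnd f m := exists2 C : R, 0 <= C & forall t x, normc (f t x) <= C * m t x.

(** Bounds up to order k, uniform in the parameter t, where m is the size of the family and [sg i]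
    the factor brought by each derivative along [e i]. SG classes (gains <x>^-r and <xi>^-rho),
    families with losses in a parameter and the anisotropic scales are all instances, so the
    calculus is done once. *)
Definition symk k sg m f := (forall t, Cinf (f t)) /\
 forall w : seq I, (size w <= k)%N ->
  bnd (fun t => Dw e w (f t)) (fun t x => m t x * \prod_(i <- w) sg i t x).

Definition sym sg m f := forall k, symk k sg m f.

Lemma bnd_le f m m' (K : R) : 0 <= K -> (forall t x, m t x <= K * m' t x) ->
 bnd f m -> bnd f m'.
Proof.
move=> K0 mm [C C0 H]; exists (C * K); first exact: mulr_ge0.
by move=> t x; rewrite (le_trans (H t x))// -mulrA ler_wpM2l.
Qed.

Lemma sym_Cinf sg m f t : sym sg m f -> Cinf (f t). Proof. by move=> /(_ 0%N)[]. Qed.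
Lemma sym_bnd sg m f : sym sg m f -> bnd f m.
Proof.
move=> /(_ 0%N)[_ /(_ [::] isT)]; apply: (bnd_le (K := 1)) => // t x.
by rewrite big_nil mulr1 mul1r.
Qed.

Lemma symk_leq k k' sg m f : (k' <= k)%N -> symk k sg m f -> symk k' sg m f.
Proof. by move=> kk [? H]; split=> // w wk; apply: H; exact: leq_trans kk. Qed.

Lemma symk_le k sg m m' f (K : R) : 0 <= K -> (forall i t x, 0 <= sg i t x) ->
 (forall t x, m t x <= K * m' t x) -> symk k sg m f -> symk k sg m' f.
Proof.
move=> K0 s0 mm [fs H]; split=> // w wk; apply: bnd_le K0 _ (H w wk) => t x.
by rewrite mulrA ler_wpM2r// prodr_ge0.
Qed.

Lemma sym_le sg m m' f (K : R) : 0 <= K -> (forall i t x, 0 <= sg i t x) ->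
 (forall t x, m t x <= K * m' t x) -> sym sg m f -> sym sg m' f.
Proof. by move=> K0 s0 mm fs k; exact: symk_le K0 s0 mm (fs k). Qed.

Lemma sym_eqw sg m m' f : (forall t x, m t x = m' t x) -> sym sg m f -> sym sg m' f.
Proof.
move=> mm; suff -> : m = m' by [].
by apply/funext => t; apply/funext => x.
Qed.

Lemma sym_sg sg sg' m f (K : R) : 0 <= K -> (forall t x, 0 <= m t x) ->
 (forall i t x, 0 <= sg i t x <= K * sg' i t x) ->
 sym sg m f -> sym sg' m f.
Proof.
move=> K0 m0 ss fs k; have [fC H] := fs k; split=> // w wk.
apply: bnd_le (exprn_ge0 (size w) K0) _ (H w wk) => t x.
rewrite mulrCA ler_wpM2l//.
elim: w {wk} => [|i w IH]; first by rewrite !big_nil expr0 mulr1.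
rewrite !big_cons exprS mulrACA; have /andP[s0 s1] := ss i t x.
rewrite ler_pM// prodr_ge0// => j _; by have /andP[] := ss j t x.
Qed.

Lemma symk_dC k sg m f i : symk k.+1 sg m f ->
 symk k sg (fun t x => m t x * sg i t x) (fun t => dC (e i) (f t)).
Proof.
move=> [fs H]; split=> [t|w wk]; first exact: Cinf_dC.
apply: (bnd_le ler01 _ (H (i :: w) wk)) => t x.
by rewrite big_cons mul1r mulrA.
Qed.

Lemma sym_dC sg m f i : sym sg m f ->
 sym sg (fun t x => m t x * sg i t x) (fun t => dC (e i) (f t)).
Proof. by move=> fs k; exact: symk_dC. Qed.

Lemma symk_of_dC k sg m f : (forall t, Cinf (f t)) -> bnd f m ->
 (forall i, symk k sg (fun t x => m t x * sg i t x) (fun t => dC (e i) (f t))) ->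
 symk k.+1 sg m f.
Proof.
move=> fs fb fd; split=> // -[|i w] wk.
 by apply: (bnd_le ler01 _ fb) => t x; rewrite big_nil mulr1 mul1r.
have [_ H] := fd i; apply: (bnd_le ler01 _ (H w wk)) => t x.
by rewrite big_cons mul1r mulrA.
Qed.

Lemma symk0 sg m f : (forall t, Cinf (f t)) -> bnd f m -> symk 0 sg m f.
Proof.
move=> fs fb; split=> // -[|//] _.
by apply: (bnd_le ler01 _ fb) => t x; rewrite big_nil mulr1 mul1r.
Qed.

Lemma symk_bnd k sg m f : symk k sg m f -> bnd f m.
Proof.
move=> [_ /(_ [::] isT)]; apply: (bnd_le (K := 1)) => // t x.
by rewrite big_nil mulr1 mul1r.
Qed.

Lemma symk_eq k sg m f g : (forall t, f t = g t) -> symk k sg m f -> symk k sg m g.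
Proof. by move=> fg; suff -> : f = g by []; apply/funext. Qed.
Lemma sym_eq sg m f g : (forall t, f t = g t) -> sym sg m f -> sym sg m g.
Proof. by move=> fg fs k; exact: symk_eq fg (fs k). Qed.

Lemma symk_add k sg m f g : symk k sg m f -> symk k sg m g ->
 symk k sg m (fun t x => f t x + g t x).
Proof.
move=> [fs Hf] [gs Hg]; split=> [t|w wk]; first exact: Cinf_add.
have [[C C0 H1] [D D0 H2]] := (Hf w wk, Hg w wk).
exists (C + D) => [|t x]; first exact: addr_ge0.
rewrite Dw_add// mulrDl (le_trans (le_normcD _ _))//.
by rewrite lerD ?H1 ?H2.
Qed.
Lemma sym_add sg m f g : sym sg m f -> sym sg m g -> sym sg m (fun t x => f t x + g t x).
Proof. by move=> fs gs k; exact: symk_add. Qed.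

Lemma symk_cst k sg m (c : T -> R[i]) : (forall t x, 0 <= m t x) ->
 (forall i t x, 0 <= sg i t x) -> bnd (fun t _ => c t) m ->
 symk k sg m (fun t _ => c t).
Proof.
move=> m0 s0 cb; split=> [t|[|i w] wk]; first exact: Cinf_cst.
 by apply: (bnd_le ler01 _ cb) => t x; rewrite big_nil mulr1 mul1r.
exists 0 => // t x; rewrite Dw_cst Normc.normc0 mul0r; exact: lexx.
Qed.
Lemma sym_cst sg m (c : T -> R[i]) : (forall t x, 0 <= m t x) ->
 (forall i t x, 0 <= sg i t x) -> bnd (fun t _ => c t) m ->
 sym sg m (fun t _ => c t).
Proof. by move=> m0 s0 cb k; exact: symk_cst. Qed.

Lemma bnd_mul f g m m' : bnd f m -> bnd g m' ->
 bnd (fun t x => f t x * g t x) (fun t x => m t x * m' t x).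
Proof.
move=> [C C0 H] [D D0 H']; exists (C * D) => [|t x]; first exact: mulr_ge0.
rewrite Normc.normcM mulrACA ler_pM ?normc_ge0//.
Qed.

Lemma symk_mul k sg m m' f g : symk k sg m f -> symk k sg m' g ->
 symk k sg (fun t x => m t x * m' t x) (fun t x => f t x * g t x).
Proof.
elim: k f g m m' => [|k IH] f g m m' fk gk.
 apply: symk0; first by move=> t; apply: Cinf_mul; [case: fk|case: gk].
 by apply: bnd_mul; [exact: symk_bnd fk|exact: symk_bnd gk].
apply: symk_of_dC; first by move=> t; apply: Cinf_mul; [case: fk|case: gk].
 by apply: bnd_mul; [exact: symk_bnd fk|exact: symk_bnd gk].
move=> i; apply: (symk_eq (f := fun t x => dC (e i) (f t) x * g t x + f t x * dC (e i) (g t) x)).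
 by move=> t; rewrite dC_mul//; [case: fk|case: gk].
apply: symk_add.
 have := IH _ _ _ _ (symk_dC i fk) (symk_leq (leqnSn k) gk).
 suff -> : (fun t x => m t x * sg i t x * m' t x) = (fun t x => m t x * m' t x * sg i t x) by [].
 by apply/funext => t; apply/funext => x; rewrite mulrAC.
have := IH _ _ _ _ (symk_leq (leqnSn k) fk) (symk_dC i gk).
suff -> : (fun t x => m t x * (m' t x * sg i t x)) = (fun t x => m t x * m' t x * sg i t x) by [].
by apply/funext => t; apply/funext => x; rewrite mulrA.
Qed.
Lemma sym_mul sg m m' f g : sym sg m f -> sym sg m' g ->
 sym sg (fun t x => m t x * m' t x) (fun t x => f t x * g t x).
Proof. by move=> fs gs k; exact: symk_mul. Qed.

Lemma sym_scale sg m f (c : R[i]) : sym sg m f -> sym sg m (fun t x => c * f t x).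
Proof.
move=> fs k; have [fC H] := fs k; split=> [t|w wk]; first exact: Cinf_scale.
have [C C0 HC] := H w wk; exists (normc c * C) => [|t x].
 by rewrite mulr_ge0// normc_ge0.
by rewrite Dw_scale// Normc.normcM -mulrA ler_wpM2l ?normc_ge0.
Qed.
Lemma sym_opp sg m f : sym sg m f -> sym sg m (fun t x => - f t x).
Proof.
move=> fs; apply: (sym_eq (f := fun t x => -1 * f t x)); last exact: sym_scale.
by move=> t; apply/funext => x; rewrite mulN1r.
Qed.
Lemma sym_sum sg m (J : Type) (r : seq J) (F : J -> fam) :
 (forall t x, 0 <= m t x) -> (forall i t x, 0 <= sg i t x) ->
 (forall j, sym sg m (F j)) -> sym sg m (fun t x => \sum_(j <- r) F j t x).
Proof.
move=> m0 s0 Fs; elim: r => [|j r IH].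
 apply: (sym_eq (f := fun _ _ => 0)); first by move=> t; apply/funext => x; rewrite big_nil.
 apply: sym_cst => //; exists 0 => // t x; rewrite Normc.normc0 mul0r; exact: lexx.
apply: (sym_eq (f := fun t x => F j t x + \sum_(j <- r) F j t x)).
 by move=> t; apply/funext => x; rewrite big_cons.
exact: sym_add.
Qed.

Lemma sym_of_dC sg m f : (forall t, Cinf (f t)) -> bnd f m ->
 (forall i, sym sg (fun t x => m t x * sg i t x) (fun t => dC (e i) (f t))) ->
 sym sg m f.
Proof.
move=> fs fb fd [|k]; first exact: symk0.
by apply: symk_of_dC => // i; exact: fd.
Qed.

Lemma normc_expi (s : R) : normc (expi s) = 1.
Proof. by rewrite /= cos2Dsin2 sqrtr1. Qed.

Lemma normc_i : normc ('i%C : R[i]) = 1.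
Proof. by rewrite /= expr0n expr1n add0r sqrtr1. Qed.

Lemma sym_expi sg (h : T -> V -> R) :
 (forall t, Cinf (fun x => (h t x)%:C)) ->
 (forall i, sym sg (sg i) (fun t => dC (e i) (fun x => (h t x)%:C))) ->
 sym sg (fun _ _ => 1) (fun t x => expi (h t x)).
Proof.
move=> hs hd k; have Es t : Cinf (fun x => expi (h t x)) by exact: Cinf_expi.
have Eb : bnd (fun t x => expi (h t x)) (fun _ _ => 1).
 by exists 1 => // t x; rewrite normc_expi mulr1.
elim: k => [|k IH]; first exact: symk0.
apply: symk_of_dC => // i.
apply: (symk_eq (f := fun t x => ('i%C * dC (e i) (fun x => (h t x)%:C) x) * expi (h t x))).
 by move=> t; rewrite (dC_expi _ (hs t)).2.
have := symk_mul (sym_scale 'i%C (hd i) k) IH.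
suff -> : (fun t x => sg i t x * 1) = (fun t x => 1 * sg i t x) by [].
by apply/funext => t; apply/funext => x; rewrite mulrC.
Qed.

(** The derivative of 1/h is a product of the derivative of h and two copies of 1/h, so the
    induction on the order closes. *)
Lemma sym_inv sg m (h : T -> V -> R) (c : R) : 0 < c ->
 (forall i t x, 0 <= sg i t x) ->
 (forall t x, 0 < m t x) -> (forall t x, c * m t x <= h t x) ->
 sym sg m (fun t x => (h t x)%:C) ->
 sym sg (fun t x => (m t x)^-1) (fun t x => ((h t x)^-1)%:C).
Proof.
move=> c0 s0 m0 cm hs k.
have h0 t x : 0 < h t x by apply: lt_le_trans (cm t x); exact: mulr_gt0.
have hne t x : h t x != 0 by rewrite gt_eqF.
have hC t : Cinf (fun x => (h t x)%:C) by exact: sym_Cinf hs.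
have Es t : Cinf (fun x => ((h t x)^-1)%:C) by apply: Cinf_inv.
have Eb : bnd (fun t x => ((h t x)^-1)%:C) (fun t x => (m t x)^-1).
 exists c^-1 => [|t x]; first by rewrite invr_ge0 ltW.
 rewrite normcR gtr0_norm ?invr_gt0// -invfM lef_pV2 ?posrE ?mulr_gt0//.
elim: k => [|k IH]; first exact: symk0.
apply: symk_of_dC => // i.
apply: (symk_eq (f := fun t x => (- dC (e i) (fun x => (h t x)%:C) x) * ((h t x)^-1)%:C * ((h t x)^-1)%:C)).
 by move=> t; rewrite (dC_inv _ (hC t) (hne t)).2.
have := symk_mul (symk_mul (sym_opp (sym_dC i hs) k) IH) IH.
apply: (symk_le (K := 1)) => // t x.
rewrite mul1r [m t x * _]mulrC mulfK ?gt_eqF//.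
by rewrite mulrC; exact: lexx.
Qed.

End symbol_classes.

Section pullback.
Context {R : realType} {V W : normedModType R} {I J : eqType} {T S : Type}.
Variables (e : I -> V) (e' : J -> W) (j : I -> J) (p : T -> S) (c : I -> T -> R)
 (A : T -> V -> W) (A0 : T -> V -> W).
Hypothesis Ac : forall t, continuous (A t).
Hypothesis AE : forall t v (s : R) x, A t (s *: v + x) = s *: A0 t v + A t x.
Hypothesis A0E : forall t i, A0 t (e i) = c i t *: e' (j i).

(** Because the linear part sends each basis vector to a multiple of a single basis vector, a word
    of derivatives is pulled back to a single word times a product of factors, without the sums of
    the chain rule. *)
Lemma Dw_pullback t w (f : W -> R[i]) : Cinf f ->
 Dw e w (fun x => f (A t x)) =
 fun x => (\prod_(i <- w) c i t)%:C * Dw e' (map j w) f (A t x).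
Proof.
elim: w f => [|i w IH] f fs; first by apply/funext => x; rewrite big_nil mul1r.
rewrite /=; have -> : dC (e i) (fun x => f (A t x)) =
  (fun x => ((c i t)%:C * dC (e' (j i)) f (A t x))).
 apply/funext => x; rewrite (dC_affine (a := A0 t (e i)))//.
 by rewrite A0E (dCZv _ _ fs).
have fs' := Cinf_dC (e' (j i)) fs.
rewrite Dw_scale; last exact: (Cinf_affine (A0 := A0 t)).
rewrite IH//; apply/funext => x.
by rewrite big_cons rmorphM /= -!mulrA.
Qed.

Lemma sym_pullback (sg : I -> T -> V -> R) (m : T -> V -> R)
  (sg' : J -> S -> W -> R) (m' : S -> W -> R) (f : S -> W -> R[i]) (K : R) :
 0 <= K -> (forall i t x, 0 <= sg i t x) -> (forall i t x, 0 <= sg' i t x) ->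
 (forall t x, 0 <= m t x) ->
 (forall t x, m' (p t) (A t x) <= K * m t x) ->
 (forall i t x, `|c i t| * sg' (j i) (p t) (A t x) <= K * sg i t x) ->
 sym e' sg' m' f -> sym e sg m (fun t x => f (p t) (A t x)).
Proof.
move=> K0 s0 s0' m0 mm ss fs k; have [fC H] := fs k.
split=> [t|w wk]; first exact: (Cinf_affine (A0 := A0 t)).
have [|C C0 HC] := H (map j w); first by rewrite size_map.
exists (C * K * K ^+ size w) => [|t x]; first by rewrite !mulr_ge0// exprn_ge0.
rewrite Dw_pullback// Normc.normcM normcR normr_prod.
apply: (@le_trans _ _ ((\prod_(i <- w) `|c i t|) *
  (C * (m' (p t) (A t x) * \prod_(i <- w) sg' (j i) (p t) (A t x))))).
 rewrite ler_wpM2l ?prodr_ge0//; have := HC (p t) (A t x).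
 by rewrite big_map.
rewrite mulrCA -!mulrA ler_wpM2l// mulrCA.
have -> : K * (K ^+ size w * (m t x * \prod_(i <- w) sg i t x)) =
 (K * m t x) * (K ^+ size w * \prod_(i <- w) sg i t x) by rewrite !mulrA [K * _ * m t x]mulrAC.
have P1 : 0 <= \prod_(i <- w) `|c i t| * \prod_(i <- w) sg' (j i) (p t) (A t x).
 by rewrite mulr_ge0// prodr_ge0.
apply: (@le_trans _ _ ((K * m t x) * (\prod_(i <- w) `|c i t| * \prod_(i <- w) sg' (j i) (p t) (A t x)))).
 by rewrite ler_wpM2r.
rewrite ler_wpM2l ?mulr_ge0// {wk HC P1}.
elim: w => [|i w IH]; first by rewrite !big_nil expr0 mulr1.
rewrite !big_cons exprS [leLHS]mulrACA [leRHS]mulrACA ler_pM// ?mulr_ge0// ?prodr_ge0//.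
Qed.
End pullback.

(** * Integration over R^n *)

Section measurable_coordinates.
Context {R : realType}.

Lemma cont_row (V : topologicalType) n (g : V -> 'rV[R]_n) :
 (forall i, continuous (fun x => g x 0 i)) -> continuous g.
Proof.
move=> gc x; apply/cvg_ballP => e e0.
have H : \forall y \near x, forall i, ball (g x 0 i) e (g y 0 i).
 by apply: filter_forall => i; exact: (cvg_ball (gc i x) e0).
near=> y; have Hy : forall i, ball (g x 0 i) e (g y 0 i) by near: y.
split => // i j; rewrite !ord1; exact: Hy.
Unshelve. all: by end_near. Qed.

(** An open subset of R^n is the union of the countably many rational cubes that it contains, and
    the preimage of a cube is a finite intersection of preimages of intervals under the
    coordinates. *)
Lemma measurable_row d (O : measurableType d) n (g : 'I_n -> O -> measurableTypeR R)
  (f : 'rV[R]_n -> R) :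
 (forall i, measurable_fun setT (g i)) -> continuous f ->
 measurable_fun setT (fun o => f (\row_i g i o) : measurableTypeR R).
Proof.
move=> mg fc.
apply: (measurability _ (RGenOInfty.measurableE R)) => _ [_ [a ->] <-]; rewrite setTI.
set B := fun (p : 'rV[rat]_n * nat) => [set v : 'rV[R]_n | forall i, `|v 0 i - ratr (p.1 0 i)| < p.2.+1%:R^-1].
set U := [set v : 'rV[R]_n | a < f v].
have -> : (fun o => f (\row_i g i o)) @^-1` `]a, +oo[%classic =
  \bigcup_p (if asbool (B p `<=` U) then (fun o => \row_i g i o) @^-1` (B p) else set0).
 apply/seteqP; split=> [w /=|w [p _]]; last first.
  case: (asboolP (B p `<=` U)) => [pU Bw|_ []].
  by have := pU _ Bw; rewrite /U/= in_itv/= andbT.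
 rewrite in_itv/= andbT => aw.
 have /nbhs_ballP[e /= e0 He] : nbhs (\row_i g i w : 'rV[R]_n) U.
  by have /cvgr_gt := fc (\row_i g i w : 'rV[R]_n); exact.
 have [k ke] : exists k : nat, k.+1%:R^-1 < e / 2.
  exists (Num.truncn (e / 2)^-1); rewrite invf_plt ?posrE ?divr_gt0//.
  by rewrite truncnS_gt.
 have Hq i : exists q : rat, `|g i w - ratr q| < k.+1%:R^-1.
  have [|q] := @rat_in_itvoo R (g i w - k.+1%:R^-1) (g i w + k.+1%:R^-1).
   by rewrite ltrBlDr -addrA ltrDl addr_gt0.
  by rewrite in_itv/= => /andP[q1 q2]; exists q; rewrite ltr_distlC q1 q2.
 pose q := \row_i xchoose (Hq i) : 'rV[rat]_n.
 have Bw : B (q, k) (\row_i g i w).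
  by move=> i; rewrite !mxE; exact: (xchooseP (Hq i)).
 exists (q, k) => //; case: (asboolP (B (q, k) `<=` U)) => [_|[]]; first exact: Bw.
 move=> v vB; apply: He.
 rewrite -ball_normE /= /Num.Def.normr/= mx_normrE (bigmax_lt _ e0)// => -[i j] _.
 rewrite ord1 !mxE/= -(subrKA (ratr (q 0 j))) (le_lt_trans (ler_normD _ _))// [e]splitr ltrD//.
  by rewrite (lt_trans _ ke)//; have := Bw j; rewrite !mxE.
 by rewrite (lt_trans _ ke)// distrC; exact: vB.
apply: countable_bigcupT_measurable; first exact: countableP.
move=> p; case: ifP => _; last exact: measurable0.
rewrite (_ : _ @^-1` _ = \bigcap_(i in [set: 'I_n])
  (g i @^-1` [set` `](ratr (p.1 0 i) - p.2.+1%:R^-1), (ratr (p.1 0 i) + p.2.+1%:R^-1)[ ])).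
 apply: fin_bigcap_measurable => // i _; rewrite -[X in measurable X]setTI.
 by apply: mg => //; exact: measurable_itv.
apply/seteqP; split=> o /= H i.
 by move=> _; have := H i; rewrite mxE/= ltr_distl.
by have := H i Logic.I; rewrite mxE/= ltr_distl.
Qed.

End measurable_coordinates.

(* A measure space mapped to V through finitely many measurable coordinates,
  together with an integrable kernel is_q used to dominate integrands. *)
Record ispace (R : realType) (V : normedModType R) := ISpace {
 is_d : measure_display; is_T : measurableType is_d;
 is_mu : {sigma_finite_measure set is_T -> \bar R};
 is_rho : is_T -> V; is_q : V -> R;
 is_N : nat; is_pi : 'rV[R]_is_N -> V; is_g : 'I_is_N -> is_T -> measurableTypeR R;
 is_pic : continuous is_pi; is_gm : forall i, measurable_fun setT (is_g i);
 is_rhoE : forall o, is_rho o = is_pi (\row_i is_g i o);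
 is_q0 : forall v, 0 <= is_q v; is_qc : continuous is_q ;
 is_qint : (\int[is_mu]_o (is_q (is_rho o))%:E < +oo)%E }.

Section integration_space.
Context {R : realType} {V : normedModType R} (S : ispace V).
Implicit Types (h : V -> R) (f : V -> R[i]).
Local Notation mu := (is_mu S).
Local Notation rho := (@is_rho _ _ S).
Local Notation q := (is_q S).

Definition rLam h : R := \int[mu]_o h (rho o).
Definition Lam f : R[i] := rLam (fun v => Re (f v)) +i* rLam (fun v => Im (f v)).

Lemma is_meas h : continuous h -> measurable_fun setT (fun o => h (rho o) : measurableTypeR R).
Proof.
move=> hc; under eq_fun do rewrite is_rhoE.
apply: (measurable_row (f := fun v => h (@is_pi _ _ S v))); first exact: is_gm.
by move=> v; apply: continuous_comp; [exact: is_pic|exact: hc].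
Qed.

Lemma is_integrable_q : mu.-integrable setT (EFin \o (fun o => q (rho o))).
Proof.
apply/integrableP; split.
 by apply/measurable_EFinP; exact: is_meas (@is_qc _ _ S).
apply: le_lt_trans (is_qint S); apply: eqW_le.
by apply: eq_integral => o _ /=; rewrite ger0_norm// is_q0.
Qed.

Lemma is_integrable h (C : R) : continuous h -> (forall v, `|h v| <= C * q v) ->
 mu.-integrable setT (EFin \o (fun o => h (rho o))).
Proof.
move=> hc hC.
have /(integrableZl measurableT C) iq := is_integrable_q.
apply: (le_integrable measurableT _ _ iq).
 by apply/measurable_EFinP; exact: is_meas.
move=> o _ /=; rewrite lee_fin (le_trans (hC _))// ler_norm//.
Qed.

Lemma rLamD h1 h2 C1 C2 : continuous h1 -> continuous h2 ->
 (forall v, `|h1 v| <= C1 * q v) -> (forall v, `|h2 v| <= C2 * q v) ->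
 rLam (fun v => h1 v + h2 v) = rLam h1 + rLam h2.
Proof.
move=> c1 c2 H1 H2; rewrite /rLam RintegralD//; exact: is_integrable.
Qed.

Lemma rLamB h1 h2 C1 C2 : continuous h1 -> continuous h2 ->
 (forall v, `|h1 v| <= C1 * q v) -> (forall v, `|h2 v| <= C2 * q v) ->
 rLam (fun v => h1 v - h2 v) = rLam h1 - rLam h2.
Proof.
move=> c1 c2 H1 H2; rewrite /rLam RintegralB//; exact: is_integrable.
Qed.

Lemma rLamZ h (c C : R) : continuous h -> (forall v, `|h v| <= C * q v) ->
 rLam (fun v => c * h v) = c * rLam h.
Proof. by move=> hc H; rewrite /rLam RintegralZl//; exact: is_integrable. Qed.

Definition Qtot : R := rLam q.

Lemma Qtot_ge0 : 0 <= Qtot.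
Proof. by apply: Rintegral_ge0 => o _; exact: is_q0. Qed.

Lemma rLam_bound h (C : R) : continuous h -> (forall v, `|h v| <= C * q v) ->
 `|rLam h| <= C * Qtot.
Proof.
move=> hc H; have ih := is_integrable hc H.
rewrite (le_trans (le_normr_Rintegral _ ih))//.
have ia : mu.-integrable setT (EFin \o (fun o => `|h (rho o)|)).
 by have := integrable_abse ih; apply: eq_integrable.
rewrite /Qtot -(rLamZ C (C := 1)) => [||v].
- apply: le_Rintegral => //.
 apply: (is_integrable (C := C) (h := fun v => C * q v)).
  by move=> v; apply: cvgM; [exact: cvg_cst|exact: is_qc].
 move=> v; have C0 : 0 <= C * q v by apply: le_trans (H v).
 by rewrite ger0_norm.
- exact: is_qc.
- by rewrite mul1r ger0_norm// is_q0.
Qed.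

Definition dom f := contC f /\ exists C : R, forall v, normc (f v) <= C * q v.

Lemma dom_Re f C : (forall v, normc (f v) <= C * q v) -> forall v, `|Re (f v)| <= C * q v.
Proof. by move=> H v; exact: le_trans (Re_le_normc _) (H v). Qed.
Lemma dom_Im f C : (forall v, normc (f v) <= C * q v) -> forall v, `|Im (f v)| <= C * q v.
Proof. by move=> H v; exact: le_trans (Im_le_normc _) (H v). Qed.

Lemma dom_add f g : dom f -> dom g -> dom (fun v => f v + g v).
Proof.
move=> [fc [C HC]] [gc [D HD]]; split; first exact: contC_add.
exists (C + D) => v; rewrite mulrDl (le_trans (le_normcD _ _))// lerD//.
Qed.
Lemma dom_scale (c : R[i]) f : dom f -> dom (fun v => c * f v).
Proof.
move=> [fc [C HC]]; split; first by apply: contC_mul => //; exact: contC_cst.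
by exists (normc c * C) => v; rewrite Normc.normcM -mulrA ler_wpM2l ?normc_ge0.
Qed.
Lemma dom0 : dom (fun=> 0).
Proof.
split; first exact: contC_cst.
by exists 0 => v; rewrite Normc.normc0 mul0r; exact: lexx.
Qed.

Lemma LamD f g : dom f -> dom g -> Lam (fun v => f v + g v) = Lam f + Lam g.
Proof.
move=> [[f1 f2] [C HC]] [[g1 g2] [D HD]]; rewrite /Lam; apply: complexP; rewrite ?ReD ?ImD /=.
 rewrite -(rLamD f1 g1 (dom_Re HC) (dom_Re HD)).
 by under eq_fun do rewrite ReD.
rewrite -(rLamD f2 g2 (dom_Im HC) (dom_Im HD)).
by under eq_fun do rewrite ImD.
Qed.

Lemma LamZ (c : R[i]) f : dom f -> Lam (fun v => c * f v) = c * Lam f.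
Proof.
move=> [[f1 f2] [C HC]]; rewrite /Lam; apply: complexP; rewrite ?ReM ?ImM /=.
 rewrite -(rLamZ _ f1 (dom_Re HC)) -(rLamZ _ f2 (dom_Im HC)).
 under eq_fun do rewrite ReM.
 rewrite (rLamB (C1 := `|Re c| * C) (C2 := `|Im c| * C))//.
 - by move=> v; apply: cvgM; [exact: cvg_cst|exact: f1].
 - by move=> v; apply: cvgM; [exact: cvg_cst|exact: f2].
 - by move=> v; rewrite normrM -mulrA ler_wpM2l// (dom_Re HC).
 - by move=> v; rewrite normrM -mulrA ler_wpM2l// (dom_Im HC).
rewrite -(rLamZ _ f1 (dom_Re HC)) -(rLamZ _ f2 (dom_Im HC)).
under eq_fun do rewrite ImM.
rewrite (rLamD (C1 := `|Re c| * C) (C2 := `|Im c| * C))//.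
- by move=> v; apply: cvgM; [exact: cvg_cst|exact: f2].
- by move=> v; apply: cvgM; [exact: cvg_cst|exact: f1].
- by move=> v; rewrite normrM -mulrA ler_wpM2l// (dom_Im HC).
- by move=> v; rewrite normrM -mulrA ler_wpM2l// (dom_Re HC).
Qed.

Lemma Lam0 : Lam (fun=> 0) = 0.
Proof.
by have := LamZ 0 dom0; rewrite !mul0r.
Qed.

Lemma LamN f : dom f -> Lam (fun v => - f v) = - Lam f.
Proof.
move=> fd; rewrite -mulN1r -LamZ//; congr Lam.
by apply/funext => v; rewrite mulN1r.
Qed.

Lemma LamB f g : dom f -> dom g -> Lam (fun v => f v - g v) = Lam f - Lam g.
Proof.
move=> fd gd; rewrite -(LamN gd) -LamD//.
have := dom_scale (-1) gd.
by under eq_fun do rewrite mulN1r.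
Qed.

Lemma dom_sum (I : Type) (r : seq I) (F : I -> V -> R[i]) :
 (forall i, dom (F i)) -> dom (fun v => \sum_(i <- r) F i v).
Proof.
move=> Fd; elim: r => [|i r IH].
 by under eq_fun do rewrite big_nil; exact: dom0.
by under eq_fun do rewrite big_cons; exact: dom_add.
Qed.

Lemma Lam_sum (I : Type) (r : seq I) (F : I -> V -> R[i]) :
 (forall i, dom (F i)) -> Lam (fun v => \sum_(i <- r) F i v) = \sum_(i <- r) Lam (F i).
Proof.
move=> Fd; elim: r => [|i r IH].
 by under eq_fun do rewrite big_nil; rewrite Lam0 big_nil.
under eq_fun do rewrite big_cons; rewrite big_cons LamD//; last exact: dom_sum.
by rewrite IH.
Qed.

Lemma Lam_bound f (C : R) : contC f -> (forall v, normc (f v) <= C * q v) ->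
 normc (Lam f) <= C * (2 * Qtot).
Proof.
move=> [f1 f2] HC; rewrite (le_trans (normc_le_ReIm _))//= mulrCA mulr_natl mulr2n.
by rewrite lerD// rLam_bound//; [exact: dom_Re|exact: dom_Im].
Qed.

End integration_space.

Section sigma_finite_product.
Context {R : realType} d1 d2 (T1 : measurableType d1) (T2 : measurableType d2).
Variables (m1 : {sigma_finite_measure set T1 -> \bar R}) (m2 : {sigma_finite_measure set T2 -> \bar R}).

Definition prodm : set (T1 * T2)%type -> \bar R := (m1 \x m2)%E.
HB.instance Definition _ := Measure.on prodm.

Let prodm_sigma_finite : sigma_finite setT prodm.
Proof.
have [F TF Foo] := sigma_finiteT m1; have [G TG Goo] := sigma_finiteT m2.
pose H n := if unpickle n is Some (i, j) then F i `*` G j else set0.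
exists H.
 rewrite -setXTT TF TG; apply/seteqP; split=> -[x y].
  by move=> [/= [i _ Fx] [k _ Gy]]; exists (pickle (i, k)); rewrite /H ?pickleK.
 by rewrite /H => -[n _]; case: (unpickle n) => [[i k] []|//]; split; [exists i|exists k].
move=> n; rewrite /H; case: (unpickle n) => [[i k]|]; last by split; rewrite ?measure0.
have [? ?] := Foo i; have [? ?] := Goo k; split; first exact: measurableX.
by rewrite /prodm product_measure1E// lte_mul_pinfty// ge0_fin_numE.
Qed.

HB.instance Definition _ := Measure_isSigmaFinite.Build _ _ _ prodm prodm_sigma_finite.
End sigma_finite_product.

Section product_space.
Context {R : realType} {V1 V2 : normedModType R} (S1 : ispace V1) (S2 : ispace V2).

Let pN := (is_N S1 + is_N S2)%N.
Let ppi (v : 'rV[R]_pN) : V1 * V2 := (@is_pi _ _ S1 (lsubmx v), @is_pi _ _ S2 (rsubmx v)).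
Let pg (i : 'I_pN) (o : is_T S1 * is_T S2) : measurableTypeR R :=
 match fintype.split i with inl j => @is_g _ _ S1 j o.1 | inr j => @is_g _ _ S2 j o.2 end.

Let ppic : continuous ppi.
Proof.
have lc : continuous (fun v : 'rV[R]_pN => lsubmx v : 'rV[R]_(is_N S1)).
 by move=> v; apply: differentiable_continuous; exact: differentiable_lsubmx.
have rc : continuous (fun v : 'rV[R]_pN => rsubmx v : 'rV[R]_(is_N S2)).
 by move=> v; apply: differentiable_continuous; exact: differentiable_rsubmx.
move=> v.
have c1 := continuous_comp (lc v) (@is_pic _ _ S1 (lsubmx v)).
have c2 := continuous_comp (rc v) (@is_pic _ _ S2 (rsubmx v)).
exact: (cvg_pair c1 c2).
Qed.

Let pgm i : measurable_fun setT (pg i).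
Proof.
rewrite /pg; case: (fintype.split i) => j.
 by apply: measurableT_comp; [exact: is_gm|exact: measurable_fst].
by apply: measurableT_comp; [exact: is_gm|exact: measurable_snd].
Qed.

Let prhoE o : (@is_rho _ _ S1 o.1, @is_rho _ _ S2 o.2) = ppi (\row_i pg i o).
Proof.
rewrite /ppi !is_rhoE; congr (_, _); congr is_pi; apply/rowP => j; rewrite !mxE /pg.
 by case: split_ordP => k /eqP; rewrite ?eq_lshift ?eq_lrshift// => /eqP->.
by case: split_ordP => k /eqP; rewrite ?eq_rshift ?eq_rlshift// => /eqP->.
Qed.

Let pq (v : V1 * V2) := is_q S1 v.1 * is_q S2 v.2.
Let pq0 v : 0 <= pq v. Proof. by rewrite mulr_ge0// is_q0. Qed.
Let pqc : continuous pq.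
Proof.
move=> v; apply: cvgM.
 exact: (continuous_comp (@cvg_fst _ _ (nbhs v.1) (nbhs v.2) _) (@is_qc _ _ S1 v.1)).
exact: (continuous_comp (@cvg_snd _ _ (nbhs v.1) (nbhs v.2) _) (@is_qc _ _ S2 v.2)).
Qed.

Let pmeas (h : V1 * V2 -> R) : continuous h ->
 measurable_fun setT (fun o : is_T S1 * is_T S2 => h (@is_rho _ _ S1 o.1, @is_rho _ _ S2 o.2) : measurableTypeR R).
Proof.
move=> hc; under eq_fun do rewrite prhoE.
apply: (measurable_row (f := fun v => h (ppi v))); first exact: pgm.
by move=> v; apply: continuous_comp; [exact: ppic|exact: hc].
Qed.

Let pqint : (\int[(is_mu S1 \x is_mu S2)%E]_o
  (pq (@is_rho _ _ S1 o.1, @is_rho _ _ S2 o.2))%:E < +oo)%E.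
Proof.
rewrite (fubini_tonelli1 (fun o => (pq (@is_rho _ _ S1 o.1, @is_rho _ _ S2 o.2))%:E)) /=; last 2 first.
- by apply/measurable_EFinP; exact: pmeas pqc.
- by move=> o; rewrite lee_fin pq0.
rewrite /fubini_F /=.
have E x : (\int[is_mu S2]_y (pq (@is_rho _ _ S1 x, @is_rho _ _ S2 y))%:E =
  (is_q S1 (@is_rho _ _ S1 x))%:E * \int[is_mu S2]_y (is_q S2 (@is_rho _ _ S2 y))%:E)%E.
 under eq_integral do rewrite /pq /= EFinM.
 rewrite ge0_integralZl//; first by apply/measurable_EFinP; exact: is_meas (@is_qc _ _ S2).
 - by move=> y _; rewrite lee_fin is_q0.
 - by rewrite lee_fin is_q0.
under eq_integral do rewrite E.
have i20 : (0 <= \int[is_mu S2]_y (is_q S2 (@is_rho _ _ S2 y))%:E)%E.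
 by apply: integral_ge0 => y _; rewrite lee_fin is_q0.
rewrite ge0_integralZr//.
- apply: lte_mul_pinfty; last exact: is_qint.
 + by apply: integral_ge0 => y _; rewrite lee_fin is_q0.
 + rewrite ge0_fin_numE ?is_qint//.
  by apply: integral_ge0 => y _; rewrite lee_fin is_q0.
- by apply/measurable_EFinP; exact: is_meas (@is_qc _ _ S1).
- by move=> y _; rewrite lee_fin is_q0.
Qed.

Definition prod_space : ispace (V1 * V2)%type :=
 @ISpace R (V1 * V2)%type _ _ (prodm (is_mu S1) (is_mu S2) : {sigma_finite_measure set (is_T S1 * is_T S2)%type -> \bar R})
  (fun o => (@is_rho _ _ S1 o.1, @is_rho _ _ S2 o.2)) pq pN ppi pg ppic pgm prhoE pq0 pqc pqint.

Lemma sec1_cont (h : V1 * V2 -> R) a : continuous h -> continuous (fun b => h (a, b)).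
Proof.
move=> hc b; have c : {for b, continuous (fun b => (a, b))}.
 exact: (cvg_pair (cvg_cst a) (@cvg_id _ (nbhs b))).
exact: (continuous_comp c (hc (a, b))).
Qed.
Lemma sec2_cont (h : V1 * V2 -> R) b : continuous h -> continuous (fun a => h (a, b)).
Proof.
move=> hc a; have c : {for a, continuous (fun a => (a, b))}.
 exact: (cvg_pair (@cvg_id _ (nbhs a)) (cvg_cst b)).
exact: (continuous_comp c (hc (a, b))).
Qed.

Lemma rLam_fubini (h : V1 * V2 -> R) C : continuous h ->
 (forall v, `|h v| <= C * is_q prod_space v) ->
 rLam prod_space h = rLam S1 (fun a => rLam S2 (fun b => h (a, b))) /\
 rLam prod_space h = rLam S2 (fun b => rLam S1 (fun a => h (a, b))).
Proof.
move=> hc H; have ih := is_integrable (S := prod_space) hc H.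
have i1 a : (is_mu S2).-integrable setT (EFin \o (fun o => h (a, @is_rho _ _ S2 o))).
 apply: (is_integrable (S := S2) (h := fun b => h (a, b)) (C := C * is_q S1 a)).
  exact: sec1_cont.
 by move=> b; rewrite -mulrA; exact: H.
have i2 b : (is_mu S1).-integrable setT (EFin \o (fun o => h (@is_rho _ _ S1 o, b))).
 apply: (is_integrable (S := S1) (h := fun a => h (a, b)) (C := C * is_q S2 b)).
  exact: sec2_cont.
 by move=> a; rewrite -mulrA [is_q S2 b * _]mulrC; exact: H.
split; rewrite /rLam /Rintegral; congr fine.
 rewrite -[LHS](integral12_prod_meas1 ih); apply: eq_integral => o _.
 by rewrite fineK//; exact: (integrable_fin_num measurableT (i1 (is_rho o))).
rewrite -[LHS](integral21_prod_meas1 ih); apply: eq_integral => o _.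
by rewrite fineK//; exact: (integrable_fin_num measurableT (i2 (is_rho o))).
Qed.

Lemma Lam_fubini (f : V1 * V2 -> R[i]) : dom prod_space f ->
 Lam prod_space f = Lam S1 (fun a => Lam S2 (fun b => f (a, b))) /\
 Lam prod_space f = Lam S2 (fun b => Lam S1 (fun a => f (a, b))).
Proof.
move=> [[f1 f2] [C HC]].
have [R1 R2] := rLam_fubini f1 (dom_Re HC).
have [I1 I2] := rLam_fubini f2 (dom_Im HC).
split; apply: complexP.
- exact: R1.
- exact: I1.
- exact: R2.
- exact: I2.
Qed.

End product_space.

Section line.
Context {R : realType}.
Local Notation leb := (@lebesgue_measure R).

Definition lq (x : R) : R := (1 + x ^+ 2)^-1.
Lemma one_sqr_gt0 (x : R) : 0 < 1 + x ^+ 2.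
Proof. by rewrite ltr_wpDr// sqr_ge0. Qed.
Lemma lq0 x : 0 <= lq x. Proof. by rewrite invr_ge0 ltW// one_sqr_gt0. Qed.
Lemma lqc : continuous lq.
Proof.
move=> x; have c : {for x, continuous (fun y : R => 1 + y ^+ 2)}.
 exact: (cvgD (cvg_cst (1 : R)) (@exprn_continuous R 2 x)).
exact: (continuous_comp c (inv_continuous (lt0r_neq0 (one_sqr_gt0 x)))).
Qed.

Let lpi (v : 'rV[R]_1) : R := v 0 0.
Let lpic : continuous lpi. Proof. exact: coord_continuous. Qed.
Let lg (i : 'I_1) (x : measurableTypeR R) : measurableTypeR R := x.
Let lgm i : measurable_fun setT (lg i). Proof. exact: measurable_id. Qed.
Let lrhoE (x : measurableTypeR R) : (x : R) = lpi (\row_i lg i x).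
Proof. by rewrite /lpi mxE. Qed.

Let lqint : (\int[leb]_x (lq x)%:E < +oo)%E.
Proof.
rewrite ge0_symfun_integralT//=; last 3 first.
- exact: lq0.
- exact: lqc.
- by move=> x; rewrite /lq /= sqrrN.
rewrite (_ : [set x | _] = `[0, +oo[%classic); last first.
 by apply/seteqP; split => x/=; rewrite in_itv/= andbT.
have := @integral0y_oneDsqr R; rewrite /oneDsqr /= => ->.
by rewrite -EFinM ltry.
Qed.

Definition line_space : ispace R :=
 @ISpace R R _ _ leb (fun x => x) lq 1 lpi lg lpic lgm lrhoE lq0 lqc lqint.

(** The fundamental theorem of calculus on [-(n+1), n+1]: the boundary terms tend to 0 by the bound
    on h, and the integrals converge by domination, by the bound on 'D_1 h. *)
Lemma rLam_line_derive (h : R -> R) (C : R) :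
 (forall x, derivable h x 1) -> continuous ('D_1 h) ->
 (forall x, `|h x| <= C * lq x) -> (forall x, `|'D_1 h x| <= C * lq x) ->
 rLam line_space ('D_1 h) = 0.
Proof.
move=> hd dc H H'.
have hc : continuous h.
 by move=> x; apply: differentiable_continuous; apply/derivable1_diffP.
have C0 : 0 <= C.
 have := le_trans (normr_ge0 _) (H 0); rewrite /lq expr0n addr0 invr1 mulr1; exact.

have iq := is_integrable_q line_space.
pose F n := ('D_1 h \_ `[- n.+1%:R, n.+1%:R]) : R -> R.
have mF n : measurable_fun setT (EFin \o F n).
 apply/measurable_EFinP; apply/(measurable_restrictT _ _).1 => //.
 exact: measurable_funTS (continuous_measurable_fun dc).
have cv : (fun n => \int[leb]_x (F n x)%:E)%E @ \oo --> (\int[leb]_x ('D_1 h x)%:E)%E.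
 apply: (@dominated_cvg _ _ _ leb setT measurableT (fun n => EFin \o F n) (EFin \o 'D_1 h) (fun x => (C * lq x)%:E)).
 - exact: mF.
 - move=> x _ /=; apply: cvg_near_cst; near=> n; congr EFin.
  rewrite /F patchE ifT// inE /= in_itv/= -ler_norml.
  rewrite (@le_trans _ _ n%:R) ?ler_nat//; near: n; exact: nbhs_infty_ger.
 - by [].
 - exact: (integrableZl measurableT C iq).
 - move=> n x _ /=; rewrite lee_fin /F patchE; case: ifP => _; first exact: H'.
  by rewrite normr0 mulr_ge0// lq0.
have E n : (\int[leb]_x (F n x)%:E = (h n.+1%:R - h (- n.+1%:R))%:E)%E.
 rewrite EFinB -(@continuous_FTC2 _ ('D_1 h)).
 - rewrite [RHS]integral_mkcond; apply: eq_integral => x _.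
  by rewrite /F !patchE; case: ifP.
 - by rewrite -subr_gt0 opprK addr_gt0.
 - by apply: continuous_subspaceT => x; exact: dc.
 - split.
  + by move=> x _; exact: hd.
  + by apply: cvg_at_right_filter; exact: hc.
  + by apply: cvg_at_left_filter; exact: hc.
 - by move=> x _; rewrite derive1E.
have cv0 : (fun n => \int[leb]_x (F n x)%:E)%E @ \oo --> 0%E.
 under eq_fun do rewrite E.
 apply/fine_cvgP; split; first exact: nearW.
 apply/cvgrPdist_le => e e0; near=> n; rewrite /= sub0r normrN.
 have n1 : (1 : R) <= n.+1%:R by rewrite ler1n.
 have B (x : R) : `|x| = n.+1%:R -> `|h x| <= e / 2.
  move=> xn; apply: le_trans (H x) _.
  rewrite /lq ler_pdivrMr// -real_normK ?num_real// xn.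
  apply: (@le_trans _ _ (e / 2 * n%:R)).
   rewrite -ler_pdivrMl ?divr_gt0//; near: n; exact: nbhs_infty_ger.
  rewrite ler_wpM2l ?divr_ge0 ?(ltW e0)//.
  apply: (@le_trans _ _ n.+1%:R); first by rewrite ler_nat.
  by apply: (@le_trans _ _ (n.+1%:R ^+ 2)); rewrite ?lerDr// ler_eXnr.
 rewrite (le_trans (ler_normB _ _))// [e]splitr lerD// B ?normrN ?ger0_norm//.
by have := cvg_unique _ cv cv0; rewrite /rLam /Rintegral => ->.
Unshelve. all: by end_near. Qed.

Lemma Lam_line_dC (f : R -> R[i]) : derC f (1 : R) -> dom line_space f -> dom line_space (dC (1 : R) f) ->
 Lam line_space (dC (1 : R) f) = 0.
Proof.
move=> fd [fc [C HC]] [[c1 c2] [D HD]].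
have ReE : (fun x => Re (dC (1 : R) f x)) = 'D_1 (fun x => Re (f x)) by apply/funext => x; exact: dC_Re.
have ImE : (fun x => Im (dC (1 : R) f x)) = 'D_1 (fun x => Im (f x)) by apply/funext => x; exact: dC_Im.
have CD (a b : R) v : a <= b -> a * lq v <= b * lq v by move=> ?; rewrite ler_wpM2r ?lq0.
apply: complexP; rewrite /Lam /= ?ReE ?ImE.
 apply: (rLam_line_derive (C := Num.max C D)).
 - by move=> x; have [] := fd x.
 - by rewrite -ReE.
 - by move=> x; rewrite (le_trans (dom_Re HC x))// CD// le_max lexx.
 - by move=> x; rewrite -dC_Re (le_trans (dom_Re HD x))// CD// le_max lexx orbT.
apply: (rLam_line_derive (C := Num.max C D)).
- by move=> x; have [] := fd x.
- by rewrite -ImE.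
- by move=> x; rewrite (le_trans (dom_Im HC x))// CD// le_max lexx.
- by move=> x; rewrite -dC_Im (le_trans (dom_Im HD x))// CD// le_max lexx orbT.
Qed.

Definition gauss1 (x : R) : R := expR (- (x ^+ 2 / 2)).

Lemma gauss1_lq x : `|gauss1 x| <= 2 * lq x.
Proof.
rewrite ger0_norm ?expR_ge0// /gauss1 expRN /lq -[2]invrK -invfM lef_pV2 ?posrE ?expR_gt0 ?mulr_gt0 ?one_sqr_gt0//.
by apply: le_trans (expR_ge1Dx _); lra.
Qed.

Lemma gauss1_cont : continuous gauss1.
Proof.
move=> x; apply: (continuous_comp (f := fun x : R => - (x ^+ 2 / 2))); last exact: continuous_expR.
by apply: cvgN; apply: cvgM; [exact: exprn_continuous|exact: cvg_cst].
Qed.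

(** Read off from the total mass 1 of the standard normal density. *)
Lemma rLam_gauss1 : rLam line_space gauss1 = Num.sqrt (2 * pi).
Proof.
have := @integral_normal_pdf R 0 1; rewrite normal_pdfE//.
have s0 : 0 < Num.sqrt (2 * pi) :> R by rewrite sqrtr_gt0 mulr_gt0// pi_gt0.
have E : normal_peak (1 : R) = (Num.sqrt (2 * pi))^-1.
 by rewrite /normal_peak expr1n mul1r mulr_natl.
have -> : (\int[leb]_x (normal_peak 1 * normal_fun 0 1 x)%:E =
  (rLam line_space (fun x => (Num.sqrt (2 * pi))^-1 * gauss1 x))%:E)%E.
 rewrite /rLam /Rintegral fineK.
  apply: eq_integral => x _; rewrite E /normal_fun /gauss1 subr0 expr1n mulNr.
  by [].
 apply: integrable_fin_num => //.
 apply: (is_integrable (S := line_space) (h := fun x => (Num.sqrt (2 * pi))^-1 * gauss1 x) (C := (Num.sqrt (2 * pi))^-1 * 2)).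
  by move=> x; apply: cvgM; [exact: cvg_cst|exact: gauss1_cont].
 move=> x; rewrite normrM [`|_^-1|]ger0_norm ?(ltW s0)// -mulrA ler_wpM2l ?(ltW s0)//.
 exact: gauss1_lq.
rewrite (rLamZ (S := line_space) _ gauss1_cont gauss1_lq) => E1.
have H : (Num.sqrt (2 * pi))^-1 * rLam line_space gauss1 = 1 by case: E1.
by rewrite -[LHS](mulVKf (lt0r_neq0 s0)) H mulr1.
Qed.

End line.

Section vec_space.
Context {R : realType}.

Definition consv n (p : R * 'rV[R]_n) : 'rV[R]_n.+1 :=
 \row_i (if unlift ord0 i is Some j then p.2 0 j else p.1).

Lemma consv0 n (p : R * 'rV[R]_n) : consv p 0 ord0 = p.1.
Proof. by rewrite mxE unlift_none. Qed.
Lemma consvS n (p : R * 'rV[R]_n) j : consv p 0 (lift ord0 j) = p.2 0 j.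
Proof. by rewrite mxE liftK. Qed.

Lemma consv_cont n : continuous (@consv n).
Proof.
apply: cont_row => i; under eq_fun do rewrite mxE.
move=> p; case: (unlift ord0 i) => [j|]; last exact: cvg_fst.
exact: (continuous_comp (@cvg_snd _ _ (nbhs p.1) (nbhs p.2) _) (@coord_continuous _ _ _ 0 j p.2)).
Qed.

Lemma row_of_consp n (p : measurableTypeR R * n.-tuple (measurableTypeR R)) :
 row_of_tuple (consp p) = consv (p.1 : R, row_of_tuple p.2).
Proof.
apply/rowP => i; rewrite !mxE; case: (unliftP ord0 i) => [j ->|->] /=.
 by rewrite mxE tnthS.
by rewrite (tnth_nth p.1).
Qed.

Definition vq n (x : 'rV[R]_n) : R := \prod_i lq (x 0 i).

Lemma vq0 n (x : 'rV[R]_n) : 0 <= vq x. Proof. by apply: prodr_ge0 => i _; exact: lq0. Qed.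
Lemma vqc n : continuous (@vq n).
Proof.
rewrite /vq; elim: (index_enum _) => [|i r IH].
 by under eq_fun do rewrite big_nil; move=> x; exact: cst_continuous.
under eq_fun do rewrite big_cons; apply: cont_mul => // x.
exact: (continuous_comp (@coord_continuous _ _ _ 0 i x) (@lqc R (x 0 i))).
Qed.
Lemma vq_consv n (p : R * 'rV[R]_n) : vq (consv p) = lq p.1 * vq p.2.
Proof.
rewrite /vq big_ord_recl consv0; congr (_ * _).
by apply: eq_bigr => i _; rewrite consvS.
Qed.

Let vgm n (i : 'I_n) : measurable_fun setT (fun t : n.-tuple (measurableTypeR R) => tnth t i).
Proof. exact: measurable_tnth. Qed.
Let vrhoE n (t : n.-tuple (measurableTypeR R)) : row_of_tuple t = id (\row_i tnth t i : 'rV[R]_n).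
Proof. by []. Qed.
Let vidc n : continuous (@id 'rV[R]_n). Proof. by move=> x; exact: cvg_id. Qed.

Let mk n (H : (\int[lebesgue_tuple R n]_t (vq (row_of_tuple t))%:E < +oo)%E) : ispace 'rV[R]_n :=
 @ISpace R 'rV[R]_n _ _ (lebesgue_tuple R n) (@row_of_tuple R n) (@vq n) n id
  (fun i t => tnth t i) (@vidc n) (@vgm n) (@vrhoE n) (@vq0 n) (@vqc n) H.

Lemma measurable_tuple_fun n (h : 'rV[R]_n -> R) : continuous h ->
 measurable_fun setT (fun t : n.-tuple (measurableTypeR R) => h (row_of_tuple t) : measurableTypeR R).
Proof. by apply: measurable_row => i; exact: measurable_tnth. Qed.

Lemma vqint n : (\int[lebesgue_tuple R n]_t (vq (row_of_tuple t))%:E < +oo)%E.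
Proof.
elim: n => [|n IH].
 have m0 := measurable_tuple_fun (@vqc 0).
 by rewrite integral_dirac//= ?ltry//; apply/measurable_EFinP.
rewrite [X in (X < _)%E](_ : _ = \int[pushforward (lebesgue_measure \x lebesgue_tuple R n)%E (@consp R n)]_t (vq (row_of_tuple t))%:E)%E//.
rewrite ge0_integral_pushforward//.
- apply: le_lt_trans (is_qint (prod_space (@line_space R) (mk IH))).
 apply: eqW_le; apply: eq_integral => p _ /=.
 by rewrite row_of_consp vq_consv.
- exact: measurable_consp.
- by apply/measurable_EFinP; exact: measurable_tuple_fun (@vqc n.+1).
- by move=> t _; rewrite lee_fin vq0.
Qed.

Definition vec_space n : ispace 'rV[R]_n := mk (vqint n).

Lemma Lam_vecE n f : Lam (vec_space n) f = integralC f.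
Proof. by []. Qed.

Lemma rLam_cons n (h : 'rV[R]_n.+1 -> R) C : continuous h ->
 (forall v, `|h v| <= C * vq v) ->
 rLam (vec_space n.+1) h = rLam (prod_space (@line_space R) (vec_space n)) (fun p => h (consv p)).
Proof.
move=> hc H; rewrite /rLam /Rintegral; congr fine.
have hc' : continuous (fun p => h (consv p)).
 by move=> p; apply: continuous_comp; [exact: consv_cont|exact: hc].
have H' p : `|h (consv p)| <= C * is_q (prod_space (@line_space R) (vec_space n)) p.
 by have := H (consv p); rewrite vq_consv.
rewrite [LHS](_ : _ = \int[pushforward (lebesgue_measure \x lebesgue_tuple R n)%E (@consp R n)]_t (h (row_of_tuple t))%:E)%E//.
rewrite integral_pushforward//.
- by apply: eq_integral => p _ /=; rewrite row_of_consp.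
- exact: measurable_consp.
- by apply/measurable_EFinP; exact: measurable_tuple_fun.
- rewrite preimage_setT; apply: eq_integrable (is_integrable hc' H') => //.
 by move=> p _ /=; rewrite row_of_consp.
Qed.

Lemma Lam_cons n (f : 'rV[R]_n.+1 -> R[i]) : dom (vec_space n.+1) f ->
 dom (prod_space (@line_space R) (vec_space n)) (fun p => f (consv p)) /\
 Lam (vec_space n.+1) f = Lam (prod_space (@line_space R) (vec_space n)) (fun p => f (consv p)).
Proof.
move=> [fc [C HC]]; split.
 split; first exact: contC_comp (@consv_cont n) fc.
 by exists C => p; have := HC (consv p); rewrite /= vq_consv.
apply: complexP; rewrite /Lam /=.
 exact: (rLam_cons fc.1 (dom_Re HC)).
exact: (rLam_cons fc.2 (dom_Im HC)).
Qed.

Definition basv n (i : 'I_n) : 'rV[R]_n := delta_mx 0 i.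

Lemma consv_line n (t a : R) (b : 'rV[R]_n) :
 consv (t *: (1 : R) + a, b) = t *: basv ord0 + consv (a, b).
Proof.
apply/rowP => i; rewrite !mxE; case: (unliftP ord0 i) => [j ->|->].
 by rewrite lift_eqF andbF mulr0 add0r.
by rewrite eqxx /= /GRing.scale /=.
Qed.

Lemma consv_vec n (t a : R) (i : 'I_n) (b : 'rV[R]_n) :
 consv (a, t *: basv i + b) = t *: basv (lift ord0 i) + consv (a, b).
Proof.
apply/rowP => k; rewrite !mxE; case: (unliftP ord0 k) => [j ->|->] /=.
 by rewrite !mxE (inj_eq (@lift_inj _ ord0)).
by rewrite ?mulr0 ?add0r.
Qed.

Lemma derC_affine1 (V W : normedModType R) (A : V -> W) v a (f : W -> R[i]) :
 (forall (t : R) x, A (t *: v + x) = t *: a + A x) -> derC f a -> derC (fun y => f (A y)) v.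
Proof.
move=> AE fd x; have [d1 d2] := fd (A x).
have E (k : W -> R) : derivable k (A x) a -> derivable (fun y => k (A y)) x v.
 rewrite /derivable (_ : (fun t : R => t^-1 *: ((k \o shift (A x)) (t *: a) - k (A x))) =
  (fun t : R => t^-1 *: (((fun y => k (A y)) \o shift x) (t *: v) - k (A x))))//.
 by apply/funext => t /=; rewrite AE.
by split; [exact: (E (fun u => Re (f u)))|exact: (E (fun u => Im (f u)))].
Qed.

Lemma dom_sec2 (V1 V2 : normedModType R) (S1 : ispace V1) (S2 : ispace V2) (f : V1 * V2 -> R[i]) b :
 dom (prod_space S1 S2) f -> dom S1 (fun a => f (a, b)).
Proof.
move=> [[f1 f2] [C HC]]; split; first by split; [exact: sec2_cont f1|exact: sec2_cont f2].
by exists (C * is_q S2 b) => a; rewrite -mulrA [is_q S2 b * _]mulrC; exact: HC.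
Qed.
Lemma dom_sec1 (V1 V2 : normedModType R) (S1 : ispace V1) (S2 : ispace V2) (f : V1 * V2 -> R[i]) a :
 dom (prod_space S1 S2) f -> dom S2 (fun b => f (a, b)).
Proof.
move=> [[f1 f2] [C HC]]; split; first by split; [exact: sec1_cont f1|exact: sec1_cont f2].
by exists (C * is_q S1 a) => b; rewrite -mulrA; exact: HC.
Qed.

(** Induction on the dimension. By Fubini the first coordinate can be separated; the inner integral
    is taken over the line if i is the first coordinate, and over the remaining ones otherwise. *)
Lemma Lam_ibp n (i : 'I_n) (f : 'rV[R]_n -> R[i]) : derC f (basv i) ->
 dom (vec_space n) f -> dom (vec_space n) (dC (basv i) f) ->
 Lam (vec_space n) (dC (basv i) f) = 0.
Proof.
elim: n i f => [[]//|n IH] i f fd fdom ddom.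
have [fp _] := Lam_cons fdom; have [dp ->] := Lam_cons ddom.
case: (unliftP ord0 i) => [j ij|i0]; subst i.
 rewrite (Lam_fubini dp).1 -[RHS](Lam0 (@line_space R)); congr Lam; apply/funext => a.
 have AE (t : R) b : consv (a, t *: basv j + b) = t *: basv (lift ord0 j) + consv (a, b).
  exact: consv_vec.
 have E : (fun b => dC (basv (lift ord0 j)) f (consv (a, b))) = dC (basv j) (fun b => f (consv (a, b))).
  by apply/funext => b; rewrite (dC_affine f AE).
 rewrite E; apply: IH.
 - exact: derC_affine1 AE fd.
 - exact: (dom_sec1 a fp).
 - by rewrite -E; exact: (dom_sec1 a dp).
rewrite (Lam_fubini dp).2 -[RHS](Lam0 (vec_space n)); congr Lam; apply/funext => b.
have AE (t : R) (a : R) : consv (t *: (1 : R) + a, b) = t *: basv ord0 + consv (a, b).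
 exact: consv_line.
have E : (fun a => dC (basv ord0) f (consv (a, b))) = dC (1 : R) (fun a => f (consv (a, b))).
 by apply/funext => a; rewrite (dC_affine (A := fun a => consv (a, b)) f AE).
rewrite E; apply: Lam_line_dC.
- exact: (derC_affine1 (A := fun a => consv (a, b)) AE fd).
- exact: (dom_sec2 b fp).
- by rewrite -E; exact: (dom_sec2 b dp).
Qed.

Definition gaussv n (x : 'rV[R]_n) : R := \prod_i gauss1 (x 0 i).

Lemma gaussv_cont n : continuous (@gaussv n).
Proof.
rewrite /gaussv; elim: (index_enum _) => [|i r IH].
 by under eq_fun do rewrite big_nil; move=> x; exact: cst_continuous.
under eq_fun do rewrite big_cons; apply: cont_mul => // x.
exact: (continuous_comp (@coord_continuous _ _ _ 0 i x) (@gauss1_cont R (x 0 i))).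
Qed.

Lemma gaussv_vq n (x : 'rV[R]_n) : `|gaussv x| <= 2 ^+ n * vq x.
Proof.
rewrite /gaussv /vq normr_prod -[n in 2 ^+ n]card_ord -prodr_const -big_split /=.
by apply: ler_prod => i _; rewrite normr_ge0 gauss1_lq.
Qed.

Lemma rLam_gaussv n : rLam (vec_space n) (@gaussv n) = Num.sqrt (2 * pi) ^+ n.
Proof.
elim: n => [|n IH].
 rewrite expr0 /rLam /Rintegral integral_dirac//=.
  by rewrite ?indicE ?in_setT /gaussv big_ord0 ?mulr1.
 by apply/measurable_EFinP; exact: measurable_tuple_fun (@gaussv_cont 0).
rewrite (rLam_cons (@gaussv_cont n.+1) (@gaussv_vq n.+1)).
have E p : gaussv (consv p) = gauss1 p.1 * gaussv (p.2 : 'rV[R]_n).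
 rewrite /gaussv big_ord_recl consv0; congr (_ * _).
 by apply: eq_bigr => i _; rewrite consvS.
rewrite (rLam_fubini (C := 2 ^+ n.+1) _ _).1.
- have -> : (fun a => rLam (vec_space n) (fun b => gaussv (consv (a, b)))) =
   (fun a => Num.sqrt (2 * pi) ^+ n * gauss1 a).
  apply/funext => a; under eq_fun do rewrite E /=.
  by rewrite (rLamZ (S := vec_space n) _ (@gaussv_cont n) (@gaussv_vq n)) IH mulrC.
 by rewrite (rLamZ (S := line_space) _ gauss1_cont gauss1_lq) rLam_gauss1 exprSr.
- by move=> p; apply: continuous_comp; [exact: consv_cont|exact: gaussv_cont].
- by move=> p; have := gaussv_vq (consv p); rewrite vq_consv.
Qed.

End vec_space.

Lemma ex2_intro_choice (A : Type) (P : A -> Prop) (Q : A -> Prop) :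
 (exists2 x, P x & Q x) -> exists x, P x /\ Q x.
Proof. by move=> [x Px Qx]; exists x. Qed.

Section nonstationary.
Context {R : realType} {V : normedModType R} {I : finType}.
Variables (e : I -> V) (S : ispace V).
Implicit Types (s G : I -> V -> R) (A : V -> R[i]).

(** The summand 1 keeps the operator below defined at stationary points of the phase, so no cutoff
    around them is needed. *)
Definition brk2 G (x : V) : R := 1 + \sum_i G i x ^+ 2.
Definition brk G (x : V) : R := Num.sqrt (brk2 G x).

Lemma brk2_ge1 G x : 1 <= brk2 G x.
Proof. by rewrite lerDl sumr_ge0// => i _; exact: sqr_ge0. Qed.
Lemma brk2_gt0 G x : 0 < brk2 G x. Proof. exact: lt_le_trans (brk2_ge1 G x). Qed.
Lemma brk_ge1 G x : 1 <= brk G x.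
Proof. by rewrite -sqrtr1 ler_wsqrtr// brk2_ge1. Qed.
Lemma brk_gt0 G x : 0 < brk G x. Proof. exact: lt_le_trans (brk_ge1 G x). Qed.
Lemma sqr_brk G x : brk G x ^+ 2 = brk2 G x.
Proof. by rewrite sqr_sqrtr// ltW// brk2_gt0. Qed.
Lemma le_brk G i x : `|G i x| <= brk G x.
Proof.
rewrite -sqrtr_sqr ler_wsqrtr// /brk2 (bigD1 i)//= addrCA lerDl addr_ge0//.
by rewrite sumr_ge0// => j _; exact: sqr_ge0.
Qed.

Definition ibp_coef s G i (x : V) : R[i] := (s i x)%:C * (G i x)%:C * ((brk2 G x)^-1)%:C.

(* The transpose of the first-order operator L that fixes exp(i Phi), when G i = s i * d_i Phi. *)
Definition ibp_op s G A (x : V) : R[i] :=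
 ((brk2 G x)^-1)%:C * A x + 'i%C * \sum_i dC (e i) (fun y => ibp_coef s G i y * A y) x.

Definition ibp_space := forall i (f : V -> R[i]), derC f (e i) -> dom S f ->
 dom S (dC (e i) f) -> Lam S (dC (e i) f) = 0.

(** * Integration by parts against a phase *)

Section smooth_coefs.
Variables s G : I -> V -> R.
Hypothesis sC : forall i, Cinf (fun x => (s i x)%:C).
Hypothesis GC : forall i, Cinf (fun x => (G i x)%:C).

Lemma brk2C : Cinf (fun x => (brk2 G x)%:C).
Proof.
have -> : (fun x => (brk2 G x)%:C) = (fun x => 1%:C + \sum_i (G i x)%:C * (G i x)%:C).
 apply/funext => x; rewrite /brk2 rmorphD rmorph_sum /=; congr (_ + _).
 by apply: eq_bigr => i _; rewrite expr2 rmorphM.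
by apply: Cinf_add; [exact: Cinf_cst|apply: Cinf_sum => i _; exact: Cinf_mul].
Qed.
Lemma brk2VC : Cinf (fun x => ((brk2 G x)^-1)%:C).
Proof. by apply: Cinf_inv; [exact: brk2C|move=> x; rewrite gt_eqF// brk2_gt0]. Qed.
Lemma ibp_coefC i : Cinf (ibp_coef s G i).
Proof. by apply: Cinf_mul; [exact: Cinf_mul|exact: brk2VC]. Qed.
Lemma ibp_opC A : Cinf A -> Cinf (ibp_op s G A).
Proof.
move=> AC; apply: Cinf_add; first by apply: Cinf_mul => //; exact: brk2VC.
apply: Cinf_scale; apply: Cinf_sum => i _; apply: Cinf_dC; apply: Cinf_mul => //.
exact: ibp_coefC.
Qed.

Lemma ibp_op_add A1 A2 : Cinf A1 -> Cinf A2 ->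
 ibp_op s G (fun x => A1 x + A2 x) = fun x => ibp_op s G A1 x + ibp_op s G A2 x.
Proof.
move=> C1 C2; apply/funext => x; rewrite /ibp_op mulrDr.
rewrite [RHS]addrACA; congr (_ + _).
rewrite -mulrDr -big_split /=; congr (_ * _); apply: eq_bigr => i _.
have -> : (fun y => ibp_coef s G i y * (A1 y + A2 y)) =
  (fun y => ibp_coef s G i y * A1 y + ibp_coef s G i y * A2 y).
 by apply/funext => y; rewrite mulrDr.
by rewrite dC_add//; apply: Cinf_mul => //; exact: ibp_coefC.
Qed.

Lemma iter_ibp_opC K A : Cinf A -> Cinf (iter K (ibp_op s G) A).
Proof. by elim: K => //= K IH AC; apply: ibp_opC; exact: IH. Qed.
Lemma iter_ibp_op_add K A1 A2 : Cinf A1 -> Cinf A2 ->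
 iter K (ibp_op s G) (fun x => A1 x + A2 x) =
 fun x => iter K (ibp_op s G) A1 x + iter K (ibp_op s G) A2 x.
Proof.
move=> C1 C2; elim: K => //= K ->; rewrite ibp_op_add//; exact: iter_ibp_opC.
Qed.
Variable Phi : V -> R.
Hypothesis PhiC : Cinf (fun x => (Phi x)%:C).
Hypothesis GE : forall i x, (G i x)%:C = (s i x)%:C * dC (e i) (fun y => (Phi y)%:C) x.
Hypothesis S_ibp : ibp_space.

(** With L the first-order operator mentioned above, exp(i Phi) = L exp(i Phi) because G_i exp(i
    Phi) = -i s_i d_i exp(i Phi) and (1 + sum of the G_i^2) / [brk2] = 1. Hence the two integrands
    differ by i times the sum of the d_i of exp(i Phi) [ibp_coef] A, whose integrals vanish. *)
Lemma Lam_ibp_op A (C : R) : Cinf A ->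
 (forall x, normc (A x) <= C * is_q S x) ->
 (forall i x, normc (ibp_coef s G i x * A x) <= C * is_q S x) ->
 (forall i x, normc (dC (e i) (fun y => ibp_coef s G i y * A y) x) <= C * is_q S x) ->
 Lam S (fun x => expi (Phi x) * ibp_op s G A x) = Lam S (fun x => expi (Phi x) * A x).
Proof.
move=> AC HA HkA HdkA.
have EC := Cinf_expi PhiC.
have kAC i : Cinf (fun y => ibp_coef s G i y * A y) by apply: Cinf_mul => //; exact: ibp_coefC.
pose f i y := expi (Phi y) * (ibp_coef s G i y * A y).
have fC i : Cinf (f i) by exact: Cinf_mul.
have nE x (z : R[i]) : normc (expi (Phi x) * z) = normc z by rewrite Normc.normcM normc_expi mul1r.
have kE i x : dC (e i) (fun y => (Phi y)%:C) x * ibp_coef s G i x = (G i x ^+ 2 / brk2 G x)%:C.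
 by rewrite /ibp_coef mulrA mulrCA !mulrA -GE -!rmorphM -expr2.
have df i : dC (e i) (f i) = fun x =>
  expi (Phi x) * ('i%C * (G i x ^+ 2 / brk2 G x)%:C * A x + dC (e i) (fun y => ibp_coef s G i y * A y) x).
 rewrite /f dC_mul// (dC_expi _ PhiC).2; apply/funext => x; rewrite -kE.
 by rewrite mulrDr; congr (_ + _); ring.
have Edom : dom S (fun x => expi (Phi x) * A x).
 by split; [apply: Cinf_cont; exact: Cinf_mul|exists C => x; rewrite nE].
have fdom i : dom S (f i).
 by split; [apply: Cinf_cont; exact: fC|exists C => x; rewrite nE].
have dfdom i : dom S (dC (e i) (f i)).
 split; first by apply: Cinf_cont; exact: Cinf_dC.
 exists (C + C) => x; rewrite df nE (le_trans (le_normcD _ _))// mulrDl lerD//.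
 rewrite !Normc.normcM normc_i mul1r normcR.
 have q1 : `|G i x ^+ 2 / brk2 G x| <= 1.
  rewrite ger0_norm ?divr_ge0 ?sqr_ge0 ?(ltW (brk2_gt0 _ _))// ler_pdivrMr ?brk2_gt0// mul1r.
  by rewrite -sqr_brk -real_normK ?num_real// ler_Xn ?(ltW (brk_gt0 _ _))// le_brk.
 by rewrite (le_trans _ (HA x))// ler_piMl// normc_ge0.
have -> : (fun x => expi (Phi x) * ibp_op s G A x) =
 (fun x => expi (Phi x) * A x + 'i%C * \sum_i dC (e i) (f i) x).
 apply/funext => x; under eq_bigr do rewrite df.
 rewrite -mulr_sumr mulrCA -mulrDr; congr (_ * _).
 rewrite /ibp_op big_split /= mulrDr addrA; congr (_ + _).
 rewrite -mulr_suml -mulr_sumr !mulrA -expr2 sqr_i -rmorph_sum -mulr_suml /=.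
 have -> : \sum_i G i x ^+ 2 = brk2 G x - 1 by rewrite /brk2 addrAC subrr add0r.
 rewrite mulrBl divff ?gt_eqF ?brk2_gt0// mul1r rmorphB /= -[X in _ = X + _]mul1r.
 by rewrite -mulrDl mulN1r opprB addrCA subrr addr0.
rewrite LamD//; last by apply: dom_scale; exact: dom_sum.
rewrite LamZ; last exact: dom_sum.
rewrite Lam_sum// big1 ?mulr0 ?addr0// => i _.
by apply: S_ibp => //; exact: Cinf_derC.
Qed.

End smooth_coefs.
End nonstationary.

Section nonstationary_families.
Context {R : realType} {V : normedModType R} {I : finType} {T : Type}.
Variables (e : I -> V) (S : ispace V).
Hypothesis S_ibp : ibp_space e S.
Variables (s G : I -> T -> V -> R) (sg : I -> T -> V -> R) (g : T -> V -> R).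
Hypothesis sg0 : forall i t x, 0 <= sg i t x.
Hypothesis s0 : forall i t x, 0 <= s i t x.
Hypothesis g0 : forall t x, 0 <= g t x.
Local Notation st t := (fun i => s i t).
Local Notation Gt t := (fun i => G i t).
Local Notation b t x := (brk (fun i => G i t) x).
Hypothesis ssg : exists2 C : R, 0 <= C & forall i t x, s i t x * sg i t x <= C * g t x.
Hypothesis bg : exists2 C : R, 0 <= C & forall t x, (b t x)^-1 <= C * g t x.
Hypothesis gb : forall t, exists2 C : R, 0 <= C & forall x, g t x <= C * b t x.
Hypothesis s_sym : forall i, sym e sg (s i) (fun t x => (s i t x)%:C).
Hypothesis G_sym : forall i, sym e sg (fun t x => b t x) (fun t x => (G i t x)%:C).

Lemma brk2_sym : sym e sg (fun t x => b t x ^+ 2) (fun t x => (brk2 (Gt t) x)%:C).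
Proof.
apply: (sym_eq (f := fun t x => 1%:C + \sum_i (G i t x)%:C * (G i t x)%:C)).
 move=> t; apply/funext => x; rewrite /brk2 rmorphD rmorph_sum /=; congr (_ + _).
 by apply: eq_bigr => i _; rewrite expr2 rmorphM.
apply: sym_add.
 apply: sym_cst => // [t x|]; first exact: sqr_ge0.
 exists 1 => // t x; rewrite normcR normr1 mul1r.
 by rewrite exprn_ege1// brk_ge1.
apply: sym_sum => // [t x|i]; first exact: sqr_ge0.
by have := sym_mul (G_sym i) (G_sym i); apply: sym_eqw => t x; rewrite expr2.
Qed.

Lemma brk2V_sym : sym e sg (fun t x => (b t x ^+ 2)^-1) (fun t x => ((brk2 (Gt t) x)^-1)%:C).
Proof.
apply: (sym_inv (c := 1)) => //; last exact: brk2_sym.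
 by move=> t x; rewrite exprn_gt0// brk_gt0.
by move=> t x; rewrite mul1r sqr_brk.
Qed.

Lemma ibp_coef_sym i : sym e sg (fun t x => s i t x * (b t x)^-1) (fun t => ibp_coef (st t) (Gt t) i).
Proof.
have := sym_mul (sym_mul (s_sym i) (G_sym i)) brk2V_sym; apply: sym_eqw => t x.
by rewrite -mulrA expr2 invfM mulVKf// gt_eqF// brk_gt0.
Qed.

(** One integration by parts gains g / b. The zeroth-order term has the factor 1/b^2, and 1/b is at
    most C g; in the other terms the coefficient is of size s / b and its derivative, or that of A,
    costs sg, while s sg is at most C g. *)
Lemma ibp_op_sym (m : T -> V -> R) A : (forall t x, 0 <= m t x) -> sym e sg m A ->
 sym e sg (fun t x => m t x * (g t x / b t x)) (fun t => ibp_op e (st t) (Gt t) (A t)).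
Proof.
move=> m0 Am.
have mgb0 t x : 0 <= m t x * (g t x / b t x).
 by rewrite mulr_ge0// divr_ge0// ltW// brk_gt0.
apply: sym_add.
 have [C C0 HC] := bg.
 apply: (sym_le (K := C)) (sym_mul brk2V_sym Am) => // t x.
 rewrite mulrC mulrCA ler_wpM2l// expr2 invfM mulrA.
 by rewrite ler_wpM2r ?invr_ge0 ?(ltW (brk_gt0 _ _)).
apply: sym_scale; apply: sym_sum => // i.
have [C C0 HC] := ssg.
apply: (sym_le (K := C)) (sym_dC i (sym_mul (ibp_coef_sym i) Am)) => // t x.
have -> : s i t x * (b t x)^-1 * m t x * sg i t x = m t x * ((s i t x * sg i t x) / b t x) by ring.
by rewrite [leRHS]mulrCA ler_wpM2l// [leRHS]mulrA ler_wpM2r ?invr_ge0 ?(ltW (brk_gt0 _ _)).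
Qed.

Variable Phi : T -> V -> R.
Hypothesis PhiC : forall t, Cinf (fun x => (Phi t x)%:C).
Hypothesis GE : forall i t x, (G i t x)%:C = (s i t x)%:C * dC (e i) (fun y => (Phi t y)%:C) x.

(** Integrability for each t separately, with a constant depending on t. It only legitimates the
    integrations by parts; the uniform estimate comes from the weight obtained after them. *)
Definition mdom (m : T -> V -> R) := forall t, exists2 C : R, 0 <= C &
 forall x, m t x <= C * is_q S x /\ (forall i, m t x * s i t x <= C * is_q S x).

Lemma Lam_ibp_op_family (m : T -> V -> R) A : (forall t x, 0 <= m t x) ->
 mdom m -> sym e sg m A -> forall t,
 Lam S (fun x => expi (Phi t x) * ibp_op e (st t) (Gt t) (A t) x) =
 Lam S (fun x => expi (Phi t x) * A t x).
Proof.
move=> m0 md Am t.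
have sC i : Cinf (fun x => (s i t x)%:C) by exact: (sym_Cinf t (s_sym i)).
have GC i : Cinf (fun x => (G i t x)%:C) by exact: (sym_Cinf t (G_sym i)).
have [C C0 HC] := md t.
have [D D0 HD] := sym_bnd Am.
have [Cg Cg0 HCg] := gb t.
have [Cs Cs0 HCs] := ssg.
have D1 i : exists2 D1 : R, 0 <= D1 & forall x, normc (ibp_coef (st t) (Gt t) i x * A t x) <= D1 * is_q S x.
 have [E E0 HE] := sym_bnd (sym_mul (ibp_coef_sym i) Am).
 exists (E * C); first exact: mulr_ge0.
 move=> x; apply: le_trans (HE t x) _; rewrite -[leRHS]mulrA ler_wpM2l//.
 have [_ /(_ i)] := HC x; apply: le_trans.
 rewrite mulrC ler_wpM2l// ler_piMr// invf_le1 ?brk_gt0// brk_ge1//.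
have D2 i : exists2 D2 : R, 0 <= D2 & forall x, normc (dC (e i) (fun y => ibp_coef (st t) (Gt t) i y * A t y) x) <= D2 * is_q S x.
 have [E E0 HE] := sym_bnd (sym_dC i (sym_mul (ibp_coef_sym i) Am)).
 exists (E * (Cs * Cg * C)); first by rewrite !mulr_ge0.
 move=> x; apply: le_trans (HE t x) _; rewrite -[leRHS]mulrA ler_wpM2l//.
 have [H _] := HC x.
 rewrite -[leRHS]mulrA; apply: le_trans (ler_wpM2l _ H); last by rewrite mulr_ge0.
 have -> : s i t x * (b t x)^-1 * m t x * sg i t x = ((s i t x * sg i t x) / b t x) * m t x by ring.
 rewrite ler_wpM2r// ler_pdivrMr ?brk_gt0// (le_trans (HCs i t x))//.
 by rewrite -mulrA ler_wpM2l.
have [d1 d1P] := choice (fun i => ex2_intro_choice (D1 i)).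
have [d2 d2P] := choice (fun i => ex2_intro_choice (D2 i)).
pose M := D * C + \sum_i (d1 i + d2 i).
have d0 i : 0 <= d1 i + d2 i by rewrite addr_ge0 ?(d1P i).1 ?(d2P i).1.
have leM i : d1 i + d2 i <= M.
 rewrite /M (bigD1 i)//= addrCA lerDl addr_ge0 ?mulr_ge0//.
 by rewrite sumr_ge0.
apply: (Lam_ibp_op sC GC (PhiC t) (GE^~ t) S_ibp (C := M)).
- exact: (sym_Cinf t Am).
- move=> x; apply: le_trans (HD t x) _; apply: (@le_trans _ _ (D * C * is_q S x)).
  by rewrite -mulrA ler_wpM2l//; have [] := HC x.
 by rewrite ler_wpM2r ?is_q0// lerDl sumr_ge0.
- move=> i x; apply: le_trans ((d1P i).2 x) _; rewrite ler_wpM2r ?is_q0//.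
 by rewrite (le_trans _ (leM i))// lerDl (d2P i).1.
- move=> i x; apply: le_trans ((d2P i).2 x) _; rewrite ler_wpM2r ?is_q0//.
 by rewrite (le_trans _ (leM i))// lerDr (d1P i).1.
Qed.

Lemma mdom_step (m : T -> V -> R) : (forall t x, 0 <= m t x) ->
 mdom m -> mdom (fun t x => m t x * (g t x / b t x)).
Proof.
move=> m0 md t; have [C C0 HC] := md t; have [Cg Cg0 HCg] := gb t.
have q1 x : g t x / b t x <= Cg by rewrite ler_pdivrMr ?brk_gt0.
have q0 x : 0 <= g t x / b t x by rewrite divr_ge0// ltW// brk_gt0.
exists (Cg * C); first exact: mulr_ge0.
move=> x; have [H1 H2] := HC x; split=> [|i].
 rewrite mulrC -[leRHS]mulrA; exact: (ler_pM (q0 x) (m0 t x) (q1 x) H1).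
rewrite mulrAC mulrC -[leRHS]mulrA.
exact: (ler_pM (q0 x) (mulr_ge0 (m0 t x) (s0 i t x)) (q1 x) (H2 i)).
Qed.

Lemma iter_ibp (m : T -> V -> R) A K : (forall t x, 0 <= m t x) ->
 mdom m -> sym e sg m A ->
 sym e sg (fun t x => m t x * (g t x / b t x) ^+ K)
   (fun t => iter K (ibp_op e (st t) (Gt t)) (A t)) /\
 forall t, Lam S (fun x => expi (Phi t x) * iter K (ibp_op e (st t) (Gt t)) (A t) x) =
  Lam S (fun x => expi (Phi t x) * A t x).
Proof.
move=> m0 md Am.
have gb0 t x : 0 <= g t x / b t x by rewrite divr_ge0// ltW// brk_gt0.
suff H : mdom (fun t x => m t x * (g t x / b t x) ^+ K) /\
 (sym e sg (fun t x => m t x * (g t x / b t x) ^+ K)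
   (fun t => iter K (ibp_op e (st t) (Gt t)) (A t)) /\
 forall t, Lam S (fun x => expi (Phi t x) * iter K (ibp_op e (st t) (Gt t)) (A t) x) =
  Lam S (fun x => expi (Phi t x) * A t x)) by exact: H.2.
elim: K => [|K [md' [IH1 IH2]]].
 have E : (fun t x => m t x * (g t x / b t x) ^+ 0) = m.
  by apply/funext => t; apply/funext => x; rewrite expr0 mulr1.
 by rewrite E.
have m0' t x : 0 <= m t x * (g t x / b t x) ^+ K by rewrite mulr_ge0// exprn_ge0.
have E : (fun t x => m t x * (g t x / b t x) ^+ K.+1) =
  (fun t x => m t x * (g t x / b t x) ^+ K * (g t x / b t x)).
 by apply/funext => t; apply/funext => x; rewrite exprSr mulrA.
rewrite E; split; first exact: mdom_step.
split; first exact: ibp_op_sym.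
by move=> t; rewrite -IH2; exact: Lam_ibp_op_family md' IH1 t.
Qed.

(** K is chosen by the user so that the factor (g / b)^K makes the weight integrable uniformly in t.
    The constants of [mdom] do not enter the result. *)
Lemma ibp_bound (m : T -> V -> R) A K (M : T -> R) : (forall t x, 0 <= m t x) ->
 mdom m -> sym e sg m A ->
 (forall t x, m t x * (g t x / b t x) ^+ K <= M t * is_q S x) ->
 exists2 C : R, 0 <= C & forall t, normc (Lam S (fun x => expi (Phi t x) * A t x)) <= C * M t.
Proof.
move=> m0 md Am HM; have [AK EK] := iter_ibp K m0 md Am.
have [D D0 HD] := sym_bnd AK.
exists (D * (2 * Qtot S)); first by rewrite !mulr_ge0// Qtot_ge0.
move=> t; rewrite -EK mulrAC; apply: Lam_bound.
 apply: Cinf_cont; apply: Cinf_mul; first exact: Cinf_expi.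
 exact: (sym_Cinf t AK).
move=> x; rewrite Normc.normcM normc_expi mul1r (le_trans (HD t x))//.
by rewrite -mulrA ler_wpM2l.
Qed.

End nonstationary_families.

(** * Norms, brackets and Gaussians on R^d *)

Section vectors.
Context {R : realType} {d : nat}.
Local Notation vec := 'rV[R]_d.
Implicit Types (x y z : vec).

Lemma sum_basv x : x = \sum_i x 0 i *: basv i.
Proof. exact: row_sum_delta. Qed.

Lemma coord_is i x v : is_dC (fun y : vec => (y 0 i)%:C) v x ((v 0 i)%:C).
Proof.
apply: (is_dC_quad (B := 0)) => t _; rewrite mul0r.
rewrite (_ : _ - _ - _ = 0) ?Normc.normc0//.
by rewrite !mxE rmorphD rmorphM [X in X - _]addrAC subrr add0r subrr.
Qed.

Lemma dC_coordE i v : derC (fun y : vec => (y 0 i)%:C) v /\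
 dC v (fun y : vec => (y 0 i)%:C) = fun=> (v 0 i)%:C.
Proof. by apply: derC_mk => x; exact: coord_is. Qed.

Lemma coord_C i : Cinf (fun y : vec => (y 0 i)%:C).
Proof.
have c : contC (fun y : vec => (y 0 i)%:C).
 by apply: contC_real; exact: coord_continuous.
move=> [|k]; first by split.
split => // v; have [dd ->] := dC_coordE i v; split => //; exact: Ck_cst.
Qed.

Definition enorm x : R := Num.sqrt (dotv x x).

Lemma enorm_ge0 x : 0 <= enorm x. Proof. exact: sqrtr_ge0. Qed.
Lemma sqr_enorm x : enorm x ^+ 2 = dotv x x. Proof. by rewrite sqr_sqrtr// dotv_ge0. Qed.
Lemma sqr_jap x : jap x ^+ 2 = 1 + dotv x x.
Proof. by rewrite sqr_sqrtr// addr_ge0// dotv_ge0. Qed.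
Lemma jap_gt0 x : 0 < jap x. Proof. exact: lt_le_trans (jap_ge1 x). Qed.
Lemma jap_ge0 x : 0 <= jap x. Proof. exact: ltW (jap_gt0 x). Qed.
Lemma le_coord_enorm x i : `|x 0 i| <= enorm x.
Proof.
rewrite -sqrtr_sqr ler_wsqrtr// /dotv (bigD1 i)//= -expr2 lerDl sumr_ge0// => j _.
by rewrite -expr2 sqr_ge0.
Qed.
Lemma enorm_le_jap x : enorm x <= jap x. Proof. by rewrite ler_wsqrtr// lerDr. Qed.
Lemma le_coord_jap x i : `|x 0 i| <= jap x.
Proof. exact: le_trans (le_coord_enorm x i) (enorm_le_jap x). Qed.
Lemma jap_le1D x : jap x <= 1 + enorm x.
Proof.
rewrite -ler_sqr ?nnegrE ?jap_ge0 ?addr_ge0 ?enorm_ge0// sqr_jap sqrrD sqr_enorm expr1n.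
by rewrite -addrA lerD2l lerDr mulrn_wge0// mul1r enorm_ge0.
Qed.
Lemma enormZ (t : R) x : enorm (t *: x) = `|t| * enorm x.
Proof.
rewrite /enorm -sqrtr_sqr -sqrtrM ?sqr_ge0//; congr Num.sqrt.
by rewrite /dotv mulr_sumr; apply: eq_bigr => i _; rewrite !mxE; ring.
Qed.
Lemma enormN x : enorm (- x) = enorm x.
Proof. by rewrite -scaleN1r enormZ normrN1 mul1r. Qed.
Lemma dotvD_le x y : dotv (x + y) (x + y) <= 2 * dotv x x + 2 * dotv y y.
Proof.
rewrite /dotv !mulr_sumr -big_split /=; apply: ler_sum => i _; rewrite !mxE.
by rewrite -subr_ge0 [leRHS](_ : _ = (x 0 i - y 0 i) ^+ 2) ?sqr_ge0//; ring.
Qed.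
Lemma enorm_sum x : enorm x <= \sum_i `|x 0 i|.
Proof.
rewrite -ler_sqr ?nnegrE ?enorm_ge0 ?sumr_ge0// sqr_enorm /dotv.
rewrite expr2 mulr_suml; apply: ler_sum => i _.
rewrite -expr2 -real_normK ?num_real// expr2 ler_wpM2l// (bigD1 i)//= lerDl sumr_ge0//.
Qed.
(** The factor 2 spares the Cauchy-Schwarz inequality; constants are immaterial in all that
    follows. *)
Lemma enormD x y : enorm (x + y) <= 2 * (enorm x + enorm y).
Proof.
rewrite -ler_sqr ?nnegrE ?mulr_ge0 ?addr_ge0 ?enorm_ge0//.
rewrite sqr_enorm (le_trans (dotvD_le _ _))// -!sqr_enorm.
have := enorm_ge0 x; have := enorm_ge0 y; nra.
Qed.
Lemma jap_near x z : enorm z <= jap x / 2 -> jap x <= 2 * jap (x + z).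
Proof.
move=> zx; rewrite -ler_sqr ?nnegrE ?mulr_ge0 ?jap_ge0// exprMn !sqr_jap.
have := dotvD_le (x + z) (- z); rewrite addrK.
have -> : dotv (- z) (- z) = dotv z z by rewrite -!sqr_enorm enormN.
have : enorm z ^+ 2 <= (jap x / 2) ^+ 2.
 by rewrite ler_sqr ?nnegrE ?enorm_ge0 ?divr_ge0 ?jap_ge0.
rewrite exprMn sqr_jap sqr_enorm.
by rewrite -[2 ^- 1 ^+ 2]/((2^-1) ^+ 2); lra.
Qed.
Lemma japD x y : jap (x + y) <= 2 * (jap x * jap y).
Proof.
rewrite -ler_sqr ?nnegrE ?mulr_ge0 ?jap_ge0// !exprMn !sqr_jap.
have := dotvD_le x y; have := dotv_ge0 x; have := dotv_ge0 y.
set a := dotv x x; set b := dotv y y; set c := dotv _ _ => b0 a0 H.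

nra.
Qed.
Lemma jap_add x y : jap (x + y) <= 2 * (jap x + enorm y).
Proof.
rewrite -ler_sqr ?nnegrE ?mulr_ge0 ?addr_ge0 ?jap_ge0 ?enorm_ge0//.
have := sqr_enorm y; have := sqr_jap x; have := sqr_jap (x + y).
have := dotvD_le x y; have := dotv_ge0 x; have := dotv_ge0 y.
have := jap_ge0 x; have := enorm_ge0 y.
set b := dotv y y.
move: (jap (x + y)) (jap x) (enorm y) => J j n n0 j0 b0 a0 H -> E1 E2.

nra.
Qed.
Lemma japN x : jap (- x) = jap x.
Proof. by rewrite /jap -!sqr_enorm enormN. Qed.

Definition japsq x : R := 1 + dotv x x.
Lemma japsq_gt0 x : 0 < japsq x. Proof. by rewrite ltr_wpDr// dotv_ge0. Qed.
Lemma japsqC : Cinf (fun x => (japsq x)%:C).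
Proof.
have -> : (fun x => (japsq x)%:C) = (fun x => 1%:C + \sum_i (x 0 i)%:C * (x 0 i)%:C).
 apply/funext => x; rewrite /japsq rmorphD /dotv rmorph_sum; congr (_ + _).
 by apply: eq_bigr => i _; rewrite rmorphM.
apply: Cinf_add; first exact: Cinf_cst.
by apply: Cinf_sum => i _; apply: Cinf_mul; exact: coord_C.
Qed.

Lemma basvE (i j : 'I_d) : (basv i : vec) 0 j = (i == j)%:R.
Proof. by rewrite mxE eqxx eq_sym. Qed.

Lemma dC_japsq i : dC (basv i) (fun x => (japsq x)%:C) = fun x => 2%:C * (x 0 i)%:C.
Proof.
have -> : (fun x => (japsq x)%:C) = (fun x => 1%:C + \sum_j (x 0 j)%:C * (x 0 j)%:C).
 apply/funext => x; rewrite /japsq rmorphD /dotv rmorph_sum; congr (_ + _).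
 by apply: eq_bigr => j _; rewrite rmorphM.
have Cj (j : 'I_d) : Cinf (fun x : vec => (x 0 j)%:C * (x 0 j)%:C) by apply: Cinf_mul; exact: coord_C.
rewrite dC_add; [|exact: Cinf_cst|by apply: Cinf_sum => j _; exact: Cj].
rewrite dC_cst dC_sum => [|j _]; last exact: Cj.
apply/funext => x; rewrite add0r (bigD1 i)//= big1 ?addr0 => [|j ji].
 rewrite dC_mul; [|exact: coord_C|exact: coord_C].
 by rewrite (dC_coordE i _).2 basvE eqxx -!rmorphM -rmorphD /=; congr (_%:C); ring.
rewrite dC_mul; [|exact: coord_C|exact: coord_C].
by rewrite (dC_coordE j _).2 basvE eq_sym (negPf ji) mul0r mulr0 addr0.
Qed.

Lemma japE x (s : R) : jap x `^ s = expR ((s / 2) * ln (japsq x)).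
Proof.
have j2 : ln (japsq x) = 2 * ln (jap x).
 by rewrite -[japsq x]sqr_jap lnXn ?jap_gt0// mulr_natl.
by rewrite /powR gt_eqF ?jap_gt0// j2 mulrA divfK.
Qed.

Lemma jap_powC (s : R) : Cinf (fun x => (jap x `^ s)%:C).
Proof.
under eq_fun do rewrite japE.
apply: Cinf_expR.
have -> : (fun y => (s / 2 * ln (japsq y))%:C) = (fun y => (s / 2)%:C * (ln (japsq y))%:C).
 by apply/funext => y; rewrite rmorphM.
by apply: Cinf_scale; apply: Cinf_ln; [exact: japsqC|exact: japsq_gt0].
Qed.

Lemma dC_jap_pow (s : R) i : dC (basv i) (fun x => (jap x `^ s)%:C) =
 fun x => s%:C * ((x 0 i)%:C * (jap x `^ (s - 2))%:C).
Proof.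
have lC : Cinf (fun y => (ln (japsq y))%:C) by apply: Cinf_ln; [exact: japsqC|exact: japsq_gt0].
have E0 : (fun y => (s / 2 * ln (japsq y))%:C) = (fun y => (s / 2)%:C * (ln (japsq y))%:C).
 by apply/funext => y; rewrite rmorphM.
have C0 : Cinf (fun y => (s / 2 * ln (japsq y))%:C) by rewrite E0; exact: Cinf_scale.
under eq_fun do rewrite japE.
rewrite (dC_expR _ C0).2 E0 dC_scale// (dC_ln _ japsqC japsq_gt0).2 dC_japsq.
apply/funext => x; rewrite -japE.
have -> : jap x `^ s = jap x `^ (s - 2) * japsq x.
 rewrite -[japsq x]sqr_jap -powR_mulrn ?jap_ge0// -powRD ?subrK//.
 by rewrite (lt0r_neq0 (jap_gt0 x)) implybT.
rewrite -!rmorphM /=; congr (_%:C); field.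
by rewrite gt_eqF// japsq_gt0.
Qed.

Definition sgj (i : 'I_d) (_ : unit) (x : vec) : R := (jap x)^-1.

Lemma sgj_ge0 i t x : 0 <= sgj i t x. Proof. by rewrite invr_ge0 jap_ge0. Qed.
Lemma jap_powE x (s t : R) : jap x `^ s * jap x `^ t = jap x `^ (s + t).
Proof. by rewrite powRD// (lt0r_neq0 (jap_gt0 x)) implybT. Qed.
Lemma jap_invE x : (jap x)^-1 = jap x `^ (-1).
Proof. by rewrite powRN powRr1// jap_ge0. Qed.
Lemma jap_pow1 x : jap x `^ 1 = jap x. Proof. by rewrite powRr1// jap_ge0. Qed.

Lemma coord_sym i : sym (@basv R d) sgj (fun _ x => jap x) (fun _ x => (x 0 i)%:C).
Proof.
apply: sym_of_dC => [t||j]; first exact: coord_C.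
 by exists 1 => // t x; rewrite normcR mul1r le_coord_jap.
apply: (sym_eq (f := fun _ _ => ((basv j : vec) 0 i)%:C)).
 by move=> t; rewrite (dC_coordE i _).2.
apply: sym_cst => [t x||]; first by rewrite mulr_ge0 ?sgj_ge0 ?jap_ge0.
 by move=> *; exact: sgj_ge0.
exists 1 => // t x; rewrite normcR /sgj divff ?gt_eqF ?jap_gt0// mulr1.
by rewrite basvE; case: (_ == _); rewrite ?normr0 ?normr1.
Qed.

Lemma jap_pow_sym (s : R) : sym (@basv R d) sgj (fun _ x => jap x `^ s) (fun _ x => (jap x `^ s)%:C).
Proof.
move=> k; elim: k s => [|k IH] s.
 apply: symk0 => [t|]; first exact: jap_powC.
 by exists 1 => // t x; rewrite normcR mul1r ger0_norm// powR_ge0.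
apply: symk_of_dC => [t||i]; first exact: jap_powC.
 by exists 1 => // t x; rewrite normcR mul1r ger0_norm// powR_ge0.
apply: (symk_eq (f := fun _ x => s%:C * ((x 0 i)%:C * (jap x `^ (s - 2))%:C))).
 by move=> t; rewrite dC_jap_pow.
have sg0 := sgj_ge0.
have H : symk (@basv R d) k sgj (fun _ _ => `|s|) (fun (_ : unit) _ => s%:C).
 apply: symk_cst => //; exists 1 => // t x; by rewrite normcR mul1r.
have := symk_mul H (symk_mul (coord_sym i k) (IH (s - 2))).
apply: (symk_le (K := `|s|)) => // t x.
rewrite ler_wpM2l// /sgj jap_invE jap_powE -{1}[jap x]jap_pow1 jap_powE.
by have -> : 1 + (s - 2) = s - 1 by ring.
Qed.

Lemma gaussvE x : gaussv x = expR (- (dotv x x / 2)).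
Proof.
rewrite /gaussv /gauss1 /dotv mulr_suml -sumrN expR_sum.
by apply: eq_bigr => i _; rewrite expr2.
Qed.

Lemma gauss_quadC : Cinf (fun x : vec => (- (dotv x x / 2))%:C).
Proof.
have -> : (fun x : vec => (- (dotv x x / 2))%:C) = (fun x => (- 2^-1)%:C * ((japsq x)%:C - 1%:C)).
 apply/funext => x; rewrite -rmorphB -rmorphM /=; congr (_%:C).
 by rewrite /japsq; ring.
by apply: Cinf_scale; apply: Cinf_sub; [exact: japsqC|exact: Cinf_cst].
Qed.

Lemma gaussvC : Cinf (fun x : vec => (gaussv x)%:C).
Proof. under eq_fun do rewrite gaussvE; apply: Cinf_expR; exact: gauss_quadC. Qed.

Lemma dC_gaussv i : dC (basv i) (fun x : vec => (gaussv x)%:C) =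
 fun x => - ((x 0 i)%:C * (gaussv x)%:C).
Proof.
under eq_fun do rewrite gaussvE.
rewrite (dC_expR _ gauss_quadC).2.
have -> : (fun x : vec => (- (dotv x x / 2))%:C) = (fun x => (- 2^-1)%:C * ((japsq x)%:C - 1%:C)).
 apply/funext => x; rewrite -rmorphB -rmorphM /=; congr (_%:C).
 by rewrite /japsq; ring.
rewrite dC_scale; last by apply: Cinf_sub; [exact: japsqC|exact: Cinf_cst].
rewrite dC_sub; [|exact: japsqC|exact: Cinf_cst].
rewrite dC_cst dC_japsq; apply/funext => x; rewrite -gaussvE subr0.
by rewrite -!rmorphM -rmorphN /=; congr (_%:C); field.
Qed.

(** From 1 + t <= (n + 1) exp(t / (n + 1)), raised to the power n. Dividing by n + 1 rather than n
    covers n = 0. *)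
Lemma expR_poly n : exists2 C : R, 0 <= C & forall t : R, 0 <= t -> (1 + t) ^+ n * expR (- t) <= C.
Proof.
exists (n.+1%:R ^+ n) => [|t t0]; first by rewrite exprn_ge0.
have tn : 1 + t <= n.+1%:R * expR (t / n.+1%:R).
 rewrite (le_trans _ (ler_wpM2l _ (expR_ge1Dx _)))// mulrDr mulr1 mulrCA divff ?mulr1//.
 by rewrite lerD2r ler1n.
have : (1 + t) ^+ n <= (n.+1%:R * expR (t / n.+1%:R)) ^+ n.
 by rewrite ler_Xn ?addr_ge0// mulr_ge0// expR_ge0.
rewrite exprMn -expRM_natl => H.
apply: (@le_trans _ _ (n.+1%:R ^+ n * expR t * expR (- t))); last by rewrite -mulrA expRxMexpNx_1 mulr1.
rewrite ler_wpM2r//.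
apply: (le_trans H); rewrite ler_wpM2l// ler_expR mulrCA.
by rewrite ler_piMr// ler_pdivrMr// mul1r ler_nat.
Qed.

Lemma gaussv_jap (n : nat) : exists2 C : R, 0 <= C & forall x : vec, gaussv x <= C * jap x ^- n.
Proof.
have [C C0 HC] := expR_poly n.
exists (2 ^+ n * C) => [|x]; first by rewrite mulr_ge0// exprn_ge0.
rewrite -ler_pdivrMr ?invr_gt0 ?exprn_gt0 ?jap_gt0// invrK gaussvE.
set t := dotv x x / 2; have t0 : 0 <= t by rewrite divr_ge0// dotv_ge0.
have jt : jap x <= 2 * (1 + t).
 have -> : 2 * (1 + t) = 1 + jap x ^+ 2 by rewrite sqr_jap /t; field.
 by have := sqr_ge0 (jap x - 1); nra.
have jn : jap x ^+ n <= 2 ^+ n * (1 + t) ^+ n.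
 by rewrite -exprMn ler_Xn ?jap_ge0// mulr_ge0// addr_ge0.
have := HC t t0; rewrite mulrC => H.
have e0 := expR_ge0 (- t).
apply: (le_trans (ler_wpM2l e0 jn)).
by rewrite mulrCA ler_wpM2l// exprn_ge0.
Qed.

Lemma gaussv_sym1 k (n : nat) : symk (@basv R d) k (fun _ _ _ => 1) (fun (_ : unit) x => jap x ^- n) (fun _ x => (gaussv x)%:C).
Proof.
have b (m : nat) : bnd (fun (_ : unit) (x : vec) => (gaussv x)%:C) (fun _ x => jap x ^- m).
 have [C C0 HC] := gaussv_jap m; exists C => // t x.
 by rewrite normcR ger0_norm ?HC// gaussvE expR_ge0.
elim: k n => [|k IH] n; first by apply: symk0 => // t; exact: gaussvC.
apply: symk_of_dC => // [t|i]; first exact: gaussvC.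
apply: (symk_eq (f := fun _ x => (- (x 0 i)%:C) * (gaussv x)%:C)).
 by move=> t; rewrite dC_gaussv; apply/funext => x; rewrite mulNr.
have cs : sym (@basv R d) (fun _ _ _ => 1) (fun (_ : unit) x => jap x) (fun _ x => - (x 0 i)%:C).
 apply: sym_opp; apply: (sym_sg (K := 1)) (coord_sym i) => // [t x|j t x]; first exact: jap_ge0.
 by rewrite sgj_ge0 mul1r /sgj invf_le1 ?jap_gt0// jap_ge1.
apply: (symk_le (K := 1)) (symk_mul (cs k) (IH n.+1)) => // t x.
by rewrite mul1r mulr1 exprSr invfM mulrCA divff ?mulr1// gt_eqF// jap_gt0.
Qed.

Lemma gaussv_sym (n : nat) : sym (@basv R d) sgj (fun (_ : unit) x => jap x ^- n) (fun _ x => (gaussv x)%:C).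
Proof.
move=> k; split=> [t|w wk]; first exact: gaussvC.
(* The gain <x>^-1 of each derivative is taken from the decay of the Gaussian, which is faster than
   any power. *)
have [_ /(_ w (leqnn _))] := gaussv_sym1 (size w) (n + size w).
apply: (bnd_le (K := 1)) => // t x; rewrite mul1r.
have -> : \prod_(i <- w) (1 : R) = 1 by rewrite big1_eq.
rewrite mulr1 exprD invfM ler_wpM2l ?invr_ge0 ?exprn_ge0 ?jap_ge0//.
have -> : \prod_(i <- w) sgj i t x = (jap x)^-1 ^+ size w.
 by rewrite /sgj; elim: (w) => [|i r IH]; rewrite ?big_nil// big_cons IH exprS.
by rewrite exprVn.
Qed.

End vectors.

Section slow_variation.
Context {R : realType} {V : normedModType R}.

(** The mean value theorem for ln f. It makes a weight comparable to itself on the balls where its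
    logarithmic derivative, times the radius, is bounded. *)
Lemma log_lipschitz (f : V -> R) (x v : V) (K : R) : Cinf (fun y => (f y)%:C) -> (forall y, 0 < f y) ->
 (forall s : R, 0 <= s <= 1 -> normc (dC v (fun y => (f y)%:C) (x + s *: v)) <= K * f (x + s *: v)) ->
 f (x + v) <= expR K * f x.
Proof.
move=> fC f0 H; have lC := Cinf_ln fC f0.
have ld y : derivable (fun y => ln (f y)) y v by have [] := Cinf_derC v lC y.
have [s /andP[s0 s1] E] := MVT_line x ld.
have s01 : 0 <= s <= 1 by rewrite !ltW.
have := H s s01; have := congr1 (fun F => F (x + s *: v)) (dC_ln v fC f0).2.
rewrite dC_real /= => E2 HK.
have L : ln (f (x + v)) - ln (f x) <= K.
 rewrite E -[X in X <= _]/(Re ('D_v (fun y => ln (f y)) (x + s *: v))%:C) E2.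
 apply: le_trans (ler_norm _) _; apply: le_trans (Re_le_normc _) _.
 rewrite Normc.normcM normcR gtr0_norm ?invr_gt0// ler_pdivrMr//.
rewrite -[f (x + v)]lnK ?posrE// -[f x in leRHS]lnK ?posrE// -expRD ler_expR.
by rewrite -lerBlDr.
Qed.

End slow_variation.

(** * Smoothness from partial derivatives; composition of symbols *)

Section partials.
Context {R : realType} {W : normedModType R} {I : finType}.
Variables (e : I -> W) (co : I -> W -> R).
Hypothesis co_sum : forall w, w = \sum_i co i w *: e i.
Hypothesis coB : forall i w w', co i (w - w') = co i w - co i w'.
Hypothesis coZ : forall i t w, co i (t *: w) = t * co i w.
Hypothesis coC : forall i, continuous (co i).

Definition locally_bounded (f : W -> R[i]) := forall y, exists2 C : R, 0 <= C &
 exists2 d : R, 0 < d & forall z, `|z - y| < d -> normc (f z) <= C.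

(** Bounded partial derivatives make h locally Lipschitz: the increment is telescoped over the
    coordinates. *)
Lemma cont_of_partials (h : W -> R) : (forall i z, derivable h z (e i)) ->
 (forall i y, exists2 C : R, 0 <= C & exists2 d : R, 0 < d & forall z, `|z - y| < d -> `|'D_(e i) h z| <= C) ->
 continuous h.
Proof.
move=> hd hb y.
have [C C0 [d d0 HC]] : exists2 C : R, 0 <= C & exists2 d : R, 0 < d & forall i z, `|z - y| < d -> `|'D_(e i) h z| <= C.
 suff [C C0 [d d0 HC]] : exists2 C : R, 0 <= C & exists2 d : R, 0 < d & forall i, i \in enum I ->
   forall z, `|z - y| < d -> `|'D_(e i) h z| <= C.
  by exists C => //; exists d => // i z; apply: HC; rewrite mem_enum.
 elim: (enum I) => [|i r [C C0 [d d0 HC]]]; first by exists 0 => //; exists 1.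
 have [C' C'0 [d' d'0 HC']] := hb i y.
 exists (C + C'); first exact: addr_ge0.
 exists (Num.min d d'); first by rewrite lt_min d0.
 move=> j; rewrite inE => /orP[/eqP -> z|jr z]; rewrite lt_min => /andP[zd zd'].
  by rewrite (le_trans (HC' _ zd'))// lerDr.
 by rewrite (le_trans (HC _ jr _ zd))// lerDl.
have tele r : forall c : I -> R, \sum_(i <- r) `|c i| * `|e i| < d ->
  `|h (y + \sum_(i <- r) c i *: e i) - h y| <= C * \sum_(i <- r) `|c i|.
 elim: r => [|i r IH] c; first by rewrite !big_nil addr0 subrr normr0 mulr0.
 rewrite !big_cons => Hd; set S := \sum_(j <- r) _.
 have SS : `|S| <= \sum_(j <- r) `|c j| * `|e j|.
  by apply: le_trans (ler_norm_sum _ _ _) _; apply: ler_sum => j _; rewrite normrZ.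
 have hdi z : derivable h z (c i *: e i) by have [] := deriveZv (c i) (hd i z).
 have [s /andP[s0 s1] Es] := MVT_line (y + S) hdi.
 rewrite (deriveZv _ (hd i _)).2 in Es.
 rewrite [c i *: _ + _]addrC [y + _]addrA -(subrK (h (y + S)) (h (y + S + _))) -addrA mulrDr.
 apply: le_trans (ler_normD _ _) _; apply: lerD; last first.
  by apply: IH; apply: le_lt_trans Hd; rewrite lerDr mulr_ge0.
 rewrite Es normrM mulrC ler_wpM2r//; apply: HC.
 rewrite addrAC [y + S]addrC addrK; apply: le_lt_trans (ler_normD _ _) _.
 rewrite addrC; apply: le_lt_trans Hd; rewrite lerD// normrZ normrZ ler_piMl//.
 by rewrite ger0_norm ltW.
apply/cvgrPdist_le => eps eps0.
pose K := \sum_i (`|e i| + 1) + 1; have K0 : 0 < K by rewrite ltr_wpDl// sumr_ge0// => i _; rewrite addr_ge0.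
pose n := #|I|.+1%:R : R.
pose a := Num.min (d / K) (eps / ((C + 1) * n)).
have a0 : 0 < a by rewrite lt_min !divr_gt0// ?mulr_gt0// ltr_wpDl.
have near_co : \forall z \near y, forall i, `|co i z - co i y| < a.
 have H i : \forall z \near y, `|co i z - co i y| < a.
  by have /cvgrPdist_lt/(_ a a0) := @coC i y; under eq_near do rewrite distrC.
 exact: (@filter_forall W I (fun i z => `|co i z - co i y| < a) (nbhs y) _ H).
near=> z; have zc : forall i, `|co i z - co i y| < a by near: z.
pose c i := co i z - co i y.
have Ez : z = y + \sum_i c i *: e i.
 rewrite -[LHS](subrK y) addrC; congr (_ + _).
 by rewrite [LHS]co_sum; apply: eq_bigr => i _; rewrite coB.
rewrite distrC Ez; apply: le_trans (tele _ _ _) _.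
 apply: (@le_lt_trans _ _ (\sum_i a * (`|e i| + 1))).
  by apply: ler_sum => i _; apply: ler_pM => //; [exact: ltW (zc i)|rewrite lerDl].
 rewrite -mulr_sumr; apply: (@lt_le_trans _ _ (a * K)); first by rewrite ltr_pM2l// ltrDl.
 by rewrite -ler_pdivlMr// ge_min lexx.
apply: (@le_trans _ _ ((C + 1) * (n * a))).
 apply: ler_pM => //; rewrite ?sumr_ge0 ?lerDl//.
 apply: (@le_trans _ _ (\sum_(i : I) a)); first by apply: ler_sum => i _; exact: ltW (zc i).
 by rewrite sumr_const -[a *+ _]mulr_natl ler_wpM2r ?(ltW a0)// ler_nat.
by rewrite mulrA mulrC -ler_pdivlMr ?mulr_gt0// ?ltr_wpDl// ge_min lexx orbT.
Unshelve. all: by end_near.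
Qed.

(** The way in which integrals depending on parameters are proved smooth: their formal derivatives
    form a family closed under partial derivatives, and local bounds are enough, since bounds on the
    derivatives of order one more give continuity. Continuous partial derivatives then give all
    directional ones. *)
Lemma Cinf_of_partials (F : seq I -> W -> R[i]) :
 (forall w i X, is_dC (F w) (e i) X (F (rcons w i) X)) -> (forall w, locally_bounded (F w)) ->
 forall w, Cinf (F w).
Proof.
move=> Fd Fb.
have dE w i : derC (F w) (e i) /\ dC (e i) (F w) = F (rcons w i) by exact: derC_mk.
have cF w : contC (F w).
 split; apply: cont_of_partials => [i z|i y].
 - by have [+ _] := (dE w i).1 z.
 - have [C C0 [d d0 H]] := Fb (rcons w i) y; exists C => //; exists d => // z zd.
  by rewrite -dC_Re (dE w i).2; apply: le_trans (Re_le_normc _) _; exact: H.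
 - by have [_ +] := (dE w i).1 z.
 have [C C0 [d d0 H]] := Fb (rcons w i) y; exists C => //; exists d => // z zd.
 by rewrite -dC_Im (dE w i).2; apply: le_trans (Im_le_normc _) _; exact: H.
have dco i v x : is_derive x v (co i) (co i v).
 suff [? ?] : derivable (co i) x v /\ 'D_v (co i) x = co i v by exact: DeriveDef.
 apply: derive_cvgP => a a0; exists 1 => // t t0 _.
 by rewrite -coB [x + _]addrC addrK coZ subrr normr0 mulr_ge0// ltW.
have ReE w i : 'D_(e i) (fun x => Re (F w x)) = (fun x => Re (F (rcons w i) x)).
 by apply/funext => x; rewrite -dC_Re (dE w i).2.
have ImE w i : 'D_(e i) (fun x => Im (F w x)) = (fun x => Im (F (rcons w i) x)).
 by apply/funext => x; rewrite -dC_Im (dE w i).2.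
have dvE w v : derC (F w) v /\ dC v (F w) = fun x => \sum_i (co i v)%:C * F (rcons w i) x.
 apply: derC_mk => x.
 have RS (G : I -> R[i]) : Re (\sum_i G i) = \sum_i Re (G i).
  by elim/big_rec2 : _ => // i y z _ <-; rewrite ReD.
 have IS (G : I -> R[i]) : Im (\sum_i G i) = \sum_i Im (G i).
  by elim/big_rec2 : _ => // i y z _ <-; rewrite ImD.
 rewrite /is_dC RS IS; split.
  under eq_bigr do rewrite ReMr -[Re (F _ _)]/((fun x => Re (F _ x)) x) -ReE.
  apply: (is_der_chain co_sum coB (h := fun y => Re (F w y)) (g := id)) => // i.
   by move=> z; have [] := (dE w i).1 z.
  by rewrite ReE; have [] := cF (rcons w i).
 under eq_bigr do rewrite ImMr -[Im (F _ _)]/((fun x => Im (F _ x)) x) -ImE.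
 apply: (is_der_chain co_sum coB (h := fun y => Im (F w y)) (g := id)) => // i.
  by move=> z; have [] := (dE w i).1 z.
 by rewrite ImE; have [] := cF (rcons w i).
move=> w k; elim: k w => [|k IH] w; first by split.
split=> // v; have [d ->] := dvE w v; split=> //.
elim: (index_enum I) => [|i r IHr].
 by under eq_fun do rewrite big_nil; exact: Ck_cst.
under eq_fun do rewrite big_cons; apply: Ck_add => //.
by apply: Ck_mul; [exact: Ck_cst|exact: IH].
Qed.

End partials.

Section composition.
Context {R : realType} {V W : normedModType R} {I J : finType} {T S : Type}.
Variables (e : J -> V) (e' : I -> W) (co : I -> W -> R).
Hypothesis co_sum : forall w, w = \sum_i co i w *: e' i.
Hypothesis coB : forall i w w', co i (w - w') = co i w - co i w'.
Variables (p : T -> S) (g : T -> V -> W) (sg : J -> T -> V -> R) (sg' : I -> S -> W -> R).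
Hypothesis sg_ge0 : forall j t x, 0 <= sg j t x.
Hypothesis sg'_gt0 : forall i s y, 0 < sg' i s y.
Hypothesis gc : forall t, continuous (g t).
Hypothesis gC : forall t i, Cinf (fun x => (co i (g t x))%:C).
Hypothesis g_sym : forall i j, sym e sg (fun t x => sg j t x / sg' i (p t) (g t x))
 (fun t => dC (e j) (fun x => (co i (g t x))%:C)).

(** In each term of the chain rule the outer derivative brings sg' i and the inner one sg j / sg' i,
    so sg j remains. *)
Lemma sym_comp m f : (forall s y, 0 <= m s y) -> sym e' sg' m f ->
 sym e sg (fun t x => m (p t) (g t x)) (fun t x => f (p t) (g t x)).
Proof.
move=> m0 fs k; elim: k m f m0 fs => [|k IH] m f m0 fs.
 have fC s := sym_Cinf s fs; have [C C0 HC] := sym_bnd fs.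
 apply: symk0 => [t|]; first exact: (Cinf_chain co_sum coB).
 by exists C => // t x; exact: HC.
have fC s := sym_Cinf s fs; have [C C0 HC] := sym_bnd fs.
apply: symk_of_dC => [t||j]; first exact: (Cinf_chain co_sum coB).
 by exists C => // t x; exact: HC.
pose h t x := \sum_i dC (e j) (fun x => (co i (g t x))%:C) x * dC (e' i) (f (p t)) (g t x).
apply: (symk_eq (f := h)) => [t|].
 have [_ ->] := dC_chain co_sum coB (e j) (fC (p t)) (gC t).
 by [].
have hs i : symk e k sg (fun t x => m (p t) (g t x) * sg j t x)
  (fun t x => dC (e j) (fun x => (co i (g t x))%:C) x * dC (e' i) (f (p t)) (g t x)).
 have m0' s y : 0 <= m s y * sg' i s y by rewrite mulr_ge0// ltW.
 have := symk_mul (g_sym i j k) (IH _ _ m0' (sym_dC i fs)).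
 apply: symk_le ler01 _ _ => // t x.
 by rewrite mul1r mulrCA divfK ?gt_eqF.
rewrite /h; elim: (index_enum I) => [|i r IHr].
 apply: (symk_eq (f := fun _ _ => 0)); first by move=> t; apply/funext => x; rewrite big_nil.
 apply: symk_cst => [t x|//|]; first by rewrite mulr_ge0.
 by exists 0 => // t x; rewrite Normc.normc0 mul0r.
apply: (symk_eq (f := fun t x => dC (e j) (fun x => (co i (g t x))%:C) x * dC (e' i) (f (p t)) (g t x) +
  \sum_(i <- r) dC (e j) (fun x => (co i (g t x))%:C) x * dC (e' i) (f (p t)) (g t x))).
 by move=> t; apply/funext => x; rewrite big_cons.
exact: symk_add.
Qed.
End composition.

(** * Inequalities between the scales *)

Section scale_inequalities.
Context {R : realFieldType}.
Implicit Types b V U Y X z : R.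

Lemma le_of_sqr (x y : R) : 0 <= y -> x ^+ 2 <= y ^+ 2 -> x <= y.
Proof. by move=> y0 h; rewrite leNgt; apply/negP => yx; nra. Qed.

(** In these inequalities b, V, U and Y stand for [bs], [Vs], [Us] and [Ya], X for <x> and z for
    |z|. As <xi> = V^4, the recurrent quantity V^3 b^2 / U is <xi> [ds] b^2, the bound sought for
    |eta - th|. *)
Lemma scale_id1 V U b : V ^+ 4 * (U * V)^-1 * b ^+ 2 = V ^+ 3 * b ^+ 2 / U.
Proof.
have [->|V0] := eqVneq V 0; first by rewrite mulr0 invr0 mulr0 expr0n /= !mul0r.
rewrite invfM [V ^+ 4]exprSr; apply/eqP; rewrite -subr_eq0; apply/eqP.
have -> : V ^+ 3 * V * (U^-1 * V^-1) * b ^+ 2 - V ^+ 3 * b ^+ 2 / U = V ^+ 3 * b ^+ 2 / U * (V / V - 1) by ring.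
by rewrite divff// subrr mulr0.
Qed.

Lemma scale_ineq1 b V U Y : 1 <= b -> 1 <= V -> 1 <= U -> 1 <= Y -> U <= 2 * Y ->
 b * V ^+ 2 / Y <= 2 * (V ^+ 3 * b ^+ 2 / U).
Proof.
move=> b1 V1 U1 Y1 UY; have Y0 : 0 < Y by lra.
have U0 : 0 < U by lra.
rewrite ler_pdivrMr//.
have -> : 2 * (V ^+ 3 * b ^+ 2 / U) * Y = V ^+ 3 * b ^+ 2 * (2 * Y) / U by ring.
have h : b * V ^+ 2 <= V ^+ 3 * b ^+ 2.
 rewrite mulrC; apply: ler_pM; rewrite ?exprn_ge0 ?ler_weXn2l//; [lra|lra|].
 by rewrite -[leLHS]expr1 ler_weXn2l.
rewrite ler_pdivlMr//; apply: ler_pM => //; rewrite ?mulr_ge0 ?exprn_ge0//; lra.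
Qed.

Lemma scale_ineq2 b V U X z : 1 <= b -> 1 <= V -> 1 <= U -> U ^+ 4 <= X -> z <= b * U / V ->
 V ^+ 4 / X * z <= V ^+ 3 * b ^+ 2 / U.
Proof.
move=> b1 V1 U1 UX zl; have U0 : 0 < U by lra.
have V0 : 0 < V by lra.
have X0 : 0 < X by apply: lt_le_trans UX; rewrite exprn_gt0.
rewrite mulrAC ler_pdivrMr//.
apply: (@le_trans _ _ (V ^+ 4 * (b * U / V))); first by rewrite ler_wpM2l ?exprn_ge0//; lra.
have -> : V ^+ 4 * (b * U / V) = V ^+ 3 * b * U * (V / V) by ring.
rewrite divff ?gt_eqF// mulr1 [leRHS]mulrAC ler_pdivlMr//.
have -> : V ^+ 3 * b * U * U = V ^+ 3 * b * U ^+ 2 by ring.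
have h : b * U ^+ 2 <= b ^+ 2 * X.
 apply: ler_pM; [lra|by rewrite exprn_ge0// ltW| |].
  by rewrite -[leLHS]expr1 ler_weXn2l.
 by apply: le_trans UX; rewrite ler_weXn2l.
by rewrite -[X in X <= _]mulrA -[X in _ <= X]mulrA ler_wpM2l// exprn_ge0// ltW.
Qed.

Lemma scale_ineq3 b V U Y : 1 <= b -> 1 <= V -> 1 <= U -> 1 <= Y -> U * V <= 2 * b ->
 b * V ^+ 2 / Y <= 2 * (V ^+ 3 * b ^+ 2 / U).
Proof.
move=> b1 V1 U1 Y1 UV; have Y0 : 0 < Y by lra.
have U0 : 0 < U by lra.
have V0 : 0 < V by lra.
apply: (@le_trans _ _ (b * V ^+ 2)).
 by rewrite ler_pdivrMr// ler_peMr// mulr_ge0 ?exprn_ge0//; lra.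
have -> : 2 * (V ^+ 3 * b ^+ 2 / U) = b * V ^+ 2 * (V * (2 * b)) / U by ring.
rewrite ler_pdivlMr//; apply: ler_wpM2l; last nra.
by rewrite mulr_ge0 ?exprn_ge0//; lra.
Qed.

Lemma scale_ineq4 b V U : 1 <= b -> 1 <= V -> 1 <= U -> U * V <= 2 * b ->
 V ^+ 4 <= 2 * (V ^+ 3 * b ^+ 2 / U).
Proof.
move=> b1 V1 U1 UV; have U0 : 0 < U by lra.
have V0 : 0 < V by lra.
have -> : 2 * (V ^+ 3 * b ^+ 2 / U) = V ^+ 3 * (b * (2 * b)) / U by ring.
rewrite ler_pdivlMr//; have -> : V ^+ 4 * U = V ^+ 3 * (U * V) by ring.
rewrite ler_wpM2l ?exprn_ge0//; nra.
Qed.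

End scale_inequalities.

Section taylor_scales.
Context {R : rcfType}.

Lemma taylor_scale1 (a X u B Q e : R) n L : X != 0 ->
 (a * (X * u * B)) ^+ n * (Q * (e * X^-1) ^+ (n + L)) =
 a ^+ n * e ^+ (n + L) * (Q * (u ^+ n * B ^+ n) * X^-1 ^+ L).
Proof.
move=> X0; have h : X ^+ n * X^-1 ^+ n = 1 by rewrite -exprMn divff// expr1n.
rewrite !exprMn [X^-1 ^+ (n + L)]exprD -[RHS]mulr1 -h; ring.
Qed.

(** Truncated subtraction is intended: the first N of the L factors q are each exchanged for u k and
    restore u^N; those beyond N are only bounded by k. *)
Lemma scale_pow (q u k : R) N L : 0 <= q -> 0 <= u -> 0 <= k -> q <= u * k -> q <= k ->
 u ^+ (N - L) * q ^+ L <= u ^+ N * k ^+ L.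
Proof.
move=> q0 u0 k0 quk qk; elim: L N => [|L IH] N; first by rewrite subn0.
case: N => [|N].
 rewrite sub0n !expr0 !mul1r; apply: lerXn2r; rewrite//.
rewrite subSS [q ^+ _]exprS [u ^+ N.+1]exprS [k ^+ _]exprS mulrCA.
have -> : u * u ^+ N * (k * k ^+ L) = u * k * (u ^+ N * k ^+ L) by ring.
by apply: ler_pM => //; rewrite mulr_ge0// exprn_ge0.
Qed.

(** After L derivatives in eta the Taylor remainder has order N - L only. The missing powers of the
    gain u = [ds] come from the factors q = <xi>^-1 which these derivatives produce, as q <= u / k
    with k = [ks]. *)
Lemma taylor_scale2 (w u k q b : R) m N L : 0 <= w -> 0 <= u -> 0 < k -> 0 <= q -> 1 <= b ->
 q <= u / k -> q <= k^-1 ->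
 w * (u ^+ (N - L) * (b ^+ 2) ^+ (N - L)) * q ^+ L <=
 w * u ^+ N * b ^+ (m + 2 * N) * (Num.sqrt b / k) ^+ L.
Proof.
move=> w0 u0 k0 q0 b1 h1 h2; have b0 := le_trans ler01 b1.
have k0' : 0 <= k^-1 by rewrite invr_ge0 ltW.
have s1 : 1 <= Num.sqrt b by rewrite -sqrtr1 ler_wsqrtr.
have H := scale_pow N L q0 u0 k0' h1 h2.
have B : (b ^+ 2) ^+ (N - L) <= b ^+ (m + 2 * N).
 rewrite -exprM ler_weXn2l//; apply: leq_trans (leq_addl _ _).
 by rewrite leq_mul2l leq_subr.
have -> : w * (u ^+ (N - L) * (b ^+ 2) ^+ (N - L)) * q ^+ L = w * ((u ^+ (N - L) * q ^+ L) * (b ^+ 2) ^+ (N - L)) by ring.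
have -> : w * u ^+ N * b ^+ (m + 2 * N) * (Num.sqrt b / k) ^+ L = w * ((u ^+ N * k^-1 ^+ L) * (b ^+ (m + 2 * N) * Num.sqrt b ^+ L)).
 by rewrite exprMn; ring.
rewrite ler_wpM2l//; apply: ler_pM => //; rewrite ?mulr_ge0 ?exprn_ge0//.
apply: le_trans B _; rewrite ler_peMr ?exprn_ge0// exprn_ege1//.
Qed.

End taylor_scales.

Lemma sym_reindex {R : realType} {V : normedModType R} {I : eqType} {T T' : Type} (e : I -> V) (p : T' -> T)
  (sg : I -> T -> V -> R) m f : sym e sg m f ->
 sym e (fun i t => sg i (p t)) (fun t => m (p t)) (fun t => f (p t)).
Proof.
move=> fs k; have [fC H] := fs k; split=> [t|u uk]; first exact: fC.
by have [C C0 HC] := H u uk; exists C => // t x; exact: HC.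
Qed.

Record composition_data (R : realType) (d : nat) := CompositionData {
 cr0 : R; cr1 : R; cr2 : R; crho0 : R; crho1 : R;
 cw0 : 'rV[R]_d -> 'rV[R]_d -> R; cw1 : 'rV[R]_d -> 'rV[R]_d -> R; cw2 : 'rV[R]_d -> 'rV[R]_d -> R;
 cphi : 'rV[R]_d -> 'rV[R]_d -> R;
 ca : 'rV[R]_d -> 'rV[R]_d -> R[i]; cp : 'rV[R]_d -> 'rV[R]_d -> R[i];
 cr1_01 : 0 <= cr1 <= 1; cr2_01 : 0 <= cr2 <= 1; crho1_01 : 0 <= crho1 <= 1;
 cr0E : cr0 = Num.min cr1 (Num.min cr2 1); crho0E : crho0 = Num.min crho1 1;
 chw0 : smooth_weight cr0 crho0 cw0;
 chw1 : smooth_weight cr1 crho1 cw1;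
 chw2 : smooth_weight cr2 1 cw2;
 chphi : simple_phase cphi;
 cw0E : forall x xi, cw0 x xi = cw1 x xi * cw2 x (gradx cphi x xi);
 chinv : phi2_invariant cphi cw2;
 cha : SG cw1 cr1 crho1 ca;
 chp : SG cw2 cr2 1 cp }.

Lemma inv_prod_le (F : realFieldType) (A1 A2 B1 B2 c1 c2 : F) : 0 < A1 -> 0 < A2 -> 0 < B1 -> 0 < B2 ->
 A1 <= c1 * B1 -> A2 <= c2 * B2 -> (B1 * B2)^-1 <= c1 * c2 * (A1 * A2)^-1.
Proof.
move=> A10 A20 B10 B20 h1 h2; rewrite ler_pdivlMr ?mulr_gt0// mulrC ler_pdivrMr ?mulr_gt0//.
have -> : c1 * c2 * (B1 * B2) = (c1 * B1) * (c2 * B2) by ring.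
by apply: ler_pM => //; exact: ltW.
Qed.

Lemma contC_sub (R : realType) (V : normedModType R) (f g : V -> R[i]) : contC f -> contC g -> contC (fun v => f v - g v).
Proof.
move=> fc gc; have := contC_add fc (contC_mul (contC_cst (-1)) gc); by under eq_fun do rewrite mulN1r.
Qed.
Lemma dom_sub (R : realType) (V : normedModType R) (S : ispace V) (f g : V -> R[i]) : dom S f -> dom S g -> dom S (fun v => f v - g v).
Proof.
move=> fd gd; have := dom_add fd (dom_scale (-1) gd); by under eq_fun do rewrite mulN1r.
Qed.

Section oscillatory_calculus.
Context {R : realType} {d : nat}.
Local Notation vec := 'rV[R]_d.
Local Notation vec2 := (vec * vec)%type.
Local Notation I2 := ('I_d + 'I_d)%type.
Local Notation ones T := (fun (_ : I2) (_ : T) (_ : vec2) => (1 : R)).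
Local Notation ones1 := (fun (_ : 'I_d) (_ : unit) (_ : vec) => (1 : R)).
Local Notation P4 := (vec2 * vec2)%type.
Local Notation basv := (@basv R d).
Local Notation S1 := (@vec_space R d).

Lemma dotv00 : dotv (0 : vec) 0 = 0.
Proof. by rewrite /dotv big1// => i _; rewrite mxE mul0r. Qed.

(** * Multi-indices, SG classes and weights on phase space *)

Section phase_space.

Definition e2 (i : I2) : vec2 := match i with inl j => (basv j, 0) | inr j => (0, basv j) end.
Definition co2 (i : I2) (X : vec2) : R := match i with inl j => X.1 0 j | inr j => X.2 0 j end.

Lemma co2_sum X : X = \sum_i co2 i X *: e2 i.
Proof.

have fst_sum (J : finType) (F : J -> vec2) : (\sum_j F j).1 = \sum_j (F j).1.
 by elim/big_rec2 : _ => // j y z _ <-.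
have snd_sum (J : finType) (F : J -> vec2) : (\sum_j F j).2 = \sum_j (F j).2.
 by elim/big_rec2 : _ => // j y z _ <-.
case: X => x xi; rewrite [RHS]surjective_pairing fst_sum snd_sum !big_sumType /=.
congr (_, _).
 rewrite [in RHS]addrC big1 ?add0r; first exact: sum_basv.
 by move=> i _; rewrite scaler0.
rewrite big1 ?add0r; first exact: sum_basv.
by move=> i _; rewrite scaler0.
Qed.

Lemma co2B i X Y : co2 i (X - Y) = co2 i X - co2 i Y.
Proof. by case: i => i; rewrite /= !mxE. Qed.

Lemma pair_affine1 (t : R) (v x xi : vec) : (t *: v + x, xi) = t *: (v, 0 : vec) + (x, xi).
Proof. by rewrite -[t *: _ in RHS]/(t *: v, t *: (0 : vec)) scaler0 -[RHS]/(t *: v + x, 0 + xi) add0r. Qed.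
Lemma pair_affine2 (t : R) (v x y : vec) : (y, t *: v + x) = t *: (0 : vec, v) + (y, x).
Proof. by rewrite -[t *: _ in RHS]/(t *: (0 : vec), t *: v) scaler0 -[RHS]/(0 + y, t *: v + x) add0r. Qed.

Lemma sec2_Dw (F : vec2 -> R[i]) y w xi :
 Dw e2 (map inr w) F (y, xi) = Dw basv w (fun eta => F (y, eta)) xi.
Proof.
elim: w F => //= i w IH F; rewrite IH; congr (Dw _ w _ xi); apply/funext => eta.
rewrite (dC_affine (A := fun eta => (y, eta)) (a := e2 (inr i)))// => t x.
exact: pair_affine2.
Qed.
Lemma sec1_Dw (F : vec2 -> R[i]) x w xi :
 Dw e2 (map inl w) F (x, xi) = Dw basv w (fun y => F (y, xi)) x.
Proof.
elim: w F => //= i w IH F; rewrite IH; congr (Dw _ w _ x); apply/funext => y.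
rewrite (dC_affine (A := fun y => (y, xi)) (a := e2 (inl i)))// => t z.
exact: pair_affine1.
Qed.

(** [pderiv] folds from the right, so it differentiates along the last coordinate first, while [Dw]
    starts from the head of the word; hence the letters i are put at the end. *)
Fixpoint wdl (al : 'I_d -> nat) (l : seq 'I_d) : seq 'I_d :=
 if l is i :: l' then wdl al l' ++ nseq (al i) i else [::].
Definition wd al := wdl al (enum 'I_d).

Lemma count_wdl al l i : uniq l -> count_mem i (wdl al l) = if i \in l then al i else 0%N.
Proof.
elim: l => //= j l IH /andP[jl ul]; rewrite count_cat IH// inE eq_sym.
rewrite count_nseq /=; have [ji|ij] := eqVneq j i; first by rewrite -ji (negPf jl) mul1n.
by rewrite mul0n addn0.
Qed.

Lemma count_wd al i : count_mem i (wd al) = al i.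
Proof. by rewrite count_wdl ?enum_uniq// mem_enum. Qed.

Lemma size_wd al : size (wd al) = mi_size al.
Proof.
rewrite /wd /mi_size -big_enum /=; elim: (enum _) => [|i l IH] /=; first by rewrite big_nil.
by rewrite size_cat size_nseq IH big_cons addnC.
Qed.

Lemma Dw_nseq (f : vec -> R[i]) i k : Dw basv (nseq k i) f = iter k (dC (basv i)) f.
Proof. by elim: k f => //= k IH f; rewrite IH -iterSr. Qed.

Lemma pderiv_Re al (f : vec -> R[i]) : (fun x => Re (Dw basv (wd al) f x)) = pderiv al (fun y => Re (f y)).
Proof.
rewrite /wd /pderiv; elim: (enum _) => //= i l IH; rewrite Dw_cat Dw_nseq -IH.
elim: (al i) => //= k IHk; rewrite -IHk; apply/funext => x; exact: dC_Re.
Qed.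
Lemma pderiv_Im al (f : vec -> R[i]) : (fun x => Im (Dw basv (wd al) f x)) = pderiv al (fun y => Im (f y)).
Proof.
rewrite /wd /pderiv; elim: (enum _) => //= i l IH; rewrite Dw_cat Dw_nseq -IH.
elim: (al i) => //= k IHk; rewrite -IHk; apply/funext => x; exact: dC_Im.
Qed.

Lemma DmiE al (f : vec -> R[i]) x : Dmi al f x = (- 'i%C) ^+ mi_size al * Dw basv (wd al) f x.
Proof.
rewrite /Dmi; congr (_ * _); apply: complexP => /=.
 by rewrite -pderiv_Re.
by rewrite -pderiv_Im.
Qed.

Lemma pderiv_real al (h : vec -> R) x : (pderiv al h x)%:C = Dw basv (wd al) (fun y => (h y)%:C) x.
Proof.
apply: complexP => /=.
 by rewrite -[RHS]/((fun x => Re (Dw basv (wd al) (fun y => (h y)%:C) x)) x) pderiv_Re.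
rewrite -[RHS]/((fun x => Im (Dw basv (wd al) (fun y => (h y)%:C) x)) x) pderiv_Im /=.
rewrite /pderiv; elim: (enum _) x => //= i l IH x.
elim: (al i) x => [|k IHk] x /=; first exact: IH.
rewrite /partial -[LHS](derive_cst (0 : R) x (delta_mx 0 i)).
by congr ('D_ _ _ x); apply/funext => y; rewrite -IHk.
Qed.

Definition cword al be : seq I2 := map inr (wd be) ++ map inl (wd al).

Lemma pderiv2E al be (h : vec -> vec -> R) x xi :
 (pderiv2 al be h x xi)%:C = Dw e2 (cword al be) (fun X => (h X.1 X.2)%:C) (x, xi).
Proof.
rewrite /cword Dw_cat sec1_Dw pderiv_real; congr (Dw _ _ _ x); apply/funext => y.
by rewrite sec2_Dw pderiv_real.
Qed.

Lemma Cinf_sec1 (F : vec2 -> R[i]) xi : Cinf F -> Cinf (fun y => F (y, xi)).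
Proof.
apply: (Cinf_affine (A := fun y : vec => (y, xi)) (A0 := fun v => (v, 0))).
 move=> x; exact: (cvg_pair (@cvg_id _ (nbhs x)) (cvg_cst xi)).
by move=> v t x; exact: pair_affine1.
Qed.
Lemma Cinf_sec2 (F : vec2 -> R[i]) y : Cinf F -> Cinf (fun xi => F (y, xi)).
Proof.
apply: (Cinf_affine (A := fun xi : vec => (y, xi)) (A0 := fun v => (0, v))).
 move=> x; exact: (cvg_pair (cvg_cst y) (@cvg_id _ (nbhs x))).
by move=> v t x; exact: pair_affine2.
Qed.

Lemma Dmi2E al be (a : vec -> vec -> R[i]) x xi : Cinf (fun X : vec2 => a X.1 X.2) ->
 Dmi2 al be a x xi = (- 'i%C) ^+ mi_size al * (- 'i%C) ^+ mi_size be *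
  Dw e2 (cword al be) (fun X => a X.1 X.2) (x, xi).
Proof.
move=> aC; rewrite /Dmi2 DmiE -mulrA; congr (_ * _).
have -> : (fun y => Dmi be (a y) xi) = (fun y => (- 'i%C) ^+ mi_size be *
  Dw e2 (map inr (wd be)) (fun X => a X.1 X.2) (y, xi)).
 by apply/funext => y; rewrite DmiE sec2_Dw.
rewrite Dw_scale /cword ?Dw_cat ?sec1_Dw//.
by apply: Cinf_sec1; exact: Cinf_Dw.
Qed.

Lemma normc_Ni n : normc ((- 'i%C : R[i]) ^+ n) = 1.
Proof.
have n1 : normc (- 'i%C : R[i]) = 1 by rewrite normcN normc_i.
by elim: n => [|n IH]; rewrite ?Normc.normc1// exprS Normc.normcM IH n1 mulr1.
Qed.

Definition sgSG (r rho : R) (i : I2) (_ : unit) (X : vec2) : R :=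
 match i with inl _ => jap X.1 `^ (- r) | inr _ => jap X.2 `^ (- rho) end.

Lemma sgSG_ge0 r rho i t X : 0 <= sgSG r rho i t X.
Proof. by case: i => i; exact: powR_ge0. Qed.

Definition symSG (w : vec -> vec -> R) r rho (F : vec2 -> R[i]) :=
 sym e2 (sgSG r rho) (fun _ X => w X.1 X.2) (fun _ => F).

(** The multiplicities of the letters determine the word up to permutation, and derivatives of
    smooth functions commute; this passes from the multi-index bounds of [SG] to bounds for all
    words. *)
Lemma word_split (w : seq I2) : exists al be, perm_eq w (cword al be).
Proof.
pose al i := count_mem (inl i) w; pose be i := count_mem (inr i) w.
exists al, be; apply/allP => i _ /=.
have cl i' (l : seq 'I_d) : count_mem (inl i') (map inl l : seq I2) = count_mem i' l.
 by rewrite count_map; apply: eq_count => j.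
have cr i' (l : seq 'I_d) : count_mem (inr i') (map inr l : seq I2) = count_mem i' l.
 by rewrite count_map; apply: eq_count => j.
have clr i' (l : seq 'I_d) : count_mem (inl i') (map inr l : seq I2) = 0%N.
 by rewrite count_map; elim: l => //= j l ->.
have crl i' (l : seq 'I_d) : count_mem (inr i') (map inl l : seq I2) = 0%N.
 by rewrite count_map; elim: l => //= j l ->.
by rewrite /cword count_cat; case: i => i; rewrite ?cl ?cr ?clr ?crl count_wd ?addn0.
Qed.

Lemma prod_sgSG r rho al be t X : \prod_(i <- cword al be) sgSG r rho i t X =
 jap X.1 `^ (- (r * (mi_size al)%:R)) * jap X.2 `^ (- (rho * (mi_size be)%:R)).
Proof.
rewrite /cword big_cat /= !big_map mulrC.
have E (x : vec) (s : R) (l : seq 'I_d) : \prod_(i <- l) jap x `^ (- s) = jap x `^ (- (s * (size l)%:R)).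
 elim: l => [|i l IH]; first by rewrite big_nil mulr0 oppr0 powRr0.
 by rewrite big_cons IH jap_powE -natr1 mulrDr mulr1 opprD addrC.
by rewrite !E !size_wd.
Qed.

Lemma symSG_of w r rho (F : vec2 -> R[i]) : Cinf F ->
 (forall al be, exists C : R, forall x xi, normc (Dw e2 (cword al be) F (x, xi)) <=
  C * (w x xi * jap x `^ (- (r * (mi_size al)%:R)) * jap xi `^ (- (rho * (mi_size be)%:R)))) ->
 (forall x xi, 0 <= w x xi) -> symSG w r rho F.
Proof.
move=> FC H w0 k; split=> // l _; have [al [be lp]] := word_split l.
have [C HC] := H al be; exists `|C| => // t [x xi].
rewrite (Dw_perm _ FC lp) (perm_big _ lp) /= prod_sgSG /= mulrA (le_trans (HC x xi))//.
by rewrite -mulrA -!mulrA ler_wpM2r ?ler_norm// !mulr_ge0// powR_ge0.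
Qed.

Lemma SG_sym w r rho a : (forall x xi, 0 <= w x xi) -> SG w r rho a ->
 symSG w r rho (fun X => a X.1 X.2).
Proof.
move=> w0 [/smooth_CinfP aC H]; apply: symSG_of => // al be.
have [c c0 Hc] := H al be; exists c => x xi.
have := Hc (x, xi); rewrite /= Dmi2E// !Normc.normcM !normc_Ni !mul1r; exact.
Qed.

Lemma sym_SG w r rho a : (forall x xi, 0 <= w x xi) ->
 symSG w r rho (fun X => a X.1 X.2) -> SG w r rho a.
Proof.
move=> w0 aS; have aC := sym_Cinf tt aS; split; first by apply/smooth_CinfP.
move=> al be; have [_ /(_ (cword al be) (leqnn _))[C C0 HC]] := aS (size (cword al be)).
exists (C + 1) => [|[x xi]]; first by rewrite ltr_wpDl.
rewrite /= Dmi2E// !Normc.normcM !normc_Ni !mul1r.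
have := HC tt (x, xi); rewrite prod_sgSG /= mulrA => /le_trans; apply.
by rewrite -mulrA -!mulrA ler_wpM2r ?lerDl// !mulr_ge0// powR_ge0.
Qed.

Lemma gradxE (phi : vec -> vec -> R) x xi i :
 (gradx phi x xi 0 i)%:C = dC (e2 (inl i)) (fun X => (phi X.1 X.2)%:C) (x, xi).
Proof.
by rewrite mxE /partial -[RHS]/(Dw e2 (map inl [:: i]) _ _) sec1_Dw /= dC_real.
Qed.
Lemma gradxiE (phi : vec -> vec -> R) x xi i :
 (gradxi phi x xi 0 i)%:C = dC (e2 (inr i)) (fun X => (phi X.1 X.2)%:C) (x, xi).
Proof.
by rewrite mxE /partial -[RHS]/(Dw e2 (map inr [:: i]) _ _) sec2_Dw /= dC_real.
Qed.

Section weights.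
Variables (r rho : R) (w : vec -> vec -> R).
Hypothesis hw : smooth_weight r rho w.

Lemma weight_gt0 x xi : 0 < w x xi.
Proof. by case: hw => -[]. Qed.
Lemma weight_ge0 x xi : 0 <= w x xi. Proof. exact: ltW (weight_gt0 x xi). Qed.

Lemma weight_C : Cinf (fun X : vec2 => (w X.1 X.2)%:C).
Proof.
apply/smooth_CinfP; split; first by case: hw.
by have /smooth_CinfP[] := @Cinf_cst R vec2 0.
Qed.

Lemma weight_sym : symSG w r rho (fun X => (w X.1 X.2)%:C).
Proof.
apply: symSG_of => [|al be|x xi]; [exact: weight_C| |exact: weight_ge0].
have [_ _ /(_ al be)[C HC]] := hw; exists C => x xi.
rewrite -pderiv2E normcR; have := HC x xi.
rewrite normrM normfV [X in _ / X]gtr0_norm ?weight_gt0// ler_pdivrMr ?weight_gt0//.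
rewrite !normrM (ger0_norm (powR_ge0 _ _)) (ger0_norm (powR_ge0 (jap xi) _)) => H.
have E (y : vec) (s : R) : jap y `^ (- s) * jap y `^ s = 1 by rewrite jap_powE addNr powRr0.
have -> : `|pderiv2 al be w x xi| = (jap x `^ (r * (mi_size al)%:R) * jap xi `^ (rho * (mi_size be)%:R)
  * `|pderiv2 al be w x xi|) * (jap x `^ (- (r * (mi_size al)%:R)) * jap xi `^ (- (rho * (mi_size be)%:R))).
 by rewrite mulrAC mulrACA mulrC [in RHS](mulrC (jap x `^ _)) E [in RHS](mulrC (jap xi `^ _)) E mul1r mulr1.
by rewrite -[w x xi * _ * _]mulrA [leRHS]mulrA ler_wpM2r// mulr_ge0// powR_ge0.
Qed.

Lemma meval_bound n (p : mpoly.mpoly n R) : exists2 C : R, 0 <= C & exists m : nat,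
 forall (u : 'I_n -> R) (B : R), 1 <= B -> (forall i, `|u i| <= B) ->
  `|mpoly.meval u p| <= C * B ^+ m.
Proof.
exists (\sum_(m <- mpoly.msupp p) `|mpoly.mcoeff m p|); first exact: sumr_ge0.
exists (\sum_(m <- mpoly.msupp p) mpoly.mdeg m)%N => u B B1 uB.
rewrite mpoly.mevalE (le_trans (ler_norm_sum _ _ _))//.
elim: (mpoly.msupp p) => [|m s IH]; first by rewrite !big_nil mul0r.
rewrite !big_cons mulrDl; have B0 : 0 <= B by rewrite (le_trans _ B1).
apply: lerD.
 rewrite normrM ler_wpM2l// normr_prod; apply: (@le_trans _ _ (B ^+ mpoly.mdeg m)).
  rewrite mpoly.mdegE -prodrXr; apply: ler_prod => i _.
  by rewrite normr_ge0 normrX lerXn2r.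
 by rewrite ler_weXn2l// leq_addr.
apply: le_trans IH _; rewrite ler_wpM2l ?sumr_ge0//.
by rewrite ler_weXn2l// leq_addl.
Qed.

(** Each argument of the polynomial is at most <y><eta>, so the polynomial is replaced by a power of
    this product. *)
Lemma weight_mod : exists2 C : R, 0 <= C & exists m : nat, forall x xi y eta,
 w (x + y) (xi + eta) <= C * w x xi * (jap y * jap eta) ^+ m.
Proof.
have [[_ _ [v [c c0 Hc]]] _ _] := hw.
have [C C0 [m Hm]] := meval_bound v.
exists (c * C); first by rewrite mulr_ge0// ltW.
exists m => x xi y eta; have := Hc ((x, xi), (y, eta)) => /= /le_trans; apply.
rewrite -!mulrA ler_wpM2l ?(ltW c0)// mulrCA ler_wpM2l ?weight_ge0//.
apply: le_trans (ler_norm _) _; apply: Hm.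
 by rewrite mulr_ege1// jap_ge1.
move=> i; have j1 := jap_ge1 y; have j2 := jap_ge1 eta.
rewrite mxE; case: (fintype.split i) => k.
 by rewrite (le_trans (le_coord_jap y k))// ler_peMr// jap_ge0.
by rewrite (le_trans (le_coord_jap eta k))// ler_peMl// jap_ge0.
Qed.

End weights.
End phase_space.

(** * Oscillatory integrals *)

Section osc_phase.

Definition phase_space_measure : ispace vec2 := prod_space S1 S1.
Local Notation S2 := phase_space_measure.

Lemma ibp_S2 : ibp_space e2 S2.
Proof.
move=> [j|j] f fd fdom ddom.
 rewrite (Lam_fubini ddom).2.
 have E b : (fun a => dC (e2 (inl j)) f (a, b)) = dC (basv j) (fun a => f (a, b)).
  apply/funext => a; rewrite (dC_affine (A := fun a => (a, b)) (a := e2 (inl j)))// => t x.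
  exact: pair_affine1.
 have -> : (fun b => Lam (vec_space d) (fun a => dC (e2 (inl j)) f (a, b))) = fun=> 0.
  apply/funext => b; rewrite E; apply: Lam_ibp.
  - apply: (derC_affine1 (A := fun a => (a, b)) _ fd) => t x; exact: pair_affine1.
  - exact: dom_sec2 b fdom.
  - by rewrite -E; exact: dom_sec2 b ddom.
 exact: Lam0.
rewrite (Lam_fubini ddom).1.
have E b : (fun a => dC (e2 (inr j)) f (b, a)) = dC (basv j) (fun a => f (b, a)).
 apply/funext => a; rewrite (dC_affine (A := fun a => (b, a)) (a := e2 (inr j)))// => t x.
 exact: pair_affine2.
have -> : (fun b => Lam (vec_space d) (fun a => dC (e2 (inr j)) f (b, a))) = fun=> 0.
 apply/funext => b; rewrite E; apply: Lam_ibp.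
 - apply: (derC_affine1 (A := fun a => (b, a)) _ fd) => t x; exact: pair_affine2.
 - exact: dom_sec1 b fdom.
 - by rewrite -E; exact: dom_sec1 b ddom.
exact: Lam0.
Qed.

Lemma co2_aff i w : dC w (fun v : vec2 => (co2 i v)%:C) = fun=> (co2 i w)%:C.
Proof.
apply/funext => v; case: i => i /=.
 rewrite (dC_affine (A := fun v : vec2 => v.1) (a := w.1) (fun x : vec => (x 0 i)%:C))//.
 by rewrite (dC_coordE _ _).2.
rewrite (dC_affine (A := fun v : vec2 => v.2) (a := w.2) (fun x : vec => (x 0 i)%:C))//.
by rewrite (dC_coordE _ _).2.
Qed.

Lemma co2_C i : Cinf (fun v : vec2 => (co2 i v)%:C).
Proof.
case: i => i /=.
 apply: (Cinf_affine (A := fun v : vec2 => v.1) (A0 := fun v : vec2 => v.1) (f := fun x : vec => (x 0 i)%:C)) => //.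
  by move=> v; exact: cvg_fst.
 exact: coord_C.
apply: (Cinf_affine (A := fun v : vec2 => v.2) (A0 := fun v : vec2 => v.2) (f := fun x : vec => (x 0 i)%:C)) => //.
 by move=> v; exact: cvg_snd.
exact: coord_C.
Qed.

Lemma co2_e2 i j : co2 i (e2 j) = (i == j)%:R.
Proof.
case: i => i; case: j => j /=; rewrite ?mxE //=.
Qed.

Definition ph (v : vec2) : R := - dotv v.1 v.2.
Definition swp (i : I2) : I2 := match i with inl j => inr j | inr j => inl j end.
Definition Gp (i : I2) (v : vec2) : R := - co2 (swp i) v.

Lemma phE : (fun v => (ph v)%:C) =
 fun v => -1 * \sum_k ((co2 (inl k) v)%:C * (co2 (inr k) v)%:C).
Proof.
apply/funext => v; rewrite /ph rmorphN /dotv rmorph_sum mulN1r /=; congr (- _).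
by apply: eq_bigr => i _; rewrite rmorphM.
Qed.

Lemma phC : Cinf (fun v => (ph v)%:C).
Proof.
rewrite phE; apply: Cinf_scale; apply: Cinf_sum => i _.
by apply: Cinf_mul; exact: co2_C.
Qed.

Lemma dC_ph i : dC (e2 i) (fun v => (ph v)%:C) = fun v => (Gp i v)%:C.
Proof.
rewrite phE dC_scale; last by apply: Cinf_sum => k _; apply: Cinf_mul; exact: co2_C.
rewrite dC_sum; last by move=> k _; apply: Cinf_mul; exact: co2_C.
apply/funext => v; rewrite /Gp rmorphN mulN1r /=; congr (- _).
have E (k : 'I_d) : dC (e2 i) (fun y : vec2 => (co2 (inl k) y)%:C * (co2 (inr k) y)%:C) v =
  ((inl k == i)%:R)%:C * (co2 (inr k) v)%:C + (co2 (inl k) v)%:C * ((inr k == i)%:R)%:C.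
 by rewrite (dC_mul _ (co2_C _) (co2_C _)) !co2_aff !co2_e2.
rewrite -[LHS]/(\sum_(k < d) dC (e2 i) (fun y : vec2 => (co2 (inl k) y)%:C * (co2 (inr k) y)%:C) v).
under eq_bigr => k _ do rewrite E.
case: i E => j E.
 rewrite (bigD1 j)//= eqxx mul1r mulr0 addr0 big1 ?addr0// => k kj.
 have -> : (inl k == inl j :> I2) = false by apply: negbTE.
 by rewrite mul0r mulr0 addr0.
rewrite (bigD1 j)//= eqxx mul0r add0r mulr1 big1 ?addr0// => k kj.
have -> : (inr k == inr j :> I2) = false by apply: negbTE.
by rewrite mul0r mulr0 addr0.
Qed.

(** The gradient of [ph] at (z, eta) is -(eta, z), so this is (1 + |z|^2 + |eta|^2)^(1/2), by
    [sqr_jap2]. *)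
Definition jap2 (v : vec2) : R := brk Gp v.

Lemma jap2_ge1 v : 1 <= jap2 v. Proof. exact: brk_ge1. Qed.
Lemma jap2_gt0 v : 0 < jap2 v. Proof. exact: brk_gt0. Qed.
Lemma jap2_ge0 v : 0 <= jap2 v. Proof. exact: ltW (jap2_gt0 v). Qed.
Lemma sqr_jap2 v : jap2 v ^+ 2 = 1 + dotv v.1 v.1 + dotv v.2 v.2.
Proof.
rewrite sqr_brk /brk2 big_sumType /= -addrA [dotv v.1 v.1 + _]addrC; congr (_ + (_ + _)).
 by apply: eq_bigr => i _; rewrite sqrrN expr2.
by apply: eq_bigr => i _; rewrite sqrrN expr2.
Qed.
Lemma jap_le_jap2l v : jap v.1 <= jap2 v.
Proof.
rewrite -ler_sqr ?nnegrE ?jap_ge0 ?jap2_ge0// sqr_jap2 sqr_jap lerDl; exact: dotv_ge0.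
Qed.
Lemma jap_le_jap2r v : jap v.2 <= jap2 v.
Proof.
rewrite -ler_sqr ?nnegrE ?jap_ge0 ?jap2_ge0// sqr_jap2 sqr_jap addrAC lerDl; exact: dotv_ge0.
Qed.
Lemma jap2_le v : jap2 v <= jap v.1 * jap v.2.
Proof.
rewrite -ler_sqr ?nnegrE ?mulr_ge0 ?jap_ge0 ?jap2_ge0// exprMn sqr_jap2 !sqr_jap.
have := dotv_ge0 v.1; have := dotv_ge0 v.2; set b := dotv _ _ => a0 b0.
by have := mulr_ge0 b0 a0; lra.
Qed.

(** Each of the d factors 1 + x_i^2 of 1 / [vq] is at most <x>^2. *)
Lemma vq_jap (x : vec) : 1 <= jap x ^+ (2 * d) * vq x.
Proof.
have -> : jap x ^+ (2 * d) = \prod_(i < d) jap x ^+ 2 by rewrite prodr_const card_ord exprM.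
rewrite /vq -big_split /=; apply: (@le_trans _ _ (\prod_(i < d) 1)); first by rewrite big1.
apply: ler_prod => i _; rewrite ler01 /lq /= ler_pdivlMr ?one_sqr_gt0// mul1r sqr_jap lerD2l.
rewrite -sqr_enorm -real_normK ?num_real// ler_Xn ?enorm_ge0//; exact: le_coord_enorm.
Qed.

Lemma jap2_q v : 1 <= jap2 v ^+ (4 * d) * is_q S2 v.
Proof.

have -> : (4 * d = 2 * d + 2 * d)%N by rewrite -mulnDl.
rewrite exprD mulrACA.
have h1 : 1 <= jap2 v ^+ (2 * d) * vq v.1.
 apply: le_trans (vq_jap v.1) _; rewrite ler_wpM2r ?vq0// ler_Xn ?jap_ge0 ?jap2_ge0//.
 exact: jap_le_jap2l.
have h2 : 1 <= jap2 v ^+ (2 * d) * vq v.2.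
 apply: le_trans (vq_jap v.2) _; rewrite ler_wpM2r ?vq0// ler_Xn ?jap_ge0 ?jap2_ge0//.
 exact: jap_le_jap2r.
by rewrite -[1]mulr1 ler_pM.
Qed.

Definition chi (eps : R) (v : vec2) : R := gaussv (eps *: v.1) * gaussv (eps *: v.2).
(** What is recorded of the decay of [chi]: enough to make any fixed power of [jap2] integrable for
    a given eps, and at most 1 uniformly in eps. *)
Definition dec (n : nat) (eps : R) (v : vec2) : R := (jap (eps *: v.1) * jap (eps *: v.2)) ^- n.

Lemma dec_ge0 n eps v : 0 <= dec n eps v.
Proof. by rewrite invr_ge0 exprn_ge0// mulr_ge0 ?jap_ge0. Qed.
Lemma dec_le1 n eps v : dec n eps v <= 1.
Proof.
by rewrite invf_le1 ?exprn_gt0 ?mulr_gt0 ?jap_gt0// exprn_ege1// mulr_ege1// jap_ge1.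
Qed.

Section cutoffs.
Context {T : Type}.
Variable eps : T -> R.
Hypothesis eps01 : forall t, 0 < eps t <= 1.

Let eps0 t : 0 < eps t. Proof. by case/andP: (eps01 t). Qed.
Let eps1 t : eps t <= 1. Proof. by case/andP: (eps01 t). Qed.

Let scale_cont (t : T) : continuous (fun x : vec => eps t *: x).
Proof. by move=> x; exact: scaler_continuous. Qed.

Lemma chi_sym n : sym e2 (fun _ t _ => eps t) (fun t v => dec n (eps t) v) (fun t v => (chi (eps t) v)%:C).
Proof.
have gs := gaussv_sym (R := R) (d := d) n.
pose cl (i : I2) t := if i is inl _ then eps t else 0.
pose cr (i : I2) t := if i is inr _ then eps t else 0.
pose jj (i : I2) : 'I_d := match i with inl j => j | inr j => j end.
have s1 (i : 'I_d) t x : 0 <= sgj (R := R) i t x <= 1.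
 by rewrite invr_ge0 jap_ge0 invf_le1 ?jap_gt0// jap_ge1.
have Sl : sym e2 (fun _ t _ => eps t) (fun t v => jap (eps t *: v.1) ^- n) (fun t v => (gaussv (eps t *: v.1))%:C).
 apply: (sym_pullback (p := fun=> tt) (A := fun t (v : vec2) => eps t *: v.1) (A0 := fun t v => eps t *: v.1)
  (j := jj) (c := cl) (K := 1) _ _ _ _ _ _ _ _ _ gs) => //.
 - by move=> t v; apply: (continuous_comp (@cvg_fst _ _ _ _ _)); exact: scale_cont.
 - by move=> t v s x; rewrite scalerDr !scalerA [eps t * _]mulrC.
 - by move=> t [i|i] /=; rewrite ?scale0r ?scaler0.
 - by move=> i t x; exact: ltW.
 - by move=> i t x; case/andP: (s1 i t x).
 - by move=> t x; rewrite invr_ge0 exprn_ge0// jap_ge0.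
 - by move=> t x; rewrite mul1r.
 - move=> [i|i] t x /=; rewrite mul1r ?normr0 ?mul0r ?(ltW (eps0 t))//.
  by rewrite gtr0_norm// ler_piMr ?(ltW (eps0 t))//; case/andP: (s1 i tt (eps t *: x.1)).
have Sr : sym e2 (fun _ t _ => eps t) (fun t v => jap (eps t *: v.2) ^- n) (fun t v => (gaussv (eps t *: v.2))%:C).
 apply: (sym_pullback (p := fun=> tt) (A := fun t (v : vec2) => eps t *: v.2) (A0 := fun t v => eps t *: v.2)
  (j := jj) (c := cr) (K := 1) _ _ _ _ _ _ _ _ _ gs) => //.
 - by move=> t v; apply: (continuous_comp (@cvg_snd _ _ _ _ _)); exact: scale_cont.
 - by move=> t v s x; rewrite scalerDr !scalerA [eps t * _]mulrC.
 - by move=> t [i|i] /=; rewrite ?scale0r ?scaler0.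
 - by move=> i t x; exact: ltW.
 - by move=> i t x; case/andP: (s1 i t x).
 - by move=> t x; rewrite invr_ge0 exprn_ge0// jap_ge0.
 - by move=> t x; rewrite mul1r.
 - move=> [i|i] t x /=; rewrite mul1r ?normr0 ?mul0r ?(ltW (eps0 t))//.
  by rewrite gtr0_norm// ler_piMr ?(ltW (eps0 t))//; case/andP: (s1 i tt (eps t *: x.2)).
have H := sym_mul Sl Sr.
have H2 := sym_eqw (m' := fun t v => dec n (eps t) v) _ H.
apply: (sym_eq _ (H2 _)) => [t|t x]; last by rewrite /dec exprMn invfM.
by apply/funext => v; rewrite /chi rmorphM.
Qed.

Lemma chi_near1 t v : `|chi (eps t) v - 1| <= eps t * jap2 v ^+ 2.
Proof.
rewrite /chi !gaussvE -expRD.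
set s := - _ + - _; have sE : s = - (eps t ^+ 2 / 2 * (dotv v.1 v.1 + dotv v.2 v.2)).
 rewrite /s -!sqr_enorm !enormZ !exprMn !real_normK ?num_real//; ring.
have d1 := dotv_ge0 v.1; have d2 := dotv_ge0 v.2.
have s0 : s <= 0 by rewrite sE oppr_le0 mulr_ge0 ?addr_ge0// divr_ge0// sqr_ge0.
have e1 : expR s <= 1 by rewrite -expR0 ler_expR.
rewrite ler0_norm ?subr_le0// opprB; have := expR_ge1Dx s.
have e2' : eps t ^+ 2 / 2 <= eps t.
 by have := eps0 t; have := eps1 t; nra.
have := ler_wpM2r (addr_ge0 d1 d2) e2'; rewrite sqr_jap2 sE.
by have := eps0 t; set a := dotv _ _; set b := dotv _ _; nra.
Qed.

(** The source of the rate O(eps): [chi] - 1 is small only against two additional powers of [jap2],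
    while its derivatives are those of [chi] and are O(eps) outright. *)
Lemma chiB1_sym : sym e2 (fun _ t _ => 1) (fun t v => eps t * jap2 v ^+ 2) (fun t v => (chi (eps t) v)%:C - 1).
Proof.
have chiC t : Cinf (fun v => (chi (eps t) v)%:C) by exact: (sym_Cinf t (chi_sym 0)).
apply: sym_of_dC => [t||i].
- by apply: Cinf_sub => //; exact: Cinf_cst.
- exists 1 => // t v; rewrite mul1r -(rmorph1 (real_complex R)) -rmorphB normcR; exact: chi_near1.
- apply: (sym_eq (f := fun t => dC (e2 i) (fun v => (chi (eps t) v)%:C))).
  by move=> t; rewrite dC_sub ?dC_cst//; [apply/funext => v; rewrite subr0|exact: Cinf_cst].
 have H := sym_dC i (chi_sym 0).
 apply: (sym_sg (sg := fun _ t _ => eps t) (K := 1)) => //.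
 + by move=> t v; rewrite mulr1 mulr_ge0 ?sqr_ge0 ?ltW.
 + by move=> k t v; rewrite mulr1 eps1 ltW.
 apply: sym_le ler01 _ _ H => [k t v|t v]; first exact: ltW.
 rewrite mul1r mulr1 [leLHS]mulrC; apply: ler_pM => //; [exact: ltW|exact: dec_ge0|].
by apply: le_trans (dec_le1 _ _ _) _; rewrite exprn_ege1// jap2_ge1.
Qed.

Lemma jap_scale_ge t (x : vec) : eps t * jap x <= jap (eps t *: x).
Proof.
rewrite -ler_sqr ?nnegrE ?mulr_ge0 ?jap_ge0 ?(ltW (eps0 t))// exprMn !sqr_jap -!sqr_enorm enormZ exprMn.
rewrite real_normK ?num_real// mulrDr mulr1 lerD2r -[leRHS](expr1n _ 2) ler_Xn ?(ltW (eps0 t))//.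
Qed.

(** From eps <z> <= <eps z>. The constant blows up with 1/eps, which is harmless: it is used for
    integrability at fixed eps only. *)
Lemma jap2_dec n t v : jap2 v ^+ n * dec n (eps t) v <= eps t ^- (2 * n).
Proof.
rewrite ler_pdivrMr ?exprn_gt0 ?mulr_gt0 ?jap_gt0//.
have -> : eps t ^- (2 * n) = (eps t ^- 2) ^+ n by rewrite exprM exprVn.
rewrite -exprMn ler_Xn ?jap2_ge0 ?mulr_ge0 ?jap_ge0 ?invr_ge0 ?exprn_ge0 ?(ltW (eps0 t))//.
rewrite ler_pdivlMl ?exprn_gt0//; apply: (@le_trans _ _ ((eps t * jap v.1) * (eps t * jap v.2))).
 by rewrite mulrACA -expr2 ler_wpM2l ?sqr_ge0// jap2_le.
by rewrite ler_pM ?jap_scale_ge ?mulr_ge0 ?jap_ge0 ?(ltW (eps0 t)).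
Qed.

End cutoffs.
End osc_phase.

Section osc.
Local Notation S2 := phase_space_measure.
Local Notation one2 := (fun (_ : I2) (_ : vec2) => (1 : R)).

Definition LT K (A : vec2 -> R[i]) := iter K (ibp_op e2 one2 Gp) A.
Definition Lcut (eps : R) (B : vec2 -> R[i]) := Lam S2 (fun v => expi (ph v) * ((chi eps v)%:C * B v)).
(** A rate is required, not mere convergence: with control of its constant the limit can be taken
    under a further integral, and limits of sums and derivatives follow by adding errors. *)
Definition isosc (B : vec2 -> R[i]) (l : R[i]) := exists C : R, forall eps, 0 < eps <= 1 ->
 normc (Lcut eps B - l) <= C * eps.

Lemma oneC i : Cinf (fun x => (one2 i x)%:C). Proof. exact: Cinf_cst. Qed.
Lemma GpC i : Cinf (fun v : vec2 => (Gp i v)%:C).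
Proof.
have -> : (fun v => (Gp i v)%:C) = (fun v : vec2 => -1 * (co2 (swp i) v)%:C).
 by apply/funext => v; rewrite rmorphN mulN1r.
by apply: Cinf_scale; exact: co2_C.
Qed.
Lemma dC_Gp i w : dC w (fun v : vec2 => (Gp i v)%:C) = fun=> (- co2 (swp i) w)%:C.
Proof.
have -> : (fun v => (Gp i v)%:C) = (fun v : vec2 => -1 * (co2 (swp i) v)%:C).
 by apply/funext => v; rewrite rmorphN mulN1r.
by rewrite dC_scale ?co2_aff ?rmorphN ?mulN1r//; exact: co2_C.
Qed.

Lemma jap2_negpow_q M v : jap2 v ^- (M + 4 * d) <= jap2 v ^- M * is_q S2 v.
Proof.
rewrite exprD invfM ler_wpM2l ?invr_ge0 ?exprn_ge0 ?jap2_ge0//.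
rewrite -[_^-1]mul1r ler_pdivrMr ?exprn_gt0 ?jap2_gt0// mulrC; exact: jap2_q.
Qed.

Section rates.
Context {T : Type}.
Variable rho : T -> R.
Hypothesis rho1 : forall t, 1 <= rho t.
Local Notation sgr := (fun (_ : I2) (t : T) (_ : vec2) => rho t).
Let rho0 t : 0 <= rho t. Proof. exact: le_trans ler01 (rho1 t). Qed.

Lemma Gp_sym i : sym e2 sgr (fun _ v => jap2 v) (fun _ v => (Gp i v)%:C).
Proof.
apply: sym_of_dC => [t||j]; first exact: GpC.
 by exists 1 => // t v; rewrite normcR mul1r; exact: le_brk.
apply: (sym_eq (f := fun _ _ => (- co2 (swp i) (e2 j))%:C)).
 by move=> t; rewrite dC_Gp.
apply: sym_cst => // [t v|]; first by rewrite mulr_ge0// jap2_ge0.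
exists 1 => // t v; rewrite mul1r normcR normrN co2_e2.
apply: (@le_trans _ _ 1); first by case: eqP => _; rewrite ?normr1 ?normr0.
by rewrite mulr_ege1// jap2_ge1.
Qed.

Let ssg : exists2 C : R, 0 <= C & forall (i : I2) (t : T) (x : vec2), 1 * rho t <= C * rho t.
Proof. by exists 1. Qed.
Let bg : exists2 C : R, 0 <= C & forall t (x : vec2), (brk (fun i => Gp i) x)^-1 <= C * rho t.
Proof.
exists 1 => // t x; rewrite mul1r; apply: le_trans (rho1 t).
by rewrite invf_le1 ?brk_gt0// brk_ge1.
Qed.
Let gb t : exists2 C : R, 0 <= C & forall x : vec2, rho t <= C * brk (fun i => Gp i) x.
Proof. by exists (rho t) => // x; rewrite ler_peMr// brk_ge1. Qed.
Let s_sym (i : I2) : sym e2 sgr (fun _ _ => 1) (fun _ _ => (1 : R)%:C).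
Proof. by apply: sym_cst => //; exists 1 => // t x; rewrite normcR normr1 mulr1. Qed.

Lemma LT_sym K (w : T -> vec2 -> R) A : (forall t v, 0 <= w t v) -> sym e2 sgr w A ->
 sym e2 sgr (fun t v => w t v * (rho t / jap2 v) ^+ K) (fun t => LT K (A t)).
Proof.
move=> w0 As; elim: K => [|K IH].
 by apply: sym_eqw As => t v; rewrite expr0 mulr1.
have w0' t v : 0 <= w t v * (rho t / jap2 v) ^+ K.
 by rewrite mulr_ge0// exprn_ge0// divr_ge0// jap2_ge0.
have := @ibp_op_sym R _ _ T e2 (fun _ _ _ => 1) (fun i _ => Gp i) sgr (fun t _ => rho t)
 (fun i t x => rho0 t) (fun t x => rho0 t) ssg bg s_sym Gp_sym _ _ w0' IH.
move=> H; have H2 := sym_eqw (m' := fun t v => w t v * (rho t / jap2 v) ^+ K.+1) _ H.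
have E t v : w t v * (rho t / jap2 v) ^+ K * (rho t / brk [eta Gp] v) = w t v * (rho t / jap2 v) ^+ K.+1.
 by rewrite exprSr [RHS]mulrA.
exact: H2 E.
Qed.

Lemma LT_Lam K (w : T -> vec2 -> R) A : (forall t v, 0 <= w t v) ->
 mdom S2 (ones T) w -> sym e2 sgr w A -> forall t,
 Lam S2 (fun v => expi (ph v) * LT K (A t) v) = Lam S2 (fun v => expi (ph v) * A t v).
Proof.
move=> w0 wd As.
have GE (i : I2) (t : T) x : (Gp i x)%:C = (1 : R)%:C * dC (e2 i) (fun y => (ph y)%:C) x.
 by rewrite mul1r dC_ph.
exact: (@iter_ibp R _ _ T e2 S2 ibp_S2 (fun _ _ _ => 1) (fun i _ => Gp i) sgr (fun t _ => rho t)
 (fun i t x => rho0 t) (fun i t x => ler01) (fun t x => rho0 t) ssg bg gb s_sym Gp_sym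
 (fun _ => ph) (fun _ => phC) GE w A K w0 wd As).2.
Qed.

(** Each application of the operator gains rho / [jap2]: M of them compensate the growth of the
    amplitude, and 4 d more reach the integrable kernel by [jap2_q]. *)
Lemma LT_bound M A (mu : T -> R) : (forall t, 0 <= mu t) ->
 sym e2 sgr (fun t v => mu t * jap2 v ^+ M) A ->
 exists2 C : R, 0 <= C & forall t v,
  normc (LT (M + 4 * d) (A t) v) <= C * (mu t * rho t ^+ (M + 4 * d)) * is_q S2 v.
Proof.
move=> mu0 As; have m0 t (v : vec2) : 0 <= mu t * jap2 v ^+ M by rewrite mulr_ge0// exprn_ge0// jap2_ge0.
have [C C0 HC] := sym_bnd (LT_sym (M + 4 * d) m0 As).
exists C => // t v; apply: le_trans (HC t v) _; rewrite -[leRHS]mulrA ler_wpM2l//.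
rewrite expr_div_n mulrACA ler_wpM2l ?mulr_ge0 ?exprn_ge0//.
apply: le_trans (ler_wpM2l _ (jap2_negpow_q M v)) _; first by rewrite exprn_ge0// jap2_ge0.
by rewrite mulrA mulfV ?mul1r// expf_neq0// gt_eqF// jap2_gt0.
Qed.

Section cut.
Variable eps : T -> R.
Hypothesis eps01 : forall t, 0 < eps t <= 1.

Lemma dec_mdom M (mu : T -> R) : (forall t, 0 <= mu t) ->
 mdom S2 (ones T) (fun t v => mu t * (jap2 v ^+ M * dec (M + 4 * d) (eps t) v)).
Proof.
move=> mu0 t; have e0 : 0 < eps t by case/andP: (eps01 t).
exists (mu t * eps t ^- (2 * (M + 4 * d))); first by rewrite mulr_ge0// invr_ge0 exprn_ge0// ltW.
move=> v; suff H : mu t * (jap2 v ^+ M * dec (M + 4 * d) (eps t) v) <=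
 mu t * eps t ^- (2 * (M + 4 * d)) * is_q S2 v by split=> // _; rewrite mulr1.
rewrite -mulrA ler_wpM2l//; have := jap2_dec eps01 (M + 4 * d) t v.
set D := dec _ _ _ => HD.
have D0 : 0 <= D by exact: dec_ge0.
clearbody D.
have -> : jap2 v ^+ M * D = (jap2 v ^+ (M + 4 * d) * D) * jap2 v ^- (4 * d).
 by rewrite exprD [RHS]mulrAC mulfK// expf_neq0// gt_eqF// jap2_gt0.
apply: ler_pM => //; rewrite ?mulr_ge0 ?invr_ge0 ?exprn_ge0 ?jap2_ge0//.
by have := jap2_negpow_q 0 v; rewrite add0n expr0 invr1 mul1r.
Qed.

(** The cutoff makes the integrations by parts legitimate through [dec_mdom], whose constant depends
    on eps; the bound obtained after them does not. *)
Lemma cut_bound M A (mu : T -> R) : (forall t, 0 <= mu t) ->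
 sym e2 sgr (fun t v => mu t * (jap2 v ^+ M * dec (M + 4 * d) (eps t) v)) A ->
 exists2 C : R, 0 <= C & forall t,
  normc (Lam S2 (fun v => expi (ph v) * A t v)) <= C * (mu t * rho t ^+ (M + 4 * d)).
Proof.
move=> mu0 As.
have w0 t (v : vec2) : 0 <= mu t * (jap2 v ^+ M * dec (M + 4 * d) (eps t) v).
 by rewrite !mulr_ge0 ?dec_ge0 ?exprn_ge0 ?jap2_ge0.
have As' : sym e2 sgr (fun t v => mu t * jap2 v ^+ M) A.
 apply: sym_le ler01 _ _ As => // t v; rewrite mul1r ler_wpM2l// ler_piMr ?exprn_ge0 ?jap2_ge0//.
 exact: dec_le1.
have [C C0 HC] := LT_bound mu0 As'.
exists (C * (2 * Qtot S2)); first by rewrite !mulr_ge0 ?Qtot_ge0.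
move=> t; rewrite -(LT_Lam (M + 4 * d) w0 (dec_mdom M mu0) As) mulrAC; apply: Lam_bound.
 apply: Cinf_cont; apply: Cinf_mul; first exact: Cinf_expi phC.
 exact: (sym_Cinf t (LT_sym (M + 4 * d) w0 As)).
by move=> v; rewrite Normc.normcM normc_expi mul1r.
Qed.

End cut.
End rates.

(** Families are indexed by whole types, so the cutoff parameter runs through R and is forced into
    ]0, 1]. *)
Definition clamp (e : R) : R := if 0 < e <= 1 then e else 1.
Lemma clamp01 e : 0 < clamp e <= 1.
Proof. by rewrite /clamp; case: ifP => //; rewrite ltr01 lexx. Qed.
Lemma clamp_id e : 0 < e <= 1 -> clamp e = e.
Proof. by rewrite /clamp => ->. Qed.

Section existence.
Context {T : Type}.
Variables (rho m : T -> R) (M : nat) (B : T -> vec2 -> R[i]).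
Hypothesis rho1 : forall t, 1 <= rho t.
Hypothesis m0 : forall t, 0 <= m t.
Hypothesis Bs : sym e2 (fun (_ : I2) (t : T) (_ : vec2) => rho t) (fun t v => m t * jap2 v ^+ M) B.

Let T' := (T * R)%type.
Let eps (t : T') := clamp t.2.
Let eps01 t : 0 < eps t <= 1. Proof. exact: clamp01. Qed.
Let rho' (t : T') := rho t.1.
Let rho1' t : 1 <= rho' t. Proof. exact: rho1. Qed.
Local Notation sgr' := (fun (_ : I2) (t : T') (_ : vec2) => rho' t).

Let Bs' : sym e2 sgr' (fun t v => m t.1 * jap2 v ^+ M) (fun t => B t.1).
Proof. exact: (sym_reindex fst Bs). Qed.

Lemma chiB_sym n : sym e2 sgr' (fun t v => m t.1 * (jap2 v ^+ M * dec n (eps t) v))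
 (fun t v => (chi (eps t) v)%:C * B t.1 v).
Proof.
have H := sym_sg (sg' := sgr') ler01 (fun t v => dec_ge0 n (eps t) v) _ (chi_sym eps01 n).
have H' := sym_mul (H _) Bs'; apply: (sym_eqw _ (H' _)) => [t v|i t v]; first by rewrite mulrCA mulrC mulrAC -mulrA mulrC -mulrA.
have /andP[e0 e1] := eps01 t; rewrite mul1r ltW//= (le_trans e1)//.
Qed.

Lemma chi1B_sym : sym e2 sgr' (fun t v => (eps t * m t.1) * jap2 v ^+ (M + 2))
 (fun t v => ((chi (eps t) v)%:C - 1) * B t.1 v).
Proof.
have e0 t : 0 <= eps t by rewrite ltW//; case/andP: (eps01 t).
have H := sym_sg (sg' := sgr') ler01 _ _ (chiB1_sym eps01).
have H' := sym_mul (H _ _) Bs'; apply: (sym_eqw _ (H' _ _)) => [t v|t v|i t v].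
- by rewrite mulrACA exprD [_ ^+ 2 * _]mulrC.
- by rewrite mulr_ge0// exprn_ge0// jap2_ge0.
- by rewrite mul1r ler01 rho1'.
Qed.

(** The limit is the absolutely convergent integral of exp(i ph) [LT] K B. Before the limit the
    amplitude is B + ([chi] - 1) B, and the second part is of size eps [jap2]^(M + 2): the 2 in K
    pays for this growth. *)
Lemma osc_exists : exists2 C : R, 0 <= C & exists K, forall t, exists l,
 normc l <= C * (m t * rho t ^+ K) /\ forall e, 0 < e <= 1 ->
  normc (Lcut e (B t) - l) <= C * (m t * rho t ^+ K) * e.
Proof.
pose K := (M + 2 + 4 * d)%N.
have BsM : sym e2 (fun (_ : I2) (t : T) (_ : vec2) => rho t) (fun t v => m t * jap2 v ^+ (M + 2)) B.
 apply: sym_le ler01 _ _ Bs => [i t v|t v]; first exact: le_trans ler01 (rho1 t).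
 by rewrite mul1r ler_wpM2l// ler_weXn2l ?jap2_ge1// leq_addr.
have em0 t : 0 <= eps t * m t.1 by rewrite mulr_ge0// ltW//; case/andP: (eps01 t).
have [C1 C10 H1] := LT_bound rho1 m0 BsM.
have [C2 C20 H2] := LT_bound rho1' em0 chi1B_sym.
have Q0 := Qtot_ge0 S2.
have LC (f : vec2 -> R[i]) : Cinf f -> Cinf (fun v => expi (ph v) * LT K f v).
 move=> fC; apply: Cinf_mul; first exact: Cinf_expi phC.
 by apply: iter_ibp_opC => // i; [exact: oneC|exact: GpC].
have LTd (f : vec2 -> R[i]) c : Cinf f -> (forall v, normc (LT K f v) <= c * is_q S2 v) ->
  dom S2 (fun v => expi (ph v) * LT K f v).
 move=> fC Hf; split; first by apply: Cinf_cont; exact: LC.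
 by exists c => v; rewrite Normc.normcM normc_expi mul1r.
exists ((C1 + C2) * (2 * Qtot S2)); first by rewrite !mulr_ge0 ?addr_ge0.
exists K => t; exists (Lam S2 (fun v => expi (ph v) * LT K (B t) v)).
have mr0 : 0 <= m t * rho t ^+ K by rewrite mulr_ge0// exprn_ge0// (le_trans ler01 (rho1 t)).
have BtC := sym_Cinf t Bs; split.
 apply: (@le_trans _ _ (C1 * (m t * rho t ^+ K) * (2 * Qtot S2))).
  apply: Lam_bound; first by apply: Cinf_cont; exact: LC.
  by move=> v; rewrite Normc.normcM normc_expi mul1r; exact: H1.
 by rewrite [leLHS]mulrAC ler_wpM2r// ler_wpM2r ?mulr_ge0// lerDl.
move=> e e01; pose t' : T' := (t, e).
have eE : eps t' = e by exact: clamp_id.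
have chC : Cinf (fun v : vec2 => (chi e v)%:C).
 by have := sym_Cinf t' (chi_sym eps01 0); rewrite eE.
have D1C : Cinf (fun v => ((chi e v)%:C - 1) * B t v).
 by apply: Cinf_mul => //; apply: Cinf_sub => //; exact: Cinf_cst.
have H2' v : normc (LT K (fun v => ((chi e v)%:C - 1) * B t v) v) <= C2 * (e * m t * rho t ^+ K) * is_q S2 v.
 by have := H2 t' v; rewrite eE.
have w0 (s : T') (v : vec2) : 0 <= m s.1 * (jap2 v ^+ M * dec (M + 4 * d) (eps s) v).
 by rewrite !mulr_ge0 ?dec_ge0 ?exprn_ge0 ?jap2_ge0.
have <- : Lam S2 (fun v => expi (ph v) * LT K (fun v => (chi e v)%:C * B t v) v) = Lcut e (B t).
 by have := LT_Lam rho1' K w0 (dec_mdom eps01 M (fun s => m0 s.1)) (chiB_sym _) t'; rewrite eE.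
have -> : (fun v => (chi e v)%:C * B t v) = (fun v => B t v + ((chi e v)%:C - 1) * B t v).
 by apply/funext => v; rewrite mulrBl mul1r addrCA subrr addr0.
have -> : (fun v => expi (ph v) * LT K (fun v => B t v + ((chi e v)%:C - 1) * B t v) v) =
  (fun v => expi (ph v) * LT K (B t) v + expi (ph v) * LT K (fun v => ((chi e v)%:C - 1) * B t v) v).
 by apply/funext => v; rewrite -mulrDr /LT iter_ibp_op_add//; [exact: oneC|exact: GpC].
rewrite LamD; last 2 first.
- by apply: LTd => //; exact: H1.
- by apply: LTd => //; exact: H2'.
rewrite addrAC subrr add0r.
apply: (@le_trans _ _ (C2 * (e * m t * rho t ^+ K) * (2 * Qtot S2))).
 apply: Lam_bound; first by apply: Cinf_cont; exact: LC.
 by move=> v; rewrite Normc.normcM normc_expi mul1r; exact: H2'.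
have -> : (C1 + C2) * (2 * Qtot S2) * (m t * rho t ^+ K) * e =
  (C1 + C2) * (e * m t * rho t ^+ K) * (2 * Qtot S2) by ring.
rewrite ler_wpM2r ?mulr_ge0// ler_wpM2r ?lerDr// -mulrA mulr_ge0// ltW//; by case/andP: e01.
Qed.

End existence.
End osc.

Section osc_functional.
Local Notation S2 := phase_space_measure.

Definition tame (B : vec2 -> R[i]) := exists M : nat,
 sym e2 (ones unit) (fun _ v => jap2 v ^+ M) (fun _ => B).
(** The value is 0 where no limit exists; tame amplitudes have one by [oscP]. *)
Definition osc (B : vec2 -> R[i]) : R[i] := xget 0 [set l | isosc B l].

Lemma tame_Cinf B : tame B -> Cinf B.
Proof. by case=> M /(sym_Cinf tt). Qed.

Lemma tame_of_sym {T : Type} (rho m : T -> R) M B : (forall t, 1 <= rho t) -> (forall t, 0 <= m t) ->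
 sym e2 (fun (_ : I2) (t : T) (_ : vec2) => rho t) (fun t v => m t * jap2 v ^+ M) B -> forall t, tame (B t).
Proof.
move=> rho1 m0 Bs t; exists M => k; have [BC H] := Bs k; split=> // u uk.
have [C C0 HC] := H u uk; exists (C * m t * rho t ^+ size u).
 by rewrite !mulr_ge0// exprn_ge0// (le_trans ler01 (rho1 t)).
move=> _ v; apply: le_trans (HC t v) _; rewrite big_const_seq iter_mulr_1 big1 // mulr1 count_predT.
by apply: eqW_le; ring.
Qed.

Lemma tame_cut_dom e B : 0 < e <= 1 -> tame B -> dom S2 (fun v => expi (ph v) * ((chi e v)%:C * B v)).
Proof.
move=> e01 [M Bs]; pose eps (_ : unit) := e.
have eps01 t : 0 < eps t <= 1 by [].
have BC := sym_Cinf tt Bs.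
split.
 apply: Cinf_cont; apply: Cinf_mul; first exact: Cinf_expi phC.
 by apply: Cinf_mul => //; exact: (sym_Cinf tt (chi_sym eps01 0)).
have S1 : sym e2 (ones unit) (fun t v => dec (M + 4 * d) (eps t) v)
  (fun t v => (chi (eps t) v)%:C).
 apply: (sym_sg (sg := fun _ t _ => eps t) (K := 1)) => //; last exact: chi_sym.
  by move=> t v; exact: dec_ge0.
 by move=> i t v; rewrite mul1r /eps; have /andP[/ltW -> ->] := e01.
have [C C0 HC] := sym_bnd (sym_mul S1 Bs).
have [D D0 HD] := dec_mdom eps01 M (mu := fun _ : unit => (1 : R)) (fun _ => ler01) tt.
exists (C * D) => v; rewrite Normc.normcM normc_expi mul1r.
apply: le_trans (HC tt v) _; rewrite -[leRHS]mulrA ler_wpM2l//.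
by have [+ _] := HD v; rewrite mul1r [dec _ _ _ * _]mulrC.
Qed.

Lemma isosc_uniq (B : vec2 -> R[i]) l1 l2 : isosc B l1 -> isosc B l2 -> l1 = l2.
Proof.
move=> [C1 H1] [C2 H2]; apply/eqP; rewrite -subr_eq0; apply/eqP; apply: Normc.eq0_normc.
apply/eqP; rewrite eq_le normc_ge0 andbT; apply/ler_addgt0Pr => e e0; rewrite add0r.
pose D := `|C1| + `|C2| + 1; have D0 : 0 < D by rewrite ltr_wpDl// addr_ge0.
pose a := Num.min 1 (e / D).
have a01 : 0 < a <= 1 by rewrite lt_min ltr01 divr_gt0// ge_min lexx.
have := H1 a a01; have := H2 a a01; set x := Lcut a B => h2 h1.
have -> : l1 - l2 = (x - l2) - (x - l1) by ring.
apply: le_trans (le_normcD _ _) _; rewrite normcN.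
apply: (@le_trans _ _ (D * a)); last first.
 by rewrite mulrC -ler_pdivlMr// ge_min lexx orbT.
have a0 : 0 <= a by case/andP: a01 => /ltW.
apply: le_trans (lerD h2 h1) _; rewrite -mulrDl ler_wpM2r//.
have := ler_norm C1; have := ler_norm C2; rewrite /D; lra.
Qed.

Lemma osc_eq B l : isosc B l -> osc B = l.
Proof. by move=> H; apply: (isosc_uniq (B := B)) => //; rewrite /osc; case: xgetP => [y _ //|/(_ l)]. Qed.

(** The uniform form: for a family whose derivatives cost a factor rho, both the value and the rate
    are controlled by m and one fixed power of rho. *)
Lemma osc_family {T : Type} (rho m : T -> R) M B : (forall t, 1 <= rho t) -> (forall t, 0 <= m t) ->
 sym e2 (fun (_ : I2) (t : T) (_ : vec2) => rho t) (fun t v => m t * jap2 v ^+ M) B ->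
 exists2 C : R, 0 <= C & exists K, forall t,
 normc (osc (B t)) <= C * (m t * rho t ^+ K) /\ forall e, 0 < e <= 1 ->
  normc (Lcut e (B t) - osc (B t)) <= C * (m t * rho t ^+ K) * e.
Proof.
move=> rho1 m0 Bs; have [C C0 [K H]] := osc_exists rho1 m0 Bs.
exists C => //; exists K => t; have [l [l1 l2]] := H t.
by rewrite (osc_eq (l := l))//; exists (C * (m t * rho t ^+ K)).
Qed.

Lemma oscP B : tame B -> isosc B (osc B).
Proof.
move=> [M Bs].
have Bs' : sym e2 (fun (_ : I2) (t : unit) (_ : vec2) => (1 : R)) (fun t v => 1 * jap2 v ^+ M) (fun _ => B).
 by apply: sym_eqw Bs => t v; rewrite mul1r.
have [C _ [K H]] := osc_family (rho := fun=> 1) (fun=> lexx 1) (fun=> ler01) Bs'.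
by exists (C * (1 * 1 ^+ K)); exact: (H tt).2.
Qed.

Lemma osc_add B1 B2 : tame B1 -> tame B2 -> osc (fun v => B1 v + B2 v) = osc B1 + osc B2.
Proof.
move=> t1 t2; apply: osc_eq; have [C1 H1] := oscP t1; have [C2 H2] := oscP t2.
exists (C1 + C2) => e e01; rewrite /Lcut.
have -> : (fun v => expi (ph v) * ((chi e v)%:C * (B1 v + B2 v))) =
 (fun v => expi (ph v) * ((chi e v)%:C * B1 v) + expi (ph v) * ((chi e v)%:C * B2 v)).
 by apply/funext => v; rewrite !mulrDr.
rewrite LamD; [|exact: tame_cut_dom..].
rewrite opprD addrACA mulrDl; apply: le_trans (le_normcD _ _) _.
by apply: lerD; [exact: H1|exact: H2].
Qed.

Lemma osc_scale (c : R[i]) B : tame B -> osc (fun v => c * B v) = c * osc B.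
Proof.
move=> t1; apply: osc_eq; have [C1 H1] := oscP t1.
exists (normc c * C1) => e e01; rewrite /Lcut.
have -> : (fun v => expi (ph v) * ((chi e v)%:C * (c * B v))) =
 (fun v => c * (expi (ph v) * ((chi e v)%:C * B v))).
 by apply/funext => v; rewrite [RHS]mulrCA; congr (_ * _); rewrite mulrCA.
rewrite LamZ; last exact: tame_cut_dom.
by rewrite -mulrBr Normc.normcM -mulrA ler_wpM2l ?normc_ge0//; exact: H1.
Qed.

Lemma tame_weight M N B : (M <= N)%N ->
 sym e2 (ones unit) (fun _ v => jap2 v ^+ M) (fun _ => B) ->
 sym e2 (ones unit) (fun _ v => jap2 v ^+ N) (fun _ => B).
Proof.
by move=> MN; apply: sym_le ler01 _ _ => // t v; rewrite mul1r ler_weXn2l// jap2_ge1.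
Qed.

Lemma tame_add B1 B2 : tame B1 -> tame B2 -> tame (fun v => B1 v + B2 v).
Proof.
move=> [M1 H1] [M2 H2]; exists (maxn M1 M2).
by apply: sym_add; [exact: tame_weight (leq_maxl _ _) H1|exact: tame_weight (leq_maxr _ _) H2].
Qed.
Lemma tame_mul B1 B2 : tame B1 -> tame B2 -> tame (fun v => B1 v * B2 v).
Proof.
move=> [M1 H1] [M2 H2]; exists (M1 + M2)%N.
by apply: sym_eqw (sym_mul H1 H2) => t v; rewrite exprD.
Qed.
Lemma tame_cst c : tame (fun=> c).
Proof.
exists 0%N; apply: sym_cst => //; exists (normc c) => [|t v]; first exact: normc_ge0.
by rewrite mulr1.
Qed.
Lemma tame_scale (c : R[i]) B : tame B -> tame (fun v => c * B v).
Proof. by move=> [M H]; exists M; exact: sym_scale. Qed.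
Lemma tame_opp B : tame B -> tame (fun v => - B v).
Proof. by move=> [M H]; exists M; exact: sym_opp. Qed.
Lemma tame_sub B1 B2 : tame B1 -> tame B2 -> tame (fun v => B1 v - B2 v).
Proof. by move=> H1 H2; apply: tame_add => //; exact: tame_opp. Qed.
Lemma tame_sum (J : Type) (r : seq J) (F : J -> vec2 -> R[i]) :
 (forall j, tame (F j)) -> tame (fun v => \sum_(j <- r) F j v).
Proof.
move=> Ft; elim: r => [|j r IH]; first by under eq_fun do rewrite big_nil; exact: tame_cst.
by under eq_fun do rewrite big_cons; exact: tame_add.
Qed.
Lemma tame_dC i B : tame B -> tame (dC (e2 i) B).
Proof. by move=> [M H]; exists M; apply: sym_eqw (sym_dC i H) => t v; rewrite mulr1. Qed.
Lemma tame_Gp i : tame (fun v => (Gp i v)%:C).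
Proof. by exists 1%N; apply: (Gp_sym (rho := fun=> 1)) => _; exact: lexx. Qed.
Lemma tame_co2 i : tame (fun v => (co2 i v)%:C).
Proof.
have := tame_scale (-1) (tame_Gp (swp i)).
have -> : (fun v => -1 * (Gp (swp i) v)%:C : R[i]) = (fun v => (co2 i v)%:C) => //.
by apply/funext => v; rewrite /Gp rmorphN mulN1r opprK; case: i.
Qed.

Lemma osc_sub B1 B2 : tame B1 -> tame B2 -> osc (fun v => B1 v - B2 v) = osc B1 - osc B2.
Proof.
move=> t1 t2.
have -> : (fun v => B1 v - B2 v) = (fun v => B1 v + -1 * B2 v) by apply/funext => v; rewrite mulN1r.
by rewrite osc_add ?osc_scale ?mulN1r//; exact: tame_scale.
Qed.

Lemma osc_sum (J : Type) (r : seq J) (F : J -> vec2 -> R[i]) :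
 (forall j, tame (F j)) -> osc (fun v => \sum_(j <- r) F j v) = \sum_(j <- r) osc (F j).
Proof.
move=> Ft; elim: r => [|j r IH].
 under eq_fun do rewrite big_nil; rewrite big_nil.
 by have := osc_scale 0 (tame_cst 0); rewrite !mul0r.
by under eq_fun do rewrite big_cons; rewrite big_cons osc_add ?IH//; exact: tame_sum.
Qed.

(* The boundary term, where a derivative falls on the cutoff, is O(eps). *)
Lemma osc_ibp i B : tame B -> osc (fun v => (Gp i v)%:C * B v) = 'i%C * osc (dC (e2 i) B).
Proof.
move=> tB; have [M Bs] := tB; have tD := tame_dC i tB.
apply: osc_eq; have [C1 H1] := oscP tD.
pose eps := @clamp; have eps01 t : 0 < eps t <= 1 by exact: clamp01.
have e0 t : 0 <= eps t by case/andP: (eps01 t) => /ltW.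
have BC := tame_Cinf tB.
have chS n := chi_sym eps01 n.
have HD : sym e2 (ones R)
  (fun t v => eps t * (jap2 v ^+ M * dec (M + 4 * d) (eps t) v)) (fun t v => dC (e2 i) (fun v => (chi (eps t) v)%:C) v * B v).
 have Bs' := sym_reindex (fun _ : R => tt) Bs.
 have K1 : sym e2 (ones R) (fun t v => dec (M + 4 * d) (eps t) v * eps t)
   (fun t => dC (e2 i) (fun v => (chi (eps t) v)%:C)).
  have H := sym_dC i (chS (M + 4 * d)%N).
  apply: (sym_sg (K := 1) _ _ _ H) => //.
   by move=> t v; rewrite mulr_ge0 ?dec_ge0.
  by move=> k t v; rewrite mulr1 e0; case/andP: (eps01 t).
 by apply: sym_eqw (sym_mul K1 Bs') => t v; ring.
have [C2 C20 H2] := cut_bound (fun _ : R => lexx 1) eps01 e0 HD.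
exists (C1 + C2) => e e01; have eE : eps e = e by exact: clamp_id.
have chC : Cinf (fun v : vec2 => (chi e v)%:C) by have := sym_Cinf e (chS 0%N); rewrite eE.
have EC := Cinf_expi phC.
have fC : Cinf (fun v => (chi e v)%:C * B v) by exact: Cinf_mul.
have dF : dC (e2 i) (fun v => expi (ph v) * ((chi e v)%:C * B v)) =
 fun v => 'i%C * (expi (ph v) * ((chi e v)%:C * ((Gp i v)%:C * B v))) +
  (expi (ph v) * ((chi e v)%:C * dC (e2 i) B v) +
   expi (ph v) * (dC (e2 i) (fun v => (chi e v)%:C) v * B v)).
 rewrite dC_mul// (dC_expi _ phC).2 dC_ph dC_mul//; apply/funext => v.
 by move: (dC _ _ v) (dC _ _ v) => x y; ring.
have d1 := tame_cut_dom e01 (tame_mul (tame_Gp i) tB).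
have d2 := tame_cut_dom e01 tD.
have d3 : dom S2 (fun v => expi (ph v) * (dC (e2 i) (fun v => (chi e v)%:C) v * B v)).
 split; first by apply: Cinf_cont; apply: Cinf_mul => //; apply: Cinf_mul => //; exact: Cinf_dC.
 have [C C0 HC] := sym_bnd HD; have [D D0 HD'] := dec_mdom eps01 M e0 e.
 exists (C * D) => v; rewrite Normc.normcM normc_expi mul1r; have := HC e v.
 rewrite eE => /le_trans; apply; rewrite -[leRHS]mulrA ler_wpM2l//.
 by have [+ _] := HD' v; rewrite eE.
have d0 := tame_cut_dom e01 tB.
have dd : dom S2 (dC (e2 i) (fun v => expi (ph v) * ((chi e v)%:C * B v))).
 by rewrite dF; apply: dom_add; [exact: dom_scale|exact: dom_add].
have Z := ibp_S2 (Cinf_derC (e2 i) (Cinf_mul EC fC)) d0 dd.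
rewrite dF LamD ?LamZ ?LamD// in Z; last 2 first.
- exact: dom_scale.
- exact: dom_add.
have -> : Lcut e (fun v => (Gp i v)%:C * B v) = 'i%C * (Lcut e (dC (e2 i) B) +
  Lam S2 (fun v => expi (ph v) * (dC (e2 i) (fun v => (chi e v)%:C) v * B v))).
 move: Z; rewrite /Lcut; move: (Lam S2 _) (Lam S2 _) (Lam S2 _) => x y z /(congr1 (fun w => 'i%C * w)).
 rewrite mulr0 mulrDr mulrA -expr2 sqr_i mulN1r => /eqP; rewrite addrC subr_eq0 => /eqP <-.
 by [].
rewrite -mulrBr Normc.normcM normc_i mul1r addrAC mulrDl; apply: le_trans (le_normcD _ _) _.
apply: lerD; first exact: H1.
by have := H2 e; rewrite eE expr1n mulr1.
Qed.

Section parameters.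
Context {P : normedModType R}.
Definition ep (i : I2) : P * vec2 := (0, e2 i).
Variable F : P * vec2 -> R[i].
Hypothesis FC : Cinf F.
Variables (X w : P) (M : nat).
Hypothesis F0 : forall Y, tame (fun v => F (Y, v)).
Hypothesis F1 : tame (fun v => dC (w, 0) F (X, v)).
Hypothesis F2 : forall u, exists2 C : R, 0 <= C & forall s v, `|s| <= 1 ->
 normc (Dw ep u (dC (w, 0) (dC (w, 0) F)) (X + s *: w, v)) <= C * jap2 v ^+ M.

Lemma sec_ep (G : P * vec2 -> R[i]) Y u : Dw e2 u (fun v => G (Y, v)) = fun v => Dw ep u G (Y, v).
Proof.
elim: u G => //= i u IH G; rewrite -IH; congr (Dw _ u); apply/funext => v.
rewrite (dC_affine (A := fun v => (Y, v)) (a := ep i))// => t x.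
by rewrite -[t *: ep i]/(t *: (0 : P), t *: e2 i) scaler0 -[RHS]/(0 + Y, t *: e2 i + x) add0r.
Qed.

(** The second-order Taylor remainder in the parameter, seen as a family of amplitudes indexed by t,
    has size t^2 in every derivative. By [osc_family] its oscillatory integral is O(t^2), which is
    the criterion [is_dC_quad]. *)
Lemma osc_is_dC : is_dC (fun Y => osc (fun v => F (Y, v))) w X (osc (fun v => dC (w, 0) F (X, v))).
Proof.
pose cl (t : R) := if `|t| <= 1 then t else 0.
have cl1 t : `|cl t| <= 1 by rewrite /cl; case: ifP => // _; rewrite normr0.
pose G t v := F (X + cl t *: w, v) - F (X, v) - (cl t)%:C * dC (w, 0) F (X, v).
have Gt t : tame (G t) by apply: tame_sub; [exact: tame_sub|exact: tame_scale].
have Gs : sym e2 (ones R) (fun t v => cl t ^+ 2 * jap2 v ^+ M) G.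
 move=> k; split=> [t|u _]; first exact: tame_Cinf.
 have [C C0 HC] := F2 u; exists (4 * C); first by rewrite mulr_ge0.
 move=> t v; rewrite big1// mulr1.
 have sC Y (H : P * vec2 -> R[i]) : Cinf H -> Cinf (fun v => H (Y, v)).
  move=> HCi; apply: (Cinf_affine (A := fun v : vec2 => (Y, v)) (A0 := fun v => (0, v))) HCi.
   by move=> x; exact: (cvg_pair (cvg_cst Y) (@cvg_id _ (nbhs x))).
  move=> x s y; by rewrite -[s *: (0 : P, x)]/(s *: (0 : P), s *: x) scaler0 -[RHS]/(0 + Y, s *: x + y) add0r.
 have F1C := Cinf_dC (w, 0) FC.
 have -> : Dw e2 u (G t) v = Dw ep u F (X + cl t *: w, v) - Dw ep u F (X, v) - (cl t)%:C * dC (w, 0) (Dw ep u F) (X, v).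
  rewrite /G Dw_sub; last 2 first.
  - by apply: Cinf_sub; exact: sC.
  - by apply: Cinf_scale; exact: sC.
  rewrite Dw_sub; [|exact: sC..]; rewrite Dw_scale; last exact: sC.
  by rewrite !sec_ep Dw_dC.
 set H := Dw ep u F; have HCi : Cinf H by exact: Cinf_Dw.
 have E : (X + cl t *: w, v) = (X, v) + (cl t *: (w, 0) : P * vec2).
  by rewrite -[cl t *: (w, 0 : vec2)]/(cl t *: w, cl t *: (0 : vec2)) scaler0 -[RHS]/(X + cl t *: w, v + 0) addr0.
 rewrite E -[(cl t)%:C * _](congr1 (fun f => f (X, v)) (dCZv (w, 0) (cl t) HCi)).
 rewrite -mulrA; apply: second_order => // s /andP[s0 s1].
 rewrite (dCZv (w, 0 : vec2) (cl t) HCi) dC_scale; last exact: Cinf_dC.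
 rewrite dCZv; last exact: Cinf_dC.
 rewrite mulrA -rmorphM Normc.normcM normcR -expr2 ger0_norm ?sqr_ge0// mulrCA ler_wpM2l ?sqr_ge0//.
 have -> : dC (w, 0) (dC (w, 0) H) = Dw ep u (dC (w, 0) (dC (w, 0) F)).
  by rewrite /H !Dw_dC//; exact: Cinf_dC.
 have -> : (X, v) + s *: (cl t *: (w, 0 : vec2)) = (X + (s * cl t) *: w, v).
  rewrite scalerA -[(s * cl t) *: (w, 0 : vec2)]/((s * cl t) *: w, (s * cl t) *: (0 : vec2)) scaler0.
  by rewrite -[LHS]/(X + (s * cl t) *: w, v + 0) addr0.
 by apply: HC; rewrite normrM mulr_ile1// ger0_norm.
have [C C0 [K HK]] := osc_family (rho := fun=> 1) (fun=> lexx 1) (fun t => sqr_ge0 (cl t)) Gs.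
apply: (is_dC_quad (B := C)) => t t1.
have clE : cl t = t by rewrite /cl t1.
have := (HK t).1; rewrite expr1n mulr1 clE; congr (normc _ <= _).
rewrite /G clE osc_sub; [|by apply: tame_sub|exact: tame_scale].
by rewrite osc_sub// osc_scale.
Qed.

End parameters.
End osc_functional.

(** * Integrals over R^d with a phase, and the Fourier transform *)

Section schwartz_integrals.

Definition rapid (u : vec -> R[i]) := forall N : nat,
 sym basv ones1 (fun _ x => jap x ^- N) (fun _ => u).
Definition amplitude (A : vec2 -> R[i]) := exists M : nat, forall N : nat,
 sym e2 (ones unit) (fun _ X => jap X.1 ^+ M * jap X.2 ^- N) (fun _ => A).

Lemma sym_sec2 {T : Type} (sg : I2 -> T -> vec2 -> R) (m : T -> vec2 -> R) (F : T -> vec2 -> R[i]) :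
 sym e2 sg m F ->
 sym basv (fun i t xi => sg (inr i) t.1 (t.2, xi)) (fun (t : T * vec) xi => m t.1 (t.2, xi))
  (fun t xi => F t.1 (t.2, xi)).
Proof.
move=> Fs k; have [FC H] := Fs k; split=> [y|u uk]; first exact: Cinf_sec2 (FC y.1).
have [|C C0 HC] := H (map inr u); first by rewrite size_map.
by exists C => // y xi; have := HC y.1 (y.2, xi); rewrite big_map sec2_Dw.
Qed.

Lemma amplitude_Cinf A : amplitude A -> Cinf A.
Proof. by case=> M /(_ 0%N)/(sym_Cinf tt). Qed.

Lemma japV_dom N (x : vec) : (2 * d <= N)%N -> jap x ^- N <= vq x.
Proof.
move=> dN; apply: (@le_trans _ _ (jap x ^- (2 * d))).
 by rewrite lef_pV2 ?posrE ?exprn_gt0 ?jap_gt0// ler_weXn2l// jap_ge1.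
by rewrite -[_^-1]mul1r ler_pdivrMr ?exprn_gt0 ?jap_gt0// mulrC vq_jap.
Qed.

Section oscillating.
Variable Phi : vec2 -> R.
Hypothesis PhiC : Cinf (fun X => (Phi X)%:C).
Hypothesis Phi1 : forall i, exists m : nat, sym e2 (ones unit)
 (fun _ X => jap X.1 ^+ m * jap X.2 ^+ m) (fun _ => dC (e2 (inl i)) (fun X => (Phi X)%:C)).

Definition dPhi i (A : vec2 -> R[i]) X :=
 'i%C * dC (e2 (inl i)) (fun X => (Phi X)%:C) X * A X + dC (e2 (inl i)) A X.
Definition oint A (y : vec) := Lam S1 (fun xi => expi (Phi (y, xi)) * A (y, xi)).

Lemma dPhi_amplitude i A : amplitude A -> amplitude (dPhi i A).
Proof.
move=> [M AM]; have [m Pm] := Phi1 i.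

have jV (X : vec2) k : 0 <= jap X.2 ^- k by rewrite invr_ge0 exprn_ge0// jap_ge0.
exists (M + m)%N => N; apply: sym_add.
 have := sym_mul (sym_scale 'i%C Pm) (AM (N + m)%N); apply: sym_le ler01 _ _ => // t X.
 rewrite mul1r mulrACA -exprD addnC ler_wpM2l ?exprn_ge0 ?jap_ge0//.
 by rewrite exprD invfM mulrCA mulfV ?mulr1// expf_neq0// gt_eqF// jap_gt0.
have := sym_dC (inl i) (AM N); apply: sym_le ler01 _ _ => // t X.
by rewrite mul1r mulr1 ler_wpM2r// ler_weXn2l ?jap_ge1// leq_addr.
Qed.

Lemma dC_oscillating i A : amplitude A ->
 dC (e2 (inl i)) (fun X => expi (Phi X) * A X) = fun X => expi (Phi X) * dPhi i A X.
Proof.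
move=> Aa; have AC := amplitude_Cinf Aa.
rewrite dC_mul//; last exact: Cinf_expi.
rewrite (dC_expi _ PhiC).2; apply/funext => X; rewrite /dPhi.
by move: (dC _ _ X) (dC _ _ X) => x y; ring.
Qed.

Lemma amplitude_dom A y : amplitude A -> dom S1 (fun xi => expi (Phi (y, xi)) * A (y, xi)).
Proof.
move=> Aa; have [M AM] := Aa; split.
 apply: Cinf_cont; apply: (@Cinf_sec2 (fun X => expi (Phi X) * A X)).
 by apply: Cinf_mul; [exact: Cinf_expi|exact: amplitude_Cinf].
have [C C0 HC] := sym_bnd (AM (2 * d)%N).
exists (C * jap y ^+ M) => xi; rewrite Normc.normcM normc_expi mul1r.
apply: le_trans (HC tt (y, xi)) _; rewrite -mulrA ler_wpM2l// ler_wpM2l ?exprn_ge0 ?jap_ge0//.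
exact: japV_dom.
Qed.

(** The second-order remainder of the integrand is bounded by t^2 times the integrable kernel, since
    two applications of [dPhi] give again an amplitude. *)
Lemma oint_is_dC i A y : amplitude A -> is_dC (oint A) (basv i) y (oint (dPhi i A) y).
Proof.
move=> Aa; pose F X := expi (Phi X) * A X.
have FC : Cinf F by apply: Cinf_mul; [exact: Cinf_expi|exact: amplitude_Cinf].
have a1 := dPhi_amplitude i Aa; have a2 := dPhi_amplitude i a1.
have [M AM] := a2; have [C C0 HC] := sym_bnd (AM (2 * d)%N).
pose v := e2 (inl i).
pose J := (2 * (jap y * jap (basv i : vec))) ^+ M.

have jle (t : R) : `|t| <= 1 -> jap (t *: (basv i : vec)) <= jap (basv i : vec).
 move=> t1; rewrite -ler_sqr ?nnegrE ?jap_ge0// !sqr_jap lerD2l -!sqr_enorm enormZ exprMn.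
 by rewrite ler_piMl ?sqr_ge0// exprn_ile1.
have B2 (t : R) xi : `|t| <= 1 -> normc (F (y + t *: basv i, xi) - F (y, xi) - t%:C * dC v F (y, xi)) <=
  4 * (t ^+ 2 * (C * J * vq xi)).
 move=> t1.
 have E (s : R) : (y + s *: basv i, xi) = (y, xi) + s *: v :> vec2.
  by rewrite -[s *: v]/(s *: (basv i : vec), s *: (0 : vec)) scaler0 -[RHS]/(y + s *: basv i, xi + 0) addr0.
 rewrite E -[t%:C * _](congr1 (fun f => f (y, xi)) (dCZv v t FC)).
 apply: second_order => // s /andP[s0 s1].
 rewrite (dCZv v t FC) dC_scale; last exact: Cinf_dC.
 rewrite dCZv; last exact: Cinf_dC.
 rewrite mulrA -rmorphM Normc.normcM normcR -expr2 ger0_norm ?sqr_ge0// ler_wpM2l ?sqr_ge0//.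
 rewrite !dC_oscillating// scalerA -E Normc.normcM normc_expi mul1r.
 apply: le_trans (HC tt _) _; rewrite -mulrA ler_wpM2l//= ler_pM ?japV_dom ?exprn_ge0 ?jap_ge0 ?invr_ge0//.
  by rewrite exprn_ge0// jap_ge0.
 rewrite ler_Xn ?mulr_ge0 ?jap_ge0//; apply: le_trans (japD _ _) _.
 by rewrite ler_wpM2l// ler_wpM2l ?jap_ge0// jle// normrM mulr_ile1// ger0_norm.
apply: (is_dC_quad (B := 4 * (C * J) * (2 * Qtot S1))) => t t1.
have d1 := amplitude_dom (y + t *: basv i) Aa; have d2 := amplitude_dom y Aa.
have d3 : dom S1 (fun xi => t%:C * (expi (Phi (y, xi)) * dPhi i A (y, xi))) by apply: dom_scale; exact: amplitude_dom.
rewrite /oint -LamZ; last exact: amplitude_dom.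
rewrite -LamB// -LamB//; last by apply: dom_add => //; have := dom_scale (-1) d2; under eq_fun do rewrite mulN1r.
rewrite mulrAC; apply: Lam_bound.
 have [+ _] := dom_add (dom_add d1 (dom_scale (-1) d2)) (dom_scale (-1) d3).
 by under [X in contC X -> _]eq_fun do rewrite !mulN1r.
move=> xi; have := B2 t xi t1; rewrite /F dC_oscillating// => /le_trans; apply.
by apply: eqW_le; rewrite -[is_q S1 xi]/(vq xi); ring.
Qed.

Variable G : 'I_d -> vec -> vec -> R.
Hypothesis GE : forall i y xi, (G i y xi)%:C = dC (e2 (inr i)) (fun X => (Phi X)%:C) (y, xi).
Local Notation bG y xi := (brk (fun i => G i y) xi).
Hypothesis G_sym : forall i, sym basv (fun (_ : 'I_d) (_ _ : vec) => (1 : R)) (fun y xi => bG y xi) (fun y xi => (G i y xi)%:C).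
Hypothesis G_ge : exists2 C : R, 0 <= C & forall y xi, jap y <= C * bG y xi.

(** Integration by parts in xi alone: the bracket of the xi-gradient of the phase is at least <y> /
    C, so M + N steps turn the growth <y>^M into the decay <y>^-N. *)
Lemma oint_bound_family {T : Type} (mu : T -> R) M A N : (forall t, 0 <= mu t) ->
 sym e2 (ones T) (fun t X => mu t * (jap X.1 ^+ M * jap X.2 ^- (2 * d))) A ->
 exists2 C : R, 0 <= C & forall t y, normc (oint (A t) y) <= C * (mu t * jap y ^- N).
Proof.
move=> mu0 AM; have As := sym_sec2 AM.
have [C C0 HC] := G_ge.
have one0 : exists2 C : R, 0 <= C & forall (i : 'I_d) (t : T * vec) (x : vec), 1 * 1 <= C * 1 by exists 1.
have ones1 : exists2 C : R, 0 <= C & forall (t : T * vec) (x : vec), (bG t.2 x)^-1 <= C * 1.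
 by exists 1 => // t x; rewrite mulr1 invf_le1 ?brk_gt0// brk_ge1.
have one_bG (t : T * vec) : exists2 C : R, 0 <= C & forall x : vec, 1 <= C * bG t.2 x.
 by exists 1 => // x; rewrite mul1r brk_ge1.
have s_sym (i : 'I_d) : sym basv (fun (_ : 'I_d) (_ : T * vec) (_ : vec) => (1 : R)) (fun _ _ => 1) (fun _ _ => (1 : R)%:C).
 by apply: sym_cst => //; exists 1 => // t x; rewrite normcR normr1 mulr1.
have PhiC' (y : T * vec) : Cinf (fun xi => (Phi (y.2, xi))%:C) by exact: Cinf_sec2 PhiC.
have GE' i (y : T * vec) xi : (G i y.2 xi)%:C = (1 : R)%:C * dC (basv i) (fun xi => (Phi (y.2, xi))%:C) xi.
 rewrite mul1r GE; have := sec2_Dw (fun X => (Phi X)%:C) y.2 [:: i] xi; exact.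
have G_sym' i : sym basv (fun (_ : 'I_d) (_ : T * vec) (_ : vec) => (1 : R)) (fun y xi => bG y.2 xi) (fun y xi => (G i y.2 xi)%:C).
 exact: (sym_reindex snd (G_sym i)).
pose m (t : T * vec) (xi : vec) := mu t.1 * (jap t.2 ^+ M * jap xi ^- (2 * d)).
have m0 t xi : 0 <= m t xi by rewrite !mulr_ge0 ?invr_ge0 ?exprn_ge0 ?jap_ge0.
have mle t xi : m t xi <= mu t.1 * jap t.2 ^+ M * vq xi.
 by rewrite -mulrA ler_wpM2l// ler_wpM2l ?exprn_ge0 ?jap_ge0// japV_dom.
have md : mdom S1 (fun (_ : 'I_d) (_ : T * vec) (_ : vec) => (1 : R)) m.
 move=> t; exists (mu t.1 * jap t.2 ^+ M); first by rewrite mulr_ge0 ?exprn_ge0 ?jap_ge0.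
 by move=> xi; split=> [|_]; rewrite ?mulr1; exact: mle.
have HM t xi : m t xi * (1 / bG t.2 xi) ^+ (M + N) <= C ^+ (M + N) * (mu t.1 * jap t.2 ^- N) * is_q S1 xi.
 rewrite div1r; set y := t.2.
 have b0 := brk_gt0 (fun i => G i y) xi.
 have H : (bG y xi)^-1 ^+ (M + N) <= C ^+ (M + N) * jap y ^- (M + N).
  rewrite -exprVn -exprMn ler_Xn ?mulr_ge0 ?invr_ge0 ?jap_ge0 ?(ltW b0)//.
  by rewrite -div1r ler_pdivrMr// mulrAC ler_pdivlMr ?jap_gt0// mul1r.
 apply: (@le_trans _ _ ((mu t.1 * jap y ^+ M * vq xi) * (C ^+ (M + N) * jap y ^- (M + N)))).
  by apply: ler_pM (m0 t xi) _ (mle t xi) H; rewrite exprn_ge0// invr_ge0 ltW.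
 rewrite -[is_q _ _]/(vq xi) [jap y ^+ (M + N)]exprD invfM; apply: eqW_le.
 have j0 : jap y ^+ M != 0 by rewrite expf_neq0// gt_eqF// jap_gt0.
 have j1 : jap y ^+ N != 0 by rewrite expf_neq0// gt_eqF// jap_gt0.
 by move: (jap y ^+ M) (jap y ^+ N) (vq xi) (C ^+ _) j0 j1 => a b c e a0 b1; field; rewrite a0 b1.
have [D D0 HD] := @ibp_bound R _ _ (T * vec) basv S1 (@Lam_ibp R d) (fun _ _ _ => 1) (fun i t => G i t.2) (fun _ _ _ => 1) (fun _ _ => 1)
 (fun _ _ _ => ler01) (fun _ _ _ => ler01) (fun _ _ => ler01) one0 ones1 one_bG s_sym G_sym'
 (fun t xi => Phi (t.2, xi)) PhiC' GE' m _ (M + N) (fun t => C ^+ (M + N) * (mu t.1 * jap t.2 ^- N)) m0 md As HM.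
exists (D * C ^+ (M + N)); first by rewrite mulr_ge0// exprn_ge0.
by move=> t y; rewrite -mulrA; exact: (HD (t, y)).
Qed.

Lemma oint_bound A N : amplitude A -> exists2 C : R, 0 <= C & forall y, normc (oint A y) <= C * jap y ^- N.
Proof.
move=> [M AM].
have AM' : sym e2 (ones unit) (fun t X => 1 * (jap X.1 ^+ M * jap X.2 ^- (2 * d))) (fun=> A).
 by apply: sym_eqw (AM (2 * d)%N) => t X; rewrite mul1r.
have [C C0 HC] := oint_bound_family N (fun=> ler01) AM'.
by exists C => // y; have := HC tt y; rewrite mul1r.
Qed.

(** The derivatives are integrals of the same kind, with amplitude transformed by [dPhi]; these form
    the family closed under partial derivatives that [Cinf_of_partials] asks for. *)
Lemma oint_Dw A u : amplitude A ->
 exists2 A', amplitude A' & Cinf (oint A) /\ Dw basv u (oint A) = oint A'.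
Proof.
move=> Aa; pose A_ w := foldl (fun B i => dPhi i B) A w.
have Aw w : amplitude (A_ w).
 suff H B : amplitude B -> amplitude (foldl (fun B i => dPhi i B) B w) by exact: H.
 by elim: w B => //= i w IH B Ba; apply: IH; exact: dPhi_amplitude.
have dA w i X : is_dC (oint (A_ w)) (basv i) X (oint (A_ (rcons w i)) X).
 by rewrite /A_ foldl_rcons; apply: oint_is_dC; exact: Aw.
have AC w : Cinf (oint (A_ w)).
 have h1 (x : vec) : x = \sum_i x 0 i *: basv i by exact: sum_basv.
 have h2 i (x y : vec) : (x - y) 0 i = x 0 i - y 0 i by rewrite !mxE.
 have h3 i (t : R) (x : vec) : (t *: x) 0 i = t * x 0 i by rewrite !mxE.
 have h4 (i : 'I_d) : continuous (fun x : vec => x 0 i) by exact: coord_continuous.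
 apply: (@Cinf_of_partials R _ _ basv (fun i x => x 0 i) h1 h2 h3 h4 (fun w => oint (A_ w)) dA) => w' y.
 have [C C0 HC] := oint_bound 0 (Aw w'); exists C => //; exists 1 => // z _.
 by have := HC z; rewrite expr0 invr1 mulr1.
exists (A_ u) => //; split; first exact: (AC [::]).
have key w : Dw basv u (oint (A_ w)) = oint (A_ (w ++ u)).
 elim: u w => [|i u IH] w /=; first by rewrite cats0.
 by rewrite (derC_mk (dA w i)).2 IH cat_rcons.
exact: (key [::]).
Qed.

Lemma oint_rapid A : amplitude A -> rapid (oint A).
Proof.
move=> Aa N k; split=> [_|u _]; first by have [A' _ [AC _]] := oint_Dw [::] Aa.
have [A' Aa' [_ ->]] := oint_Dw u Aa; have [C C0 HC] := oint_bound N Aa'.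
by exists C => // _ x; rewrite big1// mulr1.
Qed.

End oscillating.
End schwartz_integrals.

Section transform.
Local Notation S2 := phase_space_measure.

Lemma dotvC_sym (x y : vec) : dotv x y = dotv y x.
Proof. by apply: eq_bigr => i _; rewrite mulrC. Qed.

Lemma ph_dC1 i : exists m : nat, sym e2 (ones unit) (fun _ X => jap X.1 ^+ m * jap X.2 ^+ m)
 (fun _ => dC (e2 (inl i)) (fun X => (ph X)%:C)).
Proof.
exists 1%N; have := Gp_sym (rho := fun _ : unit => (1 : R)) (fun=> lexx 1) (inl i).
rewrite dC_ph; apply: sym_le ler01 _ _ => // t X.
by rewrite mul1r !expr1 jap2_le.
Qed.

Definition Gph (i : 'I_d) (y xi : vec) : R := Gp (inr i) (y, xi).
Lemma GphE i y xi : (Gph i y xi)%:C = dC (e2 (inr i)) (fun X => (ph X)%:C) (y, xi).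
Proof. by rewrite dC_ph. Qed.
Lemma brk_Gph y xi : brk (fun i => Gph i y) xi = jap y.
Proof.
rewrite /brk /brk2 /jap /dotv; congr (Num.sqrt (_ + _)); apply: eq_bigr => i _.
by rewrite /Gph /Gp /= sqrrN expr2.
Qed.
Lemma Gph_sym i : sym basv (fun (_ : 'I_d) (_ _ : vec) => (1 : R)) (fun y xi => brk (fun i => Gph i y) xi)
 (fun y xi => (Gph i y xi)%:C).
Proof.
apply: (sym_eq (f := fun (y _ : vec) => (- y 0 i)%:C)) => //.
apply: sym_cst => // [y xi|]; first by rewrite brk_Gph jap_ge0.
by exists 1 => // y xi; rewrite normcR mul1r normrN brk_Gph le_coord_jap.
Qed.
Lemma Gph_ge : exists2 C : R, 0 <= C & forall y xi, jap y <= C * brk (fun i => Gph i y) xi.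
Proof. by exists 1 => // y xi; rewrite brk_Gph mul1r. Qed.

(** As [ph] at (eta, z) is -<z, eta>, this is the Fourier transform without its factor (2
    pi)^(-d/2). *)
Definition ft (u : vec -> R[i]) (eta : vec) := oint ph (fun X => u X.2) eta.

Lemma japV_ge0 N (x : vec) : 0 <= jap x ^- N.
Proof. by rewrite invr_ge0 exprn_ge0// jap_ge0. Qed.

Lemma sym_snd {T : Type} (sg : 'I_d -> T -> vec -> R) m (f : T -> vec -> R[i]) :
 (forall i t x, 0 <= sg i t x) -> (forall t x, 0 <= m t x) -> sym basv sg m f ->
 sym e2 (fun (i : I2) t (X : vec2) => if i is inr j then sg j t X.2 else 0) (fun t X => m t X.2) (fun t X => f t X.2).
Proof.
move=> s0 m0; pose jj (i : I2) : 'I_d := match i with inl j => j | inr j => j end.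
pose c (i : I2) (_ : T) : R := if i is inr _ then 1 else 0.
move=> Hs; apply: (sym_pullback (p := id) (A := fun _ (X : vec2) => X.2) (A0 := fun _ X => X.2) (j := jj) (c := c) (K := 1)
 _ _ _ _ _ _ _ _ _ Hs) => //.
- by move=> t X; exact: cvg_snd.
- by move=> t [i|i] /=; rewrite ?scale0r ?scale1r.
- by move=> [i|i] t x.
- by move=> t x; rewrite mul1r.
- by move=> [i|i] t x /=; rewrite ?normr0 ?normr1 ?mul0r.
Qed.
Lemma sym_fst {T : Type} (sg : 'I_d -> T -> vec -> R) m (f : T -> vec -> R[i]) :
 (forall i t x, 0 <= sg i t x) -> (forall t x, 0 <= m t x) -> sym basv sg m f ->
 sym e2 (fun (i : I2) t (X : vec2) => if i is inl j then sg j t X.1 else 0) (fun t X => m t X.1) (fun t X => f t X.1).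
Proof.
move=> s0 m0; pose jj (i : I2) : 'I_d := match i with inl j => j | inr j => j end.
pose c (i : I2) (_ : T) : R := if i is inl _ then 1 else 0.
move=> Hs; apply: (sym_pullback (p := id) (A := fun _ (X : vec2) => X.1) (A0 := fun _ X => X.1) (j := jj) (c := c) (K := 1)
 _ _ _ _ _ _ _ _ _ Hs) => //.
- by move=> t X; exact: cvg_fst.
- by move=> t [i|i] /=; rewrite ?scale0r ?scale1r.
- by move=> [i|i] t x.
- by move=> t x; rewrite mul1r.
- by move=> [i|i] t x /=; rewrite ?normr0 ?normr1 ?mul0r.
Qed.

Lemma rapid_amplitude u : rapid u -> amplitude (fun X : vec2 => u X.2).
Proof.
move=> ur; exists 0%N => N; have H := sym_snd (fun _ _ _ => ler01) (fun _ x => japV_ge0 N x) (ur N).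
apply: (sym_sg (K := 1) (sg := fun (i : I2) (t : unit) (X : vec2) => if i is inr j then 1 else 0)) => //.
- by move=> t X; rewrite mulr_ge0 ?invr_ge0 ?exprn_ge0 ?jap_ge0.
- by move=> [i|i] t X; rewrite mul1r ?lexx ?ler01.
by apply: sym_eqw H => t X; rewrite expr0 mul1r.
Qed.

Lemma ft_rapid u : rapid u -> rapid (ft u).
Proof.
by move=> ur; exact: (oint_rapid phC ph_dC1 GphE Gph_sym Gph_ge (rapid_amplitude ur)).
Qed.

Lemma rapid_bound (u : vec -> R[i]) N : rapid u -> exists2 C : R, 0 <= C & forall x, normc (u x) <= C * jap x ^- N.
Proof. by move=> /(_ N)/sym_bnd[C C0 HC]; exists C => // x; exact: HC. Qed.

Lemma rapid_Cinf (u : vec -> R[i]) : rapid u -> Cinf u.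
Proof. by move=> /(_ 0%N)/(sym_Cinf tt). Qed.

Lemma rapid_tame (u : vec -> R[i]) : rapid u -> tame (fun v : vec2 => u v.1).
Proof.
move=> ur; exists 0%N; have H := sym_fst (fun _ _ _ => ler01) (fun _ x => japV_ge0 0 x) (ur 0%N).
apply: (sym_sg (K := 1) (sg := fun (i : I2) (t : unit) (X : vec2) => if i is inl j then 1 else 0)) => //.
- by move=> [i|i] t X; rewrite mul1r ?lexx ?ler01.
by apply: sym_eqw H => t X; rewrite !expr0 invr1.
Qed.

Lemma chi0E e (x : vec) : chi e (0, x) = gaussv (e *: x).
Proof.
rewrite /chi /= scaler0 !gaussvE.
rewrite dotv00.
by rewrite mul0r oppr0 expR0 mul1r.
Qed.

Lemma jap2_0 (x : vec) : jap2 (0, x) = jap x.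
Proof.
apply/eqP; rewrite -(eqrXn2 (n := 2))// ?jap2_ge0 ?jap_ge0// sqr_jap2 sqr_jap /=.
rewrite dotv00.
by rewrite addr0.
Qed.

Lemma gauss_cut_sym : sym e2 (ones R) (fun t X => clamp t * jap X.2 ^+ 2)
 (fun t X => (gaussv (clamp t *: X.2))%:C - 1).
Proof.
have H := chiB1_sym (eps := @clamp) clamp01.
pose c (i : I2) (_ : R) : R := if i is inr _ then 1 else 0.
apply: (sym_eq (f := fun t X => (chi (clamp t) (0 : vec, X.2))%:C - 1)).
 by move=> t; apply/funext => X; rewrite chi0E.
apply: (sym_pullback (p := id) (A := fun _ (X : vec2) => (0 : vec, X.2)) (A0 := fun _ X => (0, X.2)) (j := id) (c := c)
  (K := 1) _ _ _ _ _ _ _ _ _ H) => //.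
- by move=> t X; exact: (cvg_pair (cvg_cst (0 : vec)) (@cvg_snd _ _ (nbhs X.1) (nbhs X.2) _)).
- by move=> t v s X; rewrite -[s *: (0 : vec, v.2)]/(s *: (0 : vec), s *: v.2) scaler0 -[RHS]/(0 + 0, s *: v.2 + X.2) addr0.
- by move=> t [i|i] /=; rewrite ?scale0r ?scale1r.
- by move=> t X; rewrite mulr_ge0 ?sqr_ge0//; case/andP: (clamp01 t) => /ltW.
- by move=> t X; rewrite mul1r jap2_0.
- by move=> [i|i] t X; rewrite /c ?normr0 ?normr1 ?mulr1.
Qed.

Lemma gaussv01 (x : vec) : 0 <= gaussv x <= 1.
Proof. by rewrite gaussvE expR_ge0 -expR0 ler_expR oppr_le0 divr_ge0// dotv_ge0. Qed.

(** With both cutoffs present Fubini applies. The z-cutoff is then removed by [oint_bound_family]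
    with mu = eps, the eta-cutoff by [chi_near1] and the rapid decay of the transform. *)
Lemma osc_transform (p u : vec -> R[i]) : tame (fun v : vec2 => p v.2) -> rapid u ->
 osc (fun v => p v.2 * u v.1) = Lam S1 (fun eta => p eta * ft u eta).
Proof.
move=> pt ur; apply: osc_eq.
have pC : Cinf p.
 by have := Cinf_sec2 (0 : vec) (tame_Cinf pt).
have [M pM] : exists M : nat, exists2 C : R, 0 <= C & forall eta, normc (p eta) <= C * jap eta ^+ M.
 have [M /sym_bnd[C C0 HC]] := pt; exists M; exists C => // eta.
 by have := HC tt (0, eta); rewrite jap2_0.
have [Cp Cp0 Hp] := pM.
have uA N : sym e2 (ones R) (fun t X => jap X.1 ^+ 0 * jap X.2 ^- N) (fun _ X => u X.2).
 have H := sym_reindex (fun _ : R => tt) (sym_snd (fun _ _ _ => ler01) (fun _ x => japV_ge0 N x) (ur N)).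
 apply: (sym_sg (K := 1) (sg := fun (i : I2) (t : R) (X : vec2) => if i is inr j then 1 else 0)) => //.
 + by move=> t X; rewrite mulr_ge0 ?invr_ge0 ?exprn_ge0 ?jap_ge0.
 + by move=> [i|i] t X; rewrite mul1r ?lexx ?ler01.
 by apply: sym_eqw H => t X; rewrite expr0 mul1r.
have c0 t : 0 <= clamp t :> R by case/andP: (clamp01 t) => /ltW.
have DA : sym e2 (ones R) (fun t X => clamp t * (jap X.1 ^+ 0 * jap X.2 ^- (2 * d)))
  (fun t X => ((gaussv (clamp t *: X.2))%:C - 1) * u X.2).
 apply: sym_eqw (sym_mul gauss_cut_sym (uA (2 + 2 * d)%N)) => t X.
 have j0 : jap X.2 ^+ 2 != 0 by rewrite expf_neq0// gt_eqF// jap_gt0.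
 by rewrite !expr0 !mul1r exprD invfM mulrA mulfK.
(* M for the growth of p, 2 for the factor <eta>^2 in the bound of [gaussv] - 1, and 2 d for
   integrability. *)
pose N := (M + 2 + 2 * d)%N.
have [C1 C10 H1] := oint_bound_family phC GphE Gph_sym Gph_ge N c0 DA.
have [C2 C20 H2] := rapid_bound N (ft_rapid ur).
exists (Cp * (C1 + C2) * (2 * Qtot S1)) => e e01.
have eE : clamp e = e by exact: clamp_id.
have tB : tame (fun v : vec2 => p v.2 * u v.1) by apply: tame_mul => //; exact: rapid_tame.
have gC : Cinf (fun x : vec => (gaussv (e *: x))%:C).
 apply: (Cinf_affine (A := fun x : vec => e *: x) (A0 := fun x => e *: x)) (@gaussvC R d) => //.
  by move=> x; exact: scaler_continuous.
 by move=> v s x; rewrite scalerDr !scalerA mulrC.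
have guA : amplitude (fun X : vec2 => (gaussv (e *: X.2))%:C * u X.2).
 exists 0%N => K.
 have S1' : sym e2 (ones R) (fun t X => jap X.1 ^+ 0 * jap X.2 ^- K)
   (fun t X => ((gaussv (clamp t *: X.2))%:C - 1) * u X.2).
  apply: sym_le ler01 _ _ (sym_mul gauss_cut_sym (uA (2 + K)%N)) => // t X.
  have j0 : jap X.2 ^+ 2 != 0 by rewrite expf_neq0// gt_eqF// jap_gt0.
  rewrite !expr0 !mul1r exprD invfM mulrA mulfK//.
  by rewrite ler_piMl ?invr_ge0 ?exprn_ge0 ?jap_ge0//; case/andP: (clamp01 t).
 have := sym_reindex (fun _ : unit => e) (sym_add S1' (uA K)).
 apply: sym_eq => t; apply/funext => X; rewrite eE; ring.
have E1 : Lcut e (fun v => p v.2 * u v.1) = Lam S1 (fun eta => (gaussv (e *: eta))%:C * p eta *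
  oint ph (fun X => (gaussv (e *: X.2))%:C * u X.2) eta).
 have dm := tame_cut_dom e01 tB.
 rewrite /Lcut (Lam_fubini dm).2; congr Lam; apply/funext => eta.
 rewrite /oint -LamZ; last exact: (amplitude_dom phC eta guA).
 congr Lam; apply/funext => z; rewrite /chi rmorphM /= /ph /= [dotv eta z]dotvC_sym.
 by ring.
have dm1 : dom S1 (fun eta => p eta * ft u eta).
 split; first by apply: Cinf_cont; apply: Cinf_mul => //; exact: rapid_Cinf (ft_rapid ur).
 exists (Cp * C2) => eta; rewrite Normc.normcM; apply: le_trans (ler_pM _ _ (Hp eta) (H2 eta)) _; rewrite ?normc_ge0//.
 rewrite mulrACA ler_wpM2l ?mulr_ge0//; apply: le_trans (japV_dom eta (leqnn _)).
 rewrite /N -addnA exprD invfM mulrA divff ?mul1r ?expf_neq0 ?gt_eqF ?jap_gt0//.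
 by rewrite lef_pV2 ?posrE ?exprn_gt0 ?jap_gt0// ler_weXn2l ?jap_ge1// leq_addl.
have oC : Cinf (oint ph (fun X => (gaussv (e *: X.2))%:C * u X.2)).
 exact: rapid_Cinf (oint_rapid phC ph_dC1 GphE Gph_sym Gph_ge guA).
have key eta : normc ((gaussv (e *: eta))%:C * p eta * oint ph (fun X => (gaussv (e *: X.2))%:C * u X.2) eta -
  p eta * ft u eta) <= Cp * (C1 + C2) * e * vq eta.
 have -> : oint ph (fun X => (gaussv (e *: X.2))%:C * u X.2) eta = ft u eta +
   oint ph (fun X => ((gaussv (e *: X.2))%:C - 1) * u X.2) eta.
  rewrite /ft /oint -LamD; first by congr Lam; apply/funext => z; ring.
   exact: (amplitude_dom phC eta (rapid_amplitude ur)).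
  have := dom_add (amplitude_dom phC eta guA) (dom_scale (-1) (amplitude_dom phC eta (rapid_amplitude ur))).
  by congr (dom _ _); apply/funext => z /=; ring.
 set w := oint _ _ _; set g := gaussv (e *: eta).
 have -> : g%:C * p eta * (ft u eta + w) - p eta * ft u eta = p eta * (g%:C * w + (g%:C - 1) * ft u eta) by ring.
 have Hw : normc w <= C1 * (e * jap eta ^- N) by have := H1 e eta; rewrite eE.
 have Hg : normc (g%:C - 1) <= e * jap eta ^+ 2.
  have := chi_near1 (fun t => clamp01 t) e (0, eta); rewrite eE chi0E jap2_0.
  by rewrite -(rmorph1 (real_complex R)) -rmorphB normcR.
 have e0 : 0 <= e by case/andP: e01 => /ltW.
 rewrite Normc.normcM.
 have K1 : normc (g%:C * w + (g%:C - 1) * ft u eta) <= (C1 + C2) * e * jap eta ^- (M + 2 * d).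
  have jj : jap eta ^- N <= jap eta ^- (M + 2 * d).
   by rewrite lef_pV2 ?posrE ?exprn_gt0 ?jap_gt0// ler_weXn2l ?jap_ge1// /N addnAC leq_addr.
  have jj2 : jap eta ^+ 2 * jap eta ^- N = jap eta ^- (M + 2 * d).
   by rewrite /N addnAC addnC exprD invfM mulrA divff ?mul1r ?expf_neq0 ?gt_eqF ?jap_gt0.
  apply: le_trans (le_normcD _ _) _; rewrite !Normc.normcM [(C1 + C2) * e]mulrDl [_ * jap eta ^- _]mulrDl.
  apply: lerD.
   have /andP[g0 g1] := gaussv01 (e *: eta); rewrite normcR ger0_norm//.
   apply: (@le_trans _ _ (normc w)); first by rewrite ler_piMl ?normc_ge0.
   by apply: le_trans Hw _; rewrite -mulrA ler_wpM2l// ler_wpM2l.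
  apply: le_trans (ler_pM _ _ Hg (H2 eta)) _; rewrite ?normc_ge0// -jj2.
  by apply: eqW_le; move: (jap eta ^- N) => b; ring.
 apply: le_trans (ler_pM _ _ (Hp eta) K1) _; rewrite ?normc_ge0//.
 have -> : Cp * jap eta ^+ M * ((C1 + C2) * e * jap eta ^- (M + 2 * d)) = Cp * (C1 + C2) * e * (jap eta ^+ M * jap eta ^- (M + 2 * d)).
  by move: (jap eta ^- _) => b; ring.
 rewrite ler_wpM2l ?mulr_ge0 ?addr_ge0// exprD invfM mulrA divff ?mul1r ?expf_neq0 ?gt_eqF ?jap_gt0//.
 exact: japV_dom.
have C3 : Cinf (fun eta => (gaussv (e *: eta))%:C * p eta * oint ph (fun X => (gaussv (e *: X.2))%:C * u X.2) eta).
 by apply: Cinf_mul => //; exact: Cinf_mul.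
rewrite E1 -LamB//; last first.
 split; first exact: Cinf_cont.
 have [_ [D HD]] := dm1; exists (Cp * (C1 + C2) * e + D) => eta.
 rewrite -[X in normc X](subrK (p eta * ft u eta)) mulrDl; apply: le_trans (le_normcD _ _) _.
 by apply: lerD; [exact: key|exact: HD].
rewrite mulrAC; apply: Lam_bound => //.
by apply: Cinf_cont; apply: Cinf_sub => //; apply: Cinf_mul => //; exact: rapid_Cinf (ft_rapid ur).
Qed.

End transform.

Section fourier_gauss.
Local Notation gaussC := (fun x : vec => (gaussv x)%:C).

Lemma gauss_rapid : rapid gaussC.
Proof.
move=> N; apply: (sym_sg (K := 1) _ _ _ (gaussv_sym (R := R) (d := d) N)) => // [t x|i t x].
 exact: japV_ge0.
by rewrite mul1r invr_ge0 jap_ge0 invf_le1 ?jap_gt0// jap_ge1.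
Qed.

(** The Gaussian solves d_i g = -z_i g. The transform exchanges differentiation and multiplication,
    so it solves the same equation. *)
Lemma dC_ft_gauss i : dC (basv i) (ft gaussC) = fun eta : vec => - ((eta 0 i)%:C * ft gaussC eta).
Proof.
have gA := rapid_amplitude gauss_rapid.
apply/funext => eta; rewrite (is_dC_val (oint_is_dC phC ph_dC1 i eta gA)).
pose E z := expi (ph (eta, z)) : R[i].
have EC : Cinf E by exact: Cinf_expi (Cinf_sec2 eta phC).
have dE : dC (basv i) E = fun z => 'i%C * (- eta 0 i)%:C * E z.
 rewrite (dC_expi _ (Cinf_sec2 eta phC)).2; apply/funext => z.
 have <- : dC (e2 (inr i)) (fun X : vec2 => (ph X)%:C) (eta, z) = dC (basv i) (fun y => (ph (eta, y))%:C) z.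
  exact: (sec2_Dw _ eta [:: i] z).
 by rewrite dC_ph.
have g1 : dC (basv i) gaussC = fun z => - ((z 0 i)%:C * gaussC z) by exact: dC_gaussv.
have dg : dPhi ph i (fun X : vec2 => gaussC X.2) = fun X => 'i%C * dC (basv i) gaussC X.2.
 apply/funext => X; rewrite /dPhi dC_ph g1.
 have -> : dC (e2 (inl i)) (fun X : vec2 => gaussC X.2) X = 0.
  rewrite (dC_affine (A := fun X : vec2 => X.2) (a := 0) gaussC) ?dC0v//.
 by rewrite addr0 /Gp /= rmorphN; ring.
have ig : amplitude (fun X : vec2 => dC (basv i) gaussC X.2).
 by apply: rapid_amplitude => N; apply: sym_eqw (sym_dC i (gauss_rapid N)) => t x; rewrite mulr1.
have d1 := amplitude_dom phC eta ig; have d2 := amplitude_dom phC eta gA.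
have prodE : dC (basv i) (fun z => E z * gaussC z) =
  fun z => 'i%C * (- eta 0 i)%:C * (E z * gaussC z) + E z * dC (basv i) gaussC z.
 rewrite dC_mul//; last exact: gaussvC.
 by rewrite dE; apply/funext => z; rewrite mulrA.
have Z : Lam S1 (dC (basv i) (fun z => E z * gaussC z)) = 0.
 apply: Lam_ibp; first by apply: Cinf_derC; apply: Cinf_mul => //; exact: gaussvC.
  exact: d2.
 by rewrite prodE; apply: dom_add => //; exact: dom_scale.
rewrite prodE LamD// ?LamZ// in Z; last exact: dom_scale.
rewrite /oint dg.
have -> : (fun xi => expi (ph (eta, xi)) * ('i%C * dC (basv i) gaussC xi)) =
  (fun xi => 'i%C * (E xi * dC (basv i) gaussC xi)) by apply/funext => z; rewrite mulrCA.
rewrite LamZ//; move/eqP: Z; rewrite addrC addr_eq0 => /eqP ->.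
rewrite -[Lam _ _]/(ft gaussC eta) rmorphN -[in RHS]mulN1r -sqr_i; ring.
Qed.

Lemma const_of_dC (f : vec -> R[i]) : Cinf f -> (forall i, dC (basv i) f = fun=> 0) -> forall x, f x = f 0.
Proof.
move=> fC f0 x; apply/eqP; rewrite -subr_eq0; apply/eqP; apply: Normc.eq0_normc.
apply/eqP; rewrite eq_le normc_ge0 andbT -[x]add0r.
apply: le_trans (mean_value (B := 0) fC _) _; last by rewrite mulr0.
have E : dC x f = fun y => \sum_i (x 0 i)%:C * dC (basv i) f y by rewrite -dC_sumv// -sum_basv.
move=> s _; rewrite E big1 ?Normc.normc0// => i _.
by rewrite f0 mulr0.
Qed.

(** Multiplied by exp(|eta|^2 / 2) the transform has vanishing derivatives by [dC_ft_gauss], hence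
    is constant; its value at 0 is the Gaussian integral. *)
Lemma ft_gauss (eta : vec) : ft gaussC eta = (Num.sqrt (2 * pi) ^+ d * gaussv eta)%:C.
Proof.
pose h (x : vec) : R := dotv x x / 2.
have hC : Cinf (fun x : vec => (h x)%:C).
 have := Cinf_scale (-1) (@gauss_quadC R d).
 by congr Cinf; apply/funext => x; rewrite rmorphN mulN1r opprK.
have ftC : Cinf (ft gaussC) by exact: rapid_Cinf (ft_rapid gauss_rapid).
pose H x := ft gaussC x * (expR (h x))%:C.
have HC : Cinf H by apply: Cinf_mul => //; exact: Cinf_expR.
have dh i : dC (basv i) (fun x => (h x)%:C) = fun x : vec => (x 0 i)%:C.
 have -> : (fun x : vec => (h x)%:C) = (fun x => (2^-1)%:C * ((japsq x)%:C - 1%:C)).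
  by apply/funext => x; rewrite -rmorphB -rmorphM /= /japsq /h; congr (_%:C); ring.
 rewrite dC_scale; last by apply: Cinf_sub; [exact: japsqC|exact: Cinf_cst].
 rewrite dC_sub; [|exact: japsqC|exact: Cinf_cst].
 rewrite dC_japsq dC_cst; apply/funext => x; rewrite subr0 mulrA -rmorphM /= mulVf ?mul1r//.
have HE := const_of_dC HC _ eta.
have {HE} : H eta = H 0.
 apply: HE => i; rewrite /H dC_mul//; last exact: Cinf_expR.
 rewrite dC_ft_gauss (dC_expR _ hC).2 dh; apply/funext => x; ring.
have h0 : h 0 = 0 by rewrite /h /dotv big1 ?mul0r// => i _; rewrite mxE mul0r.
rewrite /H h0 expR0 mulr1.
have -> : ft gaussC 0 = (Num.sqrt (2 * pi) ^+ d)%:C.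
 have -> : ft gaussC 0 = Lam S1 gaussC.
  rewrite /ft /oint; congr Lam; apply/funext => z /=; rewrite /ph /=.
  have -> : dotv (0 : vec) z = 0 by rewrite /dotv big1// => i _; rewrite mxE mul0r.
  by rewrite oppr0 /expi cos0 sin0 mul1r.
 rewrite /Lam; apply: complexP => /=; first exact: rLam_gaussv.
 exact: (congr1 (fun z : R[i] => Re z) (@Lam0 R vec S1)).
move=> HH; rewrite gaussvE -/(h eta) expRN rmorphM /= fmorphV -HH mulfK//.
by rewrite (inj_eq (@complexI R)) gt_eqF// expR_gt0.
Qed.

Lemma osc_gauss : osc (fun v : vec2 => gaussC v.1) = ((2 * pi) ^+ d)%:C.
Proof.
have := osc_transform (p := fun=> 1) (tame_cst 1) gauss_rapid.
have -> : (fun v : vec2 => 1 * gaussC v.1) = (fun v => gaussC v.1) by apply/funext => v; rewrite mul1r.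
move=> ->.
have -> : (fun eta => 1 * ft gaussC eta) = (fun eta => (Num.sqrt (2 * pi) ^+ d)%:C * gaussC eta).
 by apply/funext => x; rewrite mul1r ft_gauss rmorphM.
have gd : dom S1 gaussC.
 split; first by apply: Cinf_cont; exact: gaussvC.
 by exists (2 ^+ d) => v; rewrite normcR; exact: gaussv_vq.
rewrite LamZ//.
have -> : Lam S1 gaussC = (Num.sqrt (2 * pi) ^+ d)%:C.
 rewrite /Lam; apply: complexP => /=; first exact: rLam_gaussv.
 exact: (congr1 (fun z : R[i] => Re z) (@Lam0 R vec S1)).
by rewrite -rmorphM -exprMn -expr2 sqr_sqrtr// mulr_ge0// pi_ge0.
Qed.

End fourier_gauss.

(** * Oscillatory integrals with parameters *)

Section osc_parameter.

Definition e4 (i : I2 + I2) : P4 := match i with inl j => (e2 j, 0) | inr j => (0, e2 j) end.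

Definition moderate (mu : vec2 -> R) := exists2 C : R, 0 <= C & exists m : nat, forall X Y : vec2,
 mu (X + Y) <= C * mu X * (jap Y.1 * jap Y.2) ^+ m.

Lemma moderate_bounded mu : (forall X, 0 <= mu X) -> moderate mu -> forall X, exists2 B : R, 0 <= B &
 forall Y : vec2, `|Y| <= 1 -> mu (X + Y) <= B.
Proof.
move=> mu0 [C C0 [m H]] X; exists (C * mu X * ((1 + d%:R) * (1 + d%:R)) ^+ m).
 by rewrite !mulr_ge0// exprn_ge0// mulr_ge0// addr_ge0.
move=> [y eta] Y1; apply: le_trans (H X _) _; rewrite ler_wpM2l ?mulr_ge0//.
have jb (x : vec) : `|x| <= 1 -> jap x <= 1 + d%:R.
 move=> x1; apply: le_trans (jap_le1D x) _; rewrite lerD2l; apply: le_trans (enorm_sum x) _.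
 apply: (@le_trans _ _ (\sum_(i < d) 1)); last by rewrite sumr_const card_ord.
 apply: ler_sum => i _; apply: le_trans x1.
 rewrite [leRHS]/Num.norm /= mx_normrE.
 exact: (le_bigmax _ (fun ij : 'I_1 * 'I_d => `|x ij.1 ij.2|) (0, i)).
have Y1' : `|y| <= 1 /\ `|eta| <= 1.
 by move: Y1; rewrite prod_normE /= ge_max => /andP[].
rewrite ler_Xn ?mulr_ge0 ?jap_ge0 ?addr_ge0//=.
by apply: ler_pM; rewrite ?jap_ge0//; apply: jb; tauto.
Qed.

Variables (mu sigma : vec2 -> R) (M : nat).
Hypothesis mu0 : forall X, 0 <= mu X.
Hypothesis sigma1 : forall X, 1 <= sigma X.
Hypothesis mu_mod : moderate mu.
Hypothesis sigma_mod : moderate sigma.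
(** A derivative in the parameter may produce growth in the integration variable, hence [jap2] in
    the first case; it raises the order of the amplitude by one, see [sgp_dC]. *)
Definition sgp (i : I2 + I2) (_ : unit) (X : P4) : R :=
 match i with inl _ => sigma X.1 * jap2 X.2 | inr _ => sigma X.1 end.
Let s0 X : 0 <= sigma X. Proof. exact: le_trans ler01 (sigma1 X). Qed.

Lemma sgp_ge1 i t X : 1 <= sgp i t X.
Proof. by case: i => i /=; rewrite ?mulr_ege1// jap2_ge1. Qed.
Lemma Dw_ep u (G : P4 -> R[i]) : Dw (ep (P := vec2)) u G = Dw e4 (map inr u) G.
Proof. by elim: u G => //= i u IH G; rewrite IH. Qed.

Lemma sec_family (mu' : vec2 -> R) M' F :
 sym e4 sgp (fun _ X => mu' X.1 * jap2 X.2 ^+ M') (fun _ => F) ->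
 sym e2 (fun (_ : I2) X (_ : vec2) => sigma X) (fun X v => mu' X * jap2 v ^+ M') (fun X v => F (X, v)).
Proof.
move=> Fs k; have [FC H] := Fs k; split=> [X|u uk].
 apply: (Cinf_affine (A := fun v : vec2 => (X, v)) (A0 := fun v => (0 : vec2, v))) (FC tt).
  by move=> x; exact: (cvg_pair (cvg_cst X) (@cvg_id _ (nbhs x))).
 by move=> x s y; rewrite -[s *: (0 : vec2, x)]/(s *: (0 : vec2), s *: x) scaler0 -[RHS]/(0 + X, s *: x + y) add0r.
have [|C C0 HC] := H (map inr u); first by rewrite size_map.
by exists C => // X v; rewrite sec_ep Dw_ep; have := HC tt (X, v); rewrite big_map.
Qed.

Lemma sgp_dC i mu' M' F : (forall X, 0 <= mu' X) ->
 sym e4 sgp (fun _ X => mu' X.1 * jap2 X.2 ^+ M') (fun _ => F) ->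
 sym e4 sgp (fun _ X => (mu' X.1 * sigma X.1) * jap2 X.2 ^+ M'.+1) (fun _ => dC (e4 (inl i)) F).
Proof.
move=> mu'0 Fs; apply: sym_eqw (sym_dC (inl i) Fs) => t X /=.
by rewrite exprSr; ring.
Qed.

(** Derivatives pass under [osc] by [osc_is_dC]. As the order of the amplitude grows with each of
    them, the exponent K depends on the word w. The moderation hypotheses give the local bounds in
    the parameter. *)
Lemma osc_param F : sym e4 sgp (fun _ X => mu X.1 * jap2 X.2 ^+ M) (fun _ => F) ->
 (Cinf (fun X => osc (fun v => F (X, v))) /\ forall i X,
  dC (e2 i) (fun X => osc (fun v => F (X, v))) X = osc (fun v => dC (e4 (inl i)) F (X, v))) /\
 forall w, exists2 C : R, 0 <= C & exists K, forall X,
  normc (Dw e2 w (fun X => osc (fun v => F (X, v))) X) <= C * (mu X * sigma X ^+ K).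
Proof.
move=> Fs; pose F_ w := Dw e4 (map inl w) F.
pose muk k X := mu X * sigma X ^+ k.
have muk0 k X : 0 <= muk k X by rewrite mulr_ge0 ?exprn_ge0.
have FS w : sym e4 sgp (fun _ X => muk (size w) X.1 * jap2 X.2 ^+ (M + size w)) (fun _ => F_ w).
 elim/last_ind: w => [|w i IH].
  by apply: sym_eqw Fs => t X; rewrite /muk expr0 mulr1 addn0.
 rewrite /F_ map_rcons Dw_rcons; apply: sym_eqw (sgp_dC i (muk0 (size w)) IH) => t X.
 by rewrite size_rcons /muk addnS [sigma X.1 ^+ _.+1]exprSr !mulrA.
have smod k : exists2 C : R, 0 <= C & exists m : nat, forall X Y : vec2,
  sigma (X + Y) ^+ k <= C * sigma X ^+ k * (jap Y.1 * jap Y.2) ^+ m.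
 have [C C0 [m H]] := sigma_mod; exists (C ^+ k); first exact: exprn_ge0.
 exists (m * k)%N => X Y; rewrite exprM -!exprMn ler_Xn ?mulr_ge0 ?exprn_ge0 ?mulr_ge0 ?jap_ge0//.
have mmod k : moderate (muk k).
 have [C C0 [m H]] := mu_mod; have [C' C'0 [m' H']] := smod k.
 exists (C * C'); first exact: mulr_ge0.
 exists (m + m')%N => X Y; apply: le_trans (ler_pM _ _ (H X Y) (H' X Y)) _; rewrite ?exprn_ge0//.
 by rewrite /muk exprD; apply: eqW_le; ring.
have Ft w X : tame (fun v => F_ w (X, v)).
 exact: (tame_of_sym sigma1 (muk0 (size w)) (sec_family (FS w)) X).
pose O w X := osc (fun v => F_ w (X, v)).
have Ob w : exists2 C : R, 0 <= C & exists K, forall X, normc (O w X) <= C * (mu X * sigma X ^+ K).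
 have [C C0 [K H]] := osc_family sigma1 (muk0 (size w)) (sec_family (FS w)).
 exists C => //; exists (size w + K)%N => X; have := (H X).1.
 by rewrite /muk -mulrA -exprD.
have e21 (i : I2) : `|e2 i| <= 1.
 case: i => i; rewrite prod_normE /= ge_max normr0 ler01 ?andbT /=.
  by rewrite [leLHS]/Num.norm /= mx_normrE; apply/bigmax_leP; split=> // -[k j] _ /=; rewrite mxE; case: andP => _; rewrite ?normr0 ?normr1.
 by rewrite [leLHS]/Num.norm /= mx_normrE; apply/bigmax_leP; split=> // -[k j] _ /=; rewrite mxE; case: andP => _; rewrite ?normr0 ?normr1.
have Od w i X : is_dC (O w) (e2 i) X (O (rcons w i) X).
 have FC : Cinf (F_ w) by exact: (sym_Cinf tt (FS w)).
 have E1 : dC (e2 i, 0 : vec2) (F_ w) = F_ (rcons w i) by rewrite /F_ map_rcons Dw_rcons.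
 have E2 : dC (e2 i, 0 : vec2) (F_ (rcons w i)) = F_ (rcons (rcons w i) i) by rewrite /F_ [in RHS]map_rcons Dw_rcons.
 have := @osc_is_dC vec2 (F_ w) FC X (e2 i) (M + (size w).+2) (Ft w); rewrite E1; apply; first exact: Ft.
 move=> u; rewrite E2.
 have [_ /(_ (map inr u) (leqnn _))[C C0 HC]] := FS (rcons (rcons w i) i) (size (map inr u : seq (I2 + I2))).
 have [B1 B10 H1] := moderate_bounded (muk0 (size w).+2) (mmod (size w).+2) X.
 have [B2 B20 H2] := moderate_bounded s0 sigma_mod X.
 exists (C * (B1 * B2 ^+ size u)); first by rewrite !mulr_ge0// exprn_ge0.
 move=> s v s1; have se : `|s *: e2 i| <= 1 by rewrite normrZ mulr_ile1.
 rewrite Dw_ep; apply: le_trans (HC tt (X + s *: e2 i, v)) _; rewrite -[leRHS]mulrA ler_wpM2l//.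
 rewrite big_map /= big_const_seq iter_mulr_1 count_predT !size_rcons mulrAC ler_wpM2r ?exprn_ge0 ?jap2_ge0//.
 by apply: ler_pM; rewrite ?exprn_ge0 ?H1// ler_Xn// H2.
have OC w : Cinf (O w).
 apply: (@Cinf_of_partials R _ _ e2 co2 co2_sum co2B _ _ O Od).
 - by move=> [i|i] t X /=; rewrite mxE.
 - move=> [i|i] X.
   exact: (continuous_comp (@cvg_fst _ _ (nbhs X.1) (nbhs X.2) _) (@coord_continuous R 1 d 0 i X.1)).
  exact: (continuous_comp (@cvg_snd _ _ (nbhs X.1) (nbhs X.2) _) (@coord_continuous R 1 d 0 i X.2)).
 move=> w' X; have [C C0 [K HC]] := Ob w'.
 have [B B0 HB] := moderate_bounded (muk0 K) (mmod K) X.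
 exists (C * B); first exact: mulr_ge0.
 exists 1 => // Z ZX; apply: le_trans (HC Z) _; rewrite ler_wpM2l//.
 by have := HB (Z - X) (ltW ZX); rewrite addrC subrK.
have OE w u : Dw e2 u (O w) = O (w ++ u).
 elim: u w => [|i u IH] w /=; first by rewrite cats0.
 by rewrite (derC_mk (Od w i)).2 IH cat_rcons.
split=> [|w]; first by split=> [|i X]; [exact: (OC [::])|exact: is_dC_val (Od [::] i X)].
have [C C0 [K HC]] := Ob w; exists C => //; exists K => X.
by have := OE [::] w => /= ->.
Qed.

End osc_parameter.

Section evaluation.
Local Notation sgh := (sgp (fun X => jap X.1)).

Definition had (X : P4) : vec := \row_k (X.1.1 0 k * X.2.1 0 k).

Lemma coordB (k : 'I_d) (x y : vec) : (x - y) 0 k = x 0 k - y 0 k. Proof. by rewrite !mxE. Qed.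
Lemma had_x (k : 'I_d) : Cinf (fun X : P4 => (X.1.1 0 k)%:C) /\ forall w, dC w (fun X : P4 => (X.1.1 0 k)%:C) = fun=> (w.1.1 0 k)%:C.
Proof.
split=> [|w].
 by apply: (Cinf_affine (A := fst) (A0 := fst)) (co2_C (inl k)) => // X; exact: cvg_fst.
by apply/funext => X; rewrite (dC_affine (A := fst) (a := w.1) (fun Y : vec2 => (co2 (inl k) Y)%:C))// co2_aff.
Qed.
Lemma had_z (k : 'I_d) : Cinf (fun X : P4 => (X.2.1 0 k)%:C) /\ forall w, dC w (fun X : P4 => (X.2.1 0 k)%:C) = fun=> (w.2.1 0 k)%:C.
Proof.
split=> [|w].
 by apply: (Cinf_affine (A := snd) (A0 := snd)) (co2_C (inl k)) => // X; exact: cvg_snd.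
by apply/funext => X; rewrite (dC_affine (A := snd) (a := w.2) (fun Y : vec2 => (co2 (inl k) Y)%:C))// co2_aff.
Qed.
Lemma hadE k : (fun X => (had X 0 k)%:C) = fun X : P4 => (X.1.1 0 k)%:C * (X.2.1 0 k)%:C.
Proof. by apply/funext => X; rewrite mxE rmorphM. Qed.
Lemma had_C k : Cinf (fun X => (had X 0 k)%:C).
Proof. by rewrite hadE; apply: Cinf_mul; [exact: (had_x k).1|exact: (had_z k).1]. Qed.
Lemma dC_had w k : dC w (fun X => (had X 0 k)%:C) = fun X =>
 (w.1.1 0 k)%:C * (X.2.1 0 k)%:C + (X.1.1 0 k)%:C * (w.2.1 0 k)%:C.
Proof. by have [xC xd] := had_x k; have [zC zd] := had_z k; rewrite hadE dC_mul// xd zd. Qed.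
Lemma had_cont : continuous had.
Proof. by apply: cont_row => i X; have [c _] := Cinf_cont (had_C i); exact: (c X). Qed.

Lemma had_sym (F : vec -> R[i]) M :
 sym basv ones1 (fun _ x => jap x ^+ M) (fun _ => F) ->
 sym e4 sgh (fun _ X => jap X.1.1 ^+ M * jap2 X.2 ^+ M) (fun _ X => F (had X)).
Proof.
have s1 i t X : 1 <= sgh i t X by apply: sgp_ge1 => Y; exact: jap_ge1.
have s0 i t X : 0 <= sgh i t X by exact: le_trans ler01 (s1 i t X).
have b2 (i : I2) (k : 'I_d) : `|(e2 i).1 0 k| <= 1.
 by case: i => j /=; rewrite ?mxE ?normr0// eqxx /=; case: eqP => _; rewrite ?normr1 ?normr0.
have b4 i (k : 'I_d) : `|(e4 i).1.1 0 k| <= 1 /\ `|(e4 i).2.1 0 k| <= 1.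
 by case: i => i /=; rewrite ?b2 ?mxE ?normr0.
have zS k : sym e4 sgh (fun _ X => jap2 X.2) (fun (_ : unit) (X : P4) => (X.2.1 0 k)%:C).
 apply: sym_of_dC => [t||i]; first exact: (had_z k).1.
  by exists 1 => // t X; rewrite normcR mul1r (le_trans (le_coord_jap _ _))// jap_le_jap2l.
 apply: (sym_eq (f := fun _ _ => ((e4 i).2.1 0 k)%:C)); first by move=> t; rewrite (had_z k).2.
 apply: sym_cst => // [t X|]; first by rewrite mulr_ge0// jap2_ge0.
 by exists 1 => // t X; rewrite normcR mul1r (le_trans (b4 _ _).2)// mulr_ege1 ?jap2_ge1.
have xS k : sym e4 sgh (fun _ X => jap X.1.1) (fun (_ : unit) (X : P4) => (X.1.1 0 k)%:C).
 apply: sym_of_dC => [t||i]; first exact: (had_x k).1.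
  by exists 1 => // t X; rewrite normcR mul1r le_coord_jap.
 apply: (sym_eq (f := fun _ _ => ((e4 i).1.1 0 k)%:C)); first by move=> t; rewrite (had_x k).2.
 apply: sym_cst => // [t X|]; first by rewrite mulr_ge0// jap_ge0.
 by exists 1 => // t X; rewrite normcR mul1r (le_trans (b4 _ _).1)// mulr_ege1 ?jap_ge1.
have gS k i : sym e4 sgh (fun _ X => sgh i tt X / 1) (fun (_ : unit) => dC (e4 i) (fun X => (had X 0 k)%:C)).
 case: i => i.
  apply: (sym_eq (f := fun (_ : unit) (X : P4) => ((e4 (inl i)).1.1 0 k)%:C * (X.2.1 0 k)%:C)).
   by move=> t; rewrite dC_had; apply/funext => X /=; rewrite mxE mulr0 addr0.
  apply: sym_le ler01 s0 _ (sym_scale _ (zS k)) => t X.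
  by rewrite mul1r divr1 /= ler_peMl ?jap2_ge0 ?jap_ge1.
 apply: (sym_eq (f := fun (_ : unit) (X : P4) => ((e4 (inr i)).2.1 0 k)%:C * (X.1.1 0 k)%:C)).
  by move=> t; rewrite dC_had; apply/funext => X /=; rewrite mxE mul0r add0r mulrC.
 by apply: sym_eqw (sym_scale _ (xS k)) => t X; rewrite divr1.
move=> Fs.
have H := @sym_comp R _ _ _ _ unit unit e4 basv (fun i (x : vec) => x 0 i) (@sum_basv R d) coordB id (fun _ => had) sgh
 (fun _ _ _ => 1) s0 (fun _ _ _ => ltr01) (fun _ => had_cont) (fun _ => had_C) gS _ _
 (fun _ y => exprn_ge0 M (jap_ge0 y)) Fs.
apply: sym_le ler01 s0 _ H => t X; rewrite mul1r -exprMn ler_Xn ?mulr_ge0 ?jap_ge0 ?jap2_ge0//.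
rewrite (le_trans _ (ler_wpM2l _ (jap_le_jap2l X.2))) ?jap_ge0//.
rewrite -ler_sqr ?nnegrE ?mulr_ge0 ?jap_ge0// exprMn !sqr_jap mulrDl mul1r addrAC -addrA lerD2l.
apply: ler_wpDr; first exact: dotv_ge0.
rewrite mulrDr mulr1; apply: ler_wpDl; first exact: dotv_ge0.
rewrite /dotv big_distrl /=; apply: ler_sum => k _; rewrite mxE mulrACA ler_wpM2l ?sqr_ge0//.
by rewrite (bigD1 k)//= lerDl sumr_ge0// => j _; exact: sqr_ge0.
Qed.

Lemma jap_mod1 k : moderate (fun X : vec2 => jap X.1 ^+ k).
Proof.
exists (2 ^+ k); first exact: exprn_ge0.
exists k => X Y; rewrite -!exprMn ler_Xn ?mulr_ge0 ?jap_ge0//.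
apply: le_trans (japD _ _) _; rewrite -mulrA ler_wpM2l// ler_wpM2l ?jap_ge0//.
by rewrite ler_peMr ?jap_ge0// jap_ge1.
Qed.

(* F (x1 z1, ..., xd zd) interpolates between F z and F 0; its x-derivatives carry factors z_i, which
  the oscillatory integral annihilates. *)
Lemma osc_at0 (F : vec -> R[i]) : tame (fun v : vec2 => F v.1) ->
 osc (fun v : vec2 => F v.1) = F 0 * osc (fun _ : vec2 => 1).
Proof.
move=> tF; have [M FM] : exists M : nat, sym basv ones1 (fun _ x => jap x ^+ M) (fun _ => F).
 have [M HM] := tF; exists M => k; have [FC H] := HM k; split=> [_|u uk]; first exact: Cinf_sec1 (0 : vec) (FC tt).
 have [|C C0 HC] := H (map inl u); first by rewrite size_map.
 exists C => // t x; have := HC tt (x, 0).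
 have j20 : jap2 (x, 0 : vec) = jap x.
  apply/eqP; rewrite -(eqrXn2 (n := 2))// ?jap2_ge0 ?jap_ge0// sqr_jap2 sqr_jap /=.
  rewrite dotv00.
  by rewrite addr0.
 by rewrite sec1_Dw /= j20 !big_map.
have tame_had (f : vec -> R[i]) X : sym basv ones1 (fun _ x => jap x ^+ M) (fun _ => f) ->
  tame (fun v => f (had (X, v))).
 move=> /had_sym H; apply: (tame_of_sym (m := fun X => jap X.1 ^+ M) (fun X => jap_ge1 X.1) _ (sec_family H) X) => Y.
 by rewrite exprn_ge0// jap_ge0.
have [[NC Nd] _] := osc_param (fun X => exprn_ge0 M (jap_ge0 X.1)) (fun X => jap_ge1 X.1) (jap_mod1 M) (jap_mod1 1) (had_sym FM).
pose N X := osc (fun v => F (had (X, v))).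
have N0 i X : dC (e2 i) N X = 0.
 rewrite Nd.
 have dG k : dC (e2 (inr k)) (fun v => dC (basv k) F (had (X, v))) = fun=> 0.
  apply/funext => v; rewrite (dC_affine (A := fun v => had (X, v)) (a := 0) (dC (basv k) F)) ?dC0v//.
  move=> s x; rewrite scaler0 add0r; apply/rowP => j; rewrite !mxE; congr (_ * _).
  by rewrite mulr0 add0r.
 have tG k : tame (fun v => dC (basv k) F (had (X, v))).
  by apply: tame_had; apply: sym_eqw (sym_dC k FM) => s x; rewrite mulr1.
 have tP k : tame (fun v : vec2 => (Gp (inr k) v)%:C * dC (basv k) F (had (X, v))).
  by apply: tame_mul; [exact: tame_Gp|exact: tG].
 have -> : (fun v => dC (e4 (inl i)) (fun X => F (had X)) (X, v)) =
   (fun v => \sum_k (- ((e2 i).1 0 k)%:C * ((Gp (inr k) v)%:C * dC (basv k) F (had (X, v))))).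
  rewrite (dC_chain (co := fun i (x : vec) => x 0 i) (@sum_basv R d) coordB _ (sym_Cinf tt FM) had_C).2.
  apply/funext => v; apply: eq_bigr => k _; rewrite dC_had /= mxE mulr0 addr0 /Gp rmorphN.
  by rewrite mulrA mulrNN.
 rewrite osc_sum; last by move=> k; exact: tame_scale.
 rewrite big1// => k _; rewrite osc_scale// osc_ibp// dG.
 by have := osc_scale 0 (tame_cst 0); rewrite !mul0r => ->; rewrite !mulr0.
have H := const_of_dC (Cinf_sec1 (0 : vec) NC) _ (const_mx 1).
have -> : osc (fun v : vec2 => F v.1) = N (const_mx 1, 0).
 by congr osc; apply/funext => v; congr F; apply/rowP => k; rewrite !mxE mul1r.
rewrite /N H => [|i]; last first.
 by apply/funext => x; exact: etrans (esym (sec1_Dw N x [:: i] 0)) (N0 (inl i) (x, 0)).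
rewrite -osc_scale; last exact: tame_cst.
by congr osc; apply/funext => v; rewrite mulr1; congr F; apply/rowP => k; rewrite !mxE mul0r.
Qed.

(** By [osc_at0] only the constant [osc] 1 remains; it is found by taking for F the Gaussian, equal
    to 1 at 0 and with known oscillatory integral. *)
Lemma osc_value (F : vec -> R[i]) : tame (fun v : vec2 => F v.1) ->
 osc (fun v : vec2 => F v.1) = F 0 * ((2 * pi) ^+ d)%:C.
Proof.
move=> tF; rewrite osc_at0//; congr (_ * _).
have := osc_at0 (rapid_tame gauss_rapid); rewrite osc_gauss => ->.
rewrite gaussvE dotv00.
by rewrite mul0r oppr0 expR0 mul1r.
Qed.
End evaluation.

Section composition_theorem.
Variable D : composition_data R d.
Local Notation S2 := phase_space_measure.
Local Notation w0 := (cw0 D).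
Local Notation w1 := (cw1 D).
Local Notation w2 := (cw2 D).
Local Notation phi := (cphi D).
Local Notation r1 := (cr1 D).

(** * The symbol of the composition *)

Section crude_estimates.
Local Notation one4 := (fun (_ : I2 + I2) (_ : unit) (_ : P4) => (1 : R)).

Definition thv (X : vec2) : vec := gradx phi X.1 X.2.
Definition phC' (X : vec2) : R[i] := (phi X.1 X.2)%:C.

Lemma w0_ge0 x xi : 0 <= w0 x xi. Proof. exact: weight_ge0 (chw0 D) x xi. Qed.
Lemma w1_ge0 x xi : 0 <= w1 x xi. Proof. exact: weight_ge0 (chw1 D) x xi. Qed.
Lemma w2_ge0 x xi : 0 <= w2 x xi. Proof. exact: weight_ge0 (chw2 D) x xi. Qed.

Lemma theta11 (x xi : vec) : theta 1 1 x xi = jap x * jap xi.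
Proof. by rewrite /theta !powRr1// jap_ge0. Qed.

Lemma phi_sym : symSG (fun x xi => jap x * jap xi) 1 1 phC'.
Proof.
have [H _ _] := chphi D.
have H2 := SG_sym _ H; have H3 := H2 _.
apply: sym_eqw (H3 _) => [t X|x xi]; first exact: theta11.
by rewrite theta11 mulr_ge0// jap_ge0.
Qed.

Lemma sgSG_le1 r rho i t (X : vec2) : 0 <= r -> 0 <= rho -> 0 <= sgSG r rho i t X <= 1.
Proof.
move=> r0 rho0; rewrite sgSG_ge0; case: i => i /=.
 rewrite powRN invf_le1 ?powR_gt0 ?jap_gt0//; apply: (@le_trans _ _ (1 `^ r)); first by rewrite powR1.
 by rewrite ge0_ler_powR ?nnegrE ?jap_ge0// jap_ge1.
rewrite powRN invf_le1 ?powR_gt0 ?jap_gt0//; apply: (@le_trans _ _ (1 `^ rho)); first by rewrite powR1.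
 by rewrite ge0_ler_powR ?nnegrE ?jap_ge0// jap_ge1.
Qed.

Lemma symSG_one w r rho F : 0 <= r -> 0 <= rho -> (forall x xi, 0 <= w x xi) -> symSG w r rho F ->
 sym e2 (ones unit) (fun _ X => w X.1 X.2) (fun _ => F).
Proof.
move=> r0 rho0 wp Hs; by apply: (sym_sg (K := 1) _ _ _ Hs) => // i t X; rewrite mul1r; exact: sgSG_le1.
Qed.

Lemma powRN1 (x : vec) : jap x `^ (- 1) = (jap x)^-1.
Proof. by rewrite powRN powRr1// jap_ge0. Qed.

Lemma phix_sym i : symSG (fun _ xi => jap xi) 1 1 (dC (e2 (inl i)) phC').
Proof.
apply: sym_eqw (sym_dC (inl i) phi_sym) => t X /=.
by rewrite powRN1 mulrAC mulfV ?mul1r// gt_eqF// jap_gt0.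
Qed.
Lemma phixi_sym i : symSG (fun x _ => jap x) 1 1 (dC (e2 (inr i)) phC').
Proof.
apply: sym_eqw (sym_dC (inr i) phi_sym) => t X /=.
by rewrite powRN1 mulfK// gt_eqF// jap_gt0.
Qed.
Lemma thvE i X : (thv X 0 i)%:C = dC (e2 (inl i)) phC' X.
Proof. by case: X => x xi; rewrite /thv gradxE. Qed.

Lemma thv_jap : exists2 C : R, 0 <= C & forall X, jap (thv X) <= C * jap X.2 /\ jap X.2 <= C * jap (thv X).
Proof.
have [_ _ [[c c0 H1] [c' c'0 H2]]] := chphi D.
exists (c + c'); first by rewrite addr_ge0// ltW.
move=> X; split.
 by apply: le_trans (H1 X) _; rewrite ler_wpM2r ?jap_ge0// lerDl ltW.
by apply: le_trans (H2 X) _; rewrite ler_wpM2r ?jap_ge0// lerDr ltW.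
Qed.

Lemma cont_Yv : continuous (fun X : P4 => (X.1.1 + X.2.1, X.1.2) : vec2).
Proof.
move=> X.
have c11 : {for X, continuous (fun X : P4 => X.1.1)} by exact: (continuous_comp (@cvg_fst _ _ _ _ _) (@cvg_fst _ _ _ _ _)).
have c21 : {for X, continuous (fun X : P4 => X.2.1)} by exact: (continuous_comp (@cvg_snd _ _ _ _ _) (@cvg_fst _ _ _ _ _)).
have c12 : {for X, continuous (fun X : P4 => X.1.2)} by exact: (continuous_comp (@cvg_fst _ _ _ _ _) (@cvg_snd _ _ _ _ _)).
exact: (cvg_pair (cvgD c11 c21) c12).
Qed.
Lemma cont_Ev : continuous (fun X : P4 => (X.1.1, X.2.2) : vec2).
Proof.
move=> X.
have c11 : {for X, continuous (fun X : P4 => X.1.1)} by exact: (continuous_comp (@cvg_fst _ _ _ _ _) (@cvg_fst _ _ _ _ _)).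
have c22 : {for X, continuous (fun X : P4 => X.2.2)} by exact: (continuous_comp (@cvg_snd _ _ _ _ _) (@cvg_snd _ _ _ _ _)).
exact: (cvg_pair c11 c22).
Qed.

Section pull.
Variables (A : P4 -> vec2) (j : I2 + I2 -> I2) (c : I2 + I2 -> R).
Hypothesis Ac : continuous A.
Hypothesis AE : forall v (s : R) x, A (s *: v + x) = s *: A v + A x.
Hypothesis Ae : forall i, A (e4 i) = c i *: e2 (j i).
Hypothesis c1 : forall i, `|c i| <= 1.

Lemma pull4 m F : (forall X, 0 <= m X) -> sym e2 (ones unit) (fun _ => m) (fun _ => F) ->
 sym e4 one4 (fun _ X => m (A X)) (fun _ X => F (A X)).
Proof.
move=> m0 Fs; apply: (sym_pullback (p := id) (A := fun _ => A) (A0 := fun _ => A) (j := j) (c := fun i _ => c i) (K := 1)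
 _ _ _ _ _ _ _ _ _ Fs) => //.
- by move=> t x; rewrite mul1r.
- by move=> i t x; rewrite !mulr1.
Qed.
End pull.

Definition Yv (X : P4) : vec2 := (X.1.1 + X.2.1, X.1.2).
Definition Ev (X : P4) : vec2 := (X.1.1, X.2.2).

Lemma pullY m F : (forall X, 0 <= m X) -> sym e2 (ones unit) (fun _ => m) (fun _ => F) ->
 sym e4 one4 (fun _ X => m (Yv X)) (fun _ X => F (Yv X)).
Proof.
apply: (@pull4 Yv (fun i => match i with inl i => i | inr (inl i) => inl i | inr (inr i) => inl i end)
 (fun i => match i with inr (inr _) => 0 | _ => 1 end)).
- exact: cont_Yv.
- move=> v s x; rewrite -[LHS]/((s *: v.1.1 + x.1.1) + (s *: v.2.1 + x.2.1), s *: v.1.2 + x.1.2).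
 by rewrite addrACA -scalerDr.
- by move=> [[i|i]|[i|i]]; rewrite /Yv /= ?addr0 ?add0r ?scale1r ?scale0r.
- by move=> [[i|i]|[i|i]]; rewrite ?normr0 ?normr1.
Qed.
Lemma pullE m F : (forall X, 0 <= m X) -> sym e2 (ones unit) (fun _ => m) (fun _ => F) ->
 sym e4 one4 (fun _ X => m (Ev X)) (fun _ X => F (Ev X)).
Proof.
apply: (@pull4 Ev (fun i => match i with inl i => i | inr i => i end)
 (fun i => match i with inl (inl _) => 1 | inr (inr _) => 1 | _ => 0 end)).
- exact: cont_Ev.
- by [].
- by move=> [[i|i]|[i|i]]; rewrite /Ev /= ?scale1r ?scale0r.
- by move=> [[i|i]|[i|i]]; rewrite ?normr0 ?normr1.
Qed.

Lemma Yv_aff i F : dC (e4 i) (fun X => F (Yv X)) =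
 fun X => match i with inl i => dC (e2 i) F (Yv X) | inr (inl i) => dC (e2 (inl i)) F (Yv X) | inr (inr _) => 0 end.
Proof.
have AE (v : P4) (s : R) x : Yv (s *: v + x) = s *: Yv v + Yv x.
 rewrite -[LHS]/((s *: v.1.1 + x.1.1) + (s *: v.2.1 + x.2.1), s *: v.1.2 + x.1.2).
 by rewrite addrACA -scalerDr.
apply/funext => X; rewrite (dC_affine (A := Yv) (a := Yv (e4 i)) F)//.
case: i => [[i|i]|[i|i]]; rewrite /Yv /= ?addr0 ?add0r//.
by rewrite dC0v.
Qed.
Lemma Xv_aff i (F : vec2 -> R[i]) : dC (e4 i) (fun X => F X.1) =
 fun X => match i with inl i => dC (e2 i) F X.1 | inr _ => 0 end.
Proof.
apply/funext => X; rewrite (dC_affine (A := fun X : P4 => X.1) (a := (e4 i).1) F)//.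
by case: i => i //=; rewrite dC0v.
Qed.

Lemma Cinf_Yv (F : vec2 -> R[i]) : Cinf F -> Cinf (fun X => F (Yv X)).
Proof.
apply: (Cinf_affine (A := Yv) (A0 := Yv)).
 exact: cont_Yv.
move=> v s x; rewrite -[LHS]/((s *: v.1.1 + x.1.1) + (s *: v.2.1 + x.2.1), s *: v.1.2 + x.1.2).
by rewrite addrACA -scalerDr.
Qed.
Lemma Cinf_Xv (F : vec2 -> R[i]) : Cinf F -> Cinf (fun X : P4 => F X.1).
Proof.
by apply: (Cinf_affine (A := fst) (A0 := fst)) => // X; exact: cvg_fst.
Qed.

Definition diffF (F : vec2 -> R[i]) (X : P4) : R[i] := F (Yv X) - F X.1.

Lemma le_normc_sum (J : Type) (r : seq J) (F : J -> R[i]) : normc (\sum_(j <- r) F j) <= \sum_(j <- r) normc (F j).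
Proof.
elim: r => [|j r IH]; first by rewrite !big_nil Normc.normc0.
by rewrite !big_cons; apply: le_trans (le_normcD _ _) _; rewrite lerD2l.
Qed.

Lemma diffF_bnd F : Cinf F ->
 (forall i, sym e2 (ones unit) (fun _ X => jap X.2) (fun _ => dC (e2 (inl i)) F)) ->
 exists2 C : R, 0 <= C & forall X, normc (diffF F X) <= C * (jap X.1.2 * jap2 X.2).
Proof.
move=> FC Fs.
have Cb i : exists C : R, 0 <= C /\ forall X, normc (dC (e2 (inl i)) F X) <= C * jap X.2.
 by have [C C0 HC] := sym_bnd (Fs i); exists C; split=> // X; exact: HC tt X.
have [C HC] := choice Cb; pose K := \sum_i C i.
have C0 i : 0 <= C i by case: (HC i).
have K0 : 0 <= K by exact: sumr_ge0.
exists (2 * K); first by rewrite mulr_ge0.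
move=> X; have EY : Yv X = X.1 + (X.2.1, 0) by rewrite /Yv -[RHS]/(X.1.1 + X.2.1, X.1.2 + 0) addr0.
rewrite /diffF EY -[leRHS]mulrA; apply: mean_value => // s _.
have E2 : (X.2.1, 0) = \sum_i X.2.1 0 i *: e2 (inl i).
 by rewrite [LHS]co2_sum big_sumType /= [X in _ + X]big1 ?addr0// => i _; rewrite mxE scale0r.
have -> : dC (X.2.1, 0) F = fun Z => \sum_i (X.2.1 0 i)%:C * dC (e2 (inl i)) F Z by rewrite -dC_sumv// -E2.
apply: le_trans (le_normc_sum _ _) _; rewrite mulr_suml; apply: ler_sum => i _.
rewrite Normc.normcM normcR mulrC mulrA; apply: ler_pM; rewrite ?normc_ge0//.
 apply: le_trans ((HC i).2 _) _.
 by rewrite -[(X.1 + s *: (X.2.1, 0 : vec)).2]/(X.1.2 + s *: (0 : vec)) scaler0 addr0.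
by apply: le_trans (le_coord_jap _ _) _; exact: jap_le_jap2l.
Qed.

(** Differentiating F(x + z, xi) - F(x, xi) in the parameters gives the same kind of difference for
    a derivative of F, and differentiating it in z a single x-derivative of F; so the mean value
    bound can be used at every order. *)
Lemma diffF_sym F : Cinf F ->
 (forall i, sym e2 (ones unit) (fun _ X => jap X.2) (fun _ => dC (e2 (inl i)) F)) ->
 sym e4 one4 (fun _ X => jap X.1.2 * jap2 X.2) (fun _ => diffF F).
Proof.
move=> FC Fs k.
have m0 (X : vec2) : 0 <= jap X.2 by exact: jap_ge0.
have dFC F' : Cinf F' -> Cinf (diffF F') by move=> FC'; apply: Cinf_sub; [exact: Cinf_Yv|exact: Cinf_Xv].
have bF F' : Cinf F' -> (forall i, sym e2 (ones unit) (fun _ X => jap X.2) (fun _ => dC (e2 (inl i)) F')) ->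
  bnd (fun _ : unit => diffF F') (fun _ X => jap X.1.2 * jap2 X.2).
 by move=> FC' Fs'; have [C C0 HC] := diffF_bnd FC' Fs'; exists C => // t X; exact: HC.
elim: k F FC Fs => [|k IH] F FC Fs.
 by apply: symk0 => [t|]; [exact: dFC|exact: bF].
apply: symk_of_dC => [t||i]; [exact: dFC|exact: bF|].
have -> : dC (e4 i) (diffF F) = match i with inl i => diffF (dC (e2 i) F)
  | inr (inl i) => fun X => dC (e2 (inl i)) F (Yv X) | inr (inr _) => fun=> 0 end.
 rewrite /diffF dC_sub; [|exact: Cinf_Yv|exact: Cinf_Xv].
 rewrite Yv_aff Xv_aff; apply/funext => X.
 by case: i => [[i|i]|[i|i]]; rewrite /= ?subr0.
have mm0 (t : unit) (X : P4) : 0 <= jap X.1.2 * jap2 X.2 * 1 by rewrite mulr1 mulr_ge0 ?jap2_ge0.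
case: i => [i|[i|i]].
- have FC' : Cinf (dC (e2 i) F) by exact: Cinf_dC.
 have Fs' j : sym e2 (ones unit) (fun _ X => jap X.2) (fun _ => dC (e2 (inl j)) (dC (e2 i) F)).
  rewrite (dC_comm (e2 i) (e2 (inl j)) FC).
  by apply: sym_eqw (sym_dC i (Fs j)) => t X; rewrite mulr1.
 by apply: symk_le ler01 _ _ (IH _ FC' Fs') => // t X; rewrite mul1r mulr1.
- have H := pullY m0 (Fs i); apply: symk_le ler01 _ _ (H k) => // t X.
 by rewrite mul1r mulr1 ler_peMr// jap2_ge1.
apply: symk_cst => //; exists 0 => // t X; by rewrite Normc.normc0 mul0r.
Qed.

Local Notation sgc := (sgp (fun X => jap X.2)).

Definition phdiff (X : P4) : R := phi (Yv X).1 (Yv X).2 - phi X.1.1 X.1.2.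

Lemma phdiffE : (fun X => (phdiff X)%:C) = diffF phC'.
Proof. by apply/funext => X; rewrite rmorphB. Qed.
Lemma phC'C : Cinf phC'. Proof. exact: (sym_Cinf tt phi_sym). Qed.
Lemma phdiffC : Cinf (fun X => (phdiff X)%:C).
Proof. by rewrite phdiffE; apply: Cinf_sub; [exact: (Cinf_Yv phC'C)|exact: (Cinf_Xv phC'C)]. Qed.

Lemma sgc_ge1 i t X : 1 <= sgc i t X. Proof. by apply: sgp_ge1 => Y; exact: jap_ge1. Qed.
Lemma sgc_ge0 i t X : 0 <= sgc i t X. Proof. exact: le_trans ler01 (sgc_ge1 i t X). Qed.
Lemma sgc_of_one m F : (forall t X, 0 <= m t X) -> sym e4 one4 m F -> sym e4 sgc m F.
Proof.
move=> m0 H; apply: (sym_sg (K := 1) _ _ _ H) => // i t X.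
by rewrite mul1r ler01 sgc_ge1.
Qed.

Lemma e2_phi2 i j : exists2 m : vec2 -> R, (forall X, m X <= jap X.2) &
 (forall X, 0 <= m X) /\ sym e2 (ones unit) (fun _ => m) (fun _ => dC (e2 (inl j)) (dC (e2 i) phC')).
Proof.

rewrite (dC_comm (e2 i) (e2 (inl j)) phC'C).
exists (fun X => jap X.2); first by [].
split; first by move=> X; exact: jap_ge0.
have H := symSG_one ler01 ler01 (fun _ xi => jap_ge0 xi) (phix_sym j).
by apply: sym_eqw (sym_dC i H) => t X; rewrite mulr1.
Qed.

(** A derivative costs <xi> and a power of [jap2], but no power of <x>: the x-derivatives of phi and
    of its first derivatives are at most of the order of <xi>. *)
Lemma expi_phdiff_sym : sym e4 sgc (fun _ _ => 1) (fun _ X => expi (phdiff X)).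
Proof.
have jpos (X : vec2) : 0 <= jap X.2 by exact: jap_ge0.
apply: sym_expi => [_|i]; first exact: phdiffC.
rewrite phdiffE.
have -> : dC (e4 i) (diffF phC') = match i with inl i => diffF (dC (e2 i) phC')
  | inr (inl i) => fun X => dC (e2 (inl i)) phC' (Yv X) | inr (inr _) => fun=> 0 end.
 rewrite /diffF dC_sub; [|exact: (Cinf_Yv phC'C)|exact: (Cinf_Xv phC'C)].
 rewrite Yv_aff Xv_aff; apply/funext => X.
 by case: i => [[i|i]|[i|i]]; rewrite /= ?subr0.
case: i => [i|[i|i]].
- apply: sgc_of_one => [t X|]; first exact: sgc_ge0.
 have FC : Cinf (dC (e2 i) phC') by exact: Cinf_dC phC'C.
 have Fs j : sym e2 (ones unit) (fun _ X => jap X.2) (fun _ => dC (e2 (inl j)) (dC (e2 i) phC')).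
  have [m mle [m0 mS]] := e2_phi2 i j.
  by apply: sym_le ler01 _ _ mS => // t X; rewrite mul1r.
 exact: diffF_sym FC Fs.
- apply: sgc_of_one => [t X|]; first exact: sgc_ge0.
 exact: (pullY jpos (symSG_one ler01 ler01 (fun _ xi => jap_ge0 xi) (phix_sym i))).
apply: sym_cst => [t X|i' t X|]; [exact: sgc_ge0|exact: sgc_ge0|].
by exists 0 => // t X; rewrite Normc.normc0 mul0r.
Qed.

Lemma jap0 : jap (0 : vec) = 1.
Proof. by rewrite /jap /dotv big1 ?addr0 ?sqrtr1// => i _; rewrite mxE mul0r. Qed.

Lemma aY_sym : exists m : nat, sym e4 sgc (fun _ X => w1 X.1.1 X.1.2 * jap2 X.2 ^+ m) (fun _ X => ca D (Yv X).1 (Yv X).2).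
Proof.
have /andP[r0 _] := cr1_01 D; have /andP[rho0 _] := crho1_01 D.
have [C C0 [m H]] := weight_mod (chw1 D); exists m.
apply: sgc_of_one => [t X|]; first by rewrite mulr_ge0 ?w1_ge0 ?exprn_ge0 ?jap2_ge0.
have as1 := symSG_one r0 rho0 w1_ge0 (SG_sym w1_ge0 (cha D)).
have := pullY (m := fun X => w1 X.1 X.2) (fun X => w1_ge0 _ _) as1.
apply: (sym_le C0 _ _) => // t X.
have := H X.1.1 X.1.2 X.2.1 0; rewrite addr0 jap0 mulr1 => /le_trans; apply.
rewrite -[leLHS]mulrA ler_wpM2l// ler_wpM2l ?w1_ge0// ler_Xn ?jap_ge0 ?jap2_ge0//.
exact: jap_le_jap2l.
Qed.

(** Moderation of w2 between eta and th; since <th> is comparable to <xi>, the price is a power of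
    <xi> and <eta>. *)
Lemma w2_shift : exists2 C : R, 0 <= C & exists m : nat, forall x xi eta,
 w2 x eta <= C * w2 x (gradx phi x xi) * (jap xi * jap eta) ^+ m.
Proof.
have [C C0 [m H]] := weight_mod (chw2 D); have [C' C'0 HC'] := thv_jap.
exists (C * (2 * C') ^+ m); first by rewrite mulr_ge0// exprn_ge0// mulr_ge0.
exists m => x xi eta; set th := gradx phi x xi.
have := H x th 0 (eta - th); rewrite addr0 addrC subrK jap0 mul1r => /le_trans; apply.
have -> : C * (2 * C') ^+ m * w2 x th * (jap xi * jap eta) ^+ m = C * w2 x th * ((2 * C') * (jap xi * jap eta)) ^+ m.
 by rewrite [(_ * _ * (_ * _)) ^+ m]exprMn; ring.
rewrite ler_wpM2l ?mulr_ge0 ?w2_ge0// ler_Xn ?mulr_ge0 ?jap_ge0//.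
apply: le_trans (japD _ _) _; rewrite japN.
have := (HC' (x, xi)).1; rewrite /thv /= -/th => h.
rewrite -mulrA ler_wpM2l// mulrC [C' * _]mulrA ler_wpM2r ?jap_ge0//.
Qed.

Lemma pE_sym : exists m : nat, sym e4 sgc (fun _ X => w2 X.1.1 (thv X.1) * jap X.1.2 ^+ m * jap2 X.2 ^+ m)
 (fun _ X => cp D (Ev X).1 (Ev X).2).
Proof.
have /andP[r0 _] := cr2_01 D.
have [C C0 [m H]] := w2_shift; exists m.
apply: sgc_of_one => [t X|]; first by rewrite !mulr_ge0 ?w2_ge0 ?exprn_ge0 ?jap2_ge0 ?jap_ge0.
have as1 := symSG_one r0 ler01 w2_ge0 (SG_sym w2_ge0 (chp D)).
have := pullE (m := fun X => w2 X.1 X.2) (fun X => w2_ge0 _ _) as1.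
apply: (sym_le C0 _ _) => // t X.
apply: le_trans (H X.1.1 X.1.2 X.2.2) _; rewrite -[leLHS]mulrA -[w2 _ _ * _ * _]mulrA ler_wpM2l// ler_wpM2l ?w2_ge0// exprMn.
rewrite ler_wpM2l ?exprn_ge0 ?jap_ge0// ler_Xn ?jap_ge0 ?jap2_ge0//; exact: jap_le_jap2r.
Qed.

Definition BB (X : P4) : R[i] := expi (phdiff X) * (cp D (Ev X).1 (Ev X).2 * ca D (Yv X).1 (Yv X).2).

Lemma BB_sym : exists m M : nat, sym e4 sgc (fun _ X => w0 X.1.1 X.1.2 * jap X.1.2 ^+ m * jap2 X.2 ^+ M) (fun _ => BB).
Proof.
have [m1 H1] := aY_sym; have [m2 H2] := pE_sym.
exists m2, (m2 + m1)%N; apply: sym_eqw (sym_mul expi_phdiff_sym (sym_mul H2 H1)) => t X.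
by rewrite cw0E exprD /thv; ring.
Qed.

Lemma jap_mod2 k : moderate (fun X : vec2 => jap X.2 ^+ k).
Proof.
exists (2 ^+ k); first exact: exprn_ge0.
exists k => X Y; rewrite -!exprMn ler_Xn ?mulr_ge0 ?jap_ge0//.
apply: le_trans (japD _ _) _; rewrite -mulrA ler_wpM2l// ler_wpM2l ?jap_ge0//.
by rewrite ler_peMl ?jap_ge0// jap_ge1.
Qed.
Lemma w0_mod : moderate (fun X => w0 X.1 X.2).
Proof.
have [C C0 [m H]] := weight_mod (chw0 D).
by exists C => //; exists m => X Y; exact: H.
Qed.
Lemma moderate_mul (mu nu : vec2 -> R) : (forall X, 0 <= mu X) -> (forall X, 0 <= nu X) ->
 moderate mu -> moderate nu -> moderate (fun X => mu X * nu X).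
Proof.
move=> mu0 nu0 [C C0 [m H]] [C' C'0 [m' H']].
exists (C * C'); first exact: mulr_ge0.
exists (m + m')%N => X Y; apply: le_trans (ler_pM _ _ (H X Y) (H' X Y)) _ => //.
by rewrite exprD; apply: eqW_le; ring.
Qed.

Definition norm_cst : R[i] := (((2 * pi) ^+ d)^-1)%:C.
Definition cc (x xi : vec) : R[i] := norm_cst * osc (fun v => BB ((x, xi), v)).

(** The exponent K depends on the derivative and the loss is in <xi> only: this is the crude control
    used in the interpolation. *)
Lemma cc_crude : Cinf (fun X : vec2 => cc X.1 X.2) /\ forall w, exists2 C : R, 0 <= C & exists K, forall X : vec2,
 normc (Dw e2 w (fun X => cc X.1 X.2) X) <= C * (w0 X.1 X.2 * jap X.2 ^+ K).
Proof.
have [m [M BS]] := BB_sym.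
pose mu (X : vec2) := w0 X.1 X.2 * jap X.2 ^+ m.
have mu0 X : 0 <= mu X by rewrite mulr_ge0 ?w0_ge0 ?exprn_ge0 ?jap_ge0.
have mm : moderate mu.
 by apply: moderate_mul (jap_mod2 m); [move=> X; exact: w0_ge0|move=> X; rewrite exprn_ge0 ?jap_ge0|exact: w0_mod].
have sm : moderate (fun X : vec2 => jap X.2) by have := jap_mod2 1.
have [[oC _] oB] := osc_param mu0 (fun X => jap_ge1 X.2) mm sm BS.
have E : (fun X : vec2 => cc X.1 X.2) = fun X => norm_cst * osc (fun v => BB (X, v)).
 by apply/funext => -[x xi].
rewrite E; split; first exact: Cinf_scale.
move=> w; have [C C0 [K HC]] := oB w; exists (normc norm_cst * C); first by rewrite mulr_ge0 ?normc_ge0.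
exists (m + K)%N => X; rewrite Dw_scale// Normc.normcM -mulrA ler_wpM2l ?normc_ge0//.
by apply: le_trans (HC X) _; rewrite /mu -mulrA exprD.
Qed.

Lemma BB_tame X : tame (fun v => BB (X, v)).
Proof.
have [m [M BS]] := BB_sym.
have mu0 X' : 0 <= w0 X'.1 X'.2 * jap X'.2 ^+ m by rewrite mulr_ge0 ?w0_ge0 ?exprn_ge0 ?jap_ge0.
exact: (tame_of_sym (fun X => jap_ge1 X.2) mu0 (sec_family BS) X).
Qed.

(** The rate is polynomial in xi for fixed x, so that a rapidly decreasing function of xi makes it
    integrable when the cutoff is removed under the xi-integral. *)
Lemma BB_rate : exists2 C : R, 0 <= C & exists K, forall X e, 0 < e <= 1 ->
 normc (Lcut e (fun v => BB (X, v)) - osc (fun v => BB (X, v))) <= C * (w0 X.1 X.2 * jap X.2 ^+ K) * e.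
Proof.
have [m [M BS]] := BB_sym.
have mu0 X' : 0 <= w0 X'.1 X'.2 * jap X'.2 ^+ m by rewrite mulr_ge0 ?w0_ge0 ?exprn_ge0 ?jap_ge0.
have [C C0 [K H]] := osc_family (fun X => jap_ge1 X.2) mu0 (sec_family BS).
exists C => //; exists (m + K)%N => X e e01; have := (H X).2 e e01.
by rewrite exprD [w0 _ _ * (_ * _)]mulrA.
Qed.

End crude_estimates.

(** * Integration by parts at anisotropic scales *)

Section scales.
Local Notation th := (thv).

Lemma enorm_e2l (z : vec) : (z, 0) = \sum_i z 0 i *: e2 (inl i).
Proof. by rewrite [LHS]co2_sum big_sumType /= [X in _ + X]big1 ?addr0// => i _; rewrite mxE scale0r. Qed.
Lemma enorm_e2r (z : vec) : (0, z) = \sum_i z 0 i *: e2 (inr i).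
Proof. by rewrite [LHS]co2_sum big_sumType /= [X in X + _]big1 ?add0r// => i _; rewrite mxE scale0r. Qed.

Lemma dC_dir_bound (F : vec2 -> R[i]) (J : 'I_d -> I2) (z : vec) v (B : R) X : Cinf F ->
 v = \sum_i z 0 i *: e2 (J i) -> (forall i, normc (dC (e2 (J i)) F X) <= B) ->
 normc (dC v F X) <= d%:R * enorm z * B.
Proof.
move=> FC E H.
have -> : dC v F = fun Z => \sum_i (z 0 i)%:C * dC (e2 (J i)) F Z by rewrite -dC_sumv// -E.
apply: le_trans (le_normc_sum _ _) _.
apply: (@le_trans _ _ (\sum_(i < d) enorm z * B)).
 by apply: ler_sum => i _; rewrite Normc.normcM normcR; apply: ler_pM; rewrite ?normc_ge0// le_coord_enorm.
by rewrite sumr_const card_ord -mulrA mulr_natl.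
Qed.

Lemma enorm_scale_le (s : R) (z : vec) : 0 <= s <= 1 -> enorm (s *: z) <= enorm z.
Proof.
by move=> /andP[s0 s1]; rewrite enormZ ger0_norm// ler_piMl// enorm_ge0.
Qed.

(** On this ball <x> is at most twice <x + s z>, and the logarithmic derivative of w1 in x is
    O(<x>^-r1), so [log_lipschitz] applies. *)
Lemma w1_slow : exists2 C : R, 0 <= C & forall x z xi, enorm z <= jap x `^ r1 / 2 ->
 w1 (x + z) xi <= C * w1 x xi.
Proof.
have /andP[r0 r1'] := cr1_01 D.
have WC := weight_C (chw1 D).
have [/= Ci HCi] := choice (fun i => ex2_intro_choice (sym_bnd (sym_dC (inl i) (weight_sym (chw1 D))))).
pose K := \sum_i Ci i; have K0 : 0 <= K by apply: sumr_ge0 => i _; case: (HCi i).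
have HK i X : normc (dC (e2 (inl i)) (fun X : vec2 => (w1 X.1 X.2)%:C) X) <= K * (w1 X.1 X.2 * jap X.1 `^ (- r1)).
 apply: le_trans ((HCi i).2 tt X) _; rewrite ler_wpM2r ?mulr_ge0 ?w1_ge0 ?powR_ge0//.
 by rewrite /K (bigD1 i)//= lerDl sumr_ge0// => j _; case: (HCi j).
exists (expR (d%:R * K)); first exact: expR_ge0.
move=> x z xi zx.
have := @log_lipschitz R _ (fun X : vec2 => w1 X.1 X.2) (x, xi) (z, 0) (d%:R * K) WC (fun X => weight_gt0 (chw1 D) X.1 X.2) _.
rewrite -[(x, xi) + (z, 0 : vec)]/(x + z, xi + 0) addr0; apply=> s s01.
have -> : (x, xi) + s *: (z, 0 : vec) = (x + s *: z, xi).
 by rewrite -[LHS]/(x + s *: z, xi + s *: (0 : vec)) scaler0 addr0.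
apply: le_trans (dC_dir_bound WC (enorm_e2l z) (fun i => HK i _)) _ => /=.
have W0 := w1_ge0 (x + s *: z) xi.
have j1 : jap x `^ r1 <= jap x by rewrite -[leRHS]powRr1 ?jap_ge0// ler_powR// jap_ge1.
have jx : jap x <= 2 * jap (x + s *: z).
 apply: jap_near; apply: le_trans (enorm_scale_le z s01) _; apply: le_trans zx _.
 by rewrite ler_wpM2r.
have jr : jap x `^ r1 <= 2 * jap (x + s *: z) `^ r1.
 apply: le_trans (ge0_ler_powR r0 _ _ jx) _; rewrite ?nnegrE ?mulr_ge0 ?jap_ge0//.
 rewrite powRM ?jap_ge0// ler_wpM2r ?powR_ge0//.
 by rewrite -[leRHS]powRr1// ler_powR// ler1n.
have ez : enorm z * jap (x + s *: z) `^ (- r1) <= 1.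
 rewrite powRN ler_pdivrMr ?powR_gt0 ?jap_gt0// mul1r; lra.
have -> : d%:R * enorm z * (K * (w1 (x + s *: z) xi * jap (x + s *: z) `^ (- r1))) =
 d%:R * K * w1 (x + s *: z) xi * (enorm z * jap (x + s *: z) `^ (- r1)) by ring.
by rewrite ler_piMr// !mulr_ge0.
Qed.

(** The hypothesis rho2 = 1 enters here: w2 varies slowly on balls of radius proportional to <xi>,
    the size of th. *)
Lemma w2_slow : exists2 C : R, 0 <= C & forall x xi z, enorm z <= jap xi / 2 ->
 w2 x (xi + z) <= C * w2 x xi.
Proof.
have WC := weight_C (chw2 D).
have [/= Ci HCi] := choice (fun i => ex2_intro_choice (sym_bnd (sym_dC (inr i) (weight_sym (chw2 D))))).
pose K := \sum_i Ci i; have K0 : 0 <= K by apply: sumr_ge0 => i _; case: (HCi i).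
have HK i X : normc (dC (e2 (inr i)) (fun X : vec2 => (w2 X.1 X.2)%:C) X) <= K * (w2 X.1 X.2 * jap X.2 `^ (- 1)).
 apply: le_trans ((HCi i).2 tt X) _; rewrite ler_wpM2r ?mulr_ge0 ?w2_ge0 ?powR_ge0//.
 by rewrite /K (bigD1 i)//= lerDl sumr_ge0// => j _; case: (HCi j).
exists (expR (d%:R * K)); first exact: expR_ge0.
move=> x xi z zx.
have := @log_lipschitz R _ (fun X : vec2 => w2 X.1 X.2) (x, xi) (0, z) (d%:R * K) WC (fun X => weight_gt0 (chw2 D) X.1 X.2) _.
rewrite -[(x, xi) + (0 : vec, z)]/(x + 0, xi + z) addr0; apply=> s s01.
have -> : (x, xi) + s *: (0 : vec, z) = (x, xi + s *: z).
 by rewrite -[LHS]/(x + s *: (0 : vec), xi + s *: z) scaler0 addr0.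
apply: le_trans (dC_dir_bound WC (enorm_e2r z) (fun i => HK i _)) _ => /=.
have W0 := w2_ge0 x (xi + s *: z).
have jx : jap xi <= 2 * jap (xi + s *: z).
 by apply: jap_near; apply: le_trans (enorm_scale_le z s01) _.
have ez : enorm z * jap (xi + s *: z) `^ (- 1) <= 1.
 rewrite powRN1 ler_pdivrMr ?jap_gt0// mul1r; lra.
have -> : d%:R * enorm z * (K * (w2 x (xi + s *: z) * jap (xi + s *: z) `^ (- 1))) =
 d%:R * K * w2 x (xi + s *: z) * (enorm z * jap (xi + s *: z) `^ (- 1)) by ring.
by rewrite ler_piMr// !mulr_ge0.
Qed.

Lemma th_diff : exists2 C : R, 0 <= C & forall x xi z, enorm z <= jap x / 2 ->
 enorm (th (x + z, xi) - th (x, xi)) <= C * (jap xi / jap x * enorm z).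
Proof.
have [/= Ci HCi] := choice (fun ij : 'I_d * 'I_d => ex2_intro_choice (sym_bnd (sym_dC (inl ij.1) (phix_sym ij.2)))).
pose K := \sum_ij Ci ij; have K0 : 0 <= K by apply: sumr_ge0 => i _; case: (HCi i).
exists (d%:R * (2 * (d%:R * (2 * K)))); first by rewrite !mulr_ge0.
move=> x xi z zx; apply: le_trans (enorm_sum _) _.
apply: (@le_trans _ _ (\sum_(i < d) 2 * (d%:R * (2 * K)) * (jap xi / jap x * enorm z))); last first.
 by rewrite sumr_const card_ord -[X in X <= _]mulr_natl mulrA.
apply: ler_sum => i _.
have -> : `|(th (x + z, xi) - th (x, xi)) 0 i| = normc (dC (e2 (inl i)) (phC') (x + z, xi) - dC (e2 (inl i)) (phC') (x, xi)).
 by rewrite -!thvE -rmorphB normcR !mxE.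
have E0 : (x + z, xi) = (x, xi) + (z, 0) by rewrite -[RHS]/(x + z, xi + 0) addr0.
have FC : Cinf (dC (e2 (inl i)) (phC')) by exact: (sym_Cinf tt (phix_sym i)).
rewrite E0 -mulrA; apply: mean_value => // s s01.
have -> : (x, xi) + s *: (z, 0 : vec) = (x + s *: z, xi).
 by rewrite -[LHS]/(x + s *: z, xi + s *: (0 : vec)) scaler0 addr0.
have HK j X : normc (dC (e2 (inl j)) (dC (e2 (inl i)) (phC')) X) <= K * (jap X.2 * jap X.1 `^ (- 1)).
 apply: le_trans ((HCi (j, i)).2 tt X) _; rewrite ler_wpM2r ?mulr_ge0 ?jap_ge0 ?powR_ge0//.
 by rewrite /K (bigD1 (j, i))//= lerDl sumr_ge0// => l _; case: (HCi l).
apply: le_trans (dC_dir_bound FC (enorm_e2l z) (fun j => HK j _)) _ => /=.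
have jx : jap x <= 2 * jap (x + s *: z).
 by apply: jap_near; apply: le_trans (enorm_scale_le z s01) _.
have jV : jap (x + s *: z) `^ (- 1) <= 2 / jap x.
 rewrite powRN1 ler_pdivlMr ?jap_gt0// mulrC ler_pdivrMr ?jap_gt0//.
have -> : d%:R * (2 * K) * (jap xi / jap x * enorm z) = d%:R * enorm z * (K * (jap xi * (2 / jap x))) by ring.
by rewrite ler_wpM2l ?mulr_ge0 ?enorm_ge0// ler_wpM2l// ler_wpM2l ?jap_ge0.
Qed.

Definition TT := (vec2 * R)%type.
Implicit Types (t : TT) (v : vec2).
(* Sealed by Qed: unfolding the real powers below makes arithmetic tactics diverge. *)
Lemma Us_key t : {u : R | u = jap t.1.1 `^ (r1 / 4)}. Proof. by eexists. Qed.
Definition Us t : R := sval (Us_key t).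
Lemma UsE t : Us t = jap t.1.1 `^ (r1 / 4). Proof. exact: svalP (Us_key t). Qed.
Lemma Vs_key t : {u : R | u = jap t.1.2 `^ (1 / 4)}. Proof. by eexists. Qed.
Definition Vs t : R := sval (Vs_key t).
Lemma VsE t : Vs t = jap t.1.2 `^ (1 / 4). Proof. exact: svalP (Vs_key t). Qed.
Definition yy t v : vec2 := (t.1.1 + v.1, t.1.2).
Lemma Ya_key t v : {u : R | u = jap (t.1.1 + v.1) `^ (r1 / 4)}. Proof. by eexists. Qed.
Definition Ya t v : R := sval (Ya_key t v).
Lemma YaE t v : Ya t v = jap (t.1.1 + v.1) `^ (r1 / 4). Proof. exact: svalP (Ya_key t v). Qed.
(** Step of the z-derivatives, small enough that its square times <xi> / <y>, the size of the second
    x-derivatives of phi, is at most 1; see [hs2X]. *)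
Lemma hs_key t v : {u : R | u = Ya t v / Vs t ^+ 2}. Proof. by eexists. Qed.
Definition hs t v : R := sval (hs_key t v).
Lemma hsE t v : hs t v = Ya t v / Vs t ^+ 2. Proof. exact: svalP (hs_key t v). Qed.
(** Step of the eta-derivatives. It must be large for |z| <= b / [ks] to be useful, but [hs] times
    [ks], the size of the mixed second derivative of the phase in these units, has to stay below 4
    b; see [hk_le]. *)
Lemma ks_key t : {u : R | u = Vs t / Us t}. Proof. by eexists. Qed.
Definition ks t : R := sval (ks_key t).
Lemma ksE t : ks t = Vs t / Us t. Proof. exact: svalP (ks_key t). Qed.
(** The gain of one Taylor order: up to b^2, a bound for |eta - th| / <xi>, see [zeta_bound]. *)
Lemma ds_key t : {u : R | u = (Us t * Vs t)^-1}. Proof. by eexists. Qed.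
Definition ds t : R := sval (ds_key t).
Lemma dsE t : ds t = (Us t * Vs t)^-1. Proof. exact: svalP (ds_key t). Qed.
(** Division by <x><xi> makes a derivative of the cutoff no more expensive than the cost [sgb] in
    the anisotropic scales; see [eps_sgb]. *)
Definition eps t : R := clamp t.2 / (jap t.1.1 * jap t.1.2).
Definition Gm (i : I2) t v : R :=
 match i with inl j => hs t v * (th (yy t v) 0 j - v.2 0 j) | inr j => - (ks t * v.1 0 j) end.
Lemma bs_key t v : {u : R | u = brk (fun i => Gm i t) v}. Proof. by eexists. Qed.
Definition bs t v : R := sval (bs_key t v).
Lemma bsE t v : bs t v = brk (fun i => Gm i t) v. Proof. exact: svalP (bs_key t v). Qed.

Let r14 : 0 <= r1 / 4. Proof. by have /andP[r0 _] := cr1_01 D; rewrite divr_ge0. Qed.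

Lemma japow_ge1 (x : vec) (s : R) : 0 <= s -> 1 <= jap x `^ s.
Proof.
move=> s0; apply: (@le_trans _ _ (1 `^ s)); first by rewrite powR1.
by rewrite ge0_ler_powR ?nnegrE ?jap_ge0// jap_ge1.
Qed.
Lemma Us1 t : 1 <= Us t. Proof. rewrite UsE; exact: japow_ge1. Qed.
Lemma Vs1 t : 1 <= Vs t. Proof. by rewrite VsE; apply: japow_ge1; rewrite divr_ge0. Qed.
Lemma Ya1 t v : 1 <= Ya t v. Proof. rewrite YaE; exact: japow_ge1. Qed.
Lemma Us4 t : Us t ^+ 4 = jap t.1.1 `^ r1.
Proof. by rewrite UsE -powR_mulrn ?powR_ge0// -powRrM; congr (_ `^ _); rewrite -mulrA mulVf ?mulr1// pnatr_eq0. Qed.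
Lemma Vs4 t : Vs t ^+ 4 = jap t.1.2.
Proof. by rewrite VsE -powR_mulrn ?powR_ge0// -powRrM -mulrA mul1r mulVf ?powRr1 ?jap_ge0// pnatr_eq0. Qed.
Lemma Ya4 t v : Ya t v ^+ 4 = jap (t.1.1 + v.1) `^ r1.
Proof. by rewrite YaE -powR_mulrn ?powR_ge0// -powRrM; congr (_ `^ _); rewrite -mulrA mulVf ?mulr1// pnatr_eq0. Qed.
Lemma powr1_le (x : vec) : jap x `^ r1 <= jap x.
Proof. by have /andP[r0 r1'] := cr1_01 D; rewrite -[leRHS]powRr1 ?jap_ge0// ler_powR// jap_ge1. Qed.
Lemma Us4X t : Us t ^+ 4 <= jap t.1.1. Proof. by rewrite Us4 powr1_le. Qed.
Lemma Ya4Y t v : Ya t v ^+ 4 <= jap (t.1.1 + v.1). Proof. by rewrite Ya4 powr1_le. Qed.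
Lemma hs_gt0 t v : 0 < hs t v.
Proof. by rewrite hsE divr_gt0 ?exprn_gt0// (lt_le_trans ltr01)// ?Ya1 ?Vs1. Qed.
Lemma ks_gt0 t : 0 < ks t.
Proof. by rewrite ksE divr_gt0// (lt_le_trans ltr01)// ?Us1 ?Vs1. Qed.
Lemma bs1 t v : 1 <= bs t v. Proof. rewrite bsE; exact: brk_ge1. Qed.

Lemma sqr_bs t v : bs t v ^+ 2 = 1 + (hs t v * enorm (th (yy t v) - v.2)) ^+ 2 + (ks t * enorm v.1) ^+ 2.
Proof.
rewrite bsE sqr_brk /brk2 big_sumType /= addrA; congr (1 + _ + _).
 rewrite exprMn sqr_enorm /dotv mulr_sumr; apply: eq_bigr => i _.
 by rewrite !mxE exprMn expr2 -expr2.
rewrite exprMn sqr_enorm /dotv mulr_sumr; apply: eq_bigr => i _.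
by rewrite sqrrN exprMn [v.1 0 i ^+ 2]expr2.
Qed.
Lemma kz_le t v : ks t * enorm v.1 <= bs t v.
Proof.
apply: le_of_sqr; first exact: le_trans ler01 (bs1 t v).
by rewrite sqr_bs lerDr addr_ge0 ?sqr_ge0.
Qed.
Lemma hz_le t v : hs t v * enorm (th (yy t v) - v.2) <= bs t v.
Proof.
apply: le_of_sqr; first exact: le_trans ler01 (bs1 t v).
by rewrite sqr_bs addrAC lerDr addr_ge0 ?sqr_ge0.
Qed.
(* All comparisons of scales below are inequalities between the three quantities U, V and b. *)
Lemma z_le t v : enorm v.1 <= bs t v * Us t / Vs t.
Proof.
have := kz_le t v; have U0 := lt_le_trans ltr01 (Us1 t); have V0 := lt_le_trans ltr01 (Vs1 t).
rewrite ksE => h; rewrite ler_pdivlMr//; move: h; rewrite mulrAC ler_pdivrMr//.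
by rewrite [_ * Vs t]mulrC.
Qed.
Lemma z_le1 t v : enorm v.1 <= bs t v * Us t.
Proof.
apply: le_trans (z_le t v) _; have V1 := Vs1 t; have U1 := Us1 t; have b1 := bs1 t v.
rewrite ler_pdivrMr ?(lt_le_trans ltr01)// ler_peMr// mulr_ge0//; lra.
Qed.

Lemma Ya_le t v : Ya t v <= 4 * (bs t v * Us t).
Proof.
have U1 := Us1 t; have b1 := bs1 t v; have X1 := jap_ge1 t.1.1.
have UX : Us t <= jap t.1.1.
 by apply: le_trans (Us4X t); rewrite -[leLHS]expr1 ler_weXn2l.
have YX : jap (t.1.1 + v.1) <= 4 * bs t v * jap t.1.1.
 apply: le_trans (jap_add _ _) _; have := z_le1 t v => h.
 have : bs t v * Us t <= bs t v * jap t.1.1 by rewrite ler_wpM2l//; lra.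
 by nra.
rewrite YaE [X in 4 * (_ * X)]UsE; apply: le_trans (ge0_ler_powR r14 _ _ YX) _; rewrite ?nnegrE ?mulr_ge0 ?jap_ge0//; [lra|].
rewrite powRM ?mulr_ge0 ?jap_ge0//; last lra.
rewrite [leRHS]mulrA ler_wpM2r ?powR_ge0// -[leRHS]powRr1; last by rewrite mulr_ge0//; lra.
have /andP[r0 r1'] := cr1_01 D; rewrite ler_powR//; [nra|].
by rewrite ler_pdivrMr// mul1r; lra.
Qed.

Lemma hk_le t v : hs t v * ks t <= 4 * bs t v.
Proof.
have := Ya_le t v; have U0 := lt_le_trans ltr01 (Us1 t); have V1 := Vs1 t; have b1 := bs1 t v.
have V0 : 0 < Vs t by lra.
have -> : hs t v * ks t = Ya t v / Us t / Vs t by rewrite hsE ksE; field; rewrite !gt_eqF.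
move=> h; rewrite ler_pdivrMr// ler_pdivrMr//.
by apply: le_trans h _; rewrite -!mulrA ler_wpM2l// ler_wpM2l ?ler_peMl//; lra.
Qed.

(** If |z| exceeds half of <x>^r1 = U^4, then [kz_le] gives V U^3 <= 2 b. So outside the region
    where w1 varies slowly, b dominates the inverse of the gain. *)
Lemma dichotomy t v : enorm v.1 <= jap t.1.1 `^ r1 / 2 \/ Us t * Vs t <= 2 * bs t v.
Proof.
case: (lerP (enorm v.1) (jap t.1.1 `^ r1 / 2)) => h; [by left|right].
have U1 := Us1 t; have V1 := Vs1 t; have b1 := bs1 t v.
have := kz_le t v; rewrite -Us4 in h; rewrite ksE mulrAC ler_pdivrMr ?(lt_le_trans ltr01)// => h2.
have h3 : Vs t * (Us t ^+ 4 / 2) <= bs t v * Us t.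
 by apply: le_trans h2; rewrite ler_wpM2l ?(le_trans ler01)// ltW.
have h4 : Vs t * Us t ^+ 3 <= 2 * bs t v.
 rewrite -(@ler_pM2r _ (Us t)) ?(lt_le_trans ltr01)// -[Vs t * _ * _]mulrA -exprSr; lra.
apply: le_trans h4; rewrite mulrC ler_wpM2l ?(le_trans ler01)// -[leLHS]expr1 ler_weXn2l//.
Qed.

Lemma jap_z_le t v : jap v.1 <= 2 * (bs t v * Us t).
Proof.
apply: le_trans (jap_le1D _) _; have := z_le1 t v; have := Us1 t; have := bs1 t v => b1 u1 h.
have : 1 <= bs t v * Us t by rewrite mulr_ege1.
lra.
Qed.

Lemma Us_near t v : enorm v.1 <= jap t.1.1 / 2 -> Us t <= 2 * Ya t v.
Proof.
move=> zx; have XY : jap t.1.1 <= 2 * jap (t.1.1 + v.1) by exact: jap_near.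
rewrite UsE YaE.
apply: le_trans (ge0_ler_powR r14 _ _ XY) _; rewrite ?nnegrE ?mulr_ge0 ?jap_ge0//.
rewrite powRM ?jap_ge0// ler_wpM2r ?powR_ge0// -[leRHS]powRr1//.
have /andP[r0 r1'] := cr1_01 D; rewrite ler_powR ?ler1n//.
by rewrite ler_pdivrMr// mul1r (le_trans r1')// ler1n.
Qed.

(** Slow variation in the first case of [dichotomy]. In the second, U <= 2 b and <z> <= 4 b^2, so
    polynomial moderation costs only powers of b. *)
Lemma w1_bound : exists2 C : R, 0 <= C & exists m : nat, forall t v,
 w1 (t.1.1 + v.1) t.1.2 <= C * (w1 t.1.1 t.1.2 * bs t v ^+ m).
Proof.
have [C C0 HC] := w1_slow; have [C' C'0 [m H]] := weight_mod (chw1 D).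
exists (C + C' * 4 ^+ m); first by rewrite addr_ge0// mulr_ge0// exprn_ge0.
exists (m + m)%N => t v; have b1 := bs1 t v; have W0 := w1_ge0 t.1.1 t.1.2.
have bm : 1 <= bs t v ^+ (m + m) by rewrite exprn_ege1.
have [zs|ub] := dichotomy t v.
 apply: le_trans (HC _ _ t.1.2 zs) _; apply: (@le_trans _ _ ((C + C' * 4 ^+ m) * w1 t.1.1 t.1.2)).
  by rewrite ler_wpM2r// lerDl mulr_ge0// exprn_ge0.
 by rewrite ler_wpM2l ?ler_peMr// addr_ge0// mulr_ge0// exprn_ge0.
have := H t.1.1 t.1.2 v.1 0; rewrite addr0 jap0 mulr1 => /le_trans; apply.
have jz : jap v.1 <= 4 * bs t v ^+ 2.
 apply: le_trans (jap_z_le t v) _; have V1 := Vs1 t; have U1 := Us1 t.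
 have : Us t <= 2 * bs t v by apply: le_trans ub; rewrite ler_peMr//; lra.
 by rewrite expr2; nra.
have -> : (C + C' * 4 ^+ m) * (w1 t.1.1 t.1.2 * bs t v ^+ (m + m)) =
  C * (w1 t.1.1 t.1.2 * bs t v ^+ (m + m)) + C' * w1 t.1.1 t.1.2 * (4 * bs t v ^+ 2) ^+ m.
 by rewrite exprMn -exprM mul2n addnn; ring.
rewrite ler_wpDl ?mulr_ge0 ?exprn_ge0//; first lra.
by rewrite ler_wpM2l ?mulr_ge0// ler_Xn ?jap_ge0 ?mulr_ge0 ?exprn_ge0//; lra.
Qed.

(** The difference is split at th(y). The distance from eta to th(y) is at most b / [hs]; that from
    th(y) to th(x) follows from [th_diff] if |z| <= <x> / 2. Otherwise both vectors are O(<xi>) and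
    U V <= 2 b pays for it. *)
Lemma zeta_bound : exists2 C : R, 0 <= C & forall t v,
 enorm (v.2 - th t.1) <= C * (jap t.1.2 * ds t * bs t v ^+ 2).
Proof.
have [C C0 HC] := th_diff; have [C' C'0 HC'] := thv_jap.
exists (2 * (2 + C + 8 * C')); first by rewrite mulr_ge0// !addr_ge0// mulr_ge0.
move=> t v; have b1 := bs1 t v; have V1 := Vs1 t; have U1 := Us1 t; have Y1 := Ya1 t v.
have V0 : 0 < Vs t by exact: lt_le_trans ltr01 V1.
have U0 : 0 < Us t by exact: lt_le_trans ltr01 U1.
have -> : v.2 - th t.1 = - (th (yy t v) - v.2) + (th (yy t v) - th t.1).
 by rewrite opprB addrA subrK.
apply: le_trans (enormD _ _) _; rewrite enormN -[leRHS]mulrA ler_wpM2l//.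
have -> : jap t.1.2 * ds t * bs t v ^+ 2 = Vs t ^+ 3 * bs t v ^+ 2 / Us t.
 by rewrite dsE -Vs4 scale_id1.
have hz : enorm (th (yy t v) - v.2) <= bs t v * Vs t ^+ 2 / Ya t v.
 have := hz_le t v; rewrite hsE => h; rewrite ler_pdivlMr ?(lt_le_trans ltr01 Y1)//.
 by move: h; rewrite mulrAC ler_pdivrMr ?exprn_gt0// mulrC.
have big : 0 <= Vs t ^+ 3 * bs t v ^+ 2 / Us t.
 by rewrite divr_ge0 ?mulr_ge0 ?exprn_ge0// ?(ltW V0) ?(ltW U0)// (le_trans ler01).
case: (lerP (enorm v.1) (jap t.1.1 / 2)) => zx.
 have p1 := le_trans hz (scale_ineq1 b1 V1 U1 Y1 (Us_near zx)).
 have p2 : enorm (th (yy t v) - th t.1) <= C * (Vs t ^+ 3 * bs t v ^+ 2 / Us t).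
  have := HC t.1.1 t.1.2 v.1 zx; rewrite -surjective_pairing => h; apply: le_trans h _.
  rewrite ler_wpM2l// -Vs4; exact: scale_ineq2 b1 V1 U1 (Us4X t) (z_le t v).
 apply: le_trans (lerD p1 p2) _; rewrite -mulrDl ler_wpM2r// lerDl mulr_ge0//.
have UV : Us t * Vs t <= 2 * bs t v.
 have [zs|//] := dichotomy t v; exfalso.
 have h : enorm v.1 <= jap t.1.1 / 2 by apply: le_trans zs _; rewrite ler_wpM2r ?invr_ge0// powr1_le.
 by move: zx; rewrite ltNge h.
have p1 := le_trans hz (scale_ineq3 b1 V1 U1 Y1 UV).
have p2 : enorm (th (yy t v) - th t.1) <= 8 * C' * (Vs t ^+ 3 * bs t v ^+ 2 / Us t).
 apply: le_trans (enormD _ _) _; rewrite enormN.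
 have e1 : enorm (th (yy t v)) <= C' * Vs t ^+ 4.
  by rewrite Vs4; apply: le_trans (HC' (yy t v)).1; exact: enorm_le_jap.
 have e3 : enorm (th t.1) <= C' * Vs t ^+ 4.
  by rewrite Vs4; apply: le_trans (HC' t.1).1; exact: enorm_le_jap.
 apply: (@le_trans _ _ (2 * (C' * Vs t ^+ 4 + C' * Vs t ^+ 4))); first by rewrite ler_wpM2l// lerD.
 have e5 := ler_wpM2l C'0 (scale_ineq4 b1 V1 U1 UV).
 apply: (@le_trans _ _ (4 * (C' * (2 * (Vs t ^+ 3 * bs t v ^+ 2 / Us t))))); last first.
  by apply: eqW_le; ring.
 have -> : 2 * (C' * Vs t ^+ 4 + C' * Vs t ^+ 4) = 4 * (C' * Vs t ^+ 4) by ring.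
 by rewrite ler_wpM2l.
by apply: le_trans (lerD p1 p2) _; rewrite -mulrDl ler_wpM2r// lerD2r lerDl.
Qed.

(** eta is compared with th(y) and th(y) with th(x). If eta is close to th(y), w2 varies slowly and
    <eta> is of order <xi> at least. If not, V^2 <= C b, and a power of b absorbs both the
    moderation of w2 and the missing decay in eta. The exponent m does not depend on n. *)
Lemma w2_bound : exists2 C : R, 1 <= C & exists m : nat, forall t v (n : nat),
 w2 t.1.1 v.2 * jap v.2 ^- n <= C ^+ n.+1 * (w2 t.1.1 (th t.1) * bs t v ^+ m * (Num.sqrt (bs t v) / ks t) ^+ n).
Proof.
have [Cs Cs0 Hs] := w2_slow; have [Cm Cm0 [m Hm]] := weight_mod (chw2 D); have [Ct Ct0 Ht] := thv_jap.
have [ci ci0 Hi] := chinv D.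
pose Cb := 2 * Ct + 1.
pose C := 1 + (Cs + Cm * (2 * Cb) ^+ m) * ci + Cb * 2.
have Cb1 : 1 <= Cb by rewrite /Cb; lra.
have C1 : 1 <= C.
 rewrite /C -addrA lerDl addr_ge0 ?mulr_ge0 ?addr_ge0 ?mulr_ge0 ?exprn_ge0 ?(ltW ci0)//; lra.
have CCb : 2 * Cb <= C.
 by rewrite /C [Cb * 2]mulrC lerDr addr_ge0// mulr_ge0 ?addr_ge0 ?mulr_ge0 ?exprn_ge0 ?(ltW ci0)//; lra.
have CC : (Cs + Cm * (2 * Cb) ^+ m) * ci <= C by rewrite /C; lra.
exists C => //; exists (2 * m)%N => t v n.
have b1 := bs1 t v; have V1 := Vs1 t; have U1 := Us1 t; have Y1 := Ya1 t v.
have [b bE] : exists b, b = bs t v by exists (bs t v).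
rewrite -?bE in b1 *; have [V VE] : exists V, V = Vs t by exists (Vs t).
rewrite -?VE in V1 *; have [U UE] : exists U, U = Us t by exists (Us t).
rewrite -?UE in U1 *.
have be1 : 1 <= Num.sqrt b by rewrite -sqrtr1 ler_wsqrtr.
have k0 := ks_gt0 t; have V0 : 0 < V by lra.
have U0 : 0 < U by lra.
have kV : ks t <= V by rewrite ksE -?VE -?UE ler_pdivrMr// ler_peMr// ltW.
pose thy := th (yy t v).
(* The invariance with z1 = x and z2 = z. No decay in z is available that would allow a power of |z|
   / <x> here uniformly, and this is the only place where it enters. *)
have winv : w2 t.1.1 thy <= ci * w2 t.1.1 (th t.1) by exact: (Hi ((t.1.1, t.1.2), (t.1.1, v.1))).
have W0 := w2_ge0 t.1.1 (th t.1).
have thy1 := Ht (yy t v); rewrite -/thy /= in thy1; case: thy1 => thy1 thy2.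
have kb0 : 0 <= Num.sqrt b / ks t by rewrite divr_ge0 ?(ltW k0)//; lra.
have bm1 : 1 <= b ^+ (2 * m) by rewrite exprn_ege1.
have fin (A : R) : w2 t.1.1 v.2 <= (Cs + Cm * (2 * Cb) ^+ m) * b ^+ (2 * m) * w2 t.1.1 thy ->
  jap v.2 ^- n <= (C * (Num.sqrt b / ks t)) ^+ n -> A = 0 ->
  w2 t.1.1 v.2 * jap v.2 ^- n <= C ^+ n.+1 * (w2 t.1.1 (th t.1) * b ^+ (2 * m) * (Num.sqrt b / ks t) ^+ n).
 move=> h1 h2 _; have -> : C ^+ n.+1 * (w2 t.1.1 (th t.1) * b ^+ (2 * m) * (Num.sqrt b / ks t) ^+ n) =
  (C * (b ^+ (2 * m) * w2 t.1.1 (th t.1))) * (C * (Num.sqrt b / ks t)) ^+ n by rewrite exprS [(C * _) ^+ n]exprMn; ring.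
 apply: ler_pM => //; rewrite ?w2_ge0 ?invr_ge0 ?exprn_ge0 ?jap_ge0//.
 apply: le_trans h1 _; apply: (@le_trans _ _ ((Cs + Cm * (2 * Cb) ^+ m) * b ^+ (2 * m) * (ci * w2 t.1.1 (th t.1)))).
  by rewrite ler_wpM2l// mulr_ge0 ?addr_ge0 ?mulr_ge0 ?exprn_ge0//; lra.
 have -> : (Cs + Cm * (2 * Cb) ^+ m) * b ^+ (2 * m) * (ci * w2 t.1.1 (th t.1)) =
  (Cs + Cm * (2 * Cb) ^+ m) * ci * (b ^+ (2 * m) * w2 t.1.1 (th t.1)) by ring.
 by rewrite ler_wpM2r// mulr_ge0 ?exprn_ge0//; lra.
have jp := jap_gt0 v.2; have V4 : V <= V ^+ 4 by rewrite -[leLHS]expr1 ler_weXn2l.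
have jb (r : R) : (jap v.2)^-1 <= r -> jap v.2 ^- n <= r ^+ n.
 by move=> jr; rewrite -exprVn ler_Xn ?invr_ge0 ?jap_ge0// (le_trans _ jr)// invr_ge0 jap_ge0.
case: (lerP (enorm (v.2 - thy)) (jap thy / 2)) => zt.
 apply: (fin 0) => //.
  have := Hs t.1.1 thy (v.2 - thy) zt; rewrite addrC subrK => /le_trans; apply.
  rewrite ler_wpM2r ?w2_ge0//; apply: (@le_trans _ _ (Cs + Cm * (2 * Cb) ^+ m)).
   by rewrite lerDl mulr_ge0// exprn_ge0//; lra.
  by rewrite ler_peMr// addr_ge0// mulr_ge0// exprn_ge0//; lra.
 apply: jb; have jt : jap thy <= 2 * jap v.2 by have := jap_near zt; rewrite addrC subrK.
 have : V <= C * jap v.2.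
  apply: le_trans V4 _; rewrite VE Vs4; apply: le_trans thy2 _.
  apply: le_trans (ler_wpM2l Ct0 jt) _; rewrite mulrA ler_wpM2r ?jap_ge0//.
  by apply: le_trans CCb; rewrite /Cb; lra.
 move=> VC; rewrite -[leLHS]mul1r ler_pdivrMr// mulrAC mulrA ler_pdivlMr// mul1r.
 apply: le_trans kV _; apply: le_trans VC _; rewrite ler_peMr// mulr_ge0//; lra.
have zt' : jap thy / 2 < enorm (thy - v.2) by rewrite -enormN opprB.
have hz : enorm (thy - v.2) <= b * V ^+ 2.
 have := hz_le t v; rewrite hsE -?VE -?bE -/thy => h.
 have V2 : 0 < V ^+ 2 by rewrite exprn_gt0.
 move: h; rewrite mulrAC ler_pdivrMr//; apply: le_trans.
 by rewrite ler_peMl ?enorm_ge0.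
have V2b : V ^+ 2 <= Cb * b.
 have : V ^+ 4 <= 2 * Ct * (b * V ^+ 2).
  have -> : V ^+ 4 = jap t.1.2 by rewrite VE Vs4.
  apply: le_trans thy2 _; rewrite [2 * _]mulrC -mulrA ler_wpM2l//; lra.
 have V2 : 0 < V ^+ 2 by rewrite exprn_gt0.
 have -> : V ^+ 4 = V ^+ 2 * V ^+ 2 by rewrite -exprD.
 rewrite mulrA ler_pM2r// => /le_trans; apply; rewrite /Cb ler_wpM2r//; lra.
apply: (fin 0) => //.
 have := Hm t.1.1 thy 0 (v.2 - thy); rewrite addr0 addrC subrK jap0 mul1r => /le_trans; apply.
 have jm : jap (v.2 - thy) <= 2 * Cb * b ^+ 2.
  apply: le_trans (jap_le1D _) _; rewrite -enormN opprB.
  have : enorm (thy - v.2) <= Cb * b ^+ 2.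
   by apply: le_trans hz _; rewrite [b ^+ 2]expr2 mulrA [Cb * b * b]mulrC ler_wpM2l//; lra.
  have : 1 <= Cb * b ^+ 2 by rewrite mulr_ege1// exprn_ege1.
  lra.
 have : jap (v.2 - thy) ^+ m <= (2 * Cb) ^+ m * b ^+ (2 * m).
  rewrite exprM -exprMn ler_Xn ?jap_ge0// mulr_ge0 ?exprn_ge0//; lra.
 move=> jm2; apply: (@le_trans _ _ (Cm * ((2 * Cb) ^+ m * b ^+ (2 * m)) * w2 t.1.1 thy)).
  by rewrite mulrAC ler_wpM2r ?w2_ge0// ler_wpM2l.
 rewrite ler_wpM2r ?w2_ge0// mulrA ler_wpM2r ?exprn_ge0//; lra.
apply: jb; apply: (@le_trans _ _ 1); first by rewrite invf_le1// jap_ge1.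
rewrite mulrA ler_pdivlMr// mul1r; apply: le_trans kV _.
apply: le_of_sqr; first by apply: mulr_ge0; lra.
rewrite exprMn sqr_sqrtr; last lra.
apply: le_trans V2b _; rewrite ler_wpM2r//; first lra.
by apply: (@le_trans _ _ (2 * Cb)); [lra|]; apply: le_trans CCb _; rewrite -[leLHS]expr1 ler_weXn2l.
Qed.

(** As <z> = O(b U) and <eta> = O(b V^4), the product is O(b^3 (U V)^4); its power 2 d, which
    compensates the kernel, costs b^(6 d) and 8 d inverse gains. *)
Lemma q_bound : exists2 C : R, 0 <= C & forall t v,
 1 <= C * (bs t v ^+ (6 * d) * ds t ^- (8 * d)) * is_q phase_space_measure v.
Proof.
have [Ct Ct0 Ht] := thv_jap; pose C := 2 * (2 * Ct + 2).
have C1 : 2 <= C by rewrite /C; lra.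
exists (C ^+ (4 * d)); first by rewrite exprn_ge0//; lra.
move=> t v; have b1 := bs1 t v; have V1 := Vs1 t; have U1 := Us1 t; have Y1 := Ya1 t v.
have [b bE] : exists b, b = bs t v by exists (bs t v).
rewrite -?bE in b1 *; have [V VE] : exists V, V = Vs t by exists (Vs t).
rewrite -?VE in V1 *; have [U UE] : exists U, U = Us t by exists (Us t).
rewrite -?UE in U1 *.
have V0 : 0 < V by lra.
have jz : jap v.1 <= C * (b * U).
 by apply: le_trans (jap_z_le t v) _; rewrite -bE -UE ler_wpM2r// mulr_ge0//; lra.
have je : jap v.2 <= C * (b * V ^+ 4).
 have -> : v.2 = th (yy t v) + - (th (yy t v) - v.2) by rewrite opprB addrC subrK.
 apply: le_trans (jap_add _ _) _; rewrite enormN /C -mulrA ler_wpM2l//.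
 have hz : enorm (th (yy t v) - v.2) <= b * V ^+ 4.
  have := hz_le t v; rewrite hsE -?VE -?bE => h.
  have V2 : 0 < V ^+ 2 by rewrite exprn_gt0.
  have h2 : enorm (th (yy t v) - v.2) <= b * V ^+ 2.
   move: h; rewrite mulrAC ler_pdivrMr//; apply: le_trans.
   by rewrite ler_peMl ?enorm_ge0.
  by apply: le_trans h2 _; rewrite ler_wpM2l ?ler_weXn2l//; lra.
 have := (Ht (yy t v)).1; rewrite /= -Vs4 -?VE => h3.
 have h4 : Ct * V ^+ 4 <= Ct * (b * V ^+ 4) by rewrite ler_wpM2l// ler_peMl// exprn_ge0//; lra.
 have : 0 <= b * V ^+ 4 by rewrite mulr_ge0 ?exprn_ge0//; lra.
 have := mulr_ge0 Ct0 (mulr_ge0 (le_trans ler01 b1) (exprn_ge0 4 (ltW V0))); lra.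
have q1 := vq_jap v.1; have q2 := vq_jap v.2.
have -> : is_q phase_space_measure v = vq v.1 * vq v.2 by [].
have B0 : 0 <= b * U by rewrite mulr_ge0//; lra.
have B1 : 0 <= b * V ^+ 4 by rewrite mulr_ge0 ?exprn_ge0//; lra.
apply: (@le_trans _ _ ((jap v.1 ^+ (2 * d) * vq v.1) * (jap v.2 ^+ (2 * d) * vq v.2))).
 by rewrite -[1]mulr1 ler_pM.
rewrite mulrACA ler_wpM2r ?mulr_ge0 ?vq0//.
apply: (@le_trans _ _ ((C * (b * U)) ^+ (2 * d) * (C * (b * V ^+ 4)) ^+ (2 * d))).
 by apply: ler_pM; rewrite ?exprn_ge0 ?jap_ge0// ler_Xn ?jap_ge0 ?mulr_ge0//; lra.
rewrite -exprMn.
have -> : C * (b * U) * (C * (b * V ^+ 4)) = C ^+ 2 * (b ^+ 2 * (U * V ^+ 4)) by ring.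
have -> : C ^+ (4 * d) = (C ^+ 2) ^+ (2 * d) by rewrite -exprM mulnA.
have -> : b ^+ (6 * d) = (b ^+ 3) ^+ (2 * d) by rewrite -exprM mulnA.
have -> : ds t ^- (8 * d) = ((U * V) ^+ 4) ^+ (2 * d).
 by rewrite dsE -?UE -?VE -exprVn invrK -exprM mulnA.
have b0 : 0 <= b by lra.
clearbody C.
have U0 : 0 <= U by lra.
have C0 : 0 <= C by lra.
have V0' := ltW V0.
rewrite -!exprMn; apply: ler_Xn; first by rewrite !(mulr_ge0, exprn_ge0).
apply: ler_wpM2l; first by rewrite exprn_ge0.
apply: ler_pM; [by rewrite exprn_ge0|by rewrite !(mulr_ge0, exprn_ge0)|by rewrite ler_weXn2l|].
by rewrite exprMn ler_wpM2r ?exprn_ge0// -[leLHS]expr1 ler_weXn2l.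
Qed.

End scales.

(** * Taylor's formula for the symbol p *)

Section taylor.
Implicit Types (f : vec -> R[i]) (th ze eta : vec).

(* The j-th differential of f at th applied to (ze, ..., ze). *)
Fixpoint tay th j f ze : R[i] :=
 match j with
 | 0 => f th
 | j'.+1 => \sum_i (ze 0 i)%:C * tay th j' (dC (basv i) f) ze
 end.

Definition trem th N f eta : R[i] := f eta - \sum_(j < N) (j`!%:R)^-1 * tay th j f (eta - th).

Lemma coordB_C th i : Cinf (fun eta : vec => ((eta - th) 0 i)%:C).
Proof.
have -> : (fun eta : vec => ((eta - th) 0 i)%:C) = (fun eta => (eta 0 i)%:C - (th 0 i)%:C).
 by apply/funext => eta; rewrite !mxE rmorphB.
by apply: Cinf_sub; [exact: coord_C|exact: Cinf_cst].
Qed.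
Lemma dC_coordB th i j : dC (basv i) (fun eta : vec => ((eta - th) 0 j)%:C) = fun=> (j == i)%:R.
Proof.
have -> : (fun eta : vec => ((eta - th) 0 j)%:C) = (fun eta => (eta 0 j)%:C - (th 0 j)%:C).
 by apply/funext => eta; rewrite !mxE rmorphB.
rewrite dC_sub ?dC_cst; [|exact: coord_C|exact: Cinf_cst].
by rewrite (dC_coordE j _).2; apply/funext => eta; rewrite subr0 mxE eqxx /=; case: eqP.
Qed.

Lemma tayC th j f : Cinf (fun eta => tay th j f (eta - th)).
Proof.
elim: j f => [|j IH] f /=; first exact: Cinf_cst.
by apply: Cinf_sum => i _; apply: Cinf_mul; [exact: coordB_C|exact: IH].
Qed.

(** The product rule produces one copy from the linear factor, and j copies from the induction
    hypothesis, since derivatives commute. *)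
Lemma dC_tay th j f i : Cinf f -> dC (basv i) (fun eta => tay th j.+1 f (eta - th)) =
 fun eta => j.+1%:R * tay th j (dC (basv i) f) (eta - th).
Proof.
elim: j f => [|j IH] f fC.
 rewrite [LHS]dC_sum => [|k _]; last by apply: Cinf_mul; [exact: coordB_C|exact: Cinf_cst].
 apply/funext => eta; rewrite /= mul1r (bigD1 i)//= big1 ?addr0 => [|k ki].
  rewrite dC_mul; [|exact: coordB_C|exact: Cinf_cst].
  by rewrite dC_coordB dC_cst eqxx mul1r mulr0 addr0.
 rewrite dC_mul; [|exact: coordB_C|exact: Cinf_cst].
 by rewrite dC_coordB dC_cst (negPf ki) mul0r mulr0 addr0.
rewrite [LHS]dC_sum => [|k _]; last by apply: Cinf_mul; [exact: coordB_C|exact: (tayC th j.+1)].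
apply/funext => eta.
have E k : dC (basv i) (fun y => ((y - th) 0 k)%:C * tay th j.+1 (dC (basv k) f) (y - th)) eta =
  (k == i)%:R * tay th j.+1 (dC (basv k) f) (eta - th) +
  j.+1%:R * (((eta - th) 0 k)%:C * tay th j (dC (basv k) (dC (basv i) f)) (eta - th)).
 rewrite dC_mul; [|exact: coordB_C|exact: (tayC th j.+1)].
 rewrite dC_coordB IH; last exact: Cinf_dC.
 by rewrite (dC_comm (basv k) (basv i) fC) [_ * (j.+1%:R * _)]mulrCA.
rewrite (eq_bigr _ (fun k _ => E k)) big_split /= -mulr_sumr.
rewrite (bigD1 i)//= eqxx mul1r [X in (_ + X) + _]big1 ?addr0 => [|k /negPf ->]; last by rewrite mul0r.
by rewrite [in RHS]mulrSr mulrDl mul1r addrC.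
Qed.

Lemma trem0 th f : trem th 0 f = f.
Proof. by apply/funext => eta; rewrite /trem big_ord0 subr0. Qed.
Lemma tremC th N f : Cinf f -> Cinf (trem th N f).
Proof.
by move=> fC; apply: Cinf_sub => //; apply: Cinf_sum => j _; apply: Cinf_scale; exact: tayC.
Qed.
(** The predecessor of 0 is 0, which is right: the remainder of order 0 is the function itself. *)
Lemma dC_trem th N f i : Cinf f -> dC (basv i) (trem th N f) = trem th N.-1 (dC (basv i) f).
Proof.
move=> fC; case: N => [|N]; first by rewrite !trem0.
have SC j : Cinf (fun eta => (j`!%:R)^-1 * tay th j f (eta - th)) by apply: Cinf_scale; exact: tayC.
rewrite /trem dC_sub//; last by apply: Cinf_sum => j _; exact: SC.
rewrite dC_sum => [|j _]; last exact: SC.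
apply/funext => eta; congr (_ - _); rewrite big_ord_recl [X in X + _](_ : _ = 0); last first.
 by rewrite /= dC_scale ?dC_cst ?mulr0//; exact: Cinf_cst.
rewrite add0r; apply: eq_bigr => j _.
rewrite -[LHS]/(dC (basv i) (fun eta => (j.+1`!%:R)^-1 * tay th j.+1 f (eta - th)) eta).
rewrite dC_scale; last exact: (tayC th j.+1).
rewrite dC_tay// mulrA; congr (_ * _).
by rewrite factS natrM invfM mulrC mulrA divff ?mul1r// pnatr_eq0.
Qed.
Lemma Dw_trem th N f w : Cinf f -> Dw basv w (trem th N f) = trem th (N - size w) (Dw basv w f).
Proof.
elim: w N f => [|i w IH] N f fC; first by rewrite subn0.
have -> : (N - size (i :: w) = N.-1 - size w)%N by case: N => [|N] /=; rewrite ?subSS.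
rewrite -[LHS]/(Dw basv w (dC (basv i) (trem th N f))) (dC_trem _ _ _ fC) IH; last exact: Cinf_dC.
by [].
Qed.

Lemma le_normc_coord_sum ze (F : 'I_d -> R[i]) (B : R) : (forall i, normc (F i) <= B) ->
 normc (\sum_i (ze 0 i)%:C * F i) <= d%:R * enorm ze * B.
Proof.
move=> H; apply: le_trans (le_normc_sum _ _) _.
apply: (@le_trans _ _ (\sum_(i < d) enorm ze * B)).
 by apply: ler_sum => i _; rewrite Normc.normcM normcR; apply: ler_pM; rewrite ?normc_ge0// le_coord_enorm.
by rewrite sumr_const card_ord -mulrA mulr_natl.
Qed.

Lemma normc_tay th j f ze (A : R) : (forall w, size w = j -> normc (Dw basv w f th) <= A) ->
 normc (tay th j f ze) <= (d%:R * enorm ze) ^+ j * A.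
Proof.
elim: j f => [|j IH] f H /=; first by rewrite mul1r; exact: (H [::]).
rewrite exprS -mulrA; apply: le_normc_coord_sum => i.
by apply: IH => w sw; apply: (H (i :: w)); rewrite /= sw.
Qed.

Lemma tay_at th j f : tay th j.+1 f 0 = 0.
Proof. by rewrite /= big1// => i _; rewrite mxE mul0r. Qed.
Lemma trem_at th N f : trem th N.+1 f th = 0.
Proof.
by rewrite /trem subrr big_ord_recl big1 ?addr0 => [|j _]; rewrite ?tay_at ?mulr0//= invr1 mul1r subrr.
Qed.

(** Induction by the mean value theorem: the remainder vanishes at th and its derivatives are
    remainders of order one less. No integral form is needed, at the price of a factor 2 per
    order. *)
Lemma trem_near th N f ze (A : R) : 0 <= A -> Cinf f ->
 (forall w s, size w = N -> 0 <= s <= 1 -> normc (Dw basv w f (th + s *: ze)) <= A) ->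
 forall s, 0 <= s <= 1 -> normc (trem th N f (th + s *: ze)) <= (2 * (d%:R * enorm ze)) ^+ N * A.
Proof.
move=> A0; elim: N f => [|N IH] f fC H s s01.
 by rewrite trem0 mul1r; exact: (H [::]).
have := @mean_value R _ (trem th N.+1 f) (s *: ze) th ((d%:R * enorm ze) * ((2 * (d%:R * enorm ze)) ^+ N * A)).
rewrite trem_at subr0 => /(_ (tremC _ _ fC) _).
have -> : (2 * (d%:R * enorm ze)) ^+ N.+1 * A = 2 * ((d%:R * enorm ze) * ((2 * (d%:R * enorm ze)) ^+ N * A)).
 by rewrite exprS !mulrA.
apply=> u u01.
have Es : s *: ze = \sum_i (s *: ze) 0 i *: basv i by exact: sum_basv.
rewrite [X in dC X _]Es dC_sumv; last exact: tremC.
have B0 : normc (\sum_i ((s *: ze) 0 i)%:C * dC (basv i) (trem th N.+1 f) (th + u *: (s *: ze))) <=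
  d%:R * enorm (s *: ze) * ((2 * (d%:R * enorm ze)) ^+ N * A).
 apply: le_normc_coord_sum => i; rewrite dC_trem// scalerA; apply: IH.
 - exact: Cinf_dC.
 - by move=> w s' sw s'01; apply: (H (i :: w)) => //; rewrite /= sw.
 - case/andP: s01 => s0 s1; case/andP: u01 => u0 u1.
  by rewrite mulr_ge0// mulr_ile1.
apply: le_trans B0 _; apply: ler_wpM2r.
 by rewrite mulr_ge0// exprn_ge0// mulr_ge0// mulr_ge0// enorm_ge0.
by rewrite ler_wpM2l// enorm_scale_le.
Qed.

End taylor.

Section remainder.
Local Notation th := (thv).
Implicit Types (t : TT) (v : vec2).

Lemma p_deriv_bound l : exists2 C : R, 0 <= C & forall x eta,
 normc (Dw basv l (cp D x) eta) <= C * (w2 x eta * jap eta ^- size l).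
Proof.
have [_ /(_ (map inr l) (leqnn _))[C C0 HC]] := SG_sym (w2_ge0) (chp D) (size (map inr l : seq I2)).
exists C => // x eta; have := HC tt (x, eta); rewrite sec2_Dw => /le_trans; apply.
rewrite ler_wpM2l// ler_wpM2l ?w2_ge0// big_map /=.
elim: l {C C0 HC} => [|i l IH]; first by rewrite big_nil expr0 invr1.
have E1 : jap eta `^ (-1) = (jap eta)^-1 by exact: powRN1.
rewrite big_cons /= exprS invfM -E1; apply: ler_wpM2l => //; exact: powR_ge0.
Qed.

Lemma p_derivs_bound j l : exists2 C : R, 0 <= C & forall w, size w = j -> forall x eta,
 normc (Dw basv w (Dw basv l (cp D x)) eta) <= C * (w2 x eta * jap eta ^- (j + size l)).
Proof.
have [/= Ci HCi] := choice (fun w : j.-tuple 'I_d => ex2_intro_choice (p_deriv_bound (l ++ w))).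
pose K := \sum_w Ci w; have Ci0 w : 0 <= Ci w by case: (HCi w).
exists K; first exact: sumr_ge0.
move=> w sw x eta.
have [tw ->] : exists tw : j.-tuple 'I_d, w = tw by exists (Tuple (introT eqP sw)).
have := (HCi tw).2 x eta; rewrite Dw_cat size_cat size_tuple addnC => /le_trans; apply.
rewrite ler_wpM2r ?mulr_ge0 ?w2_ge0 ?invr_ge0 ?exprn_ge0 ?jap_ge0//.
by rewrite /K (bigD1 tw)//= lerDl sumr_ge0.
Qed.

Lemma japV_scale1 t : (jap t.1.2)^-1 <= ds t / ks t.
Proof.
have V0 := lt_le_trans ltr01 (Vs1 t); have U0 := lt_le_trans ltr01 (Us1 t).
rewrite dsE ksE -Vs4.
have -> : (Us t * Vs t)^-1 / (Vs t / Us t) = (Vs t ^+ 2)^-1.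
 by field; rewrite !gt_eqF.
by rewrite lef_pV2 ?posrE ?exprn_gt0// ler_weXn2l// Vs1.
Qed.
Lemma japV_scale2 t : (jap t.1.2)^-1 <= (ks t)^-1.
Proof.
have V0 := lt_le_trans ltr01 (Vs1 t); have U0 := lt_le_trans ltr01 (Us1 t).
rewrite lef_pV2 ?posrE ?jap_gt0 ?ks_gt0// -Vs4 ksE ler_pdivrMr//.
apply: (@le_trans _ _ (Vs t ^+ 4 * 1)).
 by rewrite mulr1 -[leLHS]expr1 ler_weXn2l// Vs1.
by rewrite ler_wpM2l ?Us1// exprn_ge0// ltW.
Qed.
Lemma ds_gt0 t : 0 < ds t.
Proof. by rewrite dsE invr_gt0 mulr_gt0// (lt_le_trans ltr01)// ?Us1 ?Vs1. Qed.
Lemma ds_le1 t : ds t <= 1.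
Proof. by rewrite dsE invf_le1 ?mulr_ege1 ?Us1 ?Vs1// mulr_gt0// (lt_le_trans ltr01)// ?Us1 ?Vs1. Qed.

Lemma normc_natV_le1 k : normc ((k%:R)^-1 : R[i]) <= 1.
Proof.
have -> : (k%:R)^-1 = ((k%:R : R)^-1)%:C :> R[i] by rewrite fmorphV rmorph_nat.
rewrite normcR ger0_norm//; case: k => [|k]; first by rewrite invr0.
by rewrite invf_le1// ler1n.
Qed.

(** For |eta - th| <= <th> / 2, [trem_near] applies and p varies slowly on the segment. Farther away
    the function and the Taylor terms are bounded one by one, the gain times b^2 being bounded below
    there. *)
Lemma rem_bound : exists m : nat, forall N l, exists2 C : R, 0 <= C & forall t v,
 normc (trem (th t.1) (N - size l) (Dw basv l (cp D t.1.1)) v.2) <=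
 C * (w2 t.1.1 (th t.1) * ds t ^+ N * bs t v ^+ (m + 2 * N) * (Num.sqrt (bs t v) / ks t) ^+ size l).
Proof.
have [Cz Cz0 Hz] := zeta_bound; have [Ct Ct0 Ht] := thv_jap.
have [Cs Cs0 Hs] := w2_slow; have [C2 C21 [m H2]] := w2_bound.
exists m => N l; set L := size l; set n := (N - L)%N.
have [/= P HP] := choice (fun j => ex2_intro_choice (p_derivs_bound j l)).
have P0 j : 0 <= P j by case: (HP j).
pose C3 := 1 + 2 * (Cz * Ct).
have C31 : 1 <= C3 by rewrite lerDl !mulr_ge0.
(* [cn] serves near th; [cf] and [ct] serve the function and its Taylor terms far from th. *)
pose cn := (2 * (d%:R * Cz)) ^+ n * (2 * Ct) ^+ (n + L) * (P n * Cs).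
pose ct j := (d%:R * Cz) ^+ j * Ct ^+ (j + L) * P j * C3 ^+ (n - j).
pose cf := P 0%N * C2 ^+ L.+1 * C3 ^+ N.
have C20 : 0 <= C2 by exact: le_trans ler01 C21.
have C30 : 0 <= C3 by exact: le_trans ler01 C31.
have cn0 : 0 <= cn by rewrite /cn !(mulr_ge0, exprn_ge0).
have ct0 j : 0 <= ct j by rewrite /ct; apply: mulr_ge0; rewrite ?exprn_ge0// !(mulr_ge0, exprn_ge0).
have cf0 : 0 <= cf by rewrite /cf !(mulr_ge0, exprn_ge0).
exists (cn + (cf + \sum_(j < n) ct j)); first by rewrite !addr_ge0// sumr_ge0.
move=> t v; have b1 := bs1 t v; have W0 := w2_ge0 t.1.1 (th t.1).
have d0 := ds_gt0 t; have X0 := jap_gt0 t.1.2; have k0 := ks_gt0 t.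

have fC : Cinf (Dw basv l (cp D t.1.1)).
 by apply: Cinf_Dw; exact: (Cinf_sec2 t.1.1 (sym_Cinf tt (SG_sym (w2_ge0) (chp D)))).
set E := _ * _ * _ * _.
have E0 : 0 <= E by rewrite /E !(mulr_ge0, exprn_ge0) ?invr_ge0 ?(ltW d0) ?(ltW k0) ?(le_trans ler01 b1) ?(le_trans ler01 s1).
have S : w2 t.1.1 (th t.1) * (ds t ^+ n * (bs t v ^+ 2) ^+ n) * (jap t.1.2)^-1 ^+ L <= E.
 apply: taylor_scale2 => //; rewrite ?invr_ge0 ?(ltW d0) ?(ltW X0) ?(ltW k0)//.
  exact: japV_scale1.
 exact: japV_scale2.
have thE : th t.1 + (v.2 - th t.1) = v.2 by rewrite addrC subrK.
have jth := (Ht t.1).2.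
have zb : enorm (v.2 - th t.1) <= Cz * (jap t.1.2 * ds t * bs t v ^+ 2) by exact: Hz.
have derth (w : seq 'I_d) xi : jap (th t.1) <= 2 * jap xi -> w2 t.1.1 xi <= Cs * w2 t.1.1 (th t.1) ->
  normc (Dw basv w (Dw basv l (cp D t.1.1)) xi) <=
  P (size w) * (Cs * w2 t.1.1 (th t.1)) * (2 * Ct * (jap t.1.2)^-1) ^+ (size w + L).
 move=> jx wx; apply: le_trans ((HP (size w)).2 w erefl t.1.1 xi) _.
 rewrite -mulrA ler_wpM2l//; apply: ler_pM; rewrite ?w2_ge0 ?invr_ge0 ?exprn_ge0 ?jap_ge0//.
 rewrite -exprVn; apply: ler_Xn; rewrite ?invr_ge0 ?jap_ge0//.
 rewrite ler_pdivlMr// mulrC ler_pdivrMr ?jap_gt0//.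
 by apply: le_trans jth _; rewrite [2 * Ct]mulrC -mulrA ler_wpM2l.
case: (lerP (enorm (v.2 - th t.1)) (jap (th t.1) / 2)) => zt.
 have := @trem_near (th t.1) n (Dw basv l (cp D t.1.1)) (v.2 - th t.1)
  (P n * (Cs * w2 t.1.1 (th t.1)) * (2 * Ct * (jap t.1.2)^-1) ^+ (n + L)) _ fC _ 1 _.
 rewrite scale1r thE => H; apply: le_trans (H _ _ _) _.
 - by apply: mulr_ge0; [rewrite !mulr_ge0|rewrite exprn_ge0// !mulr_ge0// invr_ge0 jap_ge0].
 - move=> w s sw s01; rewrite -sw; apply: derth.
   by apply: jap_near; apply: le_trans (enorm_scale_le _ s01) zt.
  by apply: Hs; apply: le_trans (enorm_scale_le _ s01) zt.
 - by rewrite ler01 lexx.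
 apply: (@le_trans _ _ ((2 * (d%:R * Cz) * (jap t.1.2 * ds t * bs t v ^+ 2)) ^+ n *
   (P n * (Cs * w2 t.1.1 (th t.1)) * (2 * Ct * (jap t.1.2)^-1) ^+ (n + L)))).
  apply: ler_wpM2r.
   by apply: mulr_ge0; [rewrite !mulr_ge0|rewrite exprn_ge0// !mulr_ge0// invr_ge0 jap_ge0].
  apply: ler_Xn; rewrite ?mulr_ge0 ?enorm_ge0 ?exprn_ge0 ?(ltW X0) ?(ltW d0) ?(le_trans ler01 b1)//.
  by rewrite -[leRHS]mulrA ler_wpM2l// -[leRHS]mulrA ler_wpM2l.
 rewrite taylor_scale1 ?gt_eqF//.
 apply: (@le_trans _ _ (cn * E)); last by rewrite ler_wpM2r// lerDl addr_ge0// sumr_ge0.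
 apply: le_trans (ler_wpM2l cn0 S); apply: eqW_le.
 rewrite /cn; ring.
(* Here <th> / 2 < |eta - th| <= Cz <xi> [ds] b^2 and <xi> <= Ct <th>. Powers of the right-hand side
   can then be inserted at will. *)
have far : 1 <= C3 * (ds t * bs t v ^+ 2).
 have j0 := jap_gt0 (th t.1).
 have dB : 0 <= ds t * bs t v ^+ 2 by rewrite mulr_ge0 ?exprn_ge0 ?(ltW d0) ?(le_trans ler01 b1).
 have h : jap (th t.1) / 2 <= Cz * (Ct * jap (th t.1) * (ds t * bs t v ^+ 2)).
  apply: le_trans (ltW zt) _; apply: le_trans zb _; rewrite ler_wpM2l// -[leLHS]mulrA ler_wpM2r//.
 have {}h : jap (th t.1) * 1 <= jap (th t.1) * (2 * (Cz * Ct) * (ds t * bs t v ^+ 2)).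
  by rewrite mulr1; move: h; lra.
 move: h; rewrite ler_pM2l// => h; apply: le_trans h _; rewrite ler_wpM2r// /C3 lerDr//.
set q := ds t * bs t v ^+ 2 in far.
have q0 : 0 <= q by rewrite mulr_ge0 ?exprn_ge0 ?(ltW d0) ?(le_trans ler01 b1).

rewrite /trem; apply: le_trans (le_normcD _ _) _; rewrite normcN.
rewrite mulrDl -[leLHS]add0r; apply: lerD; first exact: mulr_ge0.
rewrite mulrDl; apply: lerD.
 have h0 := (HP 0%N).2 [::] erefl t.1.1 v.2; rewrite /= add0n in h0.
 apply: le_trans h0 _; rewrite /cf -!mulrA ler_wpM2l//.
 apply: le_trans (H2 t v L) _; rewrite ler_wpM2l ?exprn_ge0//.
 have -> : C3 ^+ N * E =
  w2 t.1.1 (th t.1) * bs t v ^+ m * (Num.sqrt (bs t v) / ks t) ^+ L * (C3 * q) ^+ N.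
  by rewrite /E /q exprD exprM [(C3 * _) ^+ N]exprMn [(ds t * _) ^+ N]exprMn; ring.
 by rewrite ler_peMr ?exprn_ege1// !(mulr_ge0, exprn_ge0) ?invr_ge0 ?(ltW k0) ?(le_trans ler01 b1) ?(le_trans ler01 s1).
apply: le_trans (le_normc_sum _ _) _; rewrite mulr_suml; apply: ler_sum => j _.
rewrite Normc.normcM; apply: (@le_trans _ _ (1 * normc (tay (th t.1) j (Dw basv l (cp D t.1.1)) (v.2 - th t.1)))).
 by rewrite ler_wpM2r ?normc_ge0// normc_natV_le1.
rewrite mul1r.
apply: (@le_trans _ _ ((d%:R * Cz * (jap t.1.2 * ds t * bs t v ^+ 2)) ^+ j *
   (P j * w2 t.1.1 (th t.1) * (Ct * (jap t.1.2)^-1) ^+ (j + L)))).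
 apply: le_trans (normc_tay (A := P j * w2 t.1.1 (th t.1) * (Ct * (jap t.1.2)^-1) ^+ (j + L)) _ _) _.
  move=> w sw; apply: le_trans ((HP j).2 w sw t.1.1 (th t.1)) _.
  rewrite -mulrA ler_wpM2l// ler_wpM2l// -exprVn; apply: ler_Xn; rewrite ?invr_ge0 ?jap_ge0//.
  by rewrite ler_pdivlMr// mulrC ler_pdivrMr ?jap_gt0.
 apply: ler_wpM2r.
  by apply: mulr_ge0; [rewrite !mulr_ge0|rewrite exprn_ge0// !mulr_ge0// invr_ge0 jap_ge0].
 apply: ler_Xn; rewrite ?mulr_ge0 ?enorm_ge0 ?exprn_ge0 ?(ltW X0) ?(ltW d0) ?(le_trans ler01 b1)//.
 by rewrite -[leRHS]mulrA ler_wpM2l.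
rewrite taylor_scale1 ?gt_eqF//.
apply: le_trans (ler_wpM2l (ct0 j) S).
have jn : (j <= n)%N by exact: ltnW.
have qn : q ^+ j <= C3 ^+ (n - j) * q ^+ n.
 rewrite -[in q ^+ n](subnK jn) exprD mulrA -exprMn ler_peMl ?exprn_ge0// exprn_ege1//.
have -> : (d%:R * Cz) ^+ j * Ct ^+ (j + L) * (P j * w2 t.1.1 (th t.1) * (ds t ^+ j * (bs t v ^+ 2) ^+ j) * (jap t.1.2)^-1 ^+ L)
 = (d%:R * Cz) ^+ j * Ct ^+ (j + L) * P j * (w2 t.1.1 (th t.1) * (jap t.1.2)^-1 ^+ L) * q ^+ j.
 by rewrite /q [(ds t * _) ^+ j]exprMn; ring.
have -> : ct j * (w2 t.1.1 (th t.1) * (ds t ^+ n * (bs t v ^+ 2) ^+ n) * (jap t.1.2)^-1 ^+ L)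
 = (d%:R * Cz) ^+ j * Ct ^+ (j + L) * P j * (w2 t.1.1 (th t.1) * (jap t.1.2)^-1 ^+ L) * (C3 ^+ (n - j) * q ^+ n).
 by rewrite /ct /q [(ds t * _) ^+ n]exprMn; ring.
rewrite ler_wpM2l//; apply: mulr_ge0; first by rewrite !(mulr_ge0, exprn_ge0).
by rewrite mulr_ge0// exprn_ge0// invr_ge0 jap_ge0.
Qed.

(** Derivatives along the fields of step [hs] and [ks] are allowed to cost the square root of b.
    Each integration by parts then gains b^(1/2) / b = b^(-1/2). *)
Definition sgb (i : I2) t v : R := Num.sqrt (bs t v) / match i with inl _ => hs t v | inr _ => ks t end.

Lemma sgb_ge0 i t v : 0 <= sgb i t v.
Proof. by rewrite divr_ge0////; case: i => _; rewrite ltW// ?hs_gt0 ?ks_gt0. Qed.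

Lemma dC_snd i (f : vec -> R[i]) : dC (e2 i) (fun v : vec2 => f v.2) =
 fun v => match i with inl _ => 0 | inr i => dC (basv i) f v.2 end.
Proof.
apply/funext => v; rewrite (dC_affine (A := fun v : vec2 => v.2) (a := (e2 i).2) f)//.
by case: i => i //=; rewrite dC0v.
Qed.
Lemma Dw_snd0 w (f : vec -> R[i]) : (forall l, w <> map inr l) -> Dw e2 w (fun v : vec2 => f v.2) = fun=> 0.
Proof.
have z u : Dw e2 u (fun=> 0 : R[i]) = fun=> 0 by case: u => // i u; rewrite Dw_cst.
elim: w f => [|[i|i] w IH] f H; first by case: (H [::]).
 by rewrite -[LHS]/(Dw e2 w (dC (e2 (inl i)) (fun v => f v.2))) dC_snd z.
rewrite -[LHS]/(Dw e2 w (dC (e2 (inr i)) (fun v => f v.2))) dC_snd; by rewrite IH// => l wl; apply: (H (i :: l)); rewrite /= wl.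
Qed.

Lemma rem_sym : exists m : nat, forall N,
 sym e2 sgb (fun t v => w2 t.1.1 (th t.1) * ds t ^+ N * bs t v ^+ (m + 2 * N))
  (fun t v => trem (th t.1) N (cp D t.1.1) v.2).
Proof.
have [m H] := rem_bound; exists m => N k.
have fC x : Cinf (cp D x) by exact: (Cinf_sec2 x (sym_Cinf tt (SG_sym (w2_ge0) (chp D)))).
have m0 t v : 0 <= w2 t.1.1 (th t.1) * ds t ^+ N * bs t v ^+ (m + 2 * N).
 by rewrite !(mulr_ge0, exprn_ge0) ?w2_ge0 ?(ltW (ds_gt0 t)) ?(le_trans ler01 (bs1 t v)).
split=> [t|w _].
 apply: (Cinf_affine (A := fun v : vec2 => v.2) (A0 := fun v : vec2 => v.2)) => //; last exact: tremC.
 by move=> v; exact: cvg_snd.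
have [[l ->]|nl] := pselect (exists l, w = map inr l); last first.
 exists 0 => // t v; rewrite Dw_snd0 ?Normc.normc0 ?mul0r// => l wl; apply: nl; by exists l.
have [C C0 HC] := H N l; exists C => // t v.
have -> : Dw e2 (map inr l) (fun v : vec2 => trem (th t.1) N (cp D t.1.1) v.2) v =
  trem (th t.1) (N - size l) (Dw basv l (cp D t.1.1)) v.2.
 by rewrite [v in LHS]surjective_pairing sec2_Dw Dw_trem.
have -> : \prod_(i <- map inr l) sgb i t v = (Num.sqrt (bs t v) / ks t) ^+ size l.
 by rewrite big_map; elim: (l) => [|i l' IH]; rewrite ?big_nil ?big_cons//= IH exprS.
exact: HC.
Qed.

End remainder.

Section main_estimate.
Local Notation th := (thv).
Local Notation sgc := (sgp (fun X => jap X.2)).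
Implicit Types (t : TT) (v : vec2).

Definition sI (i : I2) t v : R := match i with inl _ => hs t v | inr _ => ks t end.
Definition Phi t v : R := ph v + phdiff (t.1, v).

Lemma expiD (x y : R) : expi (x + y) = expi x * expi y.
Proof. by apply: complexP; rewrite /= ?cosD ?sinD// addrC. Qed.

Lemma yy_affine t v (s : R) x : yy t (s *: v + x) = s *: (v.1, 0 : vec) + yy t x.
Proof.
rewrite -[LHS]/(t.1.1 + (s *: v.1 + x.1), t.1.2) -[RHS]/(s *: v.1 + (t.1.1 + x.1), s *: (0 : vec) + t.1.2).
by rewrite scaler0 add0r addrCA.
Qed.
Lemma cont_yy t : continuous (yy t).
Proof.
move=> v; have c1 : {for v, continuous (fun v : vec2 => v.1)} by exact: cvg_fst.
exact: (cvg_pair (cvgD (cvg_cst _) c1) (cvg_cst _)).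
Qed.
Lemma Cinf_yy t (F : vec2 -> R[i]) : Cinf F -> Cinf (fun v => F (yy t v)).
Proof.
apply: (Cinf_affine (A := yy t) (A0 := fun v => (v.1, 0))); first exact: cont_yy.
move=> v s x; exact: yy_affine.
Qed.
Lemma dC_yy t i (F : vec2 -> R[i]) : dC (e2 i) (fun v => F (yy t v)) =
 fun v => match i with inl j => dC (e2 (inl j)) F (yy t v) | inr _ => 0 end.
Proof.
apply/funext => v; rewrite (dC_affine (A := yy t) (a := ((e2 i).1, 0)) F); last by move=> s x; exact: yy_affine.
case: i => i //.
by rewrite dC0v.
Qed.

Lemma PhiE t : (fun y => (Phi t y)%:C) = (fun y => (ph y)%:C + (phC' (yy t y) - phC' t.1)).
Proof. by apply/funext => y; rewrite /Phi rmorphD /phdiff rmorphB. Qed.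
Lemma PhiC t : Cinf (fun v => (Phi t v)%:C).
Proof.
rewrite PhiE; apply: Cinf_add; first exact: phC.
by apply: Cinf_sub; [exact: (Cinf_yy _ (phC'C))|exact: Cinf_cst].
Qed.
Lemma GmE i t v : (Gm i t v)%:C = (sI i t v)%:C * dC (e2 i) (fun y => (Phi t y)%:C) v.
Proof.
have yC := Cinf_yy t (phC'C).
rewrite PhiE dC_add; [|exact: phC|apply: Cinf_sub => //; exact: Cinf_cst].
rewrite dC_ph dC_sub//; last exact: Cinf_cst.
rewrite dC_cst dC_yy; case: i => i /=; rewrite subr0.
 by rewrite -thvE -rmorphD -rmorphM; congr (_%:C); rewrite /Gp /= addrC.
by rewrite addr0 -rmorphM; congr (_%:C); rewrite /Gp /= mulrN.
Qed.

Lemma hs_le t v : hs t v <= Ya t v.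
Proof.
have V1 := Vs1 t; have Y0 := lt_le_trans ltr01 (Ya1 t v).
rewrite hsE ler_pdivrMr ?exprn_gt0 ?(lt_le_trans ltr01 V1)// ler_peMr ?(ltW Y0)// exprn_ege1//.
Qed.
Lemma YaY t v : Ya t v <= jap (t.1.1 + v.1).
Proof. by apply: le_trans (Ya4Y t v); rewrite -[leLHS]expr1 ler_weXn2l// Ya1. Qed.
Lemma sqrt_bs1 t v : 1 <= Num.sqrt (bs t v).
Proof. by rewrite -sqrtr1 ler_wsqrtr// bs1. Qed.

Lemma rate_z t v r i : r1 <= r -> jap (t.1.1 + v.1) `^ (- r) <= sgb (inl i) t v.
Proof.
move=> rr; have Y1 := Ya1 t v; have Y0 := lt_le_trans ltr01 Y1.
apply: (@le_trans _ _ (Ya t v ^+ 4)^-1).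
 by rewrite Ya4 -powRN ler_powR ?jap_ge1// lerN2.
rewrite /sgb ler_pdivlMr ?hs_gt0//; apply: le_trans (sqrt_bs1 t v).
rewrite mulrC ler_pdivrMr ?exprn_gt0// mul1r; apply: le_trans (hs_le t v) _.
by rewrite -[leLHS]expr1 ler_weXn2l.
Qed.

Lemma yy_pull m r rho F : r1 <= r -> (forall x xi, 0 <= m x xi) -> symSG m r rho F ->
 sym e2 sgb (fun t v => m (yy t v).1 (yy t v).2) (fun t v => F (yy t v)).
Proof.
move=> rr m0 Fs.
apply: (sym_pullback (p := fun _ => tt) (A := fun t => yy t) (A0 := fun _ v => (v.1, 0))
 (j := fun i => match i with inl j => inl j | inr j => inl j end)
 (c := fun i _ => match i with inl _ => 1 | inr _ => 0 end) (K := 1) _ _ _ _ _ _ _ _ _ Fs).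
- by move=> t; exact: cont_yy.
- by move=> t v s x; exact: yy_affine.
- by move=> t [i|i]; rewrite ?scale1r ?scale0r.
- exact: ler01.
- exact: sgb_ge0.
- by move=> i t x; exact: sgSG_ge0.
- by move=> t v; exact: m0.
- by move=> t v; rewrite mul1r.
- move=> [i|i] t v; rewrite mul1r ?normr1 ?normr0 ?mul1r ?mul0r ?sgb_ge0//.
 exact: rate_z.
Qed.

Lemma Ya_sym : sym e2 sgb (Ya) (fun t v => (Ya t v)%:C).
Proof.
have /andP[r0 r1'] := cr1_01 D.
have H : symSG (fun x _ => jap x `^ (r1 / 4)) 1 0 (fun X : vec2 => (jap X.1 `^ (r1 / 4))%:C).
 have := sym_fst (@sgj_ge0 R d) (fun _ x => powR_ge0 (jap x) (r1 / 4)) (jap_pow_sym (r1 / 4)).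
 apply: (sym_sg (K := 1) _ _ _) => // [t X|i t X]; first exact: powR_ge0.
 by case: i => i; rewrite mul1r /= ?lexx ?powR_ge0//= /sgj powRN1 lexx invr_ge0 jap_ge0.
have := yy_pull r1' (fun x _ => powR_ge0 (jap x) (r1 / 4)) H.
move=> H2; apply: (sym_eqw (m := fun t v => jap (yy t v).1 `^ (r1 / 4))); first by move=> t v; rewrite YaE.
by apply: sym_eq H2 => t; apply/funext => v; rewrite YaE.
Qed.

Lemma hs_sym : sym e2 sgb (hs) (fun t v => (hs t v)%:C).
Proof.
have cs : sym e2 sgb (fun t _ => (Vs t ^+ 2)^-1) (fun t _ => ((Vs t ^+ 2)^-1)%:C).
 have p t : 0 <= (Vs t ^+ 2)^-1 by rewrite invr_ge0 exprn_ge0// (le_trans ler01 (Vs1 t)).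
 apply: sym_cst => // [|]; first exact: sgb_ge0.
 by exists 1 => // t v; rewrite normcR mul1r ger0_norm.
apply: (sym_eqw (m := fun t v => Ya t v * (Vs t ^+ 2)^-1)); first by move=> t v; rewrite hsE.
by apply: sym_eq (sym_mul Ya_sym cs) => t; apply/funext => v; rewrite hsE rmorphM.
Qed.

Lemma hs2X t v : hs t v ^+ 2 * jap t.1.2 <= jap (t.1.1 + v.1).
Proof.
have V0 := lt_le_trans ltr01 (Vs1 t); apply: le_trans (Ya4Y t v).
rewrite hsE -Vs4; have -> : (Ya t v / Vs t ^+ 2) ^+ 2 * Vs t ^+ 4 = Ya t v ^+ 2.
 by field; rewrite gt_eqF.
by rewrite ler_weXn2l// Ya1.
Qed.

Lemma hk_le2 t v : hs t v * ks t <= 4 * (bs t v * Num.sqrt (bs t v)).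
Proof.
apply: le_trans (hk_le t v) _; rewrite ler_wpM2l// ler_peMr ?sqrt_bs1//.
exact: le_trans ler01 (bs1 t v).
Qed.

Lemma Gm_le i t v : `|Gm i t v| <= bs t v.
Proof. by rewrite bsE; exact: (le_brk (fun i => Gm i t)). Qed.

(** The bound itself is |Gm| <= b. A z-derivative gives a second derivative of phi, O(<xi> / <y>)
    and so O([hs]^-2); an eta-derivative gives a constant, which is O(b^(3/2) / ([hs] [ks])). *)
Lemma fib_sym j : sym e2 sgb (fun t v => bs t v / hs t v)
 (fun t v => dC (e2 (inl j)) (phC') (yy t v) - (co2 (inr j) v)%:C).
Proof.
have pC : Cinf (dC (e2 (inl j)) (phC')) by exact: (sym_Cinf tt (phix_sym j)).
have yC t := Cinf_yy t pC.
have b0 t v : 0 <= bs t v by exact: le_trans ler01 (bs1 t v).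
have m0 t v : 0 <= bs t v / hs t v by rewrite divr_ge0// ltW// hs_gt0.
have /andP[r0 r1'] := cr1_01 D.
apply: sym_of_dC => [t||i].
- by apply: Cinf_sub => //; exact: co2_C.
- exists 1 => // t v; rewrite mul1r -thvE -rmorphB normcR ler_pdivlMr ?hs_gt0// mulrC.
 rewrite -[X in X * _](gtr0_norm (hs_gt0 t v)) -normrM.
 exact: (Gm_le (inl j)).
have -> : (fun t => dC (e2 i) (fun v => dC (e2 (inl j)) (phC') (yy t v) - (co2 (inr j) v)%:C)) =
 fun t v => match i with inl i => dC (e2 (inl i)) (dC (e2 (inl j)) (phC')) (yy t v) | inr i => - (co2 (inr j) (e2 (inr i)))%:C end.
 apply/funext => t; rewrite dC_sub//; last exact: co2_C.
 rewrite dC_yy co2_aff; apply/funext => v; case: i => i; rewrite ?sub0r//.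
 by rewrite co2_e2 subr0.
case: i => i.
 have H0 (x xi : vec) : 0 <= jap xi * jap x `^ (- 1) by rewrite mulr_ge0 ?jap_ge0 ?powR_ge0.
 have := yy_pull (m := fun x xi => jap xi * jap x `^ (- 1)) r1' H0 (sym_dC (inl i) (phix_sym j)).
 apply: (sym_le ler01 sgb_ge0) => t v.
 rewrite mul1r /= powRN1 ler_pdivrMr ?jap_gt0//.
 have h0 := hs_gt0 t v.
 have -> : bs t v / hs t v * (Num.sqrt (bs t v) / hs t v) * jap (t.1.1 + v.1) =
   bs t v * Num.sqrt (bs t v) * jap (t.1.1 + v.1) / hs t v ^+ 2.
  by field; rewrite gt_eqF.
 rewrite ler_pdivlMr ?exprn_gt0// mulrC; apply: le_trans (hs2X t v) _.
 by rewrite ler_peMl ?jap_ge0// mulr_ege1// ?bs1 ?sqrt_bs1.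
apply: sym_cst => [t v|i' t v|]; [by rewrite mulr_ge0// sgb_ge0|exact: sgb_ge0|].
exists 4 => // t v; rewrite normcN normcR co2_e2; apply: (@le_trans _ _ 1).
 by case: eqP; rewrite ?normr1 ?normr0.
have h0 := hs_gt0 t v; have k0 := ks_gt0 t.
have -> : 4 * (bs t v / hs t v * (Num.sqrt (bs t v) / ks t)) = 4 * (bs t v * Num.sqrt (bs t v)) / (hs t v * ks t).
 by field; rewrite !gt_eqF.
by rewrite ler_pdivlMr ?mulr_gt0// mul1r; exact: hk_le2.
Qed.

Lemma Gm_sym i : sym e2 sgb (fun t v => brk (fun i => Gm i t) v) (fun t v => (Gm i t v)%:C).
Proof.
apply: (sym_eqw (m := bs)); first by move=> t v; rewrite bsE.
have b0 t v : 0 <= bs t v by exact: le_trans ler01 (bs1 t v).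
case: i => j.
 apply: (sym_eqw (m := fun t v => hs t v * (bs t v / hs t v))).
  by move=> t v; rewrite mulrCA divff ?mulr1// gt_eqF// hs_gt0.
 by apply: sym_eq (sym_mul hs_sym (fib_sym j)) => t; apply/funext => v; rewrite -thvE -rmorphB -rmorphM.
apply: (sym_eq (f := fun t v => (- ks t)%:C * (co2 (inl j) v)%:C)).
 by move=> t; apply/funext => v; rewrite -rmorphM mulNr.
apply: sym_of_dC => [t||i].
- by apply: Cinf_scale; exact: co2_C.
- exists 1 => // t v; rewrite mul1r -rmorphM mulNr normcR; exact: (Gm_le (inr j)).
have -> : (fun t => dC (e2 i) (fun v => (- ks t)%:C * (co2 (inl j) v)%:C)) = fun t _ => (- ks t)%:C * (co2 (inl j) (e2 i))%:C.
 by apply/funext => t; rewrite dC_scale ?co2_aff//; exact: co2_C.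
apply: sym_cst => [t v|i' t v|]; [by rewrite mulr_ge0// sgb_ge0|exact: sgb_ge0|].
exists 4 => // t v; rewrite -rmorphM normcR mulNr normrN co2_e2.
have h0 := hs_gt0 t v; have k0 := ks_gt0 t.
case: i => i; last first.
 by rewrite mulr0 normr0; apply: mulr_ge0 => //; apply: mulr_ge0 => //; exact: sgb_ge0.
apply: (@le_trans _ _ (ks t)).
 rewrite normrM (gtr0_norm k0) ler_piMr ?(ltW k0)//; by case: eqP; rewrite ?normr1 ?normr0.
rewrite /sgb !mulrA ler_pdivlMr// mulrC -[leRHS]mulrA; exact: hk_le2.
Qed.

Lemma sI_sym i : sym e2 sgb (sI i) (fun t v => (sI i t v)%:C).
Proof.
case: i => i; first exact: hs_sym.
suff H : sym e2 sgb (fun t _ => ks t) (fun t _ => (ks t)%:C) by exact: H.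
apply: sym_cst => [t v|i' t v|]; [exact: ltW (ks_gt0 t)|exact: sgb_ge0|].
by exists 1 => // t v; rewrite normcR mul1r gtr0_norm// ks_gt0.
Qed.

Lemma bs_near t v : jap (t.1.1 + v.1) <= 4 * (bs t v * jap t.1.1).
Proof.
have U1 := Us1 t; have b1 := bs1 t v.
have UX : Us t <= jap t.1.1.
 by apply: le_trans (Us4X t); rewrite -[leLHS]expr1 ler_weXn2l.
apply: le_trans (jap_add _ _) _; have -> : 4 * (bs t v * jap t.1.1) = 2 * (bs t v * jap t.1.1 + bs t v * jap t.1.1) by ring.
rewrite ler_wpM2l//; apply: lerD; first by rewrite ler_peMl// jap_ge0.
by apply: le_trans (z_le1 t v) _; rewrite ler_wpM2l// (le_trans ler01 b1).
Qed.

Lemma eps01 t : 0 < eps t <= 1.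
Proof.
have /andP[c0 c1] := clamp01 t.2; have j1 : 1 <= jap t.1.1 * jap t.1.2 by rewrite mulr_ege1// jap_ge1.
rewrite /eps divr_gt0 ?(lt_le_trans ltr01 j1)//= ler_pdivrMr ?(lt_le_trans ltr01 j1)// mul1r.
exact: le_trans c1 j1.
Qed.
Lemma eps_le t : eps t * (jap t.1.1 * jap t.1.2) <= 1.
Proof.
have /andP[c0 c1] := clamp01 t.2; have j1 : 1 <= jap t.1.1 * jap t.1.2 by rewrite mulr_ege1// jap_ge1.
by rewrite /eps divfK// gt_eqF// (lt_le_trans ltr01 j1).
Qed.

Lemma eps_sgb i t v : eps t <= 2 * sgb i t v.
Proof.
have /andP[e0 e1] := eps01 t; have X1 := jap_ge1 t.1.1; have Z1 := jap_ge1 t.1.2.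
have b0 : 0 <= bs t v by exact: le_trans ler01 (bs1 t v).
have s1 := sqrt_bs1 t v; have el := eps_le t.
case: i => i; rewrite /sgb mulrA ler_pdivlMr ?hs_gt0 ?ks_gt0//.
 have h : hs t v <= 2 * Num.sqrt (bs t v) * jap t.1.1.
  apply: le_trans (hs_le t v) _; apply: le_of_sqr; first by rewrite !mulr_ge0 ?sqrtr_ge0.
  rewrite !exprMn sqr_sqrtr//; apply: (@le_trans _ _ (Ya t v ^+ 4)); first by rewrite ler_weXn2l// Ya1.
  apply: le_trans (Ya4Y t v) _; apply: le_trans (bs_near t v) _.
  have -> : 2 ^+ 2 * bs t v * jap t.1.1 ^+ 2 = 4 * (bs t v * (jap t.1.1 * jap t.1.1)) by ring.
  by rewrite ler_wpM2l// ler_wpM2l// ler_peMl// jap_ge0.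
 apply: le_trans (ler_wpM2l (ltW e0) h) _.
 have -> : eps t * (2 * Num.sqrt (bs t v) * jap t.1.1) = 2 * Num.sqrt (bs t v) * (eps t * (jap t.1.1 * 1)) by ring.
 rewrite ler_piMr//; apply: le_trans el.
 by rewrite ler_wpM2l ?(ltW e0)// ler_wpM2l// jap_ge0.
have k : ks t <= jap t.1.1 * jap t.1.2.
 rewrite ksE ler_pdivrMr ?(lt_le_trans ltr01 (Us1 t))// -mulrA mulrC -mulrA -Vs4.
 apply: (@le_trans _ _ (Vs t ^+ 4 * (1 * 1))); first by rewrite !mulr1 -[leLHS]expr1 ler_weXn2l// Vs1.
 rewrite [leRHS](_ : _ = Vs t ^+ 4 * (Us t * jap t.1.1)); last by ring.
 rewrite ler_wpM2l ?exprn_ge0 ?(le_trans ler01 (Vs1 t))//; apply: ler_pM => //; exact: Us1.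
apply: le_trans (ler_wpM2l (ltW e0) k) _; apply: le_trans el _; lra.
Qed.

Lemma chi_sgb n : sym e2 sgb (fun t v => dec n (eps t) v) (fun t v => (chi (eps t) v)%:C).
Proof.
apply: (sym_sg (K := 2) _ _ _ (chi_sym eps01 n)) => // [t v|i t v]; first exact: dec_ge0.
by have /andP[e0 e1] := eps01 t; rewrite (ltW e0) eps_sgb.
Qed.

Lemma bs_poly t : exists2 C : R, 1 <= C & forall v, bs t v <= C * jap2 v ^+ 2 /\ forall i, sI i t v <= C * jap2 v.
Proof.
have [Ct Ct0 Ht] := thv_jap; have X1 := jap_ge1 t.1.1; have V1 := Vs1 t.
pose c := Ct * jap t.1.2 + 1.
have c0 : 0 <= c by rewrite addr_ge0// mulr_ge0// jap_ge0.
pose C := 1 + 2 * jap t.1.1 * (2 * c) + Vs t + 2 * jap t.1.1.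
have p1 : 0 <= 2 * jap t.1.1 * (2 * c) by rewrite !mulr_ge0 ?jap_ge0.
have C1 : 1 <= C by rewrite /C; lra.
exists C => // v; have J1 := jap2_ge1 v; have J0 := jap2_ge0 v.
have hX : hs t v <= 2 * jap t.1.1 * jap2 v.
 apply: le_trans (hs_le t v) _; apply: le_trans (YaY t v) _; apply: le_trans (japD _ _) _.
 by rewrite -mulrA ler_wpM2l// ler_wpM2l ?jap_ge0// jap_le_jap2l.
have kV : ks t <= Vs t.
 rewrite ksE ler_pdivrMr ?(lt_le_trans ltr01 (Us1 t))// ler_peMr ?Us1// (le_trans ler01 V1)//.
split; last first.
 case=> i /=.
  apply: le_trans hX _; rewrite ler_wpM2r// /C; lra.
 apply: (@le_trans _ _ (Vs t * 1)); first by rewrite mulr1.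
 apply: ler_pM => //; rewrite ?(le_trans ler01 V1)// /C; lra.
have zJ : enorm v.1 <= jap2 v by apply: le_trans (enorm_le_jap _) (jap_le_jap2l v).
have eJ : enorm v.2 <= jap2 v by apply: le_trans (enorm_le_jap _) (jap_le_jap2r v).
have tJ : enorm (th (yy t v) - v.2) <= 2 * c * jap2 v.
 apply: le_trans (enormD _ _) _; rewrite enormN -mulrA ler_wpM2l// /c mulrDl mul1r; apply: lerD => //.
 apply: le_trans (enorm_le_jap _) _; apply: le_trans (Ht (yy t v)).1 _ => /=.
 by rewrite ler_peMr// mulr_ge0// jap_ge0.
have hA : hs t v * enorm (th (yy t v) - v.2) <= 2 * jap t.1.1 * (2 * c) * jap2 v ^+ 2.
 have -> : 2 * jap t.1.1 * (2 * c) * jap2 v ^+ 2 = 2 * jap t.1.1 * jap2 v * (2 * c * jap2 v) by ring.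
 by apply: ler_pM => //; rewrite ?enorm_ge0// ltW// hs_gt0.
have hB : ks t * enorm v.1 <= Vs t * jap2 v ^+ 2.
 apply: ler_pM => //; rewrite ?enorm_ge0// ?(ltW (ks_gt0 t))//.
 by apply: le_trans zJ _; rewrite -[leLHS]expr1 ler_weXn2l.
have A0 : 0 <= hs t v * enorm (th (yy t v) - v.2) by rewrite mulr_ge0 ?enorm_ge0// ltW// hs_gt0.
have B0 : 0 <= ks t * enorm v.1 by rewrite mulr_ge0 ?enorm_ge0// ltW// ks_gt0.
have hb : bs t v <= 1 + hs t v * enorm (th (yy t v) - v.2) + ks t * enorm v.1.
 apply: le_of_sqr; first by rewrite !addr_ge0.
 rewrite sqr_bs; move: A0 B0; set A := _ * _; set B := ks t * _ => A0 B0.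
 rewrite -subr_ge0; have -> : (1 + A + B) ^+ 2 - (1 + A ^+ 2 + B ^+ 2) = 2 * (A + B + A * B) by ring.
 by rewrite mulr_ge0// !addr_ge0// mulr_ge0.
apply: le_trans hb _.
have J2 : 1 <= jap2 v ^+ 2 by rewrite exprn_ege1.
have E : C * jap2 v ^+ 2 = jap2 v ^+ 2 + 2 * jap t.1.1 * (2 * c) * jap2 v ^+ 2 + Vs t * jap2 v ^+ 2 + 2 * jap t.1.1 * jap2 v ^+ 2.
 by rewrite /C; ring.
rewrite E; apply: ler_wpDr; first by rewrite !mulr_ge0 ?jap_ge0.
by apply: lerD => //; apply: lerD.
Qed.

(** For fixed t, b is at most quadratic in [jap2]: 2 M powers for b^M, one for the steps [sI], and 4
    d for the kernel. *)
Lemma bs_mdom M (mu : TT -> R) : (forall t, 0 <= mu t) ->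
 mdom S2 sI (fun t v => mu t * (bs t v ^+ M * dec (2 * M + 1 + 4 * d) (eps t) v)).
Proof.
move=> mu0 t; have [C C1 HC] := bs_poly t; have C0 := le_trans ler01 C1.
have /andP[e0 _] := eps01 t; set n := (2 * M + 1 + 4 * d)%N.
have K0 : 0 <= mu t * (C ^+ M.+1 * eps t ^- (2 * n)).
 by rewrite mulr_ge0// mulr_ge0 ?exprn_ge0// invr_ge0 exprn_ge0// ltW.
exists (mu t * (C ^+ M.+1 * eps t ^- (2 * n))) => // v.
have b0 : 0 <= bs t v by exact: le_trans ler01 (bs1 t v).
have [HB HS] := HC v; have J1 := jap2_ge1 v; have J0 := jap2_ge0 v.
have q0 : 0 <= is_q S2 v by exact: is_q0.
have bM : bs t v ^+ M <= C ^+ M * jap2 v ^+ (2 * M).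
 by rewrite exprM -exprMn; apply: ler_Xn; rewrite ?mulr_ge0.
have key (s : R) : 0 <= s -> s <= C * jap2 v ->
  mu t * (bs t v ^+ M * dec n (eps t) v) * s <= mu t * (C ^+ M.+1 * eps t ^- (2 * n)) * is_q S2 v.
 move=> s0 sC; rewrite -!mulrA ler_wpM2l//.
 have D0 := dec_ge0 n (eps t) v.
 apply: (@le_trans _ _ (C ^+ M * jap2 v ^+ (2 * M) * (dec n (eps t) v * (C * jap2 v)))).
  by apply: ler_pM => //; rewrite ?exprn_ge0 ?mulr_ge0// ler_wpM2l.
 have -> : C ^+ M * jap2 v ^+ (2 * M) * (dec n (eps t) v * (C * jap2 v)) =
  C ^+ M.+1 * (jap2 v ^+ (2 * M + 1) * dec n (eps t) v) by rewrite exprSr exprD expr1; ring.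
 rewrite ler_wpM2l ?exprn_ge0//.
 apply: (@le_trans _ _ (jap2 v ^+ (2 * M + 1) * dec n (eps t) v * (jap2 v ^+ (4 * d) * is_q S2 v))).
  by rewrite ler_peMr ?jap2_q// mulr_ge0 ?exprn_ge0.
 have -> : jap2 v ^+ (2 * M + 1) * dec n (eps t) v * (jap2 v ^+ (4 * d) * is_q S2 v) =
  (jap2 v ^+ n * dec n (eps t) v) * is_q S2 v by rewrite /n [jap2 v ^+ (_ + _ * d)]exprD; ring.
 by rewrite ler_wpM2r//; exact: (jap2_dec eps01).
split; last by move=> i; apply: key => //; case: i => i; rewrite ltW// ?hs_gt0 ?ks_gt0.
have := key 1 ler01; rewrite mulr1; apply.
by rewrite mulr_ege1.
Qed.

Lemma a_sgb : exists m : nat, sym e2 sgb (fun t v => w1 t.1.1 t.1.2 * bs t v ^+ m) (fun t v => ca D (yy t v).1 (yy t v).2).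
Proof.
have [C C0 [m H]] := w1_bound; exists m.
have := yy_pull (lexx _) (w1_ge0) (SG_sym (w1_ge0) (cha D)).
by apply: (sym_le C0 sgb_ge0) => t v; exact: H.
Qed.

(** With a gain b^(-1/2) per step, 2 (M + 6 d) steps remove the growth b^M of the amplitude and the
    b^(6 d) of [q_bound]; there remain N gains minus the 8 d lost to the kernel, uniformly in the
    cutoff parameter. *)
Lemma main_cut N : exists2 C : R, 0 <= C & forall t,
 normc (Lam S2 (fun v => expi (Phi t v) * ((chi (eps t) v)%:C * (ca D (yy t v).1 (yy t v).2 *
  trem (th t.1) N (cp D t.1.1) v.2)))) <= C * (w0 t.1.1 t.1.2 * ds t ^+ N * ds t ^- (8 * d)).
Proof.
have [m1 H1] := a_sgb; have [m2 H2] := rem_sym; have [Cq Cq0 Hq] := q_bound.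
pose M := (m1 + (m2 + 2 * N))%N; pose n := (2 * M + 1 + 4 * d)%N.
pose mu t := w0 t.1.1 t.1.2 * ds t ^+ N.
have mu0 t : 0 <= mu t by rewrite mulr_ge0 ?w0_ge0// exprn_ge0// ltW// ds_gt0.
have b0 t v : 0 < bs t v by exact: lt_le_trans ltr01 (bs1 t v).
have AS : sym e2 sgb (fun t v => mu t * (bs t v ^+ M * dec n (eps t) v))
  (fun t v => (chi (eps t) v)%:C * (ca D (yy t v).1 (yy t v).2 * trem (th t.1) N (cp D t.1.1) v.2)).
 apply: sym_eqw (sym_mul (chi_sgb n) (sym_mul H1 (H2 N))) => t v.
 by rewrite /mu cw0E /M !exprD /thv; ring.
suff [C C0 HC] : exists2 C : R, 0 <= C & forall t,
  normc (Lam S2 (fun v => expi (Phi t v) * ((chi (eps t) v)%:C * (ca D (yy t v).1 (yy t v).2 *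
  trem (th t.1) N (cp D t.1.1) v.2)))) <= C * (Cq * (w0 t.1.1 t.1.2 * ds t ^+ N * ds t ^- (8 * d))).
 by exists (C * Cq); [exact: mulr_ge0|move=> t; rewrite -[leRHS]mulrA; exact: HC].
apply: (ibp_bound (e := e2) (S := S2) ibp_S2 (s := sI) (G := Gm) (sg := sgb) (g := fun t v => Num.sqrt (bs t v))
 _ _ _ _ _ _ _ _ PhiC _ _ (bs_mdom M mu0) AS (K := (2 * (M + 6 * d))%N)
 (M := fun t => Cq * (w0 t.1.1 t.1.2 * ds t ^+ N * ds t ^- (8 * d)))).
- exact: sgb_ge0.
- by move=> i t v; case: i => i; rewrite ltW// ?hs_gt0 ?ks_gt0.
- by move=> t v; exact: sqrtr_ge0.
- exists 1 => // i t v; rewrite mul1r; case: i => i; rewrite /sgb /sI mulrC divfK// gt_eqF// ?hs_gt0 ?ks_gt0//.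
- exists 1 => // t v; rewrite mul1r -bsE; apply: le_trans (sqrt_bs1 t v).
 by rewrite invf_le1 ?bs1.
- move=> t; exists 1 => // v; rewrite mul1r -bsE; apply: le_of_sqr; first exact: ltW.
 by rewrite sqr_sqrtr ?(ltW (b0 t v))// -[leLHS]expr1 ler_weXn2l// bs1.
- exact: sI_sym.
- exact: Gm_sym.
- exact: GmE.
- by move=> t v; rewrite mulr_ge0// mulr_ge0 ?exprn_ge0 ?dec_ge0// ltW.
move=> t v; rewrite -bsE; have E : (Num.sqrt (bs t v) / bs t v) ^+ 2 = (bs t v)^-1.
 by rewrite expr_div_n sqr_sqrtr ?(ltW (b0 t v))// expr2 invfM mulrA divff ?mul1r// gt_eqF.
rewrite exprM E -/(mu t); have b0' := ltW (b0 t v).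
have -> : mu t * (bs t v ^+ M * dec n (eps t) v) * (bs t v)^-1 ^+ (M + 6 * d) =
 mu t * (dec n (eps t) v * ((bs t v)^-1 ^+ (6 * d) * (bs t v / bs t v) ^+ M)).
 by rewrite exprD [(_ / _) ^+ M]exprMn; ring.
rewrite divff ?gt_eqF// expr1n mulr1.
have -> : Cq * (mu t * ds t ^- (8 * d)) * is_q S2 v = mu t * (Cq * ds t ^- (8 * d) * is_q S2 v) by ring.
rewrite ler_wpM2l//; apply: (@le_trans _ _ (1 * (bs t v)^-1 ^+ (6 * d))).
 by rewrite ler_wpM2r ?dec_le1// exprn_ge0// invr_ge0.
rewrite mul1r exprVn -[leLHS]mul1r ler_pdivrMr ?exprn_gt0//; apply: le_trans (Hq t v) _.
by apply: eqW_le; ring.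
Qed.

Lemma tame_phdiff X : tame (fun v => expi (phdiff (X, v))).
Proof.
have H : sym e4 sgc (fun _ X => 1 * jap2 X.2 ^+ 0) (fun _ X => expi (phdiff X)).
 by apply: sym_eqw (expi_phdiff_sym) => t Y; rewrite mul1r.
exact: (tame_of_sym (m := fun=> 1) (fun X => jap_ge1 X.2) (fun=> ler01) (sec_family H) X).
Qed.
Lemma tame_aY X : tame (fun v => ca D (Yv (X, v)).1 (Yv (X, v)).2).
Proof.
have [m H] := aY_sym.
exact: (tame_of_sym (m := fun X => w1 X.1 X.2) (fun X => jap_ge1 X.2) (fun X => w1_ge0 _ _) (sec_family H) X).
Qed.
Lemma tame_pE x : tame (fun v => cp D x v.2).
Proof.
have [m H] := pE_sym.
have m0 (X : vec2) : 0 <= w2 X.1 (th X) * jap X.2 ^+ m by rewrite mulr_ge0 ?w2_ge0 ?exprn_ge0 ?jap_ge0.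
exact: (tame_of_sym (m := fun X => w2 X.1 (th X) * jap X.2 ^+ m) (fun X => jap_ge1 X.2) m0 (sec_family H) (x, 0)).
Qed.
Lemma tame_tay (eta : vec) j (f : vec -> R[i]) : tame (fun v => tay eta j f (v.2 - eta)).
Proof.
elim: j f => [|j IH] f /=; first exact: tame_cst.
apply: tame_sum => i; apply: tame_mul; last exact: IH.
have -> : (fun v : vec2 => ((v.2 - eta) 0 i)%:C) = (fun v => (co2 (inr i) v)%:C - (eta 0 i)%:C).
 by apply/funext => v; rewrite !mxE rmorphB.
by apply: tame_sub; [exact: tame_co2|exact: tame_cst].
Qed.
Lemma tame_trem (eta : vec) N x : tame (fun v => trem eta N (cp D x) v.2).
Proof.
apply: tame_sub; first exact: tame_pE.
by apply: tame_sum => j; apply: tame_scale; exact: tame_tay.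
Qed.

Definition dl (X : vec2) : R := (jap X.1 `^ (r1 / 4) * jap X.2 `^ (1 / 4))^-1.
Lemma dlE t : ds t = dl t.1. Proof. by rewrite dsE UsE VsE. Qed.

(** For fixed X the cutoff parameter of [main_cut] is sent to 0. The rate for the amplitude at X,
    with an uncontrolled constant, is enough because the bound on the cut integrals is uniform. *)
Lemma osc_rem_bound N : exists2 C : R, 0 <= C & forall X,
 normc (osc (fun v => expi (phdiff (X, v)) * (ca D (Yv (X, v)).1 (Yv (X, v)).2 *
  trem (th X) N (cp D X.1) v.2))) <= C * (w0 X.1 X.2 * dl X ^+ N * dl X ^- (8 * d)).
Proof.
have [C C0 HC] := main_cut N; exists C => // X; set B := fun v => _.
have tB : tame B.
 by apply: tame_mul; [exact: tame_phdiff|apply: tame_mul; [exact: tame_aY|exact: tame_trem]].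
have [C' H'] := oscP tB; have J1 : 1 <= jap X.1 * jap X.2 by rewrite mulr_ege1// jap_ge1.
have J0 := lt_le_trans ltr01 J1.
apply/ler_addgt0Pr => e e0; pose e' := Num.min 1 (e / (`|C'| + 1)).
have C'1 : 0 < `|C'| + 1 by rewrite ltr_wpDl.
have e'0 : 0 < e' by rewrite lt_min ltr01 divr_gt0.
have e'1 : 0 < e' <= 1 by rewrite e'0 ge_min lexx.
pose t : TT := (X, e'); have et : eps t = e' / (jap X.1 * jap X.2) by rewrite /eps clamp_id.
have := HC t; rewrite dlE => Ht; have := H' _ (eps01 t) => Hl.
have EL : Lcut (eps t) B = Lam S2 (fun v => expi (Phi t v) * ((chi (eps t) v)%:C * (ca D (yy t v).1 (yy t v).2 *
  trem (th t.1) N (cp D t.1.1) v.2))).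
 by congr (Lam S2 _); apply/funext => v; rewrite /B /Phi expiD -!mulrA; congr (_ * _); rewrite mulrCA.
rewrite -EL in Ht.
have -> : osc B = Lcut (eps t) B + - (Lcut (eps t) B - osc B) by rewrite opprB addrCA subrr addr0.
apply: le_trans (le_normcD _ _) _; rewrite normcN; apply: lerD => //.
apply: le_trans Hl _; apply: (@le_trans _ _ (`|C'| * e')).
 apply: (@le_trans _ _ (`|C'| * eps t)); first by rewrite ler_wpM2r ?ler_norm//; case/andP: (eps01 t) => /ltW.
 by rewrite ler_wpM2l// et ler_pdivrMr// ler_peMr// ltW.
apply: (@le_trans _ _ ((`|C'| + 1) * e')); first by rewrite ler_wpM2r ?lerDl// ltW.
by rewrite mulrC -ler_pdivlMr// ge_min lexx orbT.
Qed.

End main_estimate.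

Section multinomial.
Implicit Types (g : seq 'I_d -> R[i]).

Definition perm_inv g := forall u u', perm_eq u u' -> g u = g u'.

(** The factor j + 1 on the right is the sum of the entries al_i. For each i the terms with al_i > 0
    are reindexed by al = be + e_i, where al_i / al! = 1 / be!. *)
Lemma sum_mi_step j g : perm_inv g ->
 \sum_i sum_mi j (fun al => (mi_fact al)%:R^-1 * g (i :: wd al)) =
 j.+1%:R * sum_mi j.+1 (fun al => (mi_fact al)%:R^-1 * g (wd al)).
Proof.
move=> gp; rewrite /sum_mi mulr_sumr.
transitivity (\sum_(al : {ffun 'I_d -> 'I_j.+2} | mi_size (fun k => al k) == j.+1)
 \sum_i (al i)%:R * ((mi_fact (fun k => al k))%:R^-1 * g (wd (fun k => al k)))); last first.
 apply: eq_bigr => al /eqP sz; rewrite -mulr_suml; congr (_ * _).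
 by rewrite -natr_sum; congr (_%:R); exact: sz.
rewrite [RHS]exchange_big /=; apply: eq_bigr => i _.
rewrite [RHS](bigID (fun al : {ffun 'I_d -> 'I_j.+2} => (0 < al i)%N)) /= [X in _ + X]big1 ?addr0; last first.
 by move=> al /andP[_]; rewrite -leqNgt leqn0 => /eqP ->; rewrite mul0r.
pose up (be : {ffun 'I_d -> 'I_j.+1}) : {ffun 'I_d -> 'I_j.+2} := [ffun k => inord (be k + (k == i))].
pose dn (al : {ffun 'I_d -> 'I_j.+2}) : {ffun 'I_d -> 'I_j.+1} := [ffun k => inord (al k - (k == i))].
have upE be k : up be k = (be k + (k == i))%N :> nat.
 have h := ltn_ord (be k); rewrite ffunE inordK//.
 by case: (k == i); rewrite ?addn1 ?addn0//; exact: ltnW.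
rewrite (reindex_onto up dn) /=; last first.
 move=> al /andP[/eqP sz ai]; apply/ffunP => k; apply: val_inj; rewrite /= upE ffunE inordK.
  by case: eqP => [->|_]; rewrite ?subnK.
 case: eqP => [->|/eqP ki]; first by have := ltn_ord (al i); rewrite subn1; case: (nat_of_ord (al i)) ai.
 (* An entry other than al i is at most j because al i > 0, so it fits in 'I_j.+1. *)
 have : (al k + al i <= mi_size (fun k => al k))%N.
  by rewrite /mi_size (bigD1 k)//= (bigD1 i) /= ?leq_add2l ?leq_addr// eq_sym.
 rewrite sz.
 case: (nat_of_ord (al i)) ai => // m _; rewrite addnS subn0 !ltnS; exact: leq_trans (leq_addr _ _).
apply: eq_big => [be|be _].
 have -> : dn (up be) = be by apply/ffunP => k; apply: val_inj; rewrite ffunE upE addnK /= inordK.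
 have -> : mi_size (fun k => up be k) = (mi_size (fun k => be k)).+1.
  rewrite /mi_size (eq_bigr _ (fun k _ => upE be k)) big_split /= [X in (_ + X)%N](bigD1 i)//= eqxx.
  by rewrite [X in (_ + (_ + X))%N]big1 ?addn1// => k /negPf ->.
 by rewrite eqSS upE !eqxx addn1 /= !andbT.
have -> : g (wd (fun k => up be k)) = g (i :: wd (fun k => be k)).
 by apply: gp; apply/allP => k _ /=; rewrite !count_wd upE (eq_sym i k) addnC eqxx.
have -> : mi_fact (fun k => up be k) = (mi_fact (fun k => be k) * (be i).+1)%N.
 rewrite /mi_fact (bigD1 i)//= [in RHS](bigD1 i)//= upE eqxx addn1 factS.
 have -> : (\prod_(k | k != i) (up be k)`! = \prod_(k | k != i) (be k)`!)%N.
  by apply: eq_bigr => k /negPf ki; rewrite upE ki addn0.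
 by rewrite -mulnA [LHS]mulnC.
by rewrite upE eqxx addn1 natrM invfM mulrA [_ * (_ * _^-1)]mulrCA divff ?mulr1// pnatr_eq0.
Qed.

Fixpoint wsum j g : R[i] := if j is j'.+1 then \sum_i wsum j' (fun u => g (i :: u)) else g [::].

(** The multinomial formula for a symmetric summand, by induction through [sum_mi_step] rather than
    by counting the words of a given multi-index. *)
Lemma wsumE j g : perm_inv g ->
 wsum j g = j`!%:R * sum_mi j (fun al => (mi_fact al)%:R^-1 * g (wd al)).
Proof.
elim: j g => [|j IH] g gp.
 have a0 (al : {ffun 'I_d -> 'I_1}) : al = [ffun=> ord0] by apply/ffunP => k; rewrite !ord1.
 have z k : ([ffun=> ord0] : {ffun 'I_d -> 'I_1}) k = 0%N :> nat by rewrite ffunE.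
 rewrite /sum_mi (big_pred1 [ffun=> ord0]) => [|al].
  have -> : wd (fun k : 'I_d => ([ffun=> ord0] : {ffun 'I_d -> 'I_1}) k) = [::].
   by apply: size0nil; rewrite size_wd /mi_size big1.
  by rewrite /mi_fact big1 => [|k _]; rewrite ?z// invr1 !mul1r.
 by rewrite [al]a0 [RHS]eqxx /mi_size big1.
have gp' i : perm_inv (fun u => g (i :: u)) by move=> u u' uu; apply: gp; rewrite perm_cons.
rewrite /= (eq_bigr _ (fun i _ => IH _ (gp' i))) -mulr_sumr sum_mi_step// mulrA -natrM.
by rewrite factS mulnC.
Qed.

End multinomial.

(** * The terms of the expansion *)

Section leading_terms.
Local Notation th := (thv).

Definition edot (eta z : vec) : R[i] := expi (dotv z eta).

Lemma dotv_sumC (eta z : vec) : (dotv z eta)%:C = \sum_k (eta 0 k)%:C * (z 0 k)%:C.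
Proof. by rewrite /dotv rmorph_sum; apply: eq_bigr => k _; rewrite mulrC rmorphM. Qed.

Lemma dC_dot1 (eta : vec) i : dC (e2 (inl i)) (fun v : vec2 => (dotv v.1 eta)%:C) = fun=> (eta 0 i)%:C.
Proof.
have -> : (fun v : vec2 => (dotv v.1 eta)%:C) = fun v => \sum_k (eta 0 k)%:C * (co2 (inl k) v)%:C.
 by apply/funext => v; rewrite dotv_sumC.
rewrite dC_sum => [|k _]; last by apply: Cinf_scale; exact: co2_C.
have E k : (co2 (inl k) (e2 (inl i)))%:C = (k == i)%:R :> R[i] by rewrite co2_e2 rmorph_nat.
apply/funext => v; rewrite (bigD1 i)// big1 => [|k /andP[_ ki]]; rewrite ?(dC_scale _ _ (co2_C _)).
 by apply: etrans (addr0 _) _; rewrite co2_aff E eqxx mulr1.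
by rewrite co2_aff E (negPf ki) mulr0.
Qed.

Lemma dot1_C (eta : vec) : Cinf (fun v : vec2 => (dotv v.1 eta)%:C).
Proof.
have -> : (fun v : vec2 => (dotv v.1 eta)%:C) = fun v => \sum_k (eta 0 k)%:C * (co2 (inl k) v)%:C.
 by apply/funext => v; rewrite dotv_sumC.
by apply: Cinf_sum => k _; apply: Cinf_scale; exact: co2_C.
Qed.

Lemma tame_edot (eta : vec) : tame (fun v => edot eta v.1).
Proof.
exists 0%N; suff H : sym e2 (ones unit) (fun _ _ => 1) (fun _ v => expi (dotv v.1 eta)).
 exact: H.
apply: sym_expi => [_|i]; first exact: dot1_C.
case: i => i.
 rewrite dC_dot1; apply: sym_cst => //; exists `|eta 0 i| => // t v.
 by rewrite normcR mulr1.
have -> : dC (e2 (inr i)) (fun v : vec2 => (dotv v.1 eta)%:C) = fun=> 0.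
 apply/funext => v; rewrite (dC_affine (A := fun v : vec2 => v.1) (a := 0) (fun x => (dotv x eta)%:C)) ?dC0v//.
by apply: sym_cst => //; exists 0 => // t v; rewrite Normc.normc0 mul0r.
Qed.

Lemma osc_shift_alg (u t A B : R[i]) : u * u = -1 -> -1 * (u * (u * t * A + B)) - t * A = - u * B.
Proof. by move=> uu; transitivity (- (u * u) * (t * A) - u * B - t * A); [ring|rewrite uu; ring]. Qed.

(** Integrating by parts in z, the derivative of the factor exp(i <z, eta>) cancels the shift by
    eta, and only the derivative of G remains. *)
Lemma osc_shift (eta : vec) i G : tame G ->
 osc (fun v => edot eta v.1 * (((v.2 - eta) 0 i)%:C * G v)) =
 - 'i%C * osc (fun v => edot eta v.1 * dC (e2 (inl i)) G v).
Proof.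
move=> tG; have tE := tame_edot eta; have GC := tame_Cinf tG; have EC := tame_Cinf tE.
have tEG := tame_mul tE tG; have tEd := tame_mul tE (tame_dC (inl i) tG).
have H := osc_ibp (inl i) tEG.
have dE : dC (e2 (inl i)) (fun v => edot eta v.1 * G v) =
  fun v => 'i%C * (eta 0 i)%:C * (edot eta v.1 * G v) + edot eta v.1 * dC (e2 (inl i)) G v.
 rewrite dC_mul// (dC_expi _ (dot1_C eta)).2 dC_dot1; apply/funext => v.
 by rewrite /edot -!mulrA.
rewrite dE osc_add ?osc_scale// in H; last exact: tame_scale.
have tg := tame_mul (tame_Gp (inl i)) tEG.
have -> : (fun v => edot eta v.1 * (((v.2 - eta) 0 i)%:C * G v)) =
  fun v => -1 * ((Gp (inl i) v)%:C * (edot eta v.1 * G v)) - (eta 0 i)%:C * (edot eta v.1 * G v).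
 by apply/funext => v; rewrite /Gp /= !mxE rmorphB rmorphN; ring.
rewrite osc_sub; [|exact: tame_scale|exact: tame_scale].
rewrite !osc_scale// H.
by apply: osc_shift_alg; rewrite -expr2 sqr_i.
Qed.

Lemma dC_fst1 i (f : vec -> R[i]) : dC (e2 (inl i)) (fun v : vec2 => f v.1) = fun v => dC (basv i) f v.1.
Proof. by apply/funext => v; rewrite (dC_affine (A := fun v : vec2 => v.1) (a := basv i) f). Qed.

(** The j linear factors are removed one after the other by [osc_shift], each putting -i d_z on F.
    The rest depends on z alone and is evaluated at 0 by [osc_value]. *)
Lemma osc_tay (eta : vec) j f F : Cinf F -> tame (fun v => F v.1) ->
 osc (fun v => edot eta v.1 * (tay eta j f (v.2 - eta) * F v.1)) =
 (- 'i%C) ^+ j * wsum j (fun u => Dw basv u f eta * Dw basv u F 0) * ((2 * pi) ^+ d)%:C.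
Proof.
have tE := tame_edot eta; elim: j f F => [|j IH] f F FC tF /=.
 rewrite (osc_value (F := fun z => edot eta z * (f eta * F z))); last by apply: tame_mul => //; exact: tame_scale.
 rewrite mul1r /edot (_ : dotv 0 eta = 0) ?/expi ?cos0 ?sin0 ?mul1r//.
 by rewrite /dotv big1// => k _; rewrite mxE mul0r.
have tG i : tame (fun v => tay eta j (dC (basv i) f) (v.2 - eta) * F v.1) by apply: tame_mul => //; exact: tame_tay.
have tc i : tame (fun v : vec2 => ((v.2 - eta) 0 i)%:C).
 have -> : (fun v : vec2 => ((v.2 - eta) 0 i)%:C) = (fun v => (co2 (inr i) v)%:C - (eta 0 i)%:C).
  by apply/funext => v; rewrite !mxE rmorphB.
 by apply: tame_sub; [exact: tame_co2|exact: tame_cst].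
have -> : (fun v : vec2 => edot eta v.1 * ((\sum_i ((v.2 - eta) 0 i)%:C * tay eta j (dC (basv i) f) (v.2 - eta)) * F v.1)) =
  fun v => \sum_i edot eta v.1 * (((v.2 - eta) 0 i)%:C * (tay eta j (dC (basv i) f) (v.2 - eta) * F v.1)).
 apply/funext => v; rewrite mulr_suml mulr_sumr; apply: eq_bigr => i _; by rewrite -!mulrA.
rewrite osc_sum => [|i]; last by do 2 apply: tame_mul => //.
rewrite mulr_sumr mulr_suml; apply: eq_bigr => i _; rewrite osc_shift//.
have -> : (fun v : vec2 => edot eta v.1 * dC (e2 (inl i)) (fun v => tay eta j (dC (basv i) f) (v.2 - eta) * F v.1) v) =
  fun v => edot eta v.1 * (tay eta j (dC (basv i) f) (v.2 - eta) * dC (basv i) F v.1).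
 apply/funext => v; congr (_ * _); rewrite dC_mul; [|exact: tame_Cinf (tame_tay _ _ _)|exact: tame_Cinf tF].
 rewrite dC_fst1; have -> : dC (e2 (inl i)) (fun v : vec2 => tay eta j (dC (basv i) f) (v.2 - eta)) = fun=> 0.
  apply/funext => u; rewrite (dC_affine (A := fun v : vec2 => v.2) (a := 0) (fun y => tay eta j (dC (basv i) f) (y - eta))) ?dC0v//.
 by rewrite mul0r add0r.
rewrite IH; [by rewrite exprS -!mulrA|exact: Cinf_dC|].
by have := tame_dC (inl i) tF; rewrite dC_fst1.
Qed.

Lemma Dw_shift u (G : vec -> R[i]) x : Dw basv u (fun z => G (x + z)) = fun z => Dw basv u G (x + z).
Proof.
elim: u G => //= i u IH G; rewrite -IH; congr (Dw _ u); apply/funext => z.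
by rewrite (dC_affine (A := fun z => x + z) (a := basv i) G)// => s y; rewrite addrCA.
Qed.

Definition ampl (X : vec2) (y : vec) : R[i] := expi (psi (cphi D) X.1 y X.2) * ca D y X.2.

Definition aj (j : nat) (x xi : vec) : R[i] := sum_mi j (fun al : 'I_d -> nat =>
 'i%C ^+ mi_size al / (mi_fact al)%:R * Dmi al (cp D x) (gradx (cphi D) x xi)
 * Dmi al (fun y => expi (psi (cphi D) x y xi) * ca D y xi) x).

Lemma psi_C X : Cinf (fun y => (psi (cphi D) X.1 y X.2)%:C).
Proof.
have -> : (fun y => (psi (cphi D) X.1 y X.2)%:C) =
  fun y => phC' (y, X.2) - phC' X - \sum_k (th X 0 k)%:C * ((y - X.1) 0 k)%:C.
 by apply/funext => y; rewrite /psi !rmorphB /= dotv_sumC.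
apply: Cinf_sub; first by apply: Cinf_sub; [exact: Cinf_sec1 (phC'C)|exact: Cinf_cst].
by apply: Cinf_sum => k _; apply: Cinf_scale; exact: coordB_C.
Qed.
Lemma aC : Cinf (fun X : vec2 => ca D X.1 X.2).
Proof. exact: (sym_Cinf tt (SG_sym (w1_ge0) (cha D))). Qed.
Lemma amplC X : Cinf (ampl X).
Proof.
by apply: Cinf_mul; [exact: Cinf_expi (psi_C X)|exact: (Cinf_sec1 X.2 aC)].
Qed.
Lemma pC x : Cinf (cp D x).
Proof. exact: (Cinf_sec2 x (sym_Cinf tt (SG_sym (w2_ge0) (chp D)))). Qed.

Lemma phdiff_psi X v : phdiff (X, v) = psi (cphi D) X.1 (X.1 + v.1) X.2 + dotv v.1 (th X).
Proof. by rewrite /psi [X.1 + v.1 - X.1]addrAC subrr add0r subrK. Qed.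

Lemma ampl_edot X v : expi (phdiff (X, v)) * ca D (Yv (X, v)).1 (Yv (X, v)).2 = edot (th X) v.1 * ampl X (X.1 + v.1).
Proof. by rewrite phdiff_psi expiD mulrAC mulrC. Qed.

Lemma norm_cstK : @norm_cst * ((2 * pi) ^+ d)%:C = 1.
Proof. by rewrite /norm_cst -rmorphM mulVf// expf_neq0// mulf_neq0// gt_eqF// pi_gt0. Qed.

(** By [ampl_edot] the phase difference is psi plus the linear part <z, th>; the latter is the
    exponential that [osc_tay] needs. The normalising constant cancels the factor (2 pi)^d. *)
Lemma ajE j X : aj j X.1 X.2 = @norm_cst * ((j`!%:R)^-1 *
 osc (fun v => expi (phdiff (X, v)) * (ca D (Yv (X, v)).1 (Yv (X, v)).2 * tay (th X) j (cp D X.1) (v.2 - th X)))).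
Proof.
have tF : tame (fun v => ampl X (X.1 + v.1)).
 have -> : (fun v : vec2 => ampl X (X.1 + v.1)) =
   fun v => edot (- th X) v.1 * (expi (phdiff (X, v)) * ca D (Yv (X, v)).1 (Yv (X, v)).2).
  apply/funext => v; rewrite ampl_edot mulrA -expiD.
  have -> : dotv v.1 (- th X) + dotv v.1 (th X) = 0.
   by rewrite /dotv -big_split big1//= => k _; rewrite !mxE mulrN addrC subrr.
  by rewrite /expi cos0 sin0 mul1r.
 by apply: tame_mul; [exact: tame_edot|apply: tame_mul; [exact: tame_phdiff|exact: tame_aY]].
have FC : Cinf (fun z => ampl X (X.1 + z)).
 apply: (Cinf_affine (A := fun z => X.1 + z) (A0 := id)) (amplC X).
  by move=> z; exact: cvgD (cvg_cst _) (@cvg_id _ (nbhs z)).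
 by move=> v s x; rewrite addrCA.
have -> : (fun v => expi (phdiff (X, v)) * (ca D (Yv (X, v)).1 (Yv (X, v)).2 * tay (th X) j (cp D X.1) (v.2 - th X)))
  = fun v => edot (th X) v.1 * (tay (th X) j (cp D X.1) (v.2 - th X) * ampl X (X.1 + v.1)).
 by apply/funext => v; rewrite mulrA ampl_edot -mulrA [ampl _ _ * _]mulrC.
rewrite (osc_tay _ _ _ FC tF) wsumE; last first.
 by move=> u u' uu; rewrite (Dw_perm _ (pC _) uu) (Dw_perm _ FC uu).
have -> (A B C E : R[i]) : @norm_cst * (A * (B * (C * E) * ((2 * pi) ^+ d)%:C)) = (@norm_cst * ((2 * pi) ^+ d)%:C) * (A * C) * (B * E) by ring.
rewrite norm_cstK mulVf -?lt0n// !mul1r /aj /sum_mi mulr_sumr; apply: eq_bigr => al /eqP sz.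
rewrite !DmiE sz Dw_shift addr0.
(* The two D^alpha of a term give (-i)^j each, against the single (-i)^j of [osc_tay]; the factor
   i^j of the expansion compensates for one of them. *)
have ii : 'i%C ^+ j * (- 'i%C) ^+ j = 1 :> R[i] by rewrite -exprMn mulrN -expr2 sqr_i opprK expr1n.
rewrite -[RHS]mul1r -ii /ampl; ring.
Qed.

Lemma expansion_bound N : exists2 C : R, 0 <= C & forall X,
 normc (cc X.1 X.2 - \sum_(j < N) aj j X.1 X.2) <= C * (w0 X.1 X.2 * dl X ^+ N * dl X ^- (8 * d)).
Proof.
have [C C0 HC] := osc_rem_bound N; exists (normc norm_cst * C); first by rewrite mulr_ge0 ?normc_ge0.
move=> X; rewrite -[leRHS]mulrA; suff -> : cc X.1 X.2 - \sum_(j < N) aj j X.1 X.2 =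
  @norm_cst * osc (fun v => expi (phdiff (X, v)) * (ca D (Yv (X, v)).1 (Yv (X, v)).2 * trem (th X) N (cp D X.1) v.2)).
 by rewrite Normc.normcM ler_wpM2l ?normc_ge0.
pose T j (v : vec2) := expi (phdiff (X, v)) * (ca D (Yv (X, v)).1 (Yv (X, v)).2 * tay (th X) j (cp D X.1) (v.2 - th X)).
have tT j : tame (T j).
 by apply: tame_mul; [exact: tame_phdiff|apply: tame_mul; [exact: tame_aY|exact: tame_tay]].
have tB := BB_tame X.
rewrite (eq_bigr _ (fun (j : 'I_N) _ => ajE j X)) -mulr_sumr /cc -mulrBr; congr (_ * _).
have -> : \sum_(j < N) (j`!%:R)^-1 * osc (T j) = osc (fun v => \sum_(j < N) (j`!%:R)^-1 * T j v).
 by rewrite osc_sum => [|j]; [apply: eq_bigr => j _; rewrite osc_scale|exact: tame_scale].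
rewrite -surjective_pairing -osc_sub; [|exact: tB|by apply: tame_sum => j; exact: tame_scale].
congr osc; apply/funext => v; rewrite /BB /trem mulrBr mulrBr; congr (_ - _).
 by rewrite [cp D _ _ * _]mulrC.
by rewrite !mulr_sumr; apply: eq_bigr => j _; rewrite /T; ring.
Qed.

End leading_terms.

Section leading_classes.
Local Notation rho1 := (crho1 D).
Local Notation th := (thv).
Local Notation tri := (vec2 -> vec -> R[i]).
Local Notation dphi := (fun i : 'I_d => dC (e2 (inl i)) (phC')).
Local Notation sgl := (@sgSG r1 rho1).

(** The price <xi>^(1/2) <x>^(-r1/2) of one y-derivative of exp(i psi) a on the diagonal. As psi
    vanishes there to second order, two derivatives are needed to produce a factor <xi> / <x>, which
    is at most [kap]^2 ([kap_ge2]). Against the decay <xi>^-1 of a derivative of p, the net gain is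
    [dl]^2 ([kap_dl]). *)
Definition kap (X : vec2) : R := dl X ^+ 2 * jap X.2.

Lemma dl_gt0 X : 0 < dl X. Proof. by rewrite -(dlE (X, 0)); exact: ds_gt0. Qed.
Lemma dl_le1 X : dl X <= 1. Proof. by rewrite -(dlE (X, 0)); exact: ds_le1. Qed.
Lemma kap_gt0 X : 0 < kap X. Proof. by rewrite mulr_gt0 ?exprn_gt0 ?dl_gt0 ?jap_gt0. Qed.

Lemma dlUV X : dl X = (Us (X, 0) * Vs (X, 0))^-1. Proof. by rewrite -(dlE (X, 0)) dsE. Qed.

Lemma kapE X : kap X = Vs (X, 0) ^+ 2 / Us (X, 0) ^+ 2.
Proof.
have V0 := lt_le_trans ltr01 (Vs1 (X, 0 : R)); have U0 := lt_le_trans ltr01 (Us1 (X, 0)).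
rewrite /kap dlUV -(Vs4 (X, 0)); field; by rewrite !gt_eqF.
Qed.

Lemma kap_ge1 X : jap X.1 `^ (- r1) <= kap X.
Proof.
have V1 := Vs1 (X, 0 : R); have U1 := Us1 (X, 0); have U0 := lt_le_trans ltr01 U1.
rewrite kapE powRN -(Us4 (X, 0)); apply: (@le_trans _ _ (Us (X, 0) ^+ 2)^-1).
 by rewrite lef_pV2 ?posrE ?exprn_gt0// ler_weXn2l.
by rewrite ler_peMl ?invr_ge0 ?exprn_ge0 ?(ltW U0)// exprn_ege1.
Qed.
Lemma kap_ge2 X : jap X.2 * jap X.1 `^ (- 1) <= kap X ^+ 2.
Proof.
have U0 := lt_le_trans ltr01 (Us1 (X, 0)).
have -> : kap X ^+ 2 = jap X.2 * (Us (X, 0) ^+ 4)^-1.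
 by rewrite kapE -(Vs4 (X, 0)) expr_div_n -!exprM.
rewrite powRN1 ler_wpM2l ?jap_ge0// lef_pV2 ?posrE ?exprn_gt0 ?jap_gt0//.
exact: (Us4X (X, 0)).
Qed.
Lemma kap_dl X : kap X * (jap X.2)^-1 = dl X ^+ 2.
Proof. by rewrite mulfK// gt_eqF// jap_gt0. Qed.

Definition gi i (X : vec2) (y : vec) : R[i] := 'i%C * (dphi i (y, X.2) - dphi i X).
Definition hi i k (X : vec2) (y : vec) : R[i] := 'i%C * dC (e2 (inl i)) (dphi k) (y, X.2).
Definition GG l (e : vec2 -> R[i]) : tri := fun X y => foldr (fun i r => gi i X y * r) (e (y, X.2)) l.

(* Sums of products of factors vanishing on the diagonal (each worth a power of kap) and of a symbol. *)
Inductive cl (M : vec2 -> R) : tri -> Prop :=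
| cl_base l e m : (forall X, 0 <= m X) -> sym e2 sgl (fun _ => m) (fun _ => e) ->
  (forall X, m X * kap X ^+ size l <= M X) -> cl M (GG l e)
| cl_add F F' : cl M F -> cl M F' -> cl M (fun X y => F X y + F' X y).

Lemma sgl_ge0 i t X : 0 <= sgl i t X. Proof. exact: sgSG_ge0. Qed.

Lemma cl_le M M' F : (forall X, M X <= M' X) -> cl M F -> cl M' F.
Proof.
move=> MM; elim=> [l e m m0 es mM|F1 F2 _ H1 _ H2]; last exact: cl_add.
by apply: cl_base es _ => // X; exact: le_trans (mM X) (MM X).
Qed.
Lemma cl_ge0 M F : cl M F -> forall X, 0 <= M X.
Proof.
elim=> // l e m m0 _ mM X; apply: le_trans (mM X); by rewrite mulr_ge0// exprn_ge0// ltW// kap_gt0.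
Qed.

Lemma dphiC k : Cinf (dphi k). Proof. exact: (sym_Cinf tt (phix_sym k)). Qed.
Lemma giC k X : Cinf (gi k X).
Proof. by apply: Cinf_scale; apply: Cinf_sub; [exact: Cinf_sec1 (dphiC k)|exact: Cinf_cst]. Qed.
Lemma GGC l e X : Cinf e -> Cinf (GG l e X).
Proof.
move=> eC; elim: l => [|k l IH]; first exact: Cinf_sec1.
by apply: Cinf_mul; [exact: giC|exact: IH].
Qed.
Lemma cl_C M F X : cl M F -> Cinf (F X).
Proof.
elim=> [l e m _ es _|F1 F2 _ H1 _ H2]; last exact: Cinf_add.
exact: GGC (sym_Cinf tt es).
Qed.

Lemma dC_sec1 i (f : vec2 -> R[i]) xi : dC (basv i) (fun y => f (y, xi)) = fun y => dC (e2 (inl i)) f (y, xi).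
Proof.
by apply/funext => y; rewrite (dC_affine (A := fun y => (y, xi)) (a := e2 (inl i)) f)// => s z; exact: pair_affine1.
Qed.
Lemma dC_gi i k X : dC (basv i) (gi k X) = hi i k X.
Proof.
have C1 := Cinf_sec1 X.2 (dphiC k).
rewrite /gi dC_scale; last by apply: Cinf_sub => //; exact: Cinf_cst.
rewrite dC_sub//; last exact: Cinf_cst.
by apply/funext => y; rewrite dC_cst subr0 dC_sec1.
Qed.

Lemma cl_g k M F : cl M F -> cl (fun X => M X * kap X) (fun X y => gi k X y * F X y).
Proof.
elim=> [l e m m0 es mM|F1 F2 _ H1 _ H2].
 have -> : (fun X y => gi k X y * GG l e X y) = GG (k :: l) e by [].
 by apply: cl_base es _ => // X; rewrite exprSr mulrA ler_wpM2r// ltW// kap_gt0.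
have -> : (fun X y => gi k X y * (F1 X y + F2 X y)) = (fun X y => gi k X y * F1 X y + gi k X y * F2 X y).
 by apply/funext => X; apply/funext => y; rewrite mulrDr.
exact: cl_add.
Qed.

Lemma hi_sym i k : sym e2 sgl (fun _ X => jap X.2 * jap X.1 `^ (- 1)) (fun _ X => 'i%C * dC (e2 (inl i)) (dphi k) X).
Proof.
have /andP[_ r11] := cr1_01 D; have /andP[_ rho11] := crho1_01 D.
apply: sym_scale; apply: (sym_sg (K := 1) _ _ _ (sym_dC (inl i) (phix_sym k))) => // [t X|j t X].
 by rewrite mulr_ge0 ?jap_ge0 ?sgSG_ge0.
by rewrite mul1r sgSG_ge0; case: j => j /=; rewrite ler_powR ?jap_ge1// lerN2.
Qed.

Lemma cl_h i k M F : cl M F -> cl (fun X => M X * kap X ^+ 2) (fun X y => hi i k X y * F X y).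
Proof.
elim=> [l e m m0 es mM|F1 F2 _ H1 _ H2].
 pose b X := 'i%C * dC (e2 (inl i)) (dphi k) X.
 have -> : (fun X y => hi i k X y * GG l e X y) = GG l (fun X => b X * e X).
  by apply/funext => X; apply/funext => y; elim: l {mM} => //= j l <-; rewrite mulrCA.
 apply: cl_base (sym_mul (hi_sym i k) es) _ => X; first by rewrite mulr_ge0// mulr_ge0 ?jap_ge0 ?powR_ge0.
 rewrite -[leLHS]mulrA [leRHS]mulrC; apply: ler_pM; [by rewrite mulr_ge0 ?jap_ge0 ?powR_ge0| |exact: kap_ge2|exact: mM].
 by rewrite mulr_ge0// exprn_ge0// ltW// kap_gt0.
have -> : (fun X y => hi i k X y * (F1 X y + F2 X y)) = (fun X y => hi i k X y * F1 X y + hi i k X y * F2 X y).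
 by apply/funext => X; apply/funext => y; rewrite mulrDr.
exact: cl_add.
Qed.

(** A derivative of the symbol costs <x>^-r1, at most [kap]. A derivative of a factor [gi] removes
    its [kap] and brings <xi> / <x>, at most [kap]^2: again one [kap] in all. *)
Lemma cl_dC i M F : cl M F -> cl (fun X => M X * kap X) (fun X => dC (basv i) (F X)).
Proof.
elim=> [l e m m0 es mM|F1 F2 c1 H1 c2 H2]; last first.
 have -> : (fun X => dC (basv i) (fun y => F1 X y + F2 X y)) = fun X y => dC (basv i) (F1 X) y + dC (basv i) (F2 X) y.
  by apply/funext => X; rewrite dC_add//; [exact: cl_C c1|exact: cl_C c2].
 exact: cl_add.
have eC := sym_Cinf tt es; elim: l M mM => [|k l IH] M mM.
 have -> : (fun X => dC (basv i) (GG [::] e X)) = GG [::] (dC (e2 (inl i)) e).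
  by apply/funext => X; rewrite /GG /= dC_sec1.
 have es' : sym e2 sgl (fun _ X => m X * jap X.1 `^ (- r1)) (fun _ => dC (e2 (inl i)) e) := sym_dC (inl i) es.
 apply: cl_base es' _ => X; first by rewrite mulr_ge0// powR_ge0.
 rewrite expr0 mulr1; apply: ler_pM; rewrite ?powR_ge0 ?kap_ge1//.
 by apply: le_trans (mM X); rewrite expr0 mulr1.
have E : (fun X => dC (basv i) (GG (k :: l) e X)) =
  fun X y => hi i k X y * GG l e X y + gi k X y * dC (basv i) (GG l e X) y.
 apply/funext => X; rewrite -[GG (k :: l) e X]/(fun y => gi k X y * GG l e X y).
 by rewrite dC_mul ?dC_gi//; [exact: giC|exact: GGC].
pose M' X := m X * kap X ^+ size l.
have c : cl M' (GG l e) by exact: cl_base es _.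
have k0 X := ltW (kap_gt0 X).
rewrite E; apply: cl_add.
 apply: cl_le (cl_h i k c) => X; apply: (@le_trans _ _ (m X * kap X ^+ (size l).+1 * kap X)); last by rewrite ler_wpM2r//; exact: mM.
 by rewrite /M' [kap X ^+ (size l).+1]exprSr [kap X ^+ 2]expr2 !mulrA.
apply: cl_le (cl_g k (IH M' (fun X => lexx _))) => X.
apply: (@le_trans _ _ (m X * kap X ^+ (size l).+1 * kap X)); last by rewrite ler_wpM2r//; exact: mM.
by rewrite /M' [kap X ^+ (size l).+1]exprSr !mulrA.
Qed.

Definition EE (X : vec2) (y : vec) : R[i] := expi (psi (cphi D) X.1 y X.2).

Lemma dC_psi i X : dC (basv i) (fun y => (psi (cphi D) X.1 y X.2)%:C) = fun y => dphi i (y, X.2) - dphi i X.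
Proof.
have -> : (fun y => (psi (cphi D) X.1 y X.2)%:C) =
  fun y => phC' (y, X.2) - phC' X - \sum_k (th X 0 k)%:C * ((y - X.1) 0 k)%:C.
 by apply/funext => y; rewrite /psi !rmorphB /= dotv_sumC.
have C1 := Cinf_sec1 X.2 (phC'C).
have C2 k : Cinf (fun y => (th X 0 k)%:C * ((y - X.1) 0 k)%:C) by apply: Cinf_scale; exact: coordB_C.
rewrite dC_sub; [|by apply: Cinf_sub => //; exact: Cinf_cst|by apply: Cinf_sum].
rewrite dC_sub//; last exact: Cinf_cst.
rewrite dC_sum//; apply/funext => y; rewrite dC_cst subr0 dC_sec1; congr (_ - _).
rewrite (bigD1 i)//= big1 ?addr0 => [|k ki]; rewrite dC_scale ?dC_coordB; try exact: coordB_C.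
 by rewrite eqxx mulr1 thvE.
by rewrite (negPf ki) mulr0.
Qed.

(** A derivative either meets the exponential and brings a factor [gi], or meets F; both cost one
    [kap]. *)
Lemma Dw_EE w M F : cl M F -> exists2 F', cl (fun X => M X * kap X ^+ size w) F' &
 forall X, Dw basv w (fun y => EE X y * F X y) = fun y => EE X y * F' X y.
Proof.
elim: w M F => [|i w IH] M F c; first by exists F => //; apply: cl_le c => X; rewrite expr0 mulr1.
have c' := cl_add (cl_g i c) (cl_dC i c).
have [F' cF' HF'] := IH _ _ c'; exists F' => [|X].
 by apply: cl_le cF' => X; rewrite exprS mulrA.
rewrite -HF' -[LHS]/(Dw basv w (dC (basv i) (fun y => EE X y * F X y))); congr (Dw _ w _).
rewrite dC_mul; [|exact: Cinf_expi (psi_C X)|exact: cl_C c].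
rewrite (dC_expi _ (psi_C X)).2 dC_psi; apply/funext => y.
by rewrite [RHS]mulrDr; congr (_ + _); rewrite [RHS]mulrA; congr (_ * _); exact: mulrC.
Qed.

Lemma gi_diag k X : gi k X X.1 = 0.
Proof. by rewrite /gi -surjective_pairing subrr mulr0. Qed.

(** On the diagonal every product with a remaining factor [gi] vanishes, so [kap] is only a device
    for counting: what is left are symbols, with derivatives gaining as such. *)
Lemma cl_diag M F : cl M F -> sym e2 sgl (fun _ => M) (fun _ X => F X X.1).
Proof.
move=> c; have M0 := cl_ge0 c; elim: c => [l e m m0 es mM|F1 F2 _ H1 _ H2]; last exact: sym_add.
case: l mM => [|k l] mM.
 have -> : (fun (_ : unit) X => GG [::] e X X.1) = fun _ => e.
  by apply/funext => t; apply/funext => X; rewrite /GG /= -surjective_pairing.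
 apply: (sym_le ler01 sgl_ge0 _ es) => t X; rewrite mul1r; have := mM X; by rewrite expr0 mulr1.
have -> : (fun (_ : unit) X => GG (k :: l) e X X.1) = fun _ _ => 0.
 by apply/funext => t; apply/funext => X; rewrite /GG /= gi_diag mul0r.
by apply: sym_cst => [t X|i t X|]; [exact: M0|exact: sgl_ge0|exists 0 => // t X; rewrite Normc.normc0 mul0r].
Qed.

Lemma ampl_sym w : sym e2 sgl (fun _ X => w1 X.1 X.2 * kap X ^+ size w) (fun _ X => Dw basv w (ampl X) X.1).
Proof.
have as1 : sym e2 sgl (fun _ X => w1 X.1 X.2) (fun _ X => ca D X.1 X.2) := SG_sym (w1_ge0) (cha D).
have c : cl (fun X => w1 X.1 X.2) (GG [::] (fun X => ca D X.1 X.2)).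
 by apply: cl_base as1 _ => X; rewrite ?w1_ge0// expr0 mulr1.
have [F' cF' HF'] := Dw_EE w c.
apply: sym_eq (cl_diag cF') => t; apply/funext => X.

rewrite HF' /EE /psi subrr sub0r (_ : dotv _ _ = 0) ?oppr0 /expi ?cos0 ?sin0 ?mul1r//.
by rewrite /dotv big1// => k _; rewrite !mxE subrr mul0r.
Qed.

Lemma sym_Dw w (sg : I2 -> unit -> vec2 -> R) m f : sym e2 sg m f ->
 sym e2 sg (fun t X => m t X * \prod_(i <- w) sg i t X) (fun t => Dw e2 w (f t)).
Proof.
elim: w m f => [|i w IH] m f fs /=; first by apply: sym_eqw fs => t X; rewrite big_nil mulr1.
by apply: sym_eqw (IH _ _ (sym_dC i fs)) => t X; rewrite big_cons mulrA.
Qed.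

(** Substituting th for the second variable preserves the class, because <th> is comparable to <xi>
    and th is itself a symbol of order 1 in xi. *)
Lemma P_sym w : sym e2 (@sgSG (cr2 D) 1) (fun _ X => w2 X.1 (th X) * (jap X.2)^-1 ^+ size w)
 (fun _ X => Dw basv w (cp D X.1) (th X)).
Proof.
have /andP[r20 r21] := cr2_01 D; have [Ct Ct0 Ht] := thv_jap.
have ps := sym_Dw (map inr w) (SG_sym (w2_ge0) (chp D)).
have tC i : Cinf (fun X => (th X 0 i)%:C).
 by have -> : (fun X => (th X 0 i)%:C) = dphi i by [apply/funext => X; exact: thvE]; exact: dphiC.
have gC (t : unit) i : Cinf (fun X : vec2 => (co2 i (X.1, th X))%:C).
 by case: i => i; [exact: (co2_C (inl i))|exact: tC].
have gc (t : unit) : continuous (fun X : vec2 => (X.1, th X) : vec2).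
 have c2 : continuous th.
  apply: cont_row => i; have [c _] := Cinf_cont (tC i); exact: c.
 move=> X; exact: (cvg_pair (@cvg_fst _ _ _ _ _) (c2 X)).
have s0 i (t : unit) (X : vec2) : 0 < sgSG (cr2 D) 1 i t X by case: i => i; exact: powR_gt0 (jap_gt0 _).
have gs i j : sym e2 (@sgSG (cr2 D) 1) (fun t X => sgSG (cr2 D) 1 j t X / @sgSG (cr2 D) 1 i tt (X.1, th X))
  (fun _ : unit => dC (e2 j) (fun X => (co2 i (X.1, th X))%:C)).
 case: i => k.
  apply: (sym_eq (f := fun _ _ => (co2 (inl k) (e2 j))%:C)).
   by move=> t; rewrite -(co2_aff (inl k) (e2 j)).
  apply: sym_cst => [t X|j' t X|]; [by rewrite divr_ge0//// ltW|exact: sgSG_ge0|].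
  exists 1 => // t X; rewrite mul1r normcR co2_e2; case: eqP => [<-|_].
   by rewrite normr1 divff// gt_eqF// powR_gt0// jap_gt0.
  by rewrite normr0 divr_ge0//// ltW.
 have -> : (fun _ : unit => dC (e2 j) (fun X => (co2 (inr k) (X.1, th X))%:C)) = fun _ => dC (e2 j) (dphi k).
  by apply/funext => t; congr (dC _ _); apply/funext => X; exact: thvE.
 have H1 : sym e2 (sgSG (cr2 D) 1) (fun t X => jap X.2 * sgSG 1 1 j t X) (fun _ => dC (e2 j) (dphi k)).
  apply: (sym_sg (K := 1) _ _ _ (sym_dC j (phix_sym k))) => // [t X|j' t X]; first by rewrite mulr_ge0 ?jap_ge0 ?sgSG_ge0.
  by rewrite mul1r sgSG_ge0; case: j' => j' //=; rewrite ler_powR ?jap_ge1// lerN2.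
 apply: (sym_le Ct0 (@sgSG_ge0 (cr2 D) 1) _ H1) => t X.
 rewrite /= powRN1 invrK mulrCA [leLHS]mulrC; apply: ler_pM; rewrite ?sgSG_ge0 ?jap_ge0 ?(Ht X).2//.
 by case: j {H1} => j //=; rewrite ler_powR ?jap_ge1// lerN2.
have H := sym_comp co2_sum co2B (p := fun _ : unit => tt) (g := fun _ (X : vec2) => (X.1, th X))
 (@sgSG_ge0 (cr2 D) 1) s0 gc gC gs _ ps.
apply: sym_eq (sym_le (exprn_ge0 (size w) Ct0) (@sgSG_ge0 (cr2 D) 1) _ (H _)) => [t|t X|t X].
- by apply/funext => X; rewrite sec2_Dw.
- rewrite [leRHS]mulrCA ler_wpM2l ?w2_ge0// big_map /=.
 have -> : \prod_(j <- w) jap (th X) `^ (- 1) = (jap (th X))^-1 ^+ size w.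
  by elim: (w) => [|i l IH]; rewrite ?big_nil ?big_cons//= IH powRN1 exprS.
 rewrite -exprMn; apply: ler_Xn; rewrite ?mulr_ge0 ?invr_ge0 ?jap_ge0//.
 by rewrite ler_pdivlMr ?jap_gt0// mulrC ler_pdivrMr ?jap_gt0// (Ht X).2.
by rewrite mulr_ge0 ?w2_ge0// prodr_ge0// => i _; exact: sgSG_ge0.
Qed.

Lemma sgSG_mono (r r' rho rho' : R) i t X : r' <= r -> rho' <= rho -> 0 <= sgSG r rho i t X <= 1 * @sgSG r' rho' i t X.
Proof.
by move=> rr hh; rewrite mul1r sgSG_ge0; case: i => i /=; rewrite ler_powR ?jap_ge1// lerN2.
Qed.

Lemma aj_sym j : sym e2 (@sgSG (cr0 D) (crho0 D)) (fun _ X => w0 X.1 X.2 * dl X ^+ (2 * j)) (fun _ X => aj j X.1 X.2).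
Proof.
have m0 (t : unit) X : 0 <= w0 X.1 X.2 * dl X ^+ (2 * j) by rewrite mulr_ge0 ?w0_ge0// exprn_ge0// ltW// dl_gt0.
have r01 : cr0 D <= r1 by rewrite cr0E ge_min lexx.
have r02 : cr0 D <= cr2 D by rewrite cr0E !ge_min lexx orbT.
have h01 : crho0 D <= rho1 by rewrite crho0E ge_min lexx.
have h02 : crho0 D <= 1 by rewrite crho0E ge_min lexx orbT.
have E : (fun (_ : unit) (X : vec2) => aj j X.1 X.2) = fun _ X =>
  \sum_(al : {ffun 'I_d -> 'I_j.+1}) (if mi_size (fun i => al i) == j then
   'i%C ^+ mi_size (fun i => al i) / (mi_fact (fun i => al i))%:R * (- 'i%C) ^+ j * (- 'i%C) ^+ j *
   (Dw basv (wd (fun i => al i)) (cp D X.1) (th X) * Dw basv (wd (fun i => al i)) (ampl X) X.1) else 0).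
 apply/funext => t; apply/funext => X; rewrite /aj /sum_mi big_mkcond /=; apply: eq_bigr => al _.
 by case: eqP => // sz; rewrite !DmiE sz /ampl; ring.
rewrite E; apply: sym_sum => // [i t X|al]; first exact: sgSG_ge0.
case: eqP => [sz|_]; last by apply: sym_cst => // [i t X|]; [exact: sgSG_ge0|exists 0 => // t X; rewrite Normc.normc0 mul0r].
apply: sym_scale.
have H1 := P_sym (wd (fun i => al i)); have H2 := ampl_sym (wd (fun i => al i)).
have {}H1 := sym_sg ler01 _ (fun i t X => sgSG_mono i t X r02 h02) H1.
have {}H2 := sym_sg ler01 _ (fun i t X => sgSG_mono i t X r01 h01) H2.
apply: sym_eqw (sym_mul (H1 _) (H2 _)) => [t X|t X|t X].
- have -> : dl X ^+ (2 * j) = kap X ^+ j * (jap X.2)^-1 ^+ j by rewrite exprM -kap_dl exprMn.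
 by rewrite size_wd sz cw0E mulrACA; congr (_ * _); exact: mulrC.
- by rewrite mulr_ge0 ?w2_ge0 ?exprn_ge0 ?invr_ge0 ?jap_ge0.
- by rewrite mulr_ge0 ?w1_ge0 ?exprn_ge0// ltW// kap_gt0.
Qed.

End leading_classes.

(** * Symbol estimates for the remainders of the expansion *)

Section asymptotics.
Local Notation r0 := (cr0 D).
Local Notation rho0 := (crho0 D).
Local Notation sg0 := (@sgSG r0 rho0).
Local Notation W X := (w0 X.1 X.2).

Definition gN N (X : vec2) : R[i] := cc X.1 X.2 - \sum_(j < N) aj j X.1 X.2.

Lemma dl_def X : dl X = (jap X.1 `^ (r1 / 4) * jap X.2 `^ (1 / 4))^-1. Proof. by []. Qed.

Lemma r0_ge0 : 0 <= r0.
Proof. by have /andP[a _] := cr1_01 D; have /andP[b _] := cr2_01 D; rewrite cr0E !le_min a b ler01. Qed.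
Lemma rho0_ge0 : 0 <= rho0.
Proof. by have /andP[a _] := crho1_01 D; rewrite crho0E le_min a ler01. Qed.

Lemma ajC j : Cinf (fun X : vec2 => aj j X.1 X.2). Proof. exact: (sym_Cinf tt (aj_sym j)). Qed.
Lemma ccC : Cinf (fun X : vec2 => cc X.1 X.2). Proof. by have [] := cc_crude. Qed.
Lemma gNC N : Cinf (gN N).
Proof. by apply: Cinf_sub; [exact: ccC|apply: Cinf_sum => j _; exact: ajC]. Qed.

Lemma W0 X : 0 <= W X. Proof. exact: w0_ge0. Qed.
Lemma dl0 X : 0 <= dl X. Proof. exact: ltW (dl_gt0 X). Qed.
Lemma dl_pow_le m n X : (m <= n)%N -> dl X ^+ n <= dl X ^+ m.
Proof. by move=> mn; rewrite ler_wiXn2l ?dl0 ?dl_le1. Qed.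
Lemma sg0_prod_le1 w t X : \prod_(i <- w) sg0 i t X <= 1.
Proof.
by apply: prodr_ile1 => i _; exact: (sgSG_le1 _ _ _ r0_ge0 rho0_ge0).
Qed.

Lemma aj_bound w j : exists2 C : R, 0 <= C & forall X,
 normc (Dw e2 w (fun X => aj j X.1 X.2) X) <= C * (W X * dl X ^+ (2 * j) * \prod_(i <- w) sg0 i tt X).
Proof. by have [_ /(_ w (leqnn _))[C C0 HC]] := aj_sym j (size w); exists C => // X; exact: HC. Qed.

(** K is independent of N, because the terms of the expansion have size at most w0; [gN_decay] fixes
    K first and the length N afterwards. *)
Lemma gN_crude w : exists K, forall N, exists2 C : R, 0 <= C & forall X, normc (Dw e2 w (gN N) X) <= C * (W X * jap X.2 ^+ K).
Proof.
have [_ /(_ w)[C C0 [K HK]]] := cc_crude; exists K; elim=> [|N [C' C'0 IH]].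
 exists C => // X; have -> : gN 0 = fun X => cc X.1 X.2 by apply/funext => Y; rewrite /gN big_ord0 subr0.
 exact: HK.
have [Ca Ca0 Ha] := aj_bound w N; exists (C' + Ca) => [|X]; first exact: addr_ge0.
have -> : gN N.+1 = fun X => gN N X - aj N X.1 X.2 by apply/funext => Y; rewrite /gN big_ord_recr /= opprD addrA.
rewrite Dw_sub; [|exact: gNC|exact: ajC]; apply: le_trans (le_normcD _ _) _; rewrite normcN mulrDl; apply: lerD => //.
apply: le_trans (Ha X) _; rewrite ler_wpM2l// -mulrA ler_wpM2l ?W0//.
apply: (@le_trans _ _ 1); last by rewrite exprn_ege1// jap_ge1.
apply: mulr_ile1; [by rewrite exprn_ge0 ?dl0| |by rewrite exprn_ile1 ?dl0 ?dl_le1|exact: sg0_prod_le1].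
by rewrite prodr_ge0// => i _; exact: sgSG_ge0.
Qed.

Lemma step_bounds i : exists2 C : R, 1 <= C & forall X s, 0 <= s <= 1 ->
 [/\ W (X + s *: e2 i) <= C * W X, dl (X + s *: e2 i) <= C * dl X & jap (X + s *: e2 i).2 <= C * jap X.2].
Proof.
have [C0 C00 [m Hm]] := weight_mod (chw0 D).
pose b1 := 1 + enorm (e2 i).1; pose b2 := 1 + enorm (e2 i).2.
have b11 : 1 <= b1 by rewrite lerDl enorm_ge0.
have b21 : 1 <= b2 by rewrite lerDl enorm_ge0.
have jb (v : vec) s : 0 <= s <= 1 -> jap (s *: v) <= 1 + enorm v.
 by move=> s01; apply: le_trans (jap_le1D _) _; rewrite lerD2l enorm_scale_le.
have /andP[p0 p1] := cr1_01 D.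
have jpow (x v : vec) s a b : 0 <= s <= 1 -> 0 <= a <= 1 -> 1 + enorm v <= b -> jap x `^ a <= 2 * b * jap (x + s *: v) `^ a.
 move=> s01 /andP[a0 a1] vb; have b0 : 1 <= 2 * b.
  have := enorm_ge0 v; lra.
 have h : jap x <= 2 * b * jap (x + s *: v).
  have := japD (x + s *: v) (- (s *: v)); rewrite addrK japN => h; apply: le_trans h _.
  rewrite -mulrA ler_wpM2l// mulrC ler_wpM2r ?jap_ge0//; exact: le_trans (jb _ _ s01) vb.
 apply: le_trans (ge0_ler_powR a0 _ _ h) _; rewrite ?nnegrE ?jap_ge0 ?mulr_ge0 ?jap_ge0//; [lra|].
 rewrite powRM ?jap_ge0//; last lra.
 by rewrite ler_wpM2r ?powR_ge0// -[leRHS]powRr1 ?ler_powR//; lra.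
pose C := (C0 * (b1 * b2) ^+ m) + (2 * b1) * (2 * b2) + 2 * b2.
have q : 1 <= (2 * b1) * (2 * b2) by rewrite mulr_ege1//; lra.
have q0 : 0 <= C0 * (b1 * b2) ^+ m by rewrite mulr_ge0// exprn_ge0// mulr_ge0//; lra.
have C1 : 1 <= C by rewrite /C; lra.
have cC1 : C0 * (b1 * b2) ^+ m <= C by rewrite /C; lra.
have cC2 : 2 * b1 * (2 * b2) <= C by rewrite /C; lra.
have cC3 : 2 * b2 <= C by rewrite /C; lra.
have a01 : 0 <= r1 / 4 <= 1 by rewrite divr_ge0//= ler_pdivrMr// mul1r; lra.
have a02 : 0 <= (1 / 4 : R) <= 1 by apply/andP; split; lra.
exists C => // X s s01; split.
- have := Hm X.1 X.2 (s *: (e2 i).1) (s *: (e2 i).2) => h; apply: le_trans h _; rewrite mulrAC ler_wpM2r ?W0//.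
 apply: le_trans cC1.
 rewrite ler_wpM2l//; apply: ler_Xn; rewrite ?mulr_ge0 ?jap_ge0//.
 by apply: ler_pM; rewrite ?jap_ge0// jb.
- have A1 := powR_gt0 (r1 / 4) (jap_gt0 X.1); have A2 := powR_gt0 (1 / 4) (jap_gt0 X.2).
 have B1 := powR_gt0 (r1 / 4) (jap_gt0 (X + s *: e2 i).1); have B2 := powR_gt0 (1 / 4) (jap_gt0 (X + s *: e2 i).2).
 apply: (@le_trans _ _ ((2 * b1) * (2 * b2) * dl X)); last by rewrite ler_wpM2r ?dl0.
 have J1 := jpow X.1 (e2 i).1 s (r1 / 4) b1 s01 a01 (lexx _).
 have J2 := jpow X.2 (e2 i).2 s (1 / 4) b2 s01 a02 (lexx _).
 by rewrite !dl_def; exact: inv_prod_le A1 A2 B1 B2 J1 J2.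
apply: (@le_trans _ _ (2 * b2 * jap X.2)); last by rewrite ler_wpM2r ?jap_ge0.
apply: le_trans (japD _ _) _; rewrite -mulrA ler_wpM2l// mulrC ler_wpM2r ?jap_ge0//; exact: jb.
Qed.

(** The left-hand side is <x>^-r1. This converts the losses in <xi> into losses of gains. *)
Lemma dl4_le X : dl X ^+ 4 * jap X.2 <= 1.
Proof.
have -> : dl X ^+ 4 * jap X.2 = kap X * dl X ^+ 2 by rewrite /kap; ring.
have V1 := Vs1 (X, 0 : R); have U1 := Us1 (X, 0).
have V0 := lt_le_trans ltr01 V1; have U0 := lt_le_trans ltr01 U1.
rewrite kapE dlUV; have -> : Vs (X, 0) ^+ 2 / Us (X, 0) ^+ 2 * (Us (X, 0) * Vs (X, 0))^-1 ^+ 2 = (Us (X, 0) ^+ 4)^-1.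
 by field; rewrite !gt_eqF.
by rewrite invf_le1 ?exprn_gt0// exprn_ege1.
Qed.
Lemma dl_jap L K X : dl X ^+ (L + 4 * K) * jap X.2 ^+ K <= dl X ^+ L.
Proof.
rewrite exprD exprM -mulrA -exprMn ler_piMr ?exprn_ge0 ?dl0//.
by rewrite exprn_ile1 ?dl4_le// mulr_ge0 ?jap_ge0 ?exprn_ge0 ?dl0.
Qed.

(* Landau's interpolation inequality with step dl^S: decay of a function and crude control of its second
  derivative give decay of the first derivative. *)
Lemma gN_decay w : forall L, exists N0, forall N, (N0 <= N)%N ->
 exists2 C : R, 0 <= C & forall X, normc (Dw e2 w (gN N) X) <= C * (W X * dl X ^+ L).
Proof.
elim/last_ind: w => [|w i IH] L.
 exists (L + 8 * d)%N => N LN; have [C C0 HC] := expansion_bound N; exists C => // X.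
 apply: le_trans (HC X) _; rewrite -[_ * _ * _]mulrA ler_wpM2l// ler_wpM2l ?W0//.
 rewrite ler_pdivrMr ?exprn_gt0 ?dl_gt0// -exprD; exact: dl_pow_le.
(* With step s = [dl]^S, dividing the decay [dl]^(L + S) by s leaves [dl]^L, and s <xi>^K is at most
   [dl]^L by [dl_jap]. *)
have [K HK] := gN_crude (rcons (rcons w i) i); pose S := (L + 4 * K)%N.
have [N0 H0] := IH (L + S)%N; exists N0 => N NN.
have [C C0 HC] := H0 N NN; have [C2 C20 HC2] := HK N; have [b b1 Hb] := step_bounds i.
have b0 := le_trans ler01 b1.
pose T := C * b ^+ (L + S).+1 + C + 4 * (C2 * b ^+ K.+1).
exists T => [|X]; first by rewrite /T !(addr_ge0, mulr_ge0, exprn_ge0).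
have fC : Cinf (Dw e2 w (gN N)) by apply: Cinf_Dw; exact: gNC.
pose s := dl X ^+ S; have s0 : 0 < s by rewrite exprn_gt0// dl_gt0.
have s1 : s <= 1 by rewrite exprn_ile1 ?dl0 ?dl_le1.
rewrite Dw_rcons; set f := Dw e2 w (gN N).
have H2 := @second_order R _ f (s *: e2 i) X (s ^+ 2 * (C2 * b ^+ K.+1 * (W X * jap X.2 ^+ K))) fC.
have {}H2 : normc (f (X + s *: e2 i) - f X - dC (s *: e2 i) f X) <= 4 * (s ^+ 2 * (C2 * b ^+ K.+1 * (W X * jap X.2 ^+ K))).
 apply: H2 => u /andP[u0 u1].
 have -> : dC (s *: e2 i) (dC (s *: e2 i) f) = fun x => (s ^+ 2)%:C * Dw e2 (rcons (rcons w i) i) (gN N) x.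
  rewrite !Dw_rcons (dCZv _ s fC) dC_scale; last exact: Cinf_dC.
  rewrite dCZv; last exact: Cinf_dC.
  by apply/funext => x; rewrite mulrA -rmorphM.
 rewrite Normc.normcM normcR ger0_norm ?sqr_ge0// ler_wpM2l ?sqr_ge0// scalerA.
 have us : 0 <= u * s <= 1 by rewrite mulr_ge0 ?(ltW s0)//= mulr_ile1 ?(ltW s0).
 have [h1 _ h3] := Hb X _ us; apply: le_trans (HC2 _) _.
 have -> : C2 * b ^+ K.+1 * (W X * jap X.2 ^+ K) = C2 * ((b * W X) * (b * jap X.2) ^+ K) by rewrite exprS exprMn; ring.
 rewrite ler_wpM2l//; apply: ler_pM; rewrite ?W0 ?exprn_ge0 ?jap_ge0//.
 by apply: ler_Xn; rewrite ?mulr_ge0 ?jap_ge0.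
have s01 : 0 <= s <= 1 by rewrite (ltW s0).
have [h1 h2 _] := Hb X s s01.
have Hv : normc (f (X + s *: e2 i)) <= C * b ^+ (L + S).+1 * (W X * dl X ^+ (L + S)).
 apply: le_trans (HC _) _.
 have -> : C * b ^+ (L + S).+1 * (W X * dl X ^+ (L + S)) = C * ((b * W X) * (b * dl X) ^+ (L + S)) by rewrite exprS exprMn; ring.
 rewrite ler_wpM2l//; apply: ler_pM; rewrite ?W0 ?exprn_ge0 ?dl0//.
 by apply: ler_Xn; rewrite ?mulr_ge0 ?dl0.
have Hx := HC X; rewrite -/f in Hx.
have E : normc (dC (s *: e2 i) f X) = s * normc (dC (e2 i) f X).
 by rewrite (dCZv _ s fC) Normc.normcM normcR gtr0_norm.
have tri : normc (dC (s *: e2 i) f X) <= normc (f (X + s *: e2 i)) + normc (f X) +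
  normc (f (X + s *: e2 i) - f X - dC (s *: e2 i) f X).
 have Et : dC (s *: e2 i) f X = f (X + s *: e2 i) + - f X + - (f (X + s *: e2 i) - f X - dC (s *: e2 i) f X).
  by rewrite opprB addrCA subrr addr0.
 rewrite {1}Et; apply: le_trans (le_normcD _ _) _; rewrite normcN lerD2r; apply: le_trans (le_normcD _ _) _; by rewrite normcN.
rewrite -(ler_pM2l s0) -E; apply: le_trans tri _; apply: le_trans (lerD (lerD Hv Hx) H2) _.
have Sl : dl X ^+ (L + S) = s * dl X ^+ L by rewrite exprD mulrC.
have Kl : W X * (s * jap X.2 ^+ K) <= W X * dl X ^+ L by rewrite ler_wpM2l ?W0// dl_jap.
have -> : s * (T * (W X * dl X ^+ L)) = C * b ^+ (L + S).+1 * (W X * dl X ^+ (L + S)) + C * (W X * dl X ^+ (L + S))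
  + 4 * (s * (C2 * b ^+ K.+1 * (W X * dl X ^+ L))) by rewrite Sl /T; ring.
rewrite lerD2l ler_wpM2l//.
have -> : s ^+ 2 * (C2 * b ^+ K.+1 * (W X * jap X.2 ^+ K)) = s * (C2 * b ^+ K.+1 * (W X * (s * jap X.2 ^+ K))) by ring.
by rewrite ler_wpM2l ?(ltW s0)// ler_wpM2l// mulr_ge0// exprn_ge0.
Qed.

(** As [dl]^4 = <x>^-r1 <xi>^-1 with r0 <= r1 and rho0 <= 1, four gains are worth the decay required
    of any one derivative. *)
Lemma dl4_sg0 i X : dl X ^+ 4 <= sg0 i tt X.
Proof.
have r01 : r0 <= r1 by rewrite cr0E ge_min lexx.
have h02 : rho0 <= 1 by rewrite crho0E ge_min lexx orbT.
have U1 := Us1 (X, 0); have V1 := Vs1 (X, 0 : R).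
have U0 := lt_le_trans ltr01 U1; have V0 := lt_le_trans ltr01 V1.
rewrite dlUV exprVn exprMn invfM (Us4 (X, 0)) (Vs4 (X, 0)).
have j1 : (jap X.1 `^ r1)^-1 <= 1 by rewrite -(Us4 (X, 0)) invf_le1 ?exprn_gt0// exprn_ege1.
have j2 : (jap X.2)^-1 <= 1 by rewrite invf_le1 ?jap_gt0 ?jap_ge1.
have p1 : 0 <= (jap X.1 `^ r1)^-1 by rewrite invr_ge0 powR_ge0.
have p2 : 0 <= (jap X.2)^-1 by rewrite invr_ge0 jap_ge0.
case: i => i /=.
 apply: (@le_trans _ _ (jap X.1 `^ r1)^-1); first by rewrite ler_piMr.
 by rewrite -powRN ler_powR ?jap_ge1// lerN2.
apply: (@le_trans _ _ (jap X.2)^-1); first by rewrite ler_piMl.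
by rewrite -powRN1 ler_powR ?jap_ge1// lerN2.
Qed.

(** For N large the remainder decays more than is asked, which also covers the losses of [gN_decay]
    and the decay of its derivatives. One then descends to n, adding back terms that are symbols of
    the right class by [aj_sym]. *)
Lemma gN_sym n : sym e2 sg0 (fun _ X => W X * dl X ^+ n) (fun _ => gN n).
Proof.
move=> k; split=> [t|w _]; first exact: gNC.
have [N0 H0] := gN_decay w (n + 4 * size w); pose N := maxn N0 n.
have pw X : dl X ^+ (4 * size w) <= \prod_(i <- w) sg0 i tt X.
 elim: (w) => [|i l IH]; first by rewrite muln0 big_nil.
 by rewrite big_cons /= mulnS exprD; apply: ler_pM; rewrite ?exprn_ge0 ?dl0 ?dl4_sg0.
have pw0 X : 0 <= \prod_(i <- w) sg0 i tt X by rewrite prodr_ge0// => i _; exact: sgSG_ge0.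
(* The minimum lets the descent be stated for every m, including those for which N - m falls below
   n. *)
suff H m : exists2 C : R, 0 <= C & forall X, normc (Dw e2 w (gN (N - m)) X) <= C * (W X * dl X ^+ minn n (N - m) * \prod_(i <- w) sg0 i tt X).
 have [C C0 HC] := H (N - n)%N; exists C => // -[] X; have := HC X.
 by rewrite subKn ?leq_maxr// minnn.
have base : exists2 C : R, 0 <= C & forall X, normc (Dw e2 w (gN N) X) <= C * (W X * dl X ^+ n * \prod_(i <- w) sg0 i tt X).
 have [C C0 HC] := H0 N (leq_maxl _ _); exists C => // X; apply: le_trans (HC X) _.
 by rewrite ler_wpM2l// exprD mulrA ler_wpM2l// mulr_ge0 ?W0 ?exprn_ge0 ?dl0.
elim: m => [|m [C C0 IH]]; first by rewrite subn0 (minn_idPl (leq_maxr _ _)).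
case: (leqP N m) => [Nm|mN].
 exists C => // X; have -> : (N - m.+1 = N - m)%N by rewrite (eqP Nm) (eqP (leqW Nm)).
 exact: IH.
pose j := (N - m.+1)%N; have Ej : (N - m = j.+1)%N by rewrite /j -subnSK.
have [Ca Ca0 Ha] := aj_bound w j; exists (C + Ca) => [|X]; first exact: addr_ge0.
rewrite -/j; have -> : gN j = fun X => gN j.+1 X + aj j X.1 X.2.
 by apply/funext => Y; rewrite /gN big_ord_recr /= opprD addrA subrK.
rewrite Dw_add; [|exact: gNC|exact: ajC]; apply: le_trans (le_normcD _ _) _; rewrite mulrDl; apply: lerD.
 have := IH X; rewrite Ej => /le_trans; apply; rewrite ler_wpM2l// ler_wpM2r// ler_wpM2l ?W0//.
 by apply: dl_pow_le; rewrite leq_min geq_minl (leq_trans (geq_minr _ _)).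
apply: le_trans (Ha X) _; rewrite ler_wpM2l// ler_wpM2r// ler_wpM2l ?W0//.
by apply: dl_pow_le; rewrite mul2n -addnn (leq_trans (geq_minr _ _)) ?leq_addr.
Qed.

Lemma cc_SG : SG w0 r0 rho0 (cc).
Proof.
apply: sym_SG; first exact: w0_ge0.
have H := gN_sym 0; have E : gN 0 = fun X => cc X.1 X.2 by apply/funext => X; rewrite /gN big_ord0 subr0.
rewrite E in H; apply: (sym_le (m' := fun _ X => W X) ler01 (@sgSG_ge0 r0 rho0) _ H) => t X.
by rewrite mul1r expr0 mulr1.
Qed.

Lemma cvgNy_lin (c : R) : 0 < c -> (fun j : nat => - (c * j%:R)) @ \oo --> -oo.
Proof.
move=> c0; apply/cvgrNyPle => A; exists (Num.truncn (`|A| / c)).+1 => // n /= hn.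
rewrite lerNl; apply: le_trans (_ : `|A| <= _); first by rewrite -normrN ler_norm.
rewrite -ler_pdivrMl// mulrC; apply: le_trans (ltW (truncnS_gt _)) _; by rewrite ler_nat.
Qed.

Lemma cc_asymp : asymp_expansion w0 r0 rho0 (cc) (aj).
Proof.
(* The exponents of [dl]^j, set to 0 where the definition of the expansion demands it; dropping a
   nonpositive exponent only weakens the bound. *)
pose s (j : nat) : R := if 0 < r0 then - (r1 / 4 * j%:R) else 0.
pose sigma (j : nat) : R := if 0 < rho0 then - (1 / 4 * j%:R) else 0.
have /andP[p0 p1] := cr1_01 D.
have q0 : 0 <= r1 / 4 by rewrite divr_ge0.
have dls j X : dl X ^+ j <= theta (s j) (sigma j) X.1 X.2.
 have -> : dl X ^+ j = jap X.1 `^ (- (r1 / 4 * j%:R)) * jap X.2 `^ (- (1 / 4 * j%:R)).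
  have E (x : vec) a : jap x `^ (- (a * j%:R)) = (jap x `^ a)^-1 ^+ j.
   by rewrite powRN powRrM powR_mulrn ?powR_ge0// exprVn.
  by rewrite !E dl_def -exprMn invfM.
 apply: ler_pM; rewrite ?powR_ge0// ler_powR ?jap_ge1// /s /sigma; case: ifP => // _; rewrite oppr_le0 mulr_ge0//.
have wp j (x xi : vec) : 0 <= w0 x xi * theta (s j) (sigma j) x xi by rewrite mulr_ge0 ?w0_ge0// mulr_ge0 ?powR_ge0.
exists s, sigma; split.
- by move=> j; rewrite /s /sigma; split; case: ifP => // _; rewrite oppr_le0 mulr_ge0.
- case: ifP => [r00|r00]; last by move=> j; rewrite /s r00.
 rewrite (_ : s = fun j => - (r1 / 4 * j%:R)); last by apply/funext => j; rewrite /s r00.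
 apply: cvgNy_lin; rewrite divr_gt0//; apply: lt_le_trans r00 _; by rewrite cr0E ge_min lexx.
- case: ifP => [h00|h00]; last by move=> j; rewrite /sigma h00.
 rewrite (_ : sigma = fun j => - (1 / 4 * j%:R)); last by apply/funext => j; rewrite /sigma h00.
 by apply: cvgNy_lin; rewrite divr_gt0.
- move=> j; apply: sym_SG; first exact: wp.
 apply: (sym_le ler01 (@sgSG_ge0 r0 rho0) _ (aj_sym j)) => t X.
 rewrite mul1r ler_wpM2l ?W0//; apply: le_trans (dls j X); apply: dl_pow_le.
 by rewrite mul2n -addnn leq_addr.
- move=> N; apply: sym_SG; first exact: wp.
 apply: (sym_le ler01 (@sgSG_ge0 r0 rho0) _ (gN_sym N.+1)) => t X.
 by rewrite mul1r ler_wpM2l ?W0.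
Qed.

End asymptotics.

(** * Exactness of the composition formula *)

Section rapid_functions.
Local Notation S2 := phase_space_measure.

(** Otherwise 1 and all |x_i| would be below, or at most, <x> / (d + 1), contradicting <x> <= 1 +
    the sum of the |x_i|. It turns monomial bounds into bounds by powers of <x>. *)
Lemma jap_dichotomy (x : vec) : jap x <= d.+1%:R \/ exists i, jap x <= d.+1%:R * `|x 0 i|.
Proof.
have [H|H] := pselect (exists i, jap x <= d.+1%:R * `|x 0 i|); first by right.
left; rewrite leNgt; apply/negP => xd.

have h i : `|x 0 i| <= jap x / d.+1%:R.
 rewrite ler_pdivlMr// mulrC leNgt; apply/negP => h; apply: H; exists i; exact: ltW.
have : jap x < jap x / d.+1%:R + \sum_(i < d) jap x / d.+1%:R.
 apply: le_lt_trans (jap_le1D x) _; apply: ltr_leD; first by rewrite ltr_pdivlMr// mul1r.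
 by apply: le_trans (enorm_sum x) _; apply: ler_sum.
suff E : jap x / d.+1%:R + (jap x / d.+1%:R) *+ d = jap x by rewrite sumr_const card_ord E ltxx.
by rewrite -mulrS -[LHS]mulr_natr divfK// gt_eqF.
Qed.

Lemma schwartz_rapid (f : vec -> R[i]) : schwartz f -> rapid f.
Proof.
move=> [/smooth_CinfP fC H] N k; split=> // w _.
pose be i := count_mem i w.
have wb : perm_eq w (wd be) by apply/allP => i _ /=; rewrite count_wd.
pose al (i k : 'I_d) := if k == i then N else 0%N.
have [C0 HC0] := H (fun=> 0%N) be; have [C HC] := choice (fun i => H (al i) be).
pose T := d.+1%:R ^+ N * (`|C0| + \sum_i `|C i|).
have T0 : 0 <= `|C0| + \sum_i `|C i| by rewrite addr_ge0// sumr_ge0.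
exists T => [|_ x]; first by rewrite mulr_ge0// exprn_ge0.
rewrite big1_eq mulr1 (Dw_perm _ fC wb) ler_pdivlMr ?exprn_gt0 ?jap_gt0//.
have nD y : normc (Dmi be f y) = normc (Dw basv (wd be) f y) by rewrite DmiE Normc.normcM normc_Ni mul1r.
have B0 : normc (Dw basv (wd be) f x) <= `|C0| + \sum_i `|C i|.
 rewrite -nD; have := HC0 x; rewrite /monom big1 ?mul1r// => h.
 by apply: le_trans h _; apply: le_trans (ler_norm _) _; rewrite lerDl sumr_ge0.
have n0 := normc_ge0 (Dw basv (wd be) f x).
case: (jap_dichotomy x) => [h|[i h]].
 rewrite mulrC /T; apply: ler_pM; rewrite ?exprn_ge0 ?jap_ge0//.
 by apply: ler_Xn; rewrite ?jap_ge0.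
apply: (@le_trans _ _ (normc (Dw basv (wd be) f x) * (d.+1%:R * `|x 0 i|) ^+ N)).
 by rewrite ler_wpM2l//; apply: ler_Xn; rewrite ?jap_ge0.
rewrite exprMn mulrCA ler_wpM2l//.
have := HC i x; rewrite Normc.normcM normcR nD.
have -> : monom (al i) x = x 0 i ^+ N.
 by rewrite /monom (bigD1 i)//= /al eqxx big1 ?mulr1// => k' /negPf ->.
rewrite normrX mulrC => h2; apply: le_trans h2 _; apply: le_trans (ler_norm _) _.
by rewrite (bigD1 i)//= addrCA lerDl addr_ge0// sumr_ge0.
Qed.

Lemma rapid_scale (c : R[i]) u : rapid u -> rapid (fun x : vec => c * u x).
Proof. by move=> ur N; exact: sym_scale (ur N). Qed.
Lemma rapid_dC i u : rapid u -> rapid (dC (basv i) u).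
Proof. by move=> ur N; apply: sym_eqw (sym_dC i (ur N)) => t x; rewrite mulr1. Qed.
Lemma rapid_dir (v : vec) u : rapid u -> rapid (dC v u).
Proof.
move=> ur N; have -> : dC v u = fun x => \sum_i (v 0 i)%:C * dC (basv i) u x.
 by rewrite {1}(sum_basv v) dC_sumv//; exact: rapid_Cinf ur.
apply: sym_sum => // [t x|i]; first exact: japV_ge0.
exact: sym_scale (rapid_dC i ur N).
Qed.

Lemma japV_shift (x z : vec) N : jap (x + z) ^- N <= (2 * jap x) ^+ N * jap z ^- N.
Proof.
rewrite ler_pdivlMr ?exprn_gt0 ?jap_gt0// mulrC ler_pdivrMr ?exprn_gt0 ?jap_gt0// -exprMn.
apply: ler_Xn; rewrite ?mulr_ge0 ?jap_ge0//.
have := japD (x + z) (- x); rewrite japN addrAC subrr add0r => h; apply: le_trans h _.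
by rewrite -mulrA ler_wpM2l// mulrC.
Qed.

Lemma shift_C u x : Cinf u -> Cinf (fun z : vec => u (x + z)).
Proof.
apply: (Cinf_affine (A := fun z => x + z) (A0 := id)).
 by move=> z; exact: cvgD (cvg_cst _) (@cvg_id _ (nbhs z)).
by move=> v s y; rewrite addrCA.
Qed.
Lemma rapid_shift (u : vec -> R[i]) x : rapid u -> rapid (fun z => u (x + z)).
Proof.
move=> ur N k; have [uC H] := ur N k; split=> [t|w wk]; first exact: shift_C (uC t).
have [C C0 HC] := H w wk; exists (C * (2 * jap x) ^+ N) => [|t z]; first by rewrite mulr_ge0 ?exprn_ge0 ?mulr_ge0 ?jap_ge0.
rewrite Dw_shift; apply: le_trans (HC t _) _; rewrite big1_eq !mulr1 -mulrA ler_wpM2l//.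
exact: japV_shift.
Qed.
Lemma rapid_dom u : rapid u -> dom S1 u.
Proof.
move=> ur; split; first exact: Cinf_cont (rapid_Cinf ur).
have [C C0 HC] := rapid_bound (2 * d) ur; exists C => x; apply: le_trans (HC x) _.
by rewrite ler_wpM2l//; exact: japV_dom.
Qed.

Lemma Lam_dC_shift u x (v : vec) : rapid u -> Lam S1 (fun z => dC v u (x + z)) = 0.
Proof.
move=> ur; have -> : (fun z => dC v u (x + z)) = fun z => \sum_i (v 0 i)%:C * dC (basv i) (fun y => u (x + y)) z.
 apply/funext => z; have := @Dw_shift; rewrite {1}(sum_basv v) dC_sumv; last exact: rapid_Cinf ur.
 by move=> H; apply: eq_bigr => i _; have /(congr1 (fun g => g z)) /= -> := H [:: i] u x.
have rs := rapid_shift x ur; have rd i := rapid_dom (rapid_dC i rs).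
rewrite Lam_sum => [|i]; last exact: dom_scale.
rewrite big1// => i _; rewrite LamZ// Lam_ibp ?mulr0//; last exact: rapid_dom.
exact: Cinf_derC (rapid_Cinf rs).
Qed.

(** Translation invariance by differentiation: the derivative of the integral of u(t x + z) in t is
    the integral of a derivative of u, which is 0, so its values at t = 1 and t = 0 agree. *)
Lemma Lam_shift u x : rapid u -> Lam S1 (fun z => u (x + z)) = Lam S1 u.
Proof.
move=> ur; have uC := rapid_Cinf ur.
pose h (t : R^o) : R[i] := Lam S1 (fun z => u (t *: x + z)).
have [C C0 HC] := rapid_bound (2 * d) (rapid_dir x (rapid_dir x ur)).
have hd t : is_dC h 1 t 0.
 pose B := C * (2 * (1 + (`|t| + 1) * enorm x)) ^+ (2 * d).
 apply: (is_dC_quad (B := 4 * B * (2 * Qtot S1))) => s s1; rewrite mulr0 subr0.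
 have d1 (r : R) := rapid_dom (rapid_shift (r *: x) ur).
 have d2 := rapid_dom (rapid_shift (t *: x) (rapid_dir x ur)).
 have -> : h (t + s *: 1) - h t = Lam S1 (fun z => u ((t + s) *: x + z) - u (t *: x + z) - s%:C * dC x u (t *: x + z)).
  rewrite LamB; [|exact: dom_sub (d1 _) (d1 _)|exact: dom_scale].
  by rewrite LamB// LamZ// Lam_dC_shift// mulr0 subr0 /h -[s *: 1]/(s * 1) mulr1.
 have -> : 4 * B * (2 * Qtot S1) * s ^+ 2 = 4 * B * s ^+ 2 * (2 * Qtot S1) by ring.
 apply: (Lam_bound (S := S1) (C := 4 * B * s ^+ 2)) => [|z].
  by have [] := dom_sub (dom_sub (d1 (t + s)) (d1 t)) (dom_scale s%:C d2).
 have -> : (t + s) *: x + z = t *: x + z + s *: x by rewrite scalerDl addrAC.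
 have E : s%:C * dC x u (t *: x + z) = dC (s *: x) u (t *: x + z) by rewrite (dCZv _ _ uC).
 rewrite E; apply: (@le_trans _ _ (4 * (s ^+ 2 * (B * vq z)))); last first.
  apply: eqW_le; rewrite -[is_q S1 z]/(vq z); ring.
 apply: second_order => // r /andP[r0 r1].
 have -> : dC (s *: x) (dC (s *: x) u) = fun y => (s ^+ 2)%:C * dC x (dC x u) y.
  rewrite (dCZv _ s uC) dC_scale; last exact: Cinf_dC.
  by rewrite dCZv; [apply/funext => y; rewrite mulrA -rmorphM|exact: Cinf_dC].
 rewrite Normc.normcM normcR ger0_norm ?sqr_ge0// ler_wpM2l ?sqr_ge0//.
 apply: le_trans (HC _) _; rewrite /B -mulrA ler_wpM2l//.
 have -> : t *: x + z + r *: (s *: x) = (t + r * s) *: x + z by rewrite scalerDl scalerA addrAC.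
 apply: le_trans (japV_shift _ _ _) _; apply: ler_pM; rewrite ?exprn_ge0 ?mulr_ge0 ?japV_ge0 ?jap_ge0 ?japV_dom//.
 apply: ler_Xn; rewrite ?mulr_ge0 ?jap_ge0 ?addr_ge0 ?mulr_ge0 ?enorm_ge0//.
 rewrite ler_wpM2l//; apply: le_trans (jap_le1D _) _; rewrite lerD2l enormZ ler_wpM2r ?enorm_ge0//.
 apply: le_trans (ler_normD _ _) _; rewrite lerD2l normrM (ger0_norm r0) mulr_ile1//.
have E : h 1 = h 0.
 apply: complexP.
  by apply: (is_derive_0_is_cst (f := fun t => Re (h t))) => t; have [] := hd t.
 by apply: (is_derive_0_is_cst (f := fun t => Im (h t))) => t; have [] := hd t.
move: E; rewrite /h scale1r scale0r => ->; congr (Lam S1 _); apply/funext => z; by rewrite add0r.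
Qed.

Lemma ft_shift u x (eta : vec) : rapid u -> ft (fun z => u (x + z)) eta = expi (dotv x eta) * ft u eta.
Proof.
move=> ur; pose g (z : vec) := expi (ph (eta, z)) * u z.
have pC : Cinf (fun z : vec => (ph (eta, z))%:C) by exact: Cinf_sec2 phC.
have gr : rapid g.
 move=> N; have H : sym basv ones1 (fun _ _ => 1) (fun _ z => expi (ph (eta, z))).
  apply: sym_expi => // i; have -> : dC (basv i) (fun z : vec => (ph (eta, z))%:C) = fun=> (- eta 0 i)%:C.
   apply/funext => z; rewrite (dC_affine (A := fun z => (eta, z)) (a := e2 (inr i)) (fun v => (ph v)%:C)) ?dC_ph// => s y.
   exact: pair_affine2.
  by apply: sym_cst => //; exists `|eta 0 i| => // t z; rewrite normcR normrN mulr1.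
 by apply: sym_eqw (sym_mul H (ur N)) => t z; rewrite mul1r.
rewrite /ft /oint -[Lam S1 (fun xi => expi (ph (eta, xi)) * u _) in RHS](Lam_shift x gr) /g.
have -> : (fun z => expi (ph (eta, x + z)) * u (x + z)) =
  fun z => expi (ph (eta, x)) * (expi (ph (eta, z)) * u (x + z)).
 apply/funext => z; rewrite mulrA -expiD; congr (expi _ * _); rewrite /ph /= -opprD; congr (- _).
 by rewrite /dotv -big_split; apply: eq_bigr => i _; rewrite mxE mulrDr.
rewrite LamZ; last first.
 have := amplitude_dom phC eta (rapid_amplitude (rapid_shift x ur)); exact.
rewrite mulrA -expiD /ph /= (dotvC_sym eta x) subrr /expi cos0 sin0 mul1r//.
Qed.

Lemma chi_one (e : R) n : 0 < e <= 1 -> sym e2 (ones unit) (fun _ v => dec n e v)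
 (fun _ v => (chi e v)%:C).
Proof.
move=> e01; have H := @chi_sym unit (fun=> e) (fun=> e01) n.
apply: (sym_sg (sg := fun _ _ _ => e) (K := 1)) => //; first by move=> t v; exact: dec_ge0.
by move=> i t v; rewrite mul1r; have /andP[/ltW -> ->] := e01.
Qed.
Lemma chi_sym1 (e : R) : 0 < e <= 1 ->
 sym e2 (ones unit) (fun _ _ => 1) (fun _ v => (chi e v)%:C).
Proof. by move=> e01; apply: sym_eqw (chi_one 0 e01) => t v; rewrite /dec expr0 invr1. Qed.

(** An amplitude already cut off is absolutely integrable, so its oscillatory integral is the
    ordinary one. *)
Lemma osc_cut e B : 0 < e <= 1 -> tame B -> osc (fun v : vec2 => (chi e v)%:C * B v) = Lcut e B.
Proof.
move=> e01 tB; apply: osc_eq; have [M Bs] := tB.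
have tc : tame (fun v : vec2 => (chi e v)%:C) by exists 0%N; apply: sym_eqw (chi_sym1 e01) => t v; rewrite expr0.
have tcB := tame_mul tc tB.
have [C C0 HC] := sym_bnd (sym_mul (chi_one (M + 2 + 4 * d) e01) Bs).
have [E E0 HE] := @dec_mdom unit (fun=> e) (fun=> e01) (M + 2) (fun=> 1) (fun=> ler01) tt.
exists (C * E * (2 * Qtot S2)) => e' e'01.
have dm1 := tame_cut_dom e'01 tcB; have dm2 := tame_cut_dom e01 tB.
rewrite /Lcut -LamB// mulrAC; apply: Lam_bound => [|v]; first by have [] := dom_sub dm1 dm2.
have -> : expi (ph v) * ((chi e' v)%:C * ((chi e v)%:C * B v)) - expi (ph v) * ((chi e v)%:C * B v) =
  expi (ph v) * ((chi e' v - 1)%:C * ((chi e v)%:C * B v)).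
 by rewrite -mulrBr -[X in _ - X]mul1r -mulrBl rmorphB.
rewrite 2!Normc.normcM normc_expi mul1r normcR.
have n0 : 0 <= normc ((chi e v)%:C * B v) by exact: normc_ge0.
have h1 := @chi_near1 unit (fun=> e') (fun=> e'01) tt v.
have h2 := HC tt v; have [h3 _] := HE v.
apply: le_trans (ler_pM _ n0 h1 h2) _; first exact: normr_ge0.
have e'0 : 0 <= e' by case/andP: e'01 => /ltW.
have -> : e' * jap2 v ^+ 2 * (C * (dec (M + 2 + 4 * d) e v * jap2 v ^+ M)) =
  C * e' * (1 * (jap2 v ^+ (M + 2) * dec (M + 2 + 4 * d) e v)) by rewrite exprD; ring.
have -> : C * E * e' * is_q S2 v = C * e' * (E * is_q S2 v) by ring.
by rewrite ler_wpM2l ?mulr_ge0//.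
Qed.

End rapid_functions.

Section exactness.
Local Notation sgc := (sgp (fun X => jap X.2)).
Local Notation Nc := norm_cst.
Local Notation phx := (fun X : vec2 => phi X.1 X.2).

Let G i (y xi : vec) := gradxi phi y xi 0 i.

Let brkG y xi : brk (fun i => G i y) xi = jap (gradxi phi y xi).
Proof. by rewrite /brk /brk2 /jap /dotv; congr (Num.sqrt (_ + _)); apply: eq_bigr => i _; rewrite expr2. Qed.
Let G_ge : exists2 C : R, 0 <= C & forall y xi, jap y <= C * brk (fun i => G i y) xi.
Proof.
have [_ [_ [c c0 H]] _] := chphi D; exists c; first exact: ltW.
by move=> y xi; rewrite brkG; exact: (H (y, xi)).
Qed.
Let G_sym i : sym basv (fun (_ : 'I_d) (_ _ : vec) => (1 : R)) (fun y xi => brk (fun i => G i y) xi) (fun y xi => (G i y xi)%:C).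
Proof.
have H0 := symSG_one ler01 ler01 (fun (x _ : vec) => jap_ge0 x) (phixi_sym i).
have H := sym_reindex (fun y : vec => (tt, y)) (sym_sec2 H0).
have [C C0 HC] := G_ge.
apply: (sym_le C0 _ (fun y xi => HC y xi)) => //.
by apply: (sym_eq _ H) => y; apply/funext => xi; rewrite /G gradxiE.
Qed.
Let Phi1 i : exists m : nat, sym e2 (ones unit) (fun _ X => jap X.1 ^+ m * jap X.2 ^+ m) (fun _ => dC (e2 (inl i)) (fun X => (phx X)%:C)).
Proof.
have H0 := symSG_one ler01 ler01 (fun (_ xi : vec) => jap_ge0 xi) (phix_sym i).
exists 1%N; apply: (sym_le ler01 _ _ H0) => // t X.
by rewrite mul1r !expr1 ler_peMl ?jap_ge0 ?jap_ge1.
Qed.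

Definition uamp (F : vec -> R[i]) (X : vec2) : R[i] := ca D X.1 X.2 * F X.2.

Lemma uamp_amplitude F : rapid F -> amplitude (uamp F).
Proof.
move=> Fr; have /andP[r0 _] := cr1_01 D; have /andP[rho0 _] := crho1_01 D.
have [C C0 [m H]] := weight_mod (chw1 D); exists m => N.
have as1 := symSG_one r0 rho0 (w1_ge0) (SG_sym (w1_ge0) (cha D)).
have F1 := sym_snd (fun _ _ _ => ler01) (fun _ x => japV_ge0 (m + N) x) (Fr (m + N)%N).
have F2 : sym e2 (ones unit) (fun _ X => jap X.2 ^- (m + N)) (fun _ X => F X.2).
 apply: (sym_sg (K := 1) _ _ _ F1) => // [t X|[i|i] t X]; first exact: japV_ge0.
 - by rewrite mul1r lexx ler01.
 - by rewrite mul1r lexx ler01.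
have K0 : 0 <= C * w1 0 0 by rewrite mulr_ge0// w1_ge0.
apply: (sym_le K0 _ _ (sym_mul as1 F2)) => // t X.
have := H 0 0 X.1 X.2; rewrite !add0r => h.
apply: (@le_trans _ _ (C * w1 0 0 * (jap X.1 * jap X.2) ^+ m * jap X.2 ^- (m + N))).
 by rewrite ler_wpM2r ?japV_ge0.
have j0 : jap X.2 ^+ m != 0 by rewrite expf_neq0// gt_eqF// jap_gt0.
by rewrite exprMn exprD invfM -!mulrA [X in _ * (_ * (_ * X))]mulrA mulfV ?mul1r.
Qed.

Lemma oint_phi_rapid F : rapid F -> rapid (oint phx (uamp F)).
Proof.
move=> Fr; apply: (oint_rapid (phC'C) Phi1 (G := G) _ G_sym G_ge (uamp_amplitude Fr)) => i y xi.
by rewrite /G gradxiE.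
Qed.

Lemma w0_poly x : exists2 C : R, 0 <= C & exists m : nat, forall xi, w0 x xi <= C * jap xi ^+ m.
Proof.
have [C C0 [m H]] := weight_mod (chw0 D); exists (C * w0 x 0).
 by rewrite mulr_ge0// w0_ge0.
by exists m => xi; have := H x 0 0 xi; rewrite addr0 add0r jap0 mul1r.
Qed.

Lemma w0_rapid x K F : rapid F -> exists2 C : R, 0 <= C & forall xi, w0 x xi * jap xi ^+ K * normc (F xi) <= C * vq xi.
Proof.
move=> Fr; have [C C0 [m H]] := w0_poly x; have [E E0 HE] := rapid_bound (m + K + 2 * d) Fr.
exists (C * E) => [|xi]; first exact: mulr_ge0.
have j0 : 0 < jap xi by exact: jap_gt0.
apply: (@le_trans _ _ (C * jap xi ^+ m * jap xi ^+ K * (E * jap xi ^- (m + K + 2 * d)))).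
 apply: ler_pM; [|exact: normc_ge0| |exact: HE].
  by rewrite mulr_ge0 ?w0_ge0// exprn_ge0// ltW.
 by rewrite ler_wpM2r ?exprn_ge0// ltW.
have -> : C * jap xi ^+ m * jap xi ^+ K * (E * jap xi ^- (m + K + 2 * d)) = C * E * jap xi ^- (2 * d).
 rewrite [jap xi ^+ (m + K + _)]exprD [jap xi ^+ (m + K)]exprD.
 have n0 k : jap xi ^+ k != 0 by rewrite expf_neq0// gt_eqF.
 move: (n0 m) (n0 K) (n0 (2 * d)%N).
 move: (jap xi ^+ m) (jap xi ^+ K) (jap xi ^+ (2 * d)) => a b c a0 b0 c0; field; exact/and3P.
by rewrite ler_wpM2l ?mulr_ge0// japV_dom.
Qed.

Lemma BB_sec x : Cinf (fun Y : vec2 * vec => BB ((x, Y.2), Y.1)).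
Proof.
have [m [M BS]] := BB_sym; have BC := sym_Cinf tt BS.
apply: (Cinf_affine (A := fun Y : vec2 * vec => ((x, Y.2), Y.1)) (A0 := fun Y => ((0, Y.2), Y.1))) BC.
 by move=> Y; exact: (cvg_pair (cvg_pair (cvg_cst x) (@cvg_snd _ _ _ _ _)) (@cvg_fst _ _ _ _ _)).
by move=> Z s Y; rewrite -[RHS]/((s *: 0 + x, s *: Z.2 + Y.2), s *: Z.1 + Y.1) scaler0 add0r.
Qed.

(** Needed to integrate this function of xi. By [osc_cut] it is an oscillatory integral with
    parameters, to which [osc_param] applies. *)
Lemma Lcut_BB_C e : 0 < e <= 1 -> Cinf (fun X => Lcut e (fun v => BB (X, v))).
Proof.
move=> e01; have [m [M BS]] := BB_sym.
have mu0 (X : vec2) : 0 <= w0 X.1 X.2 * jap X.2 ^+ m by rewrite mulr_ge0 ?w0_ge0 ?exprn_ge0 ?jap_ge0.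
have cs : sym e4 sgc (fun _ _ => 1) (fun _ X => (chi e X.2)%:C).
 apply: sgc_of_one => //.
 apply: (pull4 (A := snd) (j := fun i => match i with inl i => i | inr i => i end)
  (c := fun i => match i with inl _ => 0 | _ => 1 end) _ _ _ _ _ (chi_sym1 e01)) => //.
 - by move=> X; exact: cvg_snd.
 - by move=> [i|i]; rewrite /= ?scale1r ?scale0r.
 - by move=> [i|i]; rewrite ?normr0 ?normr1.
have FS : sym e4 sgc (fun _ X => (w0 X.1.1 X.1.2 * jap X.1.2 ^+ m) * jap2 X.2 ^+ M) (fun _ X => (chi e X.2)%:C * BB X).
 by apply: sym_eqw (sym_mul cs BS) => t X; rewrite mul1r.
have mm : moderate (fun X : vec2 => w0 X.1 X.2 * jap X.2 ^+ m).
 by apply: moderate_mul (jap_mod2 m); [move=> X; exact: w0_ge0|move=> X; rewrite exprn_ge0 ?jap_ge0|exact: w0_mod].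
have [[H _] _] := osc_param mu0 (fun X => jap_ge1 X.2) mm (@jap_mod2 1) FS.
suff -> : (fun X => Lcut e (fun v => BB (X, v))) = fun X => osc (fun v => (chi e v)%:C * BB (X, v)) by [].
by apply/funext => X; rewrite osc_cut//; exact: BB_tame.
Qed.

Lemma cc_int_dom x F : rapid F -> dom S1 (fun xi => expi (phi x xi) * cc x xi * F xi).
Proof.
move=> Fr; have [cC H] := cc_crude; have [C C0 [K HC]] := H [::].
have [E E0 HE] := w0_rapid x K Fr; split.
 apply: contC_mul; last exact: Cinf_cont (rapid_Cinf Fr).
 apply: contC_mul; last exact: Cinf_cont (Cinf_sec2 x cC).
 exact: Cinf_cont (Cinf_expi (Cinf_sec2 x (phC'C))).
exists (C * E) => xi; rewrite 2!Normc.normcM normc_expi mul1r.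
apply: (@le_trans _ _ (C * (w0 x xi * jap xi ^+ K) * normc (F xi))).
 by rewrite ler_wpM2r ?normc_ge0//; exact: (HC (x, xi)).
by rewrite -!mulrA ler_wpM2l// mulrA; exact: HE.
Qed.

(** At fixed cutoff the integral over (z, eta) and xi converges absolutely, and Fubini brings the
    xi-integral outside, with the cut integral of [BB] inside. The error of [BB_rate] is polynomial
    in xi, hence integrable against F and O(eps). *)
Lemma osc_compose x F : rapid F ->
 osc (fun v => Nc * (cp D x v.2 * oint phx (uamp F) (x + v.1))) =
 Lam S1 (fun xi => expi (phi x xi) * cc x xi * F xi).
Proof.
move=> Fr; apply: osc_eq.
have [m [M BS]] := BB_sym.
have [Cr Cr0 [Kr Hr]] := BB_rate; have [Er Er0 HEr] := w0_rapid x Kr Fr.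
have [Cb Cb0 Hb] := sym_bnd BS; have [Eb Eb0 HEb] := w0_rapid x m Fr.
have dL := cc_int_dom x Fr.

exists (normc Nc * (Cr * Er) * (2 * Qtot S1)) => e e01.
have [C1 C10 H1] := sym_bnd (@chi_one e (M + 4 * d) e01).
have [E1 E10 HE1] := @dec_mdom unit (fun=> e) (fun=> e01) M (fun=> 1) (fun=> ler01) tt.
pose gx xi := expi (phi x xi) * F xi * Nc.
(* The factor exp(i phi(x, xi)) is taken out so that the phase left in [BB] is the difference of phi
   at y and x. *)
pose K (Y : vec2 * vec) : R[i] := gx Y.2 * (expi (ph Y.1) * ((chi e Y.1)%:C * BB ((x, Y.2), Y.1))).
have gC : Cinf gx.
 apply: Cinf_mul; last exact: Cinf_cst.
 by apply: Cinf_mul; [exact: Cinf_expi (Cinf_sec2 x (phC'C))|exact: rapid_Cinf].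
have KC : Cinf K.
 apply: Cinf_mul.
  by apply: (Cinf_affine (A := snd) (A0 := snd)) gC => // Y; exact: cvg_snd.
 apply: Cinf_mul; last apply: Cinf_mul; last exact: BB_sec.
  by apply: (Cinf_affine (A := fst) (A0 := fst)) (Cinf_expi phC) => // Y; exact: cvg_fst.
 by apply: (Cinf_affine (A := fst) (A0 := fst)) (sym_Cinf tt (chi_sym1 e01)) => // Y; exact: cvg_fst.
have Kd : dom (prod_space S2 S1) K.
 split; first exact: Cinf_cont.
 exists (normc Nc * (C1 * E1) * (Cb * Eb)) => -[v xi].
 rewrite -[is_q _ _]/(is_q S2 v * vq xi) 5!Normc.normcM !normc_expi !mul1r.
 have h1 : normc (chi e v)%:C <= C1 * dec (M + 4 * d) e v := H1 tt v.
 have h2 : normc (BB ((x, xi), v)) <= Cb * (w0 x xi * jap xi ^+ m * jap2 v ^+ M) := Hb tt ((x, xi), v).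
 have h3 := HEb xi.
 have h4 : jap2 v ^+ M * dec (M + 4 * d) e v <= E1 * is_q S2 v by have [+ _] := HE1 v; rewrite mul1r.
 move: h1 h2 h3 h4.
 set a1 := normc (chi e v)%:C; set a2 := normc (BB _); set a3 := normc (F xi); set a4 := normc Nc.
 set b1 := dec _ _ _; set b2 := _ ^+ M; set b3 := w0 x xi * _; set q1 := is_q S2 v; set q2 := vq xi.
 move=> h1 h2 h3 h4.
 have a10 : 0 <= a1 by exact: normc_ge0. have a20 : 0 <= a2 by exact: normc_ge0.
 have a30 : 0 <= a3 by exact: normc_ge0. have a40 : 0 <= a4 by exact: normc_ge0.
 have b10 : 0 <= b1 by exact: dec_ge0. have b20 : 0 <= b2 by rewrite exprn_ge0// jap2_ge0.
 have b30 : 0 <= b3 by rewrite mulr_ge0 ?w0_ge0 ?exprn_ge0 ?jap_ge0.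
 clearbody a1 a2 a3 a4 b1 b2 b3 q1 q2.
 apply: (@le_trans _ _ (a3 * a4 * ((C1 * b1) * (Cb * (b3 * b2))))).
  by rewrite ler_wpM2l ?mulr_ge0//; apply: ler_pM.
 have -> : a3 * a4 * (C1 * b1 * (Cb * (b3 * b2))) = (a4 * C1 * Cb) * ((b2 * b1) * (b3 * a3)) by ring.
 have -> : a4 * (C1 * E1) * (Cb * Eb) * (q1 * q2) = (a4 * C1 * Cb) * ((E1 * q1) * (Eb * q2)) by ring.
 by rewrite ler_wpM2l ?mulr_ge0//; apply: ler_pM; rewrite ?mulr_ge0.
have [FE1 FE2] := Lam_fubini Kd.
have L1 : Lcut e (fun v => Nc * (cp D x v.2 * oint phx (uamp F) (x + v.1))) = Lam (prod_space S2 S1) K.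
 rewrite FE1 /Lcut; congr Lam; apply/funext => v.
 have dA := amplitude_dom (phC'C) (x + v.1) (uamp_amplitude Fr).
 have -> : expi (ph v) * ((chi e v)%:C * (Nc * (cp D x v.2 * oint phx (uamp F) (x + v.1)))) =
   (expi (ph v) * (chi e v)%:C * Nc * cp D x v.2) * oint phx (uamp F) (x + v.1) by rewrite -!mulrA.
 rewrite /oint -LamZ//; congr Lam; apply/funext => xi.
 rewrite /K /gx /BB /uamp /phdiff /Yv /Ev /=.
 have -> : expi (phi (x + v.1) xi) = expi (phi x xi) * expi (phi (x + v.1) xi - phi x xi).
  by rewrite -expiD addrCA subrr addr0.
 move: (expi _) (expi _) (expi _) (F xi) (ca D _ _) (cp D _ _) Nc (_%:C) => t1 t2 t3 t4 t5 t6 t7 t8.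
 ring.
have L2 : Lam (prod_space S2 S1) K = Lam S1 (fun xi => gx xi * Lcut e (fun v => BB ((x, xi), v))).
 rewrite FE2; congr Lam; apply/funext => xi; rewrite /K /= LamZ//.
 exact: tame_cut_dom e01 (BB_tame (x, xi)).
have bd xi : normc (gx xi * Lcut e (fun v => BB ((x, xi), v)) - expi (phi x xi) * cc x xi * F xi) <=
  normc Nc * (Cr * Er) * e * vq xi.
 have -> : gx xi * Lcut e (fun v => BB ((x, xi), v)) - expi (phi x xi) * cc x xi * F xi =
   expi (phi x xi) * (F xi * (Nc * (Lcut e (fun v => BB ((x, xi), v)) - osc (fun v => BB ((x, xi), v))))).
  rewrite /gx /cc; move: (expi _) (Lcut _ _) (osc _) => t1 t2 t3; ring.
 rewrite Normc.normcM normc_expi mul1r 2!Normc.normcM.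
 have h : normc (Lcut e (fun v => BB ((x, xi), v)) - osc (fun v => BB ((x, xi), v))) <=
  Cr * (w0 x xi * jap xi ^+ Kr) * e := Hr (x, xi) e e01.
 have h2 := HEr xi; move: h h2.
 have e0 : 0 <= e by case/andP: e01 => /ltW.
 set a1 := normc (F xi); set a2 := normc Nc; set a3 := normc (_ - _); set b := w0 _ _ * _; set q := vq xi.
 move=> h h2.
 have a10 : 0 <= a1 by exact: normc_ge0. have a20 : 0 <= a2 by exact: normc_ge0.
 clearbody a1 a2 a3 b q.
 apply: (@le_trans _ _ (a1 * (a2 * (Cr * b * e)))); first by rewrite !ler_wpM2l.
 have -> : a1 * (a2 * (Cr * b * e)) = a2 * Cr * e * (b * a1) by ring.
 have -> : a2 * (Cr * Er) * e * q = a2 * Cr * e * (Er * q) by ring.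
 by rewrite ler_wpM2l ?mulr_ge0.
have cL : contC (fun xi => gx xi * Lcut e (fun v => BB ((x, xi), v))).
 apply: contC_mul; first exact: Cinf_cont.
 exact: Cinf_cont (Cinf_sec2 x (Lcut_BB_C e01)).
have dd : dom S1 (fun xi => gx xi * Lcut e (fun v => BB ((x, xi), v)) - expi (phi x xi) * cc x xi * F xi).
 split; last by exists (normc Nc * (Cr * Er) * e) => xi; exact: bd.
 by have [c1 _] := dL; exact: contC_sub.
have d1 : dom S1 (fun xi => gx xi * Lcut e (fun v => BB ((x, xi), v))).
 by have := dom_add dd dL; under eq_fun do rewrite subrK.
rewrite L1 L2 -LamB// mulrAC; apply: Lam_bound; [by have [] := dd|exact: bd].
Qed.

Definition kc : R[i] := ((2 * pi) `^ (- (d%:R / 2)))%:C.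
Lemma kc2 : kc * kc = Nc.
Proof.
have p0 : 0 <= 2 * pi :> R by rewrite mulr_ge0// pi_ge0.
have pn : 2 * pi != 0 :> R by rewrite mulf_neq0// gt_eqF// pi_gt0.
rewrite /kc /norm_cst -rmorphM -powRD; last by rewrite pn implybT.
by rewrite -opprD -splitr powRN powR_mulrn.
Qed.

Lemma fourierE (f : vec -> R[i]) : fourier f = fun xi => kc * ft f xi.
Proof.
apply/funext => xi; rewrite /fourier /ft /oint -Lam_vecE; congr (_ * Lam _ _).
by apply/funext => z; rewrite mulrC /ph /= dotvC_sym.
Qed.

(** Applying Op(p) to u is read, by [ft_shift] and [osc_transform] for z -> u(x + z), as an
    oscillatory integral over (z, eta); inserting u = Op_phi(a) f turns it into the one computed by
    [osc_compose]. *)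
Lemma OpE (f : vec -> R[i]) x : schwartz f ->
 Op (cp D) (Opphi phi (ca D) f) x = Opphi phi (cc) f x.
Proof.
move=> /schwartz_rapid fr; pose F := fourier f.
have Fr : rapid F by rewrite /F fourierE; exact: rapid_scale (ft_rapid fr).
have ur := oint_phi_rapid Fr.
have uE : Opphi phi (ca D) f = fun y => kc * oint phx (uamp F) y.
 apply/funext => y; rewrite /Opphi -Lam_vecE; congr (_ * Lam _ _).
 by apply/funext => xi; rewrite /uamp -mulrA.
pose u := Opphi phi (ca D) f.
have ur' : rapid u by rewrite /u uE; exact: rapid_scale.
have us := rapid_shift x ur'.
have tp : tame (fun v : vec2 => kc * cp D x v.2) by exact: tame_scale (tame_pE x).
rewrite -[RHS]/(kc * integralC (fun xi => expi (phi x xi) * cc x xi * F xi)) -Lam_vecE -(osc_compose x Fr).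
rewrite -[LHS]/(kc * integralC (fun eta => expi (dotv x eta) * cp D x eta * fourier u eta)) -Lam_vecE.
congr (kc * _).
have -> : (fun v : vec2 => Nc * (cp D x v.2 * oint phx (uamp F) (x + v.1))) = fun v => kc * cp D x v.2 * u (x + v.1).
 by apply/funext => v; rewrite /u uE -kc2; move: (oint _ _ _) => t; ring.
have /= -> := osc_transform (p := fun eta => kc * cp D x eta) tp us; congr Lam; apply/funext => eta.
rewrite ft_shift// fourierE; move: (expi _) (ft u eta) => t1 t2; ring.
Qed.

End exactness.

End composition_theorem.
End oscillatory_calculus.

Lemma Dw_zero (R : realType) (V : normedModType R) (I : eqType) (e : I -> V) (w : seq I) :
 Dw e w (fun=> 0 : R[i]) = fun=> 0.
Proof. by case: w => // i w; exact: Dw_cst. Qed.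

Lemma zero_SG (R : realType) d (w : 'rV[R]_d -> 'rV[R]_d -> R) (r rho : R) : (forall x xi, 0 <= w x xi) ->
 SG w r rho (fun _ _ => 0).
Proof.
move=> w0; split=> [|al be]; first by apply/smooth_CinfP; exact: Cinf_cst.
exists 1 => // X; rewrite Dmi2E; last exact: Cinf_cst.
by rewrite Dw_zero mulr0 Normc.normc0 mul1r !mulr_ge0 ?powR_ge0.
Qed.

Lemma zero_schwartz2 (R : realType) d : @schwartz2 R d (fun _ _ => 0).
Proof.
split=> [|al be ga de]; first by apply/smooth_CinfP; exact: Cinf_cst.
exists 0 => x xi; rewrite Dmi2E; last exact: Cinf_cst.
by rewrite Dw_zero !mulr0 Normc.normc0.
Qed.

Lemma Opphi_zero (R : realType) d (phi : 'rV[R]_d -> 'rV[R]_d -> R) f x : Opphi phi (fun _ _ => 0) f x = 0.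
Proof.
rewrite /Opphi (_ : (fun xi => _) = fun=> 0); last by apply/funext => xi; rewrite mulr0 mul0r.
by rewrite -Lam_vecE Lam0 mulr0.
Qed.

Theorem theorem3p9 (R : realType) (d : nat)
    (r0 r1 r2 rho0 rho1 rho2 : R)
    (w0 w1 w2 : 'rV[R]_d -> 'rV[R]_d -> R)
    (phi : 'rV[R]_d -> 'rV[R]_d -> R)
    (a p : 'rV[R]_d -> 'rV[R]_d -> R[i])
    (hr0 : 0 <= r0 <= 1) (hr1 : 0 <= r1 <= 1) (hr2 : 0 <= r2 <= 1)
    (hrho0 : 0 <= rho0 <= 1) (hrho1 : 0 <= rho1 <= 1) (hrho2 : 0 <= rho2 <= 1)
    (hpos0 : 0 < r0 + rho0) (hpos1 : 0 < r1 + rho1) (hpos2 : 0 < r2 + rho2)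
    (hw0 : smooth_weight r0 rho0 w0)
    (hw1 : smooth_weight r1 rho1 w1)
    (hw2 : smooth_weight r2 rho2 w2)
    (hphi : simple_phase phi)
    (rho2E : rho2 = 1)
    (r0E : r0 = Num.min r1 (Num.min r2 1))
    (rho0E : rho0 = Num.min rho1 1)
    (w0E : forall x xi, w0 x xi = w1 x xi * w2 x (gradx phi x xi))
    (hinv : phi2_invariant phi w2)
    (ha : SG w1 r1 rho1 a)
    (hp : SG w2 r2 1 p) :
  exists c : 'rV[R]_d -> 'rV[R]_d -> R[i],
    [/\ SG w0 r0 rho0 c,
        asymp_expansion w0 r0 rho0 c (fun j x xi =>
          sum_mi j (fun alpha : 'I_d -> nat =>
            'i%C ^+ mi_size alpha / (mi_fact alpha)%:R
            * Dmi alpha (p x) (gradx phi x xi)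
            * Dmi alpha (fun y => expi (psi phi x y xi) * a y xi) x)),
        r1 = 0 ->
          Opphi_class phi (SG_moo w0 0)
            (fun f x => Op p (Opphi phi a f) x - Opphi phi c f x)
      & 0 < r1 ->
          Op_class (@schwartz2 R d)
            (fun f x => Op p (Opphi phi a f) x - Opphi phi c f x)].
Proof.
rewrite {}rho2E in hrho2 hpos2 hw2.
pose D := CompositionData hr1 hr2 hrho1 r0E rho0E hw0 hw1 hw2 hphi w0E hinv ha hp.
have E f : schwartz f -> (fun x => Op p (Opphi phi a f) x - Opphi phi (cc D) f x) = fun=> 0.
 by move=> fs; apply/funext => x; rewrite -(OpE D x fs) subrr.
exists (cc D); split; first exact: (cc_SG D).
- exact: (cc_asymp D).
- move=> _; exists (fun _ _ => 0) => [N _|f fs].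
  apply: zero_SG => x xi; rewrite mulr_ge0//; first exact: (w0_ge0 D).
  by rewrite mulr_ge0 ?powR_ge0.
 by rewrite E//; apply/funext => x; rewrite Opphi_zero.
- move=> _; exists (fun _ _ => 0) => [|f fs]; first exact: zero_schwartz2.
 by rewrite E//; apply/funext => x; rewrite /Op Opphi_zero.
Qed.
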